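(* Let $Y$ be a complex Banach space. The following are equivalent: (1) $Y$ is an $\mathcal L_\infty$-space. (2) Every short exact sequence of Banach spaces $0\to Y\to X\to Z\to 0$ locally splits. (3) Every short exact sequence of Banach spaces $0\to Y\to X\to Z\to 0$ $\mathcal A$-lifts, for each of the choices $\mathcal A=\mathfrak K$, $\mathcal A=\mathcal P_{\mathfrak K}$ and $\mathcal A=\mathcal H_{\mathfrak K}$. (4) Each of the functors $Y\check\otimes_\varepsilon(-)$, $\mathfrak K_{w^*}(Y^*,-)$, $\mathcal P_{\mathfrak K w^*}(^nY^*,-)$ (every $n\ge1$) and $\mathcal H_{\mathfrak K w^*}(Y^*,-)$ transforms short exact sequences of Banach spaces into short exact sequences.
   Context: A Banach space is an $\mathcal L_\infty$-space if there is $\lambda\ge1$ such that every finite-dimensional subspace $E$ is contained in a finite-dimensional subspace $F$ that is $\lambda$-isomorphic to $\ell_\infty^{\dim F}$. A short exact sequence $0\to Y\xrightarrow{i} X\xrightarrow{q} Z\to 0$: $i$ injective, $q$ surjective bounded operators, $i(Y)=\ker q$. It locally splits if there is $\lambda>0$ such that for every finite-dimensional $E\subset X$ there is a linear $T_E:E\to Y$ with $\|T_E\|\le\lambda$ and $i(T_E(e))=e$ for $e\in E\cap i(Y)$. For a class $\mathcal A$, the sequence $\mathcal A$-lifts if for every Banach space $V$ every $t\in\mathcal A(V,Z)$ has $T\in\mathcal A(V,X)$ with $q\circ T=t$ (for polynomial classes, for every degree $n\ge1$). $\mathfrak K$: compact operators; $\mathcal P_{\mathfrak K}(^nV,W)$: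 $n$-homogeneous continuous polynomials mapping the unit ball to a relatively compact set; $\mathcal H_{\mathfrak K}(V,W)$: holomorphic mappings bounded on bounded sets such that each point has a neighbourhood with relatively compact image. $\check\otimes_\varepsilon$: completed injective tensor product. $\mathfrak K_{w^*}(Y^*,W)$: compact operators $Y^*\to W$ that are weak*-to-weak continuous. $\mathcal P_{\mathfrak K w^*}(^nY^*,W)$ (resp. $\mathcal H_{\mathfrak K w^*}(Y^*,W)$): $n$-homogeneous continuous polynomials (resp. holomorphic mappings bounded on bounded sets) $Y^*\to W$ that are weak*-to-norm continuous on bounded sets. A (covariant) functor $F$ transforms $0\to A\xrightarrow{a} B\xrightarrow{b} C\to 0$ into the sequence $0\to F(A)\to F(B)\to F(C)\to 0$ with induced maps ($Id\otimes a$, resp. composition on the left with $a$, and similarly for $b$). *)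

(* Defs.v *)
(* Complex Banach spaces are
   [completeNormedModType (Cplx R)] with [Cplx R] = R[i], the complex numbers
   over an arbitrary real type R (all realTypes are isomorphic to the reals). *)
From HB Require Import structures.
From mathcomp Require Import all_boot all_order all_algebra.
From mathcomp Require Import complex.
From mathcomp Require Import all_classical all_reals all_analysis.
Import numFieldNormedType.Exports numFieldTopology.Exports.
Import Order.TTheory GRing.Theory Num.Theory.

Set Implicit Arguments.
Unset Strict Implicit.
Unset Printing Implicit Defensive.

Local Open Scope ring_scope.
Local Open Scope classical_set_scope.

(* the field of complex numbers; norms/constants live in it (real ones) *)
Definition Cplx (R : realType) : numClosedFieldType := R[i].

Section Defs.
Context {R : realType}.
Local Notation K := (Cplx R).

(* span of finitely many vectors: the finite-dimensional subspaces are exactly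
   the sets [span_of v] *)
Definition span_of {X : normedModType K} (n : nat) (v : 'I_n -> X) : set X :=
  [set x | exists c : 'I_n -> K, x = \sum_(k < n) c k *: v k].

Definition supn (n : nat) (c : 'I_n -> K) : K := \big[Num.max/0]_(k < n) `|c k|.

(* F = span v is lam-isomorphic to l_infty^n via T : c |-> \sum c_k v_k, with
   ||T|| <= b, ||T^-1|| <= a, a * b <= lam  (T injective, so n = dim F) *)
Definition linfty_iso {X : normedModType K} (lam : K) (n : nat)
    (v : 'I_n -> X) : Prop :=
  exists a b : K, [/\ 0 < a, 0 < b, a * b <= lam &
    forall c : 'I_n -> K,
      supn c <= a * `|\sum_(k < n) c k *: v k| /\
      `|\sum_(k < n) c k *: v k| <= b * supn c].

Definition Linfty_space (Y : completeNormedModType K) : Prop :=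
  exists lam : K, 1 <= lam /\
    forall (m : nat) (e : 'I_m -> Y),
      exists (n : nat) (v : 'I_n -> Y),
        span_of e `<=` span_of v /\ linfty_iso lam v.

Definition short_exact {Y X Z : completeNormedModType K}
    (i : Y -> X) (q : X -> Z) : Prop :=
  [/\ linear i /\ continuous i, linear q /\ continuous q,
      injective i, (forall z, exists x, q x = z) &
      (forall x, q x = 0 <-> exists y, i y = x)].

Definition locally_splits {Y X Z : completeNormedModType K}
    (i : Y -> X) (q : X -> Z) : Prop :=
  exists lam : K, 0 < lam /\
    forall (n : nat) (v : 'I_n -> X), exists T : X -> Y,
      [/\ (forall (a : K) x y, span_of v x -> span_of v y ->
              T (a *: x + y) = a *: T x + T y),
          (forall e, span_of v e -> `|T e| <= lam * `|e|) &
          (forall e, span_of v e -> (exists y, i y = e) -> i (T e) = e)].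

Definition compact_op {V W : completeNormedModType K} (f : V -> W) : Prop :=
  [/\ linear f, continuous f &
      compact (closure (f @` [set x | `|x| <= 1]))].

Definition upd {T : Type} (n : nat) (x : 'I_n -> T) (j : 'I_n) (t : T) :
  'I_n -> T := fun k => if k == j then t else x k.

Definition multilinear {V W : completeNormedModType K} (n : nat)
    (A : ('I_n -> V) -> W) : Prop :=
  forall (j : 'I_n) (x : 'I_n -> V) (a : K) (u w : V),
    A (upd x j (a *: u + w)) = a *: A (upd x j u) + A (upd x j w).

Definition hpoly {V W : completeNormedModType K} (n : nat) (P : V -> W) : Prop :=
  continuous P /\
  exists A : ('I_n -> V) -> W, multilinear A /\ forall x, P x = A (fun _ => x).

Definition compact_hpoly {V W : completeNormedModType K} (n : nat)
    (P : V -> W) : Prop :=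
  hpoly n P /\ compact (closure (P @` [set x | `|x| <= 1])).

Definition bdd_on_bdd {V W : completeNormedModType K} (f : V -> W) : Prop :=
  forall r : K, exists M : K, forall x, `|x| <= r -> `|f x| <= M.

Definition compact_holo {V W : completeNormedModType K} (f : V -> W) : Prop :=
  [/\ (forall x, differentiable f x), bdd_on_bdd f &
      forall x : V, exists U : set V, nbhs x U /\ compact (closure (f @` U))].

Definition lifts {X Z : completeNormedModType K} (q : X -> Z)
   (A : forall V W : completeNormedModType K, (V -> W) -> Prop) : Prop :=
  forall (V : completeNormedModType K) (t : V -> Z), A V Z t ->
    exists T : V -> X, A V X T /\ q \o T = t.

Definition A_compact := fun V W : completeNormedModType K =>
  @compact_op V W.
Definition A_poly (n : nat) := fun V W : completeNormedModType K =>
  @compact_hpoly V W n.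
Definition A_holo := fun V W : completeNormedModType K =>
  @compact_holo V W.

Definition is_dual {Y : completeNormedModType K} (f : Y -> K) : Prop :=
  (forall (a : K) x y, f (a *: x + y) = a * f x + f y) /\ continuous f.

Definition Dual (Y : completeNormedModType K) := {f : Y -> K | is_dual f}.

Definition dual_dist_le {Y : completeNormedModType K} (phi psi : Dual Y)
    (c : K) : Prop :=
  forall y, `|proj1_sig phi y - proj1_sig psi y| <= c * `|y|.
Definition dual_le {Y : completeNormedModType K} (phi : Dual Y) (c : K) : Prop :=
  forall y, `|proj1_sig phi y| <= c * `|y|.
Definition dual_comb {Y : completeNormedModType K} (chi : Dual Y) (a : K)
    (phi psi : Dual Y) : Prop :=
  forall y, proj1_sig chi y = a * proj1_sig phi y + proj1_sig psi y.

Definition dual_bounded {Y : completeNormedModType K} (B : set (Dual Y)) :=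
  exists c : K, forall phi, B phi -> dual_le phi c.

Definition wstar_conv {Y : completeNormedModType K} (F : set_system (Dual Y))
    (phi0 : Dual Y) : Prop :=
  forall y : Y, (fun phi : Dual Y => proj1_sig phi y) @ F --> proj1_sig phi0 y.

Definition dual_cont {Y W : completeNormedModType K} (g : Dual Y -> W) :=
  forall (phi0 : Dual Y) (eps : K), 0 < eps -> exists delta : K, 0 < delta /\
    forall phi, dual_dist_le phi phi0 delta -> `|g phi - g phi0| < eps.

Definition wstar_norm_cont_bdd {Y W : completeNormedModType K}
    (g : Dual Y -> W) : Prop :=
  forall B : set (Dual Y), dual_bounded B ->
    forall phi0, B phi0 -> forall F : set_system (Dual Y), ProperFilter F ->
      F B -> wstar_conv F phi0 -> g @ F --> g phi0.

Definition wstar_weak_cont {Y W : completeNormedModType K}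
    (g : Dual Y -> W) : Prop :=
  forall (phi0 : Dual Y) (F : set_system (Dual Y)), ProperFilter F ->
    wstar_conv F phi0 ->
    forall psi : Dual W, (fun phi => proj1_sig psi (g phi)) @ F -->
                         proj1_sig psi (g phi0).

Definition dual_linear {Y W : completeNormedModType K} (g : Dual Y -> W) :=
  forall (a : K) (chi phi psi : Dual Y), dual_comb chi a phi psi ->
    g chi = a *: g phi + g psi.

Definition Kwstar (Y W : completeNormedModType K) (T : Dual Y -> W) : Prop :=
  [/\ dual_linear T, dual_cont T,
      compact (closure (T @` [set phi | dual_le phi 1])) &
      wstar_weak_cont T].

Definition dual_multilinear {Y W : completeNormedModType K} (n : nat)
    (A : ('I_n -> Dual Y) -> W) : Prop :=
  forall (j : 'I_n) (x : 'I_n -> Dual Y) (a : K) (chi phi psi : Dual Y),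
    dual_comb chi a phi psi ->
    A (upd x j chi) = a *: A (upd x j phi) + A (upd x j psi).

Definition PKwstar (n : nat) (Y W : completeNormedModType K)
    (P : Dual Y -> W) : Prop :=
  [/\ exists A : ('I_n -> Dual Y) -> W,
        dual_multilinear A /\ forall phi, P phi = A (fun _ => phi),
      dual_cont P & wstar_norm_cont_bdd P].

Definition dual_holomorphic {Y W : completeNormedModType K}
    (g : Dual Y -> W) : Prop :=
  forall phi0 : Dual Y, exists L : Dual Y -> W,
    [/\ dual_linear L,
        (exists M : K, forall h c, 0 <= c -> dual_le h c -> `|L h| <= M * c) &
        forall eps : K, 0 < eps -> exists delta : K, 0 < delta /\
          forall (phi h : Dual Y) (c : K),
            (forall y, proj1_sig phi y = proj1_sig phi0 y + proj1_sig h y) ->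
            0 <= c -> c <= delta -> dual_le h c ->
            `|g phi - g phi0 - L h| <= eps * c].

Definition HKwstar (Y W : completeNormedModType K) (g : Dual Y -> W) : Prop :=
  [/\ dual_holomorphic g,
      (forall c : K, exists M : K, forall phi, dual_le phi c -> `|g phi| <= M) &
      wstar_norm_cont_bdd g].

(* Y \check\otimes_eps W, realized as the closure of the algebraic tensor
   product Y (x) W in the bounded bilinear forms on Y^* x W^* (eps-norm =
   sup over the product of the dual unit balls) *)
Definition inj_tensor (Y W : completeNormedModType K)
    (u : Dual Y -> Dual W -> K) : Prop :=
  [/\ (forall (a : K) (chi phi psi : Dual Y) (th : Dual W),
         dual_comb chi a phi psi -> u chi th = a * u phi th + u psi th),
      (forall (a : K) (phi : Dual Y) (chi th1 th2 : Dual W),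
         dual_comb chi a th1 th2 -> u phi chi = a * u phi th1 + u phi th2) &
      forall eps : K, 0 < eps -> exists (n : nat) (ys : 'I_n -> Y)
        (ws : 'I_n -> W), forall phi th, dual_le phi 1 -> dual_le th 1 ->
        `|u phi th - \sum_(k < n) proj1_sig phi (ys k) * proj1_sig th (ws k)|
          <= eps].

(* v = (Id (x) a) u, i.e. v(phi, th) = u(phi, th o a) *)
Definition tensor_map {Y A B : completeNormedModType K} (a : A -> B)
    (u : Dual Y -> Dual A -> K) (v : Dual Y -> Dual B -> K) : Prop :=
  forall (phi : Dual Y) (th : Dual B) (chi : Dual A),
    (forall x, proj1_sig chi x = proj1_sig th (a x)) -> v phi th = u phi chi.

(* exactness of 0 -> F(A) -> F(B) -> F(C) -> 0, induced maps given as
   (functional) relations *)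
Definition exact_seq {FA FB FC : Type} (PA : FA -> Prop) (PB : FB -> Prop)
    (PC : FC -> Prop) (fa : FA -> FB -> Prop) (fb : FB -> FC -> Prop)
    (zeroC : FC) : Prop :=
  [/\ (forall u u' v, PA u -> PA u' -> fa u v -> fa u' v -> u = u'),
      (forall v, PB v -> ((exists u, PA u /\ fa u v) <-> fb v zeroC)) &
      (forall w, PC w -> exists v, PB v /\ fb v w)].

Definition comp_functor_exact (Y : completeNormedModType K)
    (Cl : forall W : completeNormedModType K, (Dual Y -> W) -> Prop) : Prop :=
  forall (A B C : completeNormedModType K) (a : A -> B) (b : B -> C),
    short_exact a b ->
    exact_seq (Cl A) (Cl B) (Cl C)
      (fun T T' => T' = a \o T) (fun T T' => T' = b \o T) (fun _ => 0).

Definition tensor_functor_exact (Y : completeNormedModType K) : Prop :=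
  forall (A B C : completeNormedModType K) (a : A -> B) (b : B -> C),
    short_exact a b ->
    exact_seq (@inj_tensor Y A) (@inj_tensor Y B) (@inj_tensor Y C)
      (tensor_map a) (tensor_map b) (fun _ _ => 0).

End Defs.

Arguments Kwstar {R} Y W T.
Arguments PKwstar {R} n Y W P.
Arguments HKwstar {R} Y W g.

(* Main.v *)
(* Everything goes through one condition [locfact Y lam]: each finite-dimensional
   subspace of Y is fixed by an operator Y -> l_infty^n -> Y whose factors have
   norms at most 1 and lam.

   An L_infty-space has this property by Hahn-Banach. Conversely, if Y is
   infinite-dimensional, such a factorization (u, v) of the identity of a subspace
   is perturbed to an isomorphism S = v + J (1 - u v) of l_infty^n onto a subspace
   of Y, where J sends almost disjointly supported functionals to a nearly
   biorthogonal system on which u is small.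

   Each of (2), (3), (4) yields [locfact]: in (2) by applying the local splitting
   to Y inside the bounded functions on the dual ball, in (3) and (4) by a gluing
   argument, a failure of [locfact] on subspaces E_n being assembled into a single
   compact operator or tensor acting with weight 2^-n on the n-th piece.

   From [locfact], functionals factor through i and extend by Hahn-Banach, which
   gives (2). For (3), a compact set has a totally bounded lift, corrected by a
   compact Y-valued extension to become linear on the span; polynomials are lifted
   through their symmetrized multilinear forms and holomorphic maps through their
   Taylor polynomials. For (4), maps that are weak*-continuous on bounded sets are
   uniform limits of their compositions with the finite-rank adjoints
   phi |-> \sum_k phi (v_k) p_k; the differences of these are finite sums whose
   coefficients are lifted one by one, with control of the norm.

   The Cauchy estimate for the derivative is proved with Goursat's subdivision
   argument for trapezoidal sums and the kernel 1/z^2, and its second-order version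
   makes derivatives of entire maps entire. *)
Require Import Defs.
From HB Require Import structures.
From mathcomp Require Import all_boot all_order all_algebra.
From mathcomp Require Import complex.
From mathcomp Require Import all_classical all_reals all_analysis.
From mathcomp Require Import ring lra.
Import numFieldNormedType.Exports numFieldTopology.Exports.
Import Order.TTheory GRing.Theory Num.Theory.

Set Implicit Arguments.
Unset Strict Implicit.
Unset Printing Implicit Defensive.

Local Open Scope ring_scope.
Local Open Scope classical_set_scope.

(** * Real-valued norms on complex normed spaces *)

(** [locfact] is weaker than the L_infty property because its two factors need not be inverse to
    each other: the vectors may be dependent or span badly. Splittings and liftings produce only
    such factorizations, so the geometry sits in the way back. There, room for the defect 1 - u v
    must be found in Y with sup-norm control. A Hilbert space count provides it: if j functionals
    admit no further one carried by an almost disjoint set of coordinates, the sup norm on the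
    factored subspace is dominated by a weighted l_2 norm of small mass, which bounds the dimension.
    Factoring a subspace of large dimension therefore yields as many almost disjoint functionals as
    desired.

    The gluing arguments rest on a competition of constants: E_n violates the constant 4^n, while
    undoing the weight 2^-n in a bounded lift costs only 2^n.

    For polynomials the obstacle is that a lift is linear only on the span of the values on the
    diagonal. Polarization puts the values of the symmetrized form into that span, which is why
    symmetrizations appear throughout. *)

Section ComplexNumbers.
Context {R : realType}.
Local Notation K := (Cplx R).

Definition rc (r : R) : K := Complex r 0.
Definition re (z : K) : R := complex.Re z.
Definition im (z : K) : R := complex.Im z.
Definition iu : K := Complex 0 1.

Lemma rcD a b : rc (a + b) = rc a + rc b.
Proof. exact: (rmorphD (real_complex R)). Qed.
Lemma rcM a b : rc (a * b) = rc a * rc b.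
Proof. exact: (rmorphM (real_complex R)). Qed.
Lemma rcN a : rc (- a) = - rc a.
Proof. exact: (rmorphN (real_complex R)). Qed.
Lemma rcB a b : rc (a - b) = rc a - rc b.
Proof. exact: (rmorphB (real_complex R)). Qed.
Lemma rc0 : rc 0 = 0. Proof. by []. Qed.
Lemma rc1 : rc 1 = 1. Proof. by []. Qed.
Lemma rcV a : rc a^-1 = (rc a)^-1.
Proof. exact: (fmorphV (real_complex R)). Qed.
Lemma rc_nat n : rc n%:R = n%:R.
Proof. exact: (rmorph_nat (real_complex R)). Qed.
Lemma rcX a n : rc (a ^+ n) = rc a ^+ n.
Proof. exact: (rmorphXn (real_complex R)). Qed.
Lemma rc_sum (I : Type) (r : seq I) (P : pred I) (F : I -> R) :
  rc (\sum_(i <- r | P i) F i) = \sum_(i <- r | P i) rc (F i).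
Proof. exact: (rmorph_sum (real_complex R)). Qed.
Lemma rc_inj : injective rc. Proof. exact: (@complexI R). Qed.
Lemma rc_le a b : (rc a <= rc b) = (a <= b).
Proof. exact: (@lecR R). Qed.
Lemma rc_lt a b : (rc a < rc b) = (a < b).
Proof. exact: (@ltcR R). Qed.
Lemma re_rc a : re (rc a) = a. Proof. by []. Qed.
Lemma im_rc a : im (rc a) = 0. Proof. by []. Qed.
Lemma reD x y : re (x + y) = re x + re y.
Proof. by case: x y => [a b] [c d]. Qed.
Lemma imD x y : im (x + y) = im x + im y.
Proof. by case: x y => [a b] [c d]. Qed.
Lemma reN x : re (- x) = - re x. Proof. by case: x. Qed.
Lemma imN x : im (- x) = - im x. Proof. by case: x. Qed.
Lemma reM x y : re (x * y) = re x * re y - im x * im y.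
Proof. by case: x y => [a b] [c d]. Qed.
Lemma imM x y : im (x * y) = re x * im y + im x * re y.
Proof. by case: x y => [a b] [c d]. Qed.
Lemma Kext (x y : K) : re x = re y -> im x = im y -> x = y.
Proof. by case: x y => [a b] [c d] /= -> ->. Qed.
Lemma re_iu : re iu = 0. Proof. by []. Qed.
Lemma im_iu : im iu = 1. Proof. by []. Qed.
Lemma re0 : re 0 = 0. Proof. by []. Qed.
Lemma im0 : im 0 = 0. Proof. by []. Qed.
Lemma re1 : re 1 = 1. Proof. by []. Qed.
Lemma im1 : im 1 = 0. Proof. by []. Qed.
Lemma K_reim (z : K) : z = rc (re z) + iu * rc (im z).
Proof. by apply: Kext; rewrite ?(reD, imD, reM, imM, re_rc, im_rc, re_iu, im_iu); ring. Qed.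

Lemma K_ge0 (a : K) : 0 <= a -> a = rc (re a) /\ 0 <= re a.
Proof. by case: a => a b; rewrite lecE /= => /andP[/eqP -> ?]; split. Qed.

(** Norms take values in the complex numbers, whose order is partial. A real-valued norm makes
    estimates accessible to [lra] and [nra]. *)
Definition nm {V : normedZmodType K} (x : V) : R := re `|x|.

Section nm.
Context {V : normedZmodType K}.
Implicit Types x y : V.

Lemma nmE x : `|x| = rc (nm x).
Proof. by have [] := K_ge0 (normr_ge0 x). Qed.
Lemma nm_ge0 x : 0 <= nm x.
Proof. by have [] := K_ge0 (normr_ge0 x). Qed.
Lemma nm0 : nm (0 : V) = 0.
Proof. by rewrite /nm normr0. Qed.
Lemma nmD x y : nm (x + y) <= nm x + nm y.
Proof. by rewrite -rc_le rcD -!nmE ler_normD. Qed.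
Lemma nmN x : nm (- x) = nm x.
Proof. by rewrite /nm normrN. Qed.
Lemma nmB x y : nm (x - y) <= nm x + nm y.
Proof. by rewrite -(nmN y); exact: nmD. Qed.
Lemma nmBC x y : nm (x - y) = nm (y - x).
Proof. by rewrite -nmN opprB. Qed.
Lemma nm_tri x y z : nm (x - z) <= nm (x - y) + nm (y - z).
Proof. by have := nmD (x - y) (y - z); rewrite addrA subrK. Qed.
Lemma nm_Bge x y : nm x - nm y <= nm (x - y).
Proof. by have := nmD (x - y) y; rewrite subrK; lra. Qed.
Lemma nm_eq0 x : nm x = 0 -> x = 0.
Proof. by move=> h; apply/normr0_eq0; rewrite nmE h. Qed.
Lemma nm_gt0 x : x != 0 -> 0 < nm x.
Proof.
move=> x0; rewrite lt_neqAle nm_ge0 andbT eq_sym; apply/eqP => /nm_eq0 h.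
by rewrite h eqxx in x0.
Qed.
Lemma nm_le0 x : nm x <= 0 -> x = 0.
Proof. by move=> h; apply: nm_eq0; apply/eqP; rewrite eq_le h nm_ge0. Qed.
Lemma nm_sum (I : Type) (r : seq I) (P : pred I) (F : I -> V) :
  nm (\sum_(i <- r | P i) F i) <= \sum_(i <- r | P i) nm (F i).
Proof.
elim/big_ind2: _ => [|a b c d h1 h2|//]; first by rewrite nm0.
by apply: (le_trans (nmD _ _)); lra.
Qed.
Lemma nmP x (a : K) : `|x| <= a -> a = rc (re a) /\ nm x <= re a.
Proof.
move=> h; have [h1 h2] := K_ge0 (le_trans (normr_ge0 x) h).
by split=> //; rewrite -rc_le -h1 -nmE.
Qed.
Lemma nm_small x : (forall e, 0 < e -> nm x <= e) -> x = 0.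
Proof.
move=> h; apply: nm_le0; rewrite leNgt; apply/negP => h0.
by have := h (nm x / 2) ltac:(lra); lra.
Qed.
End nm.

Lemma nmZ {V : normedModType K} (a : K) (x : V) : nm (a *: x) = nm a * nm x.
Proof. by apply: rc_inj; rewrite rcM -!nmE normrZ. Qed.
Lemma nmM (a b : K) : nm (a * b) = nm a * nm b.
Proof. by apply: rc_inj; rewrite rcM -!nmE normrM. Qed.
Lemma nm1 : nm (1 : K) = 1.
Proof. by rewrite /nm normr1. Qed.
Lemma nmV (a : K) : nm a^-1 = (nm a)^-1.
Proof. by apply: rc_inj; rewrite rcV -!nmE normfV. Qed.
Lemma nmX (a : K) n : nm (a ^+ n) = nm a ^+ n.
Proof. by apply: rc_inj; rewrite rcX -!nmE normrX. Qed.
Lemma nm_rc (a : R) : nm (rc a) = `|a|.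
Proof.
have h b : 0 <= b -> nm (rc b) = b.
  by move=> b0; rewrite /nm ger0_norm ?re_rc // -rc0 rc_le.
have [a0|a0] := leP 0 a; first by rewrite ger0_norm // h.
by rewrite ltr0_norm // -(h (- a)) ?rcN ?nmN //; lra.
Qed.
Lemma nm_iu : nm iu = 1.
Proof.
have h : nm iu ^+ 2 = 1.
  rewrite -nmX (_ : iu ^+ 2 = - 1) ?nmN ?nm1 //.
  by rewrite expr2; apply: Kext; rewrite ?(reM, imM, reN, imN, re1, im1, re_iu, im_iu); ring.
by have := nm_ge0 iu; nra.
Qed.
Lemma nm_sqr (z : K) : nm z ^+ 2 = re z ^+ 2 + im z ^+ 2.
Proof. by apply: rc_inj; rewrite rcX -nmE; exact/esym/add_Re2_Im2. Qed.
Lemma re_le_nm (z : K) : re z <= nm z.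
Proof. by have := nm_sqr z; have := nm_ge0 z; nra. Qed.
Lemma im_le_nm (z : K) : im z <= nm z.
Proof. by have := nm_sqr z; have := nm_ge0 z; nra. Qed.
Lemma abs_re_le_nm (z : K) : `|re z| <= nm z.
Proof.
by rewrite ler_norml re_le_nm andbT; have := re_le_nm (- z); rewrite reN nmN; lra.
Qed.
Lemma abs_im_le_nm (z : K) : `|im z| <= nm z.
Proof.
by rewrite ler_norml im_le_nm andbT; have := im_le_nm (- z); rewrite imN nmN; lra.
Qed.
Lemma nm_le_reim (z : K) : nm z <= `|re z| + `|im z|.
Proof.
rewrite {1}(K_reim z); apply: (le_trans (nmD _ _)).
by rewrite nmM nm_iu mul1r !nm_rc.
Qed.
(** Unimodular factors align the terms of a sum, so that a bound on combinations with bounded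
    coefficients becomes a bound on a sum of moduli. *)
Lemma phase (z : K) : exists c : K, nm c = 1 /\ c * z = rc (nm z).
Proof.
have [->|z0] := eqVneq z 0; first by exists 1; rewrite nm1 mulr0 nm0 rc0.
exists (rc (nm z) / z); rewrite mulfVK //; split=> //.
have h := nm_gt0 z0.
by rewrite nmM nmV nm_rc ger0_norm ?mulfV ?lt0r_neq0 // ltW.
Qed.
End ComplexNumbers.
Arguments iu {R}.

(** * The complex Hahn-Banach theorem *)

Section HahnBanach.
Context {R : realType}.
Local Notation K := (Cplx R).
Variables (L : lmodType K) (G : L -> R -> Prop).
Hypothesis GD : forall x y r s, G x r -> G y s -> G (x + y) (r + s).
Hypothesis GZ : forall (a : K) x r, G x r -> G (a *: x) (nm a * r).

(** Partial real-linear functionals dominated by [G] are represented by their graphs: extension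
    becomes inclusion, and the union of a chain is again a candidate. The third clause expresses
    single-valuedness. *)
Let rgood (A : set (L * R)) :=
  [/\ (forall x y a b, A (x, a) -> A (y, b) -> A (x + y, a + b)),
      (forall t x a, A (x, a) -> A (rc t *: x, t * a)),
      (forall a, A (0, a) -> a = 0) &
      (forall x a r, A (x, a) -> G x r -> a <= r)].

Let GZp t x r : 0 <= t -> G x r -> G (rc t *: x) (t * r).
Proof. by move=> t0 /(GZ (rc t)); rewrite nm_rc ger0_norm. Qed.
Let GN x r : G x r -> G (- x) r.
Proof. by move=> /(GZ (- 1)); rewrite scaleN1r nmN nm1 mul1r. Qed.

Let ext1 (A : set (L * R)) (x0 : L) : rgood A -> A (0, 0) ->
  (forall a, ~ A (x0, a)) ->
  exists al : R, rgood [set z | exists x a t, A (x, a) /\ z = (x + rc t *: x0, a + t * al)].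
Proof.
move=> [Ad Az A0 AG] A00 nA.
have AN x a : A (x, a) -> A (- x, - a).
  by move=> /(Az (- 1)); rewrite rcN rc1 scaleN1r mulN1r.
(* [al] is the value at [x0]. Every lower bound a - r lies below every upper bound r' - a', because
   adding the two elements cancels [x0] and leaves the domination on the old domain. *)
have [al hal] : exists al : R, forall x a r, A (x, a) ->
    (G (x - x0) r -> a - r <= al) /\ (G (x + x0) r -> al <= r - a).
  pose S := [set s | exists x a r, [/\ A (x, a), G (x - x0) r & s = a - r]].
  have up x a r x' a' r' : A (x, a) -> G (x - x0) r -> A (x', a') ->
      G (x' + x0) r' -> a - r <= r' - a'.
    move=> h1 h2 h3 h4; have := AG _ _ _ (Ad _ _ _ _ h1 h3).
    have := GD h2 h4; rewrite addrACA (addrC (- x0)) subrr addr0 => h /(_ _ h); lra.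
  (* [G] may hold for no radius at all, so [S] can be empty. By symmetry of [G] both conditions are
     then vacuous and any value serves. *)
  have [[s Ss]|nS] := pselect (S !=set0); last first.
    exists 0 => x a r Ax; split=> h.
      by case: nS; exists (a - r), x, a, r.
    case: nS; exists (- a - r), (- x), (- a), r; split=> //; first exact: AN.
    by rewrite -opprD; exact: GN.
  exists (sup S) => x a r Ax; split=> h.
    apply: ub_le_sup; last by exists x, a, r.
    case: Ss => x1 [a1 [r1 [h1 h2 _]]].
    exists (r1 + a1) => _ [x2 [a2 [r2 [h3 h4 ->]]]].
    have := up _ _ _ _ _ _ h3 h4 (AN _ _ h1); rewrite opprK; apply.
    by rewrite addrC -opprB; exact: GN.
  apply: ge_sup; first by exists s.
  by move=> _ [x2 [a2 [r2 [h3 h4 ->]]]]; exact: up h3 h4 Ax h.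
exists al; split.
- move=> x y a b [x1 [a1 [t1 [h1 [-> ->]]]]] [x2 [a2 [t2 [h2 [-> ->]]]]].
  exists (x1 + x2), (a1 + a2), (t1 + t2); split; first exact: Ad.
  by rewrite rcD scalerDl mulrDl addrACA [X in (_, X)]addrACA.
- move=> t x a [x1 [a1 [t1 [h1 [-> ->]]]]].
  exists (rc t *: x1), (t * a1), (t * t1); split; first exact: Az.
  by rewrite scalerDr scalerA rcM mulrDr mulrA.
- move=> a [x1 [a1 [t1 [h1 []]]]].
  have [->|t0] := eqVneq t1 0.
    by rewrite rc0 scale0r addr0 mul0r addr0 => e ->; apply: A0; rewrite e.
  move=> e; exfalso; apply: (nA (- t1^-1 * a1)).
  have := Az (- t1^-1) _ _ h1.
  suff -> : rc (- t1^-1) *: x1 = x0 by [].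
  have /eqP := esym e; rewrite addr_eq0 => /eqP ->.
  by rewrite scalerN scalerA -rcM mulNr mulVf // rcN rc1 scaleN1r opprK.
- move=> x a r [x1 [a1 [t1 [h1 [-> ->]]]]] Gr.
  have [t0|t0|t0] := ltgtP t1 0; last first.
  + by move: Gr; rewrite t0 rc0 scale0r addr0 mul0r addr0; exact: AG.
  + have tV : 0 <= t1^-1 by rewrite invr_ge0 ltW.
    have := GZp tV Gr; rewrite scalerDr scalerA -rcM mulVf ?gt_eqF // rc1 scale1r.
    move=> /(proj2 (hal _ _ _ (Az t1^-1 _ _ h1))).
    rewrite -mulrBr -ler_pdivrMl ?invr_gt0 // invrK; lra.
  + have t0' : 0 < - t1 by lra.
    have tV : 0 <= (- t1)^-1 by rewrite invr_ge0 ltW.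
    have e1 : (- t1)^-1 * t1 = - 1 by rewrite invrN mulNr mulVf ?lt_eqF.
    have := GZp tV Gr; rewrite scalerDr scalerA -rcM e1.
    rewrite rcN rc1 scaleN1r.
    move=> /(proj1 (hal _ _ _ (Az (- t1)^-1 _ _ h1))).
    by rewrite -mulrBr ler_pdivrMl //; lra.
Qed.

Let real_ext (N : set (L * R)) : rgood N -> N (0, 0) ->
  exists h : L -> R, [/\ (forall x y, h (x + y) = h x + h y),
    (forall t x, h (rc t *: x) = t * h x),
    (forall x a, N (x, a) -> h x = a) & (forall x r, G x r -> h x <= r)].
Proof.
move=> gN N0.
(* The second clause is vacuous on the empty graph, so that the union of the empty chain also
   satisfies [P]; maximality later excludes the empty graph. *)
pose P (A : set (L * R)) := rgood A /\ (forall z, A z -> N `<=` A).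
have [A [[gA AN] maxA]] : exists A, P A /\ forall B, A `<` B -> ~ P B.
  apply: Zorn_bigcup => F FP Ftot; split; last first.
    by move=> z [B FB Bz] w Nw; exists B => //; exact: (FP _ FB).2 z Bz w Nw.
  have two z w : (\bigcup_(X in F) X) z -> (\bigcup_(X in F) X) w ->
      exists2 B, F B & B z /\ B w.
    move=> [B FB Bz] [C FC Cw].
    by have [BC|CB] := Ftot _ _ FB FC; [exists C => //; split=> //; exact: BC|
      exists B => //; split=> //; exact: CB].
  split.
  - move=> x y a b h1 h2; have [B FB [Bx By]] := two _ _ h1 h2.
    by exists B => //; have [[Bd _ _ _] _] := FP _ FB; exact: Bd.
  - move=> t x a [B FB Bx]; exists B => //.
    by have [[_ Bz _ _] _] := FP _ FB; exact: Bz.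
  - by move=> a [B FB Bx]; have [[_ _ B0 _] _] := FP _ FB; exact: B0.
  - by move=> x a r [B FB Bx]; have [[_ _ _ BG] _] := FP _ FB; exact: BG.
have A00 : A (0, 0).
  have [A0|/set0P[z Az]] := eqVneq A set0; last exact: AN Az _ N0.
  case: (maxA N); last by split=> // z _ w.
  rewrite A0; split; last by move=> /(_ _ N0).
  by move=> ? [].
have [Ad Az A0 AG] := gA.
have dom x : exists a, A (x, a).
  apply: contrapT => /forallNP nA.
  have [al gB] := ext1 gA A00 nA.
  apply: (maxA _ _ (conj gB _)).
  - split.
      move=> [y b] Ay; exists y, b, 0; split=> //.
      by rewrite rc0 scale0r addr0 mul0r addr0.
    move=> h; apply: (nA al); apply: h; exists 0, 0, 1; split=> //.
    by rewrite rc1 scale1r !add0r mul1r.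
  - move=> _ _ [y b] /(AN _ A00) Ay; exists y, b, 0; split=> //.
    by rewrite rc0 scale0r addr0 mul0r addr0.
have [h hA] := choice dom.
have funA x a : A (x, a) -> h x = a.
  move=> Ax; have := Ad _ _ _ _ (hA x) (Az (-1) _ _ Ax).
  by rewrite rcN rc1 scaleN1r subrr mulN1r => /A0 e; lra.
exists h; split.
- by move=> x y; apply: funA; exact: Ad.
- by move=> t x; apply: funA; exact: Az.
- by move=> x a Nx; apply: funA; exact: AN A00 _ Nx.
- by move=> x r; exact: AG.
Qed.

(* G x r reads "x has size at most r"; since G need not hold for every x, this
   covers gauges of convex sets that absorb only a subspace. *)
Theorem hahn_banach (N : set L) (f : L -> K) :
  N 0 -> (forall (a : K) x y, N x -> N y -> N (a *: x + y)) ->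
  (forall (a : K) x y, N x -> N y -> f (a *: x + y) = a * f x + f y) ->
  (forall x r, N x -> G x r -> nm (f x) <= r) ->
  exists g : L -> K, [/\ (forall (a : K) x y, g (a *: x + y) = a * g x + g y),
    (forall x, N x -> g x = f x) & (forall x r, G x r -> nm (g x) <= r)].
Proof.
move=> N0 Nl fl fG.
have fD x y : N x -> N y -> f (x + y) = f x + f y.
  by move=> hx hy; have := fl 1 _ _ hx hy; rewrite scale1r mul1r.
have f0 : f 0 = 0.
  by have := fD _ _ N0 N0; rewrite addr0 => /eqP; rewrite -subr_eq0 opprD addNKr oppr_eq0 => /eqP.
have NZ a x : N x -> N (a *: x) by move=> hx; rewrite -[_ *: _]addr0; exact: Nl.
have fZ a x : N x -> f (a *: x) = a * f x.
  by move=> hx; have := fl a _ _ hx N0; rewrite f0 !addr0.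
have [||h [hD hZ hN hG]] := @real_ext [set z | N z.1 /\ z.2 = re (f z.1)].
- split=> /=.
  + move=> x y a b [hx ->] [hy ->]; rewrite fD // reD; split=> //.
    by rewrite -[x]scale1r; exact: Nl.
  + move=> t x a [hx ->]; rewrite fZ // reM re_rc im_rc mul0r subr0; split=> //.
    exact: NZ.
  + by move=> a [_ ->]; rewrite f0 re0.
  + by move=> x a r [hx ->] hr; apply: (le_trans (re_le_nm _)); exact: fG.
- by rewrite /= f0.
(* This is the complex-linear functional with real part [h]. *)
pose g x := rc (h x) - iu * rc (h (iu *: x)).
have iu2 : iu * iu = -1 :> K.
  by apply: Kext; rewrite ?(reM, imM, reN, imN, re1, im1, re_iu, im_iu); ring.
have gD x y : g (x + y) = g x + g y.
  by rewrite /g scalerDr !hD !rcD mulrDr opprD addrACA.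
have gr t x : g (rc t *: x) = rc t * g x.
  rewrite /g hZ (_ : iu *: (rc t *: x) = rc t *: (iu *: x)).
    by rewrite hZ !rcM mulrBr mulrCA.
  by rewrite !scalerA mulrC.
have gi x : g (iu *: x) = iu * g x.
  rewrite /g scalerA iu2 scaleN1r (_ : h (- x) = - h x).
    by rewrite rcN mulrBr mulrA iu2; ring.
  have -> : - x = rc (-1) *: x by rewrite rcN rc1 scaleN1r.
  by rewrite hZ mulN1r.
have gZ a x : g (a *: x) = a * g x.
  by rewrite (K_reim a) scalerDl gD gr -scalerA gi gr mulrA mulrDl.
exists g; split.
- by move=> a x y; rewrite gD gZ.
- move=> x hx; rewrite /g (hN x (re (f x))) //.
  rewrite (hN _ (re (f (iu *: x)))); last by split=> //; exact: NZ.
  rewrite fZ //; apply: Kext;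
    by rewrite ?(reD, imD, reM, imM, reN, imN, re_rc, im_rc, re_iu, im_iu); ring.
(* Rotating x makes the value real and nonnegative, so the bound on the real part bounds the
   modulus. *)
- move=> x r hr; have [c [c1 hc]] := phase (g x).
  have : re (g (c *: x)) <= r.
    rewrite /g reD reN reM re_iu mul0r im_rc mulr0 subr0 oppr0 addr0 re_rc.
    by apply: hG; have := GZ c hr; rewrite c1 mul1r.
  by rewrite gZ hc re_rc.
Qed.
End HahnBanach.

(** * Linear maps, bounded functionals and biorthogonal coordinates *)

Section LinearMaps.
Context {R : realType}.
Local Notation K := (Cplx R).

Definition lin {V W : lmodType K} (f : V -> W) :=
  forall (a : K) x y, f (a *: x + y) = a *: f x + f y.
Definition lfun {V : lmodType K} (f : V -> K) :=
  forall (a : K) x y, f (a *: x + y) = a * f x + f y.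

Section lin.
Variables (V W : lmodType K) (f : V -> W).
Hypothesis hf : lin f.
Lemma linD x y : f (x + y) = f x + f y.
Proof. by have := hf 1 x y; rewrite !scale1r. Qed.
Lemma lin0 : f 0 = 0.
Proof.
by have := linD 0 0; rewrite addr0 => /eqP; rewrite -subr_eq0 opprD addNKr oppr_eq0 => /eqP.
Qed.
Lemma linZ a x : f (a *: x) = a *: f x.
Proof. by have := hf a x 0; rewrite lin0 !addr0. Qed.
Lemma linN x : f (- x) = - f x.
Proof. by rewrite -scaleN1r linZ scaleN1r. Qed.
Lemma linB x y : f (x - y) = f x - f y.
Proof. by rewrite linD linN. Qed.
Lemma lin_sum (I : Type) (r : seq I) (P : pred I) (F : I -> V) :
  f (\sum_(i <- r | P i) F i) = \sum_(i <- r | P i) f (F i).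
Proof. exact: (big_morph f linD lin0). Qed.
End lin.

Section lfun.
Variables (V : lmodType K) (f : V -> K).
Hypothesis hf : lfun f.
Let hf' : lin (f : V -> K^o) := hf.
Lemma lfunD x y : f (x + y) = f x + f y. Proof. exact: (linD hf'). Qed.
Lemma lfun0 : f 0 = 0. Proof. exact: (lin0 hf'). Qed.
Lemma lfunZ a x : f (a *: x) = a * f x. Proof. exact: (linZ hf'). Qed.
Lemma lfunB x y : f (x - y) = f x - f y. Proof. exact: (linB hf'). Qed.
Lemma lfun_sum (I : Type) (r : seq I) (P : pred I) (F : I -> V) :
  f (\sum_(i <- r | P i) F i) = \sum_(i <- r | P i) f (F i).
Proof. exact: (lin_sum hf'). Qed.
End lfun.

Lemma rcK (a : K) : 0 < a -> exists2 r, 0 < r & a = rc r.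
Proof.
move=> a0; have [h _] := K_ge0 (ltW a0).
by exists (re a) => //; rewrite -rc_lt -h rc0.
Qed.

Lemma nm_lt {V : normedZmodType K} (x : V) (e : R) : (`|x| < rc e) = (nm x < e).
Proof. by rewrite nmE rc_lt. Qed.
Lemma nm_le {V : normedZmodType K} (x : V) (e : R) : (`|x| <= rc e) = (nm x <= e).
Proof. by rewrite nmE rc_le. Qed.

Lemma nbhs_nmP (V : pseudoMetricNormedZmodType K) (x : V) (P : set V) :
  nbhs x P <-> exists2 e, 0 < e & forall y, nm (x - y) < e -> P y.
Proof.
split=> [/nbhs_normP[e /= e0 h]|[e e0 h]].
  have [r r0 er] := rcK e0; exists r => // y hy; apply: h.
  by rewrite /= er nm_lt.
apply/nbhs_normP; exists (rc e) => /=; first by rewrite -rc0 rc_lt.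
by move=> y /=; rewrite nm_lt; exact: h.
Qed.

Lemma cvg_nmP (T : Type) (F : set_system T) (V : pseudoMetricNormedZmodType K) (f : T -> V) (y : V) :
  Filter F -> f @ F --> y <-> forall e, 0 < e -> F [set t | nm (y - f t) < e].
Proof.
move=> FF; split.
  move=> /cvgrPdist_lt h e e0; have := h (rc e) ltac:(by rewrite -rc0 rc_lt).
  by apply: filterS => t /=; rewrite nm_lt.
move=> h; apply/cvgrPdist_lt => e e0; have [r r0 ->] := rcK e0.
by apply: filterS (h r r0) => t /=; rewrite nm_lt.
Qed.

Lemma cont_nmP (V W : pseudoMetricNormedZmodType K) (f : V -> W) :
  continuous f <-> forall x e, 0 < e ->
    exists2 d, 0 < d & forall y, nm (x - y) < d -> nm (f x - f y) < e.
Proof.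
split=> h x.
  by move=> e e0; have /cvg_nmP/(_ e e0)/nbhs_nmP := h x.
by apply/cvg_nmP => e e0; apply/nbhs_nmP; exact: h.
Qed.

Lemma lin_cont (V W : normedModType K) (f : V -> W) (c : R) :
  lin f -> (forall x, nm (f x) <= c * nm x) -> continuous f.
Proof.
move=> fl fc; apply/cont_nmP => x e e0.
have c1 : 0 < `|c| + 1 by have := normr_ge0 c; lra.
exists (e / (`|c| + 1)); first exact: divr_gt0.
move=> y; rewrite ltr_pdivlMr // -linB // => h.
have := fc (x - y); have := nm_ge0 (x - y); have := ler_norm c; nra.
Qed.

Lemma lin_bound (V W : normedModType K) (f : V -> W) :
  lin f -> continuous f -> exists2 c : R, 0 < c & forall x, nm (f x) <= c * nm x.
Proof.
move=> fl /cont_nmP/(_ 0 1 ltr01)[d d0 h].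
exists (2 / d); first by rewrite divr_gt0.
move=> x; have [->|x0] := eqVneq x 0; first by rewrite lin0 // !nm0 mulr0.
have nx := nm_gt0 x0.
have := h (rc (d / (2 * nm x)) *: x); rewrite sub0r nmN nmZ nm_rc.
rewrite ger0_norm; last by apply: divr_ge0; lra.
have -> : d / (2 * nm x) * nm x = d / 2 by field; exact: lt0r_neq0.
move=> /(_ ltac:(lra)); rewrite lin0 // sub0r nmN linZ // nmZ nm_rc.
rewrite ger0_norm; last by apply: divr_ge0; lra.
move=> h1; have : d / (2 * nm x) * nm (f x) * (2 / d * nm x) <= 1 * (2 / d * nm x).
  by rewrite ler_wpM2r ?ltW // mulr_gt0 // divr_gt0.
rewrite mul1r (_ : d / (2 * nm x) * nm (f x) * (2 / d * nm x) = nm (f x)) //.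
by field; rewrite !lt0r_neq0.
Qed.

Lemma lfun_cont (V : normedModType K) (f : V -> K) (c : R) :
  lfun f -> (forall x, nm (f x) <= c * nm x) -> continuous f.
Proof. by move=> fl fc; exact: (@lin_cont V K^o f c fl fc). Qed.

Lemma lfun_bound (V : normedModType K) (f : V -> K) :
  lfun f -> continuous f -> exists2 c : R, 0 < c & forall x, nm (f x) <= c * nm x.
Proof. by move=> fl fc; exact: (@lin_bound V K^o f fl fc). Qed.

Lemma hb_norm (V : normedModType K) (N : set V) (f : V -> K) (c : R) :
  N 0 -> (forall (a : K) x y, N x -> N y -> N (a *: x + y)) ->
  (forall (a : K) x y, N x -> N y -> f (a *: x + y) = a * f x + f y) ->
  (forall x, N x -> nm (f x) <= c * nm x) -> 0 <= c ->
  exists g : V -> K, [/\ lfun g, (forall x, N x -> g x = f x) &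
                       (forall x, nm (g x) <= c * nm x)].
Proof.
move=> N0 Nl fl fc c0.
pose G (x : V) r := c * nm x <= r.
have GD x y r s : G x r -> G y s -> G (x + y) (r + s).
  by rewrite /G => h1 h2; have := nmD x y; nra.
have GZ (a : K) x r : G x r -> G (a *: x) (nm a * r).
  move=> h; rewrite /G nmZ mulrCA; apply: ler_wpM2l => //; exact: nm_ge0.
have [|g [gl gf gc]] := hahn_banach GD GZ N0 Nl fl.
  by move=> x r Nx; apply: le_trans; exact: fc.
by exists g; split=> // x; apply: gc; rewrite /G.
Qed.

Lemma norming (V : normedModType K) (x : V) :
  exists g : V -> K, [/\ lfun g, (forall y, nm (g y) <= nm y) & g x = rc (nm x)].
Proof.
have [->|x0] := eqVneq x 0.
  exists (fun=> 0); split.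
  - by move=> a u v; rewrite mulr0 addr0.
  - by move=> y; rewrite nm0 nm_ge0.
  - by rewrite nm0 rc0.
pose N := [set y | exists c : K, y = c *: x].
have hc y : exists c : K, N y -> y = c *: x.
  by have [[c hc]|n] := pselect (N y); [exists c | exists 0].
have [co hco] := choice hc.
have cox c : co (c *: x) = c.
  have /eqP := hco (c *: x) (ex_intro _ c erefl).
  by rewrite -subr_eq0 -scalerBl scaler_eq0 subr_eq0 (negbTE x0) orbF => /eqP.
have [|||||g [gl gf gc]] := @hb_norm V N (fun y => co y * rc (nm x)) 1 => //.
- by exists 0; rewrite scale0r.
- by move=> a _ _ [c ->] [d ->]; exists (a * c + d); rewrite scalerDl scalerA.
- move=> a _ _ [c ->] [d ->]; rewrite scalerA -scalerDl !cox; ring.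
- move=> _ [c ->]; rewrite cox nmM nmZ nm_rc ger0_norm ?nm_ge0 //; lra.
exists g; split=> //; first by move=> y; have := gc y; rewrite mul1r.
by rewrite gf; [rewrite -[in co x](scale1r x) cox mul1r | exists 1; rewrite scale1r].
Qed.

(* Biorthogonal coordinates on a finite-dimensional subspace: each step only
   needs one functional that is nonzero on the new residual vector. *)
Lemma fd_coord (V : normedModType K) (m : nat) (e : 'I_m -> V) :
  exists (n : nat) (v : 'I_n -> V) (p : 'I_n -> V -> K),
    [/\ (forall k, span_of e (v k)),
        (forall k, lfun (p k) /\ exists2 c : R, 0 < c & forall x, nm (p k x) <= c * nm x),
        (forall k l, p k (v l) = (k == l)%:R) &
        (forall j, e j = \sum_(k < n) p k (e j) *: v k)].
Proof.
elim: m e => [|m IH] e.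
  exists 0%N, (fun=> 0), (fun _ _ => 0); split.
  - by case. - by case. - by case. - by case.
pose w := widen_ord (leqnSn m).
have [n [v [p [vs pb pv pe]]]] := IH (fun j => e (w j)).
pose r := e ord_max - \sum_(k < n) p k (e ord_max) *: v k.
have sp k : span_of e (v k).
  have [c ->] := vs k; exists (fun j => if unlift ord_max j is Some j' then c j' else 0).
  rewrite big_ord_recr /= unlift_none scale0r addr0; apply: eq_bigr => j _.
  have -> : widen_ord (leqnSn m) j = lift ord_max j.
    by apply: val_inj; rewrite /= /bump leqNgt ltn_ord.
  by rewrite liftK /w; congr (_ *: e _); apply: val_inj; rewrite /= /bump leqNgt ltn_ord.
have decomp (j : 'I_m.+1) : (j < m)%N -> e j = \sum_(k < n) p k (e j) *: v k.
  move=> jm; have -> : j = w (Ordinal jm) by apply: val_inj.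
  exact: pe.
have ordm (j : 'I_m.+1) : (j < m)%N \/ j = ord_max.
  have := ltn_ord j; rewrite ltnS leq_eqVlt => /orP[/eqP h|->]; last by left.
  by right; apply: val_inj.
have pr k : p k r = 0.
  have [pl _] := pb k.
  rewrite /r lfunB // lfun_sum // (bigD1 k) //= lfunZ // pv eqxx mulr1 big1 ?addr0 ?subrr //.
  by move=> l lk; rewrite lfunZ // pv eq_sym (negbTE lk) mulr0.
(* If the residual vanishes, the new vector already lies in the span and no coordinate is added. *)
have [r0|r0] := eqVneq r 0.
  exists n, v, p; split=> // j.
  have [/decomp //|->] := ordm j.
  by apply/eqP; rewrite -subr_eq0; apply/eqP.
have [f [fl f1 fr]] := norming r.
have nr := nm_gt0 r0.
pose f' x := rc (nm r)^-1 * f x.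
have f'l : lfun f' by move=> a x y; rewrite /f' fl mulrDr mulrCA.
have f'r : f' r = 1 by rewrite /f' fr -rcM mulVf ?rc1 // lt0r_neq0.
(* The old functionals vanish on the residual; the correction makes the new one vanish on the old
   vectors, so biorthogonality extends without touching earlier data. *)
pose p' x := f' x - \sum_(k < n) p k x * f' (v k).
have p'l : lfun p'.
  move=> a x y; rewrite /p' f'l.
  rewrite (_ : \sum_(k < n) p k (a *: x + y) * f' (v k) =
    a * (\sum_(k < n) p k x * f' (v k)) + \sum_(k < n) p k y * f' (v k)); first by ring.
  rewrite mulr_sumr -big_split /=; apply: eq_bigr => k _.
  by have [-> _] := pb k; rewrite mulrDl mulrA.
have p'r : p' r = 1.
  by rewrite /p' f'r big1 ?subr0 // => k _; rewrite pr mul0r.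
have p'v l : p' (v l) = 0.
  rewrite /p' (bigD1 l) //= pv eqxx mul1r big1 ?addr0 ?subrr // => k kl.
  by rewrite pv (negbTE kl) mul0r.
have p'e (j : 'I_m.+1) : (j < m)%N -> p' (e j) = 0.
  move=> jm; rewrite (decomp j jm) lfun_sum // big1 // => k _.
  by rewrite lfunZ // p'v mulr0.
exists n.+1.
exists (fun k => if unlift ord_max k is Some k' then v k' else r).
exists (fun k => if unlift ord_max k is Some k' then p k' else p').
split.
- move=> k; case: unliftP => [k' _|_]; first exact: sp.
  have : exists c : 'I_m.+1 -> K, \sum_(k < n) p k (e ord_max) *: v k = \sum_(j < m.+1) c j *: e j.
    have [c hc] := choice sp.
    exists (fun j => \sum_(k < n) p k (e ord_max) * c k j).
    under [RHS]eq_bigr do rewrite scaler_suml.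
    rewrite exchange_big /=; apply: eq_bigr => l _; rewrite {1}hc scaler_sumr.
    by apply: eq_bigr => j _; rewrite scalerA.
  move=> [c hc]; exists (fun j => (j == ord_max)%:R - c j).
  under eq_bigr do rewrite scalerBl.
  rewrite big_split /= sumrN -hc /r; congr (_ - _).
  rewrite (bigD1 ord_max) //= eqxx scale1r big1 ?addr0 // => j /negbTE ->.
  by rewrite scale0r.
- move=> k; case: unliftP => [k' _|_]; first exact: pb.
  split=> //.
  have [c hc] : exists c : 'I_n -> R, forall k, 0 < c k /\ forall x, nm (p k x) <= c k * nm x.
    have h k1 : exists c : R, 0 < c /\ forall x, nm (p k1 x) <= c * nm x.
      by have [_ [c c0 h]] := pb k1; exists c.
    by have [c hc] := choice h; exists c => k2; exact: hc.
  have S0 : 0 <= \sum_(k < n) c k * nm (f' (v k)).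
    by apply: sumr_ge0 => l _; apply: mulr_ge0; rewrite ?nm_ge0 // ltW //; have [] := hc l.
  exists ((nm r)^-1 + \sum_(k < n) c k * nm (f' (v k))).
    by apply: ltr_wpDr => //; rewrite invr_gt0.
  move=> x; rewrite /p'; apply: (le_trans (nmB _ _)); rewrite mulrDl; apply: lerD.
    rewrite /f' nmM nm_rc ger0_norm ?invr_ge0 ?nm_ge0 //.
    by rewrite ler_wpM2l ?invr_ge0 ?nm_ge0.
  apply: (le_trans (nm_sum _ _ _)); rewrite mulr_suml; apply: ler_sum => l _.
  rewrite nmM mulrAC; apply: ler_wpM2r; first exact: nm_ge0.
  by have [_] := hc l; apply.
- move=> k l; case: unliftP => [k' ->|->]; case: unliftP => [l' ->|->].
  + by rewrite pv (inj_eq lift_inj).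
  + by rewrite pr (eq_sym (lift _ _)) (negbTE (neq_lift _ _)).
  + by rewrite p'v (negbTE (neq_lift _ _)).
  + by rewrite p'r eqxx.
- move=> j; rewrite big_ord_recr /= unlift_none.
  under eq_bigr => k _.
    have -> : widen_ord (leqnSn n) k = lift ord_max k.
      by apply: val_inj; rewrite /= /bump leqNgt ltn_ord.
    rewrite liftK; over.
  have [jm|->] := ordm j; first by rewrite p'e // scale0r addr0; exact: decomp.
  rewrite {1}(_ : e ord_max = \sum_(k < n) p k (e ord_max) *: v k + r); last by rewrite /r addrC subrK.
  congr (_ + _); rewrite (_ : p' (e ord_max) = 1) ?scale1r //.
  rewrite -p'r /r lfunB // lfun_sum // big1 ?subr0 // => k _.
  by rewrite lfunZ // p'v mulr0.
Qed.

End LinearMaps.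

(** * Totally bounded sets and completeness *)

Section TotallyBounded.
Context {R : realType}.
Local Notation K := (Cplx R).

Definition tbdd {W : normedModType K} (A : set W) :=
  forall e : R, 0 < e -> exists s : seq W, forall x, A x -> exists2 y, y \in s & nm (x - y) <= e.

Section gen.
Context {W : normedModType K}.
Implicit Types A B : set W.

Lemma tbdd_sub A B : A `<=` B -> tbdd B -> tbdd A.
Proof. by move=> AB hB e e0; have [s hs] := hB e e0; exists s => x /AB; exact: hs. Qed.

Lemma tbdd_approx A :
  (forall e : R, 0 < e -> exists B, tbdd B /\ forall x, A x -> exists2 b, B b & nm (x - b) <= e) ->
  tbdd A.
Proof.
move=> h e e0; have [B [hB AB]] := h (e / 2) ltac:(lra).
have [s hs] := hB (e / 2) ltac:(lra).
exists s => x /AB[b /hs[y ys h1] h2]; exists y => //.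
by apply: (le_trans (nm_tri _ b _)); lra.
Qed.

(** Nets in [tbdd] have arbitrary centres. Replacing each centre that is close to A by a point of A
    doubles the radius, hence the start from e / 2. *)
Lemma tbdd_in A : tbdd A -> forall e : R, 0 < e ->
  exists n (a : 'I_n -> W), (forall i, A (a i)) /\
    forall x, A x -> exists i, nm (x - a i) <= e.
Proof.
move=> hA e e0; have [s hs] := hA (e / 2) ltac:(lra).
have /choice[a ha] : forall y, exists z, (exists2 x, A x & nm (x - y) <= e / 2) ->
    A z /\ nm (z - y) <= e / 2.
  move=> y; have [[x Ax xy]|n] := pselect (exists2 x, A x & nm (x - y) <= e / 2).
    by exists x.
  by exists 0 => /n.
pose s' := [seq a y | y <- s & `[< exists2 x, A x & nm (x - y) <= e / 2 >]].
exists (size s'), (fun i => nth 0 s' i); split.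
  move=> i; have : nth 0 s' i \in s' by apply: mem_nth.
  by move=> /mapP[y]; rewrite mem_filter => /andP[/asboolP/ha[h _] _] ->.
move=> x Ax; have [y ys xy] := hs x Ax.
have hy : exists2 x, A x & nm (x - y) <= e / 2 by exists x.
have /(nthP 0)[i hi hia] : a y \in s'.
  by apply/mapP; exists y => //; rewrite mem_filter ys andbT; apply/asboolP.
exists (Ordinal hi) => /=; rewrite hia.
have [_ h] := ha y hy; rewrite nmBC in h.
by apply: (le_trans (nm_tri _ y _)); lra.
Qed.

Lemma tbdd_bdd A : tbdd A -> exists2 c : R, 0 < c & forall x, A x -> nm x <= c.
Proof.
move=> /(_ 1 ltr01)[s hs].
have S0 : 0 <= \sum_(y <- s) nm y by apply: sumr_ge0 => *; exact: nm_ge0.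
exists (1 + \sum_(y <- s) nm y); first by lra.
move=> x /hs[y ys h].
have : nm y <= \sum_(y <- s) nm y.
  rewrite (perm_big _ (perm_to_rem ys)) big_cons lerDl.
  by apply: sumr_ge0 => *; exact: nm_ge0.
by have := nm_Bge x y; lra.
Qed.

Lemma tbdd_seq (s : seq W) : tbdd [set x | x \in s].
Proof. by move=> e e0; exists s => x xs; exists x => //; rewrite subrr nm0 ltW. Qed.

Lemma tbdd_add A B : tbdd A -> tbdd B -> tbdd [set z | exists x y, [/\ A x, B y & z = x + y]].
Proof.
move=> hA hB e e0; have [s hs] := hA (e / 2) ltac:(lra); have [t ht] := hB (e / 2) ltac:(lra).
exists [seq x + y | x <- s, y <- t] => _ [x [y [/hs[x' xs hx] /ht[y' yt hy] ->]]].
exists (x' + y'); first by apply/allpairsP; exists (x', y').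
by rewrite opprD addrACA; apply: (le_trans (nmD _ _)); lra.
Qed.

Lemma tbdd_setU A B : tbdd A -> tbdd B -> tbdd (A `|` B).
Proof.
move=> hA hB e e0; have [s hs] := hA e e0; have [t ht] := hB e e0.
exists (s ++ t) => x [/hs|/ht] [y ys h]; exists y => //; by rewrite mem_cat ys ?orbT.
Qed.
End gen.

Lemma tbdd_img {V W : normedModType K} (A : set V) (f : V -> W) (c : R) :
  tbdd A -> (forall x y, A x -> A y -> nm (f x - f y) <= c * nm (x - y)) ->
  tbdd (f @` A).
Proof.
move=> hA hf e e0.
have c0 : 0 < `|c| + 1 by have := normr_ge0 c; lra.
have [n [a [aA ha]]] := tbdd_in hA (divr_gt0 e0 c0).
exists [seq f (a i) | i <- enum 'I_n] => _ [x Ax <-].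
have [i hi] := ha x Ax; exists (f (a i)); first by apply: map_f; rewrite mem_enum.
apply: (le_trans (hf _ _ Ax (aA i))).
rewrite ler_pdivlMr // in hi; have := nm_ge0 (x - a i); have := ler_norm c; nra.
Qed.

Lemma tbdd_lin {V W : normedModType K} (A : set V) (f : V -> W) (c : R) :
  lin f -> (forall x, nm (f x) <= c * nm x) -> tbdd A -> tbdd (f @` A).
Proof. by move=> fl fc hA; apply: tbdd_img hA _ => x y _ _; rewrite -linB. Qed.

Lemma net_itv (a e : R) (n : nat) : 0 < e ->
  exists s : seq R, forall x, a <= x <= a + n%:R * e -> exists2 y, y \in s & `|x - y| <= e.
Proof.
move=> e0; elim: n => [|n [s hs]].
  exists [:: a] => x; rewrite mul0r addr0 => /andP[h1 h2].
  by exists a; rewrite ?inE //; rewrite (_ : x = a) ?subrr ?normr0 ?ltW //; lra.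
exists (a + n.+1%:R * e :: s) => x /andP[h1 h2].
have [h|h] := leP x (a + n%:R * e).
  by have [|y ys h3] := hs x; [rewrite h1|exists y => //; rewrite inE ys orbT].
exists (a + n.+1%:R * e); rewrite ?inE ?eqxx //.
by move: h2; rewrite -natr1 => h2; rewrite ler_norml; apply/andP; split; lra.
Qed.

Lemma tbdd_disc (c : R) : tbdd [set z : K^o | nm z <= c].
Proof.
move=> e e0.
have [n hn] : exists n : nat, 2 * `|c| <= n%:R * (e / 2).
  exists (Num.bound (2 * `|c| / (e / 2))); rewrite -ler_pdivrMr ?ltW ?archi_boundP //; last lra.
  by apply: divr_ge0; [apply: mulr_ge0 => //|lra].
have [s hs] := @net_itv (- `|c|) (e / 2) n ltac:(lra).
exists [seq (rc a + iu * rc b : K^o) | a <- s, b <- s] => z hz.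
have hr (x : R) : `|x| <= nm z -> - `|c| <= x <= - `|c| + n%:R * (e / 2).
  by move=> h; have := ler_norm c; have := ler_norm x; have := ler_norm (- x); rewrite normrN => *; apply/andP; split; move: hz => /= hz; lra.
have [a sa ha] := hs _ (hr _ (abs_re_le_nm z)).
have [b sb hb] := hs _ (hr _ (abs_im_le_nm z)).
exists (rc a + iu * rc b : K^o); first by apply/allpairsP; exists (a, b).
apply: (le_trans (nm_le_reim _)).
have -> : re (z - (rc a + iu * rc b) : K) = re z - a.
  by rewrite ?(reD, imD, reM, imM, reN, imN, re_rc, im_rc, re_iu, im_iu); ring.
have -> : im (z - (rc a + iu * rc b) : K) = im z - b.
  by rewrite ?(reD, imD, reM, imM, reN, imN, re_rc, im_rc, re_iu, im_iu); ring.
lra.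
Qed.

Lemma tbdd_fd {W : normedModType K} (n : nat) (v : 'I_n -> W) (c : R) :
  tbdd [set x | exists a : 'I_n -> K, (forall k, nm (a k) <= c) /\ x = \sum_(k < n) a k *: v k].
Proof.
elim: n v => [|n IH] v.
  by apply: tbdd_sub (tbdd_seq [:: 0]) => x [a [_ ->]]; rewrite big_ord0 /= inE.
pose w := widen_ord (leqnSn n).
have h1 : tbdd [set a *: v ord_max | a in [set z : K^o | nm z <= c]].
  apply: (@tbdd_img K^o W _ (fun a => a *: v ord_max) (nm (v ord_max))); first exact: tbdd_disc.
  by move=> a b _ _; rewrite -scalerBl nmZ mulrC.
apply: tbdd_sub (tbdd_add (IH (fun k => v (w k))) h1) => x [a [ha ->]].
exists (\sum_(k < n) a (w k) *: v (w k)), (a ord_max *: v ord_max); split.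
- by exists (fun k => a (w k)).
- by exists (a ord_max) => //=.
- by rewrite big_ord_recr.
Qed.

Definition aconv {W : lmodType K} (A : set W) : set W :=
  [set x | exists n (c : 'I_n -> K) (a : 'I_n -> W), [/\ (forall k, A (a k)),
     \sum_(k < n) nm (c k) <= 1 & x = \sum_(k < n) c k *: a k]].

(** Replacing every point of a combination by a nearby net point moves the combination by at most
    the same distance, since the moduli of its coefficients sum to at most 1. What remains is a
    bounded subset of the span of the net. *)
Lemma tbdd_aconv {W : normedModType K} (A : set W) : tbdd A -> tbdd (aconv A).
Proof.
move=> hA; apply: tbdd_approx => e e0; have [N [s [sA hs]]] := tbdd_in hA e0.
exists [set x | exists a : 'I_N -> K, (forall k, nm (a k) <= 1) /\ x = \sum_(k < N) a k *: s k].
split; first exact: (@tbdd_fd W N s 1).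
move=> _ [n [c [a [aA c1 ->]]]].
have /choice[j hj] : forall k, exists j, nm (a k - s j) <= e by move=> k; exact: hs.
exists (\sum_(k < n) c k *: s (j k)).
  exists (fun i => \sum_(k < n | j k == i) c k); split.
    move=> i; apply: le_trans c1; apply: (le_trans (nm_sum _ _ _)).
    by rewrite [leRHS](bigID (fun k => j k == i)) /= lerDl; apply: sumr_ge0 => *; exact: nm_ge0.
  rewrite (partition_big j xpredT) //=; apply: eq_bigr => i _; rewrite scaler_suml.
  by apply: eq_bigr => k /eqP ->.
rewrite -sumrB; apply: (le_trans (nm_sum _ _ _)).
rewrite -[leRHS]mul1r; apply: le_trans (_ : (\sum_(k < n) nm (c k)) * e <= _).
  rewrite mulr_suml; apply: ler_sum => k _; rewrite -scalerBr nmZ.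
  by apply: ler_wpM2l => //; exact: nm_ge0.
by apply: ler_wpM2r => //; exact: ltW.
Qed.

Lemma cvg_complete (W : completeNormedModType K) (F : set_system W) : ProperFilter F ->
  (forall e : R, 0 < e -> exists y, F [set x | nm (x - y) <= e]) -> cvg F.
Proof.
move=> FF h; apply: cauchy_cvg; apply: cauchy_exP => e e0.
have [r r0 ->] := rcK e0.
have [y hy] := h (r / 2) ltac:(lra); exists y; apply: filterS hy => x /=.
by rewrite -ball_normE /= nm_lt nmBC; lra.
Qed.

(** An ultrafilter containing a finite union of small balls contains one of them; it is therefore
    Cauchy and converges. *)
Lemma tbdd_compact (W : completeNormedModType K) (A : set W) :
  tbdd A -> compact (closure A).
Proof.
move=> hA; rewrite compact_ultra => F FU FA.
have cA x e : 0 < e -> closure A x -> exists2 y, A y & nm (x - y) <= e.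
  move=> e0 /(_ [set y | nm (x - y) < e])[]; first by apply/nbhs_nmP; exists e.
  by move=> y [Ay /= h]; exists y => //; exact: ltW.
have ultra_seq (s : seq W) e : F [set x | exists2 y, y \in s & nm (x - y) <= e] ->
    exists y, F [set x | nm (x - y) <= e].
  elim: s => [h|z s IH h].
    by have : F set0 by [apply: filterS h => x [y]]; move=> /filter_not_empty.
  have [h1|h1] := in_ultra_setVsetC [set x | nm (x - z) <= e] FU; first by exists z.
  apply: IH; apply: filterS2 h h1 => x [y]; rewrite inE => /orP[/eqP -> h2 /(_ h2)//|ys h2 _].
  by exists y.
have cF : cvg F.
  apply: cvg_complete => e e0; have [s hs] := hA (e / 2) ltac:(lra).
  apply: (ultra_seq s); apply: filterS FA => x /(cA _ (e / 2) ltac:(lra))[y /hs[z zs h1] h2].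
  by exists z => //; apply: (le_trans (nm_tri _ y _)); lra.
exists (lim F); split=> //.
have : closed (closure A) by exact: closed_closure.
move=> h; apply: h => B hB; have := cF B hB => FB.
by have [x [h1 h2]] := filter_ex (filterI FA FB); exists x.
Qed.

Lemma compact_tbdd (W : completeNormedModType K) (A : set W) :
  compact (closure A) -> tbdd A.
Proof.
rewrite compact_cover => h e e0.
have e0' : 0 < rc e by rewrite -rc0 rc_lt.
have [|x Ax|D _ hD] := h W (closure A) (fun x => ball x (rc e)).
- by move=> x _; exact: ball_open.
- by exists x => //; exact: ballxx.
exists (finmap.enum_fset D) => x Ax; have [y /= yD hy] := hD x (subset_closure Ax).
by exists y => //; move: hy; rewrite -ball_normE /= nm_lt nmBC => /ltW.
Qed.
End TotallyBounded.

(** * Completeness and geometric series *)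

Section Completeness.
Context {R : realType}.
Local Notation K := (Cplx R).

Lemma half_pow (e : R) : 0 < e -> exists n : nat, (2^-1) ^+ n < e.
Proof.
move=> e0; exists (Num.bound e^-1).
have h : e^-1 < 2 ^+ Num.bound e^-1.
  apply: lt_trans (archi_boundP _) _; first by rewrite invr_ge0 ltW.
  by rewrite -natrX ltr_nat ltn_expl.
by rewrite exprVn invf_plt ?posrE ?exprn_gt0.
Qed.

Lemma halfX_gt0 n : 0 < (2^-1 : R) ^+ n.
Proof. by rewrite exprn_gt0 // invr_gt0. Qed.

Lemma half_anti m n : (n <= m)%N -> (2^-1 : R) ^+ m <= (2^-1) ^+ n.
Proof. by move=> nm; apply: ler_wiXn2l => //; lra. Qed.

(** Stated for plain normed modules, so that it applies to [K^o] and can be the hypothesis from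
    which the complete structure of [bsp] is built. *)
Definition seqcomplete (W : normedModType K) :=
  forall u : nat -> W,
    (forall e : R, 0 < e -> exists N, forall m n, (N <= m)%N -> (N <= n)%N -> nm (u m - u n) <= e) ->
    exists l, forall e : R, 0 < e -> exists N, forall n, (N <= n)%N -> nm (u n - l) <= e.

Lemma seqcompleteP (W : completeNormedModType K) : seqcomplete W.
Proof.
move=> u hu.
have cu : cvg (u @ \oo).
  apply: cvg_complete => e e0; have [N hN] := hu e e0.
  by exists (u N); exists N => // n /= hn; exact: hN.
exists (lim (u @ \oo)) => e e0.
have /cvg_nmP/(_ e e0)[N _ hN] := cu.
by exists N => n hn; rewrite nmBC ltW //; exact: (hN n hn).
Qed.

Lemma seqcomplete_K : seqcomplete K^o.
Proof.
have RC (u : nat -> R) : (forall e : R, 0 < e -> exists N, forall m n, (N <= m)%N -> (N <= n)%N -> `|u m - u n| <= e) ->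
    exists l, forall e : R, 0 < e -> exists N, forall n, (N <= n)%N -> `|u n - l| <= e.
  move=> hu; have cu : cvg (u @ \oo).
    apply: R_complete; apply: cauchy_exP => e e0; have [N hN] := hu (e / 2) ltac:(lra).
    exists (u N); exists N => // n /= hn; rewrite -ball_normE /=.
    by have := hN N n (leqnn N) hn; lra.
  exists (lim (u @ \oo)) => e e0.
  have /cvgrPdist_le/(_ e e0)[N _ hN] := cu.
  by exists N => n hn; rewrite distrC; exact: (hN n hn).
move=> u hu.
have [a ha] : exists a, forall e : R, 0 < e -> exists N, forall n, (N <= n)%N -> `|re (u n) - a| <= e.
  apply: RC => e e0; have [N hN] := hu e e0; exists N => m n hm hn.
  have := abs_re_le_nm (u m - u n : K); rewrite reD reN => /le_trans; apply; exact: hN.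
have [b hb] : exists a, forall e : R, 0 < e -> exists N, forall n, (N <= n)%N -> `|im (u n) - a| <= e.
  apply: RC => e e0; have [N hN] := hu e e0; exists N => m n hm hn.
  have := abs_im_le_nm (u m - u n : K); rewrite imD imN => /le_trans; apply; exact: hN.
exists (rc a + iu * rc b) => e e0.
have [N1 h1] := ha (e / 2) ltac:(lra); have [N2 h2] := hb (e / 2) ltac:(lra).
exists (maxn N1 N2) => n; rewrite geq_max => /andP[/h1 n1 /h2 n2].
apply: (le_trans (nm_le_reim _)).
have -> : re (u n - (rc a + iu * rc b) : K) = re (u n) - a.
  by rewrite ?(reD, imD, reM, imM, reN, imN, re_rc, im_rc, re_iu, im_iu); ring.
have -> : im (u n - (rc a + iu * rc b) : K) = im (u n) - b.
  by rewrite ?(reD, imD, reM, imM, reN, imN, re_rc, im_rc, re_iu, im_iu); ring.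
lra.
Qed.

Lemma lim_nm_le (W : normedModType K) (u : nat -> W) (l : W) (c : R) (N : nat) :
  (forall e : R, 0 < e -> exists N, forall n, (N <= n)%N -> nm (u n - l) <= e) ->
  (forall n, (N <= n)%N -> nm (u n) <= c) -> nm l <= c.
Proof.
move=> hl hc; rewrite leNgt; apply/negP => h.
have [M hM] := hl ((nm l - c) / 2) ltac:(lra).
have h1 := hM (maxn M N) (leq_maxl _ _); have h2 := hc (maxn M N) (leq_maxr _ _).
by have := nm_Bge l (u (maxn M N)); rewrite nmBC; lra.
Qed.

Lemma geo_tail (W : normedModType K) (s : nat -> W) (c : R) :
  (forall n, nm (s n.+1 - s n) <= c * (2^-1) ^+ n) ->
  forall n m, (n <= m)%N -> nm (s m - s n) <= 2 * c * (2^-1) ^+ n.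
Proof.
move=> hs n m nm0.
have c0 : 0 <= c by have := hs 0%N; rewrite expr0 mulr1; apply: le_trans; exact: nm_ge0.
(* The subtracted power is what makes the induction on m close. *)
suff : nm (s m - s n) <= 2 * c * ((2^-1) ^+ n - (2^-1) ^+ m).
  move=> h; apply: (le_trans h); have := halfX_gt0 m; nra.
elim: m nm0 => [|m IH]; first by rewrite leqn0 => /eqP ->; rewrite !subrr mulr0 nm0.
rewrite leq_eqVlt => /orP[/eqP ->|]; first by rewrite !subrr mulr0 nm0.
rewrite ltnS => /IH h; apply: (le_trans (nm_tri _ (s m) _)).
by have := hs m; rewrite exprS; lra.
Qed.

Lemma geo_cvg (W : normedModType K) (s : nat -> W) (c : R) : seqcomplete W ->
  (forall n, nm (s n.+1 - s n) <= c * (2^-1) ^+ n) ->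
  exists l, forall n, nm (l - s n) <= 2 * c * (2^-1) ^+ n.
Proof.
move=> cW hs; have ht := geo_tail hs.
have c0 : 0 <= c by have := hs 0%N; rewrite expr0 mulr1; apply: le_trans; exact: nm_ge0.
have [l hl] : exists l, forall e : R, 0 < e -> exists N, forall n, (N <= n)%N -> nm (s n - l) <= e.
  apply: cW => e e0; have e1 : 0 < e / (4 * c + 1) by apply: divr_gt0 => //; lra.
  have [N hN] := half_pow e1; exists N => m n hm hn.
  apply: (le_trans (nm_tri _ (s N) _)); rewrite (nmBC (s N)).
  have := ht N m hm; have := ht N n hn; rewrite ltr_pdivlMr in hN; last lra.
  by have := halfX_gt0 N; nra.
exists l => n; apply: (@lim_nm_le _ (fun m => s m - s n) _ _ n); last by move=> m; exact: ht.
move=> e e0; have [N hN] := hl e e0; exists N => m hm.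
by rewrite opprB addrA subrK; exact: hN.
Qed.

Lemma seqcomplete_filter (V : normedModType K) : seqcomplete V ->
  forall F : set_system V, ProperFilter F -> cauchy F -> cvg F.
Proof.
move=> cV F FF cF.
have /choice[x hx] : forall n, exists x, F [set y | nm (x - y) < (2^-1) ^+ n].
  move=> n; have /cauchyP/(_ (rc ((2^-1) ^+ n)))[] := cF.
    by rewrite -rc0 rc_lt halfX_gt0.
  by move=> x hx; exists x; apply: filterS hx => y /=; rewrite -ball_normE /= nm_lt.
have [l hl] : exists l, forall n, nm (l - x n) <= 2 * 2 * (2^-1) ^+ n.
  apply: geo_cvg => // n; have [y [/= h1 h2]] := filter_ex (filterI (hx n) (hx n.+1)).
  apply: (le_trans (nm_tri _ y _)); rewrite (nmBC y).
  by move: h1 h2; rewrite exprS => h1 h2; have := halfX_gt0 n; lra.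
apply/cvg_ex; exists l.
apply: (proj2 (@cvg_nmP R V F V id l _)) => e e0.
have e5 : 0 < e / 5 by lra.
have [n hn] := half_pow e5.
apply: filterS (hx n) => y /= hy; apply: (le_lt_trans (nm_tri _ (x n) _)).
by have := hl n; lra.
Qed.
End Completeness.

(** * Supremum norms and Banach spaces of bounded functions *)

Section SupNorm.
Context {R : realType}.
Local Notation K := (Cplx R).

(** The value 0 is put into the set so that the supremum is taken over a nonempty set even when D is
    empty. *)
Definition supnm {T : Type} {W : normedZmodType K} (D : set T) (f : T -> W) : R :=
  sup [set r | r = 0 \/ exists2 x, D x & r = nm (f x)].

Lemma supnm_ge {T : Type} {W : normedZmodType K} (D : set T) (f : T -> W) (c : R) :
  (forall x, D x -> nm (f x) <= c) -> forall x, D x -> nm (f x) <= supnm D f.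
Proof.
move=> h x Dx; apply: ub_le_sup; last by right; exists x.
exists (Num.max 0 c) => _ [->|[y Dy ->]]; first by rewrite le_max lexx.
by rewrite le_max (h y Dy) orbT.
Qed.

Lemma supnm_ge0 {T : Type} {W : normedZmodType K} (D : set T) (f : T -> W) (c : R) :
  (forall x, D x -> nm (f x) <= c) -> 0 <= supnm D f.
Proof.
move=> h; apply: ub_le_sup; last by left.
exists (Num.max 0 c) => _ [->|[y Dy ->]]; first by rewrite le_max lexx.
by rewrite le_max (h y Dy) orbT.
Qed.

Lemma supnm_le {T : Type} {W : normedZmodType K} (D : set T) (f : T -> W) (c : R) :
  0 <= c -> (forall x, D x -> nm (f x) <= c) -> supnm D f <= c.
Proof.
move=> c0 h; apply: ge_sup; first by exists 0; left.
by move=> _ [->//|[y Dy ->]]; exact: h.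
Qed.
End SupNorm.

Section BoundedFunctions.
Context {R : realType}.
Local Notation K := (Cplx R).

Definition bs_ok {G : Type} {W : normedModType K} (S : set (G -> W)) :=
  [/\ S (fun=> 0), (forall (a : K) f g, S f -> S g -> S (fun x => a *: f x + g x)) &
    forall f, (forall e : R, 0 < e -> exists2 g, S g & forall x, nm (f x - g x) <= e) -> S f].

(** The common source of the Banach spaces constructed below: bounded functions on a dual ball,
    quotients, closed subspaces (functions on [unit]), and l_infty-sums. The proofs [cW] and [hS]
    are arguments of the type because its normed and complete structures depend on them. *)
Definition bsp (G : Type) (W : normedModType K) (S : set (G -> W))
  (cW : seqcomplete W) (hS : bs_ok S) : Type :=
  {f : G -> W | S f /\ exists c : R, forall x, nm (f x) <= c}.

Section bsp.
Variables (G : Type) (W : normedModType K) (S : set (G -> W)).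
Variables (cW : seqcomplete W) (hS : bs_ok S).
Local Notation V := (bsp cW hS).
Implicit Types f g h : V.

Lemma bsp_ext f g : (forall x, sval f x = sval g x) -> f = g.
Proof.
case: f g => f pf [g pg] /= /funext h; subst g.
by congr exist; exact: Prop_irrelevance.
Qed.

Lemma bspS f : S (sval f). Proof. by case: f => f []. Qed.
Lemma bsp_bd f : exists c : R, forall x, nm (sval f x) <= c.
Proof. by case: f => f []. Qed.

Fact bsp_add_key f g : S (fun x => sval f x + sval g x) /\
  exists c : R, forall x, nm (sval f x + sval g x) <= c.
Proof.
case: hS => _ SD _; split.
  have := SD 1 _ _ (bspS f) (bspS g); congr S; apply/funext => x.
  by rewrite scale1r.
have [c hc] := bsp_bd f; have [d hd] := bsp_bd g; exists (c + d) => x.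
by apply: (le_trans (nmD _ _)); exact: lerD.
Qed.
Definition bsp_add f g : V := exist _ (fun x => sval f x + sval g x) (bsp_add_key f g).

Fact bsp_zero_key : S (fun=> 0) /\ exists c : R, forall x : G, nm (0 : W) <= c.
Proof. by case: hS => S0 _ _; split=> //; exists 0 => x; rewrite nm0. Qed.
Definition bsp_zero : V := exist _ (fun=> 0) bsp_zero_key.

Fact bsp_scale_key (a : K) f : S (fun x => a *: sval f x) /\
  exists c : R, forall x, nm (a *: sval f x) <= c.
Proof.
case: hS => S0 SD _; split.
  have := SD a _ _ (bspS f) S0; congr S; apply/funext => x.
  by rewrite addr0.
have [c hc] := bsp_bd f; exists (nm a * c) => x.
by rewrite nmZ; apply: ler_wpM2l => //; exact: nm_ge0.
Qed.
Definition bsp_scale (a : K) f : V := exist _ (fun x => a *: sval f x) (bsp_scale_key a f).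

HB.instance Definition _ := gen_eqMixin V.
HB.instance Definition _ := gen_choiceMixin V.

Let addA : associative bsp_add.
Proof. by move=> f g h; apply: bsp_ext => x /=; rewrite addrA. Qed.
Let addC : commutative bsp_add.
Proof. by move=> f g; apply: bsp_ext => x /=; rewrite addrC. Qed.
Let add0 : left_id bsp_zero bsp_add.
Proof. by move=> f; apply: bsp_ext => x /=; rewrite add0r. Qed.
Let addN : left_inverse bsp_zero (bsp_scale (-1)) bsp_add.
Proof. by move=> f; apply: bsp_ext => x /=; rewrite scaleN1r addNr. Qed.
HB.instance Definition _ := GRing.isZmodule.Build V addA addC add0 addN.

Let sA a b f : bsp_scale a (bsp_scale b f) = bsp_scale (a * b) f.
Proof. by apply: bsp_ext => x /=; rewrite scalerA. Qed.
Let s1 : left_id 1 bsp_scale.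
Proof. by move=> f; apply: bsp_ext => x /=; rewrite scale1r. Qed.
Let sDr : right_distributive bsp_scale +%R.
Proof. by move=> a f g; apply: bsp_ext => x /=; rewrite scalerDr. Qed.
Let sDl f : {morph bsp_scale^~ f : a b / a + b}.
Proof. by move=> a b; apply: bsp_ext => x /=; rewrite scalerDl. Qed.
HB.instance Definition _ := GRing.Zmodule_isLmodule.Build K V sA s1 sDr sDl.

Lemma bspD f g x : sval (f + g) x = sval f x + sval g x. Proof. by []. Qed.
Lemma bspZ a f x : sval (a *: f) x = a *: sval f x. Proof. by []. Qed.
Lemma bspN f x : sval (- f) x = - sval f x.
Proof. by rewrite -scaleN1r bspZ scaleN1r. Qed.
Lemma bspB f g x : sval (f - g) x = sval f x - sval g x.
Proof. by rewrite bspD bspN. Qed.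

Definition bsp_norm f : K := rc (supnm setT (sval f)).

Let ub f x : nm (sval f x) <= supnm setT (sval f).
Proof. by have [c hc] := bsp_bd f; apply: (@supnm_ge _ _ _ _ _ c). Qed.
Let sup_ge0 f : 0 <= supnm setT (sval f).
Proof. by have [c hc] := bsp_bd f; apply: (@supnm_ge0 _ _ _ _ _ c). Qed.
Let supP f (c : R) : 0 <= c -> (forall x, nm (sval f x) <= c) -> supnm setT (sval f) <= c.
Proof. by move=> c0 h; apply: supnm_le => // x _; exact: h. Qed.

Let normD f g : bsp_norm (f + g) <= bsp_norm f + bsp_norm g.
Proof.
rewrite -rcD rc_le; apply: supP => [|x]; first exact: addr_ge0.
by apply: (le_trans (nmD _ _)); exact: lerD.
Qed.
Let normZ (a : K) f : bsp_norm (a *: f) = `|a| * bsp_norm f.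
Proof.
rewrite nmE -rcM; congr rc; apply/eqP; rewrite eq_le; apply/andP; split.
  apply: supP => [|x]; first by rewrite mulr_ge0 // nm_ge0.
  by rewrite bspZ nmZ; apply: ler_wpM2l => //; exact: nm_ge0.
have [->|a0] := eqVneq a 0; first by rewrite nm0 mul0r.
rewrite -ler_pdivlMl ?nm_gt0 //; apply: supP => [|x].
  by rewrite mulr_ge0 // invr_ge0 nm_ge0.
by rewrite ler_pdivlMl ?nm_gt0 // -nmZ -bspZ.
Qed.
Let norm0 f : bsp_norm f = 0 -> f = 0.
Proof.
move=> /rc_inj h; apply: bsp_ext => x; apply: nm_le0.
by apply: (le_trans (ub f x)); rewrite h.
Qed.
HB.instance Definition _ := Lmodule_isNormed.Build K V normD normZ norm0.

Lemma nm_bsp_ge f x : nm (sval f x) <= nm f. Proof. exact: ub. Qed.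
Lemma nm_bsp_le f (c : R) : 0 <= c -> (forall x, nm (sval f x) <= c) -> nm f <= c.
Proof. exact: supP. Qed.

Lemma bsp_seqcomplete : seqcomplete V.
Proof.
move=> u hu.
have /choice[l hl] : forall x, exists l, forall e : R, 0 < e -> exists N, forall n, (N <= n)%N -> nm (sval (u n) x - l) <= e.
  move=> x; apply: cW => e e0; have [N hN] := hu e e0; exists N => m n hm hn.
  by rewrite -bspB; apply: (le_trans (nm_bsp_ge _ _)); exact: hN.
have lu (e : R) : 0 < e -> exists N, forall n, (N <= n)%N -> forall x, nm (l x - sval (u n) x) <= e.
  move=> e0; have [N hN] := hu e e0; exists N => n hn x.
  apply: (@lim_nm_le _ _ (fun m => sval (u m) x - sval (u n) x) _ _ N); last first.
    by move=> m hm; rewrite -bspB; apply: (le_trans (nm_bsp_ge _ _)); exact: hN.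
  move=> e' e0'; have [M hM] := hl x e' e0'; exists M => m hm.
  by rewrite opprB addrA subrK; exact: hM.
have [S0 SD Scl] := hS.
have Sl : S l.
  apply: Scl => e e0; have [N hN] := lu e e0; exists (sval (u N)); first exact: bspS.
  by move=> x; exact: hN.
have bl : exists c : R, forall x, nm (l x) <= c.
  have [N hN] := lu 1 ltr01; exists (1 + nm (u N)) => x.
  by have := hN N (leqnn _) x; have := nm_Bge (l x) (sval (u N) x); have := nm_bsp_ge (u N) x; lra.
exists (exist _ l (conj Sl bl) : V) => e e0; have [N hN] := lu e e0; exists N => n hn.
apply: nm_bsp_le => [|x]; first exact: ltW.
by rewrite bspB nmBC; exact: hN.
Qed.

Let cvgV (F : set_system V) : ProperFilter F -> cauchy F -> cvg F.
Proof. exact: (seqcomplete_filter bsp_seqcomplete). Qed.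
HB.instance Definition _ := Uniform_isComplete.Build V cvgV.

End bsp.

End BoundedFunctions.

(** * The dual space and the open mapping theorem *)

Section DualSpace.
Context {R : realType}.
Local Notation K := (Cplx R).
Variable Y : completeNormedModType K.
Implicit Types phi psi : Dual Y.

Lemma dual_lfun phi : lfun (sval phi). Proof. by case: phi => f []. Qed.
Lemma dual_bd phi : exists2 c : R, 0 < c & forall y, nm (sval phi y) <= c * nm y.
Proof. by case: phi => f [fl fc] /=; exact: lfun_bound. Qed.

Definition mkdual (f : Y -> K) (c : R) (fl : lfun f) (fc : forall y, nm (f y) <= c * nm y) : Dual Y :=
  exist _ f (conj fl (lfun_cont fl fc)).

Lemma dual_ext_eq phi psi : (forall y, sval phi y = sval psi y) -> phi = psi.
Proof.
case: phi psi => f pf [g pg] /= /funext h; subst g.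
by congr exist; exact: Prop_irrelevance.
Qed.

Fact dual_add_key phi psi : is_dual (fun y => sval phi y + sval psi y).
Proof.
have [c _ hc] := dual_bd phi; have [d _ hd] := dual_bd psi.
have hl : lfun (fun y => sval phi y + sval psi y).
  by move=> a x y; rewrite (dual_lfun phi) (dual_lfun psi); ring.
split=> //; apply: (@lfun_cont _ _ _ (c + d)) => // y.
by apply: (le_trans (nmD _ _)); rewrite mulrDl; exact: lerD.
Qed.
Definition dual_add phi psi : Dual Y := exist _ _ (dual_add_key phi psi).
Fact dual_scale_key (a : K) phi : is_dual (fun y => a * sval phi y).
Proof.
have [c _ hc] := dual_bd phi.
have hl : lfun (fun y => a * sval phi y).
  by move=> b x y; rewrite (dual_lfun phi); ring.
split=> //; apply: (@lfun_cont _ _ _ (nm a * c)) => // y.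
by rewrite nmM -mulrA; apply: ler_wpM2l => //; exact: nm_ge0.
Qed.
Definition dual_scale (a : K) phi : Dual Y := exist _ _ (dual_scale_key a phi).
Fact dual_zero_key : @is_dual R Y (fun=> 0).
Proof.
have hl : @lfun R Y (fun=> 0) by move=> a x y; rewrite mulr0 addr0.
by split=> //; apply: (@lfun_cont _ _ _ 0) => // y; rewrite nm0 mul0r.
Qed.
Definition dual_zero : Dual Y := exist _ _ dual_zero_key.

HB.instance Definition _ := gen_eqMixin (Dual Y).
HB.instance Definition _ := gen_choiceMixin (Dual Y).

Let addA : associative dual_add.
Proof. by move=> f g h; apply: dual_ext_eq => x /=; rewrite addrA. Qed.
Let addC : commutative dual_add.
Proof. by move=> f g; apply: dual_ext_eq => x /=; rewrite addrC. Qed.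
Let add0 : left_id dual_zero dual_add.
Proof. by move=> f; apply: dual_ext_eq => x /=; rewrite add0r. Qed.
Let addN : left_inverse dual_zero (dual_scale (-1)) dual_add.
Proof. by move=> f; apply: dual_ext_eq => x /=; rewrite mulN1r addNr. Qed.
HB.instance Definition _ := GRing.isZmodule.Build (Dual Y) addA addC add0 addN.

Let sA a b f : dual_scale a (dual_scale b f) = dual_scale (a * b) f.
Proof. by apply: dual_ext_eq => x /=; rewrite mulrA. Qed.
Let s1 : left_id 1 dual_scale.
Proof. by move=> f; apply: dual_ext_eq => x /=; rewrite mul1r. Qed.
Let sDr : right_distributive dual_scale +%R.
Proof. by move=> a f g; apply: dual_ext_eq => x /=; rewrite mulrDr. Qed.
Let sDl f : {morph dual_scale^~ f : a b / a + b}.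
Proof. by move=> a b; apply: dual_ext_eq => x /=; rewrite mulrDl. Qed.
HB.instance Definition _ := GRing.Zmodule_isLmodule.Build K (Dual Y) sA s1 sDr sDl.

Lemma dualD phi psi y : sval (phi + psi) y = sval phi y + sval psi y. Proof. by []. Qed.
Lemma dualZ a phi y : sval (a *: phi) y = a * sval phi y. Proof. by []. Qed.
Lemma dualN phi y : sval (- phi) y = - sval phi y.
Proof. by rewrite -scaleN1r dualZ mulN1r. Qed.
Lemma dualB phi psi y : sval (phi - psi) y = sval phi y - sval psi y.
Proof. by rewrite dualD dualN. Qed.

Let B1 : set Y := [set y | nm y <= 1].
Definition dual_norm phi : K := rc (supnm B1 (sval phi)).

Let bdB phi : exists c : R, forall y, B1 y -> nm (sval phi y) <= c.
Proof.
have [c c0 hc] := dual_bd phi; exists c => y y1.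
by apply: (le_trans (hc y)); rewrite -[leRHS]mulr1 ler_wpM2l // ltW.
Qed.
Let sup_ge0 phi : 0 <= supnm B1 (sval phi).
Proof. by have [c hc] := bdB phi; apply: supnm_ge0 hc. Qed.
Let ub phi y : nm (sval phi y) <= supnm B1 (sval phi) * nm y.
Proof.
have [->|y0] := eqVneq y 0; first by rewrite (lfun0 (dual_lfun phi)) !nm0 mulr0.
have y1 := nm_gt0 y0; have [c hc] := bdB phi.
have := supnm_ge hc (x := rc (nm y)^-1 *: y).
rewrite (lfunZ (dual_lfun phi)) nmM nm_rc ger0_norm ?invr_ge0 ?nm_ge0 //.
rewrite -ler_pdivrMr // mulrC; apply.
by rewrite /B1 /= nmZ nm_rc ger0_norm ?invr_ge0 ?nm_ge0 // mulVf // lt0r_neq0.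
Qed.
Let supP phi (c : R) : 0 <= c -> (forall y, nm (sval phi y) <= c * nm y) -> supnm B1 (sval phi) <= c.
Proof.
move=> c0 h; apply: supnm_le => // y y1; apply: (le_trans (h y)).
by rewrite -[leRHS]mulr1 ler_wpM2l.
Qed.
Let normD f g : dual_norm (f + g) <= dual_norm f + dual_norm g.
Proof.
rewrite -rcD rc_le; apply: supP => [|x]; first exact: addr_ge0.
by apply: (le_trans (nmD _ _)); rewrite mulrDl; exact: lerD.
Qed.
Let normZ (a : K) f : dual_norm (a *: f) = `|a| * dual_norm f.
Proof.
rewrite nmE -rcM; congr rc; apply/eqP; rewrite eq_le; apply/andP; split.
  apply: supP => [|x]; first by rewrite mulr_ge0 // nm_ge0.
  by rewrite dualZ nmM -mulrA; apply: ler_wpM2l => //; exact: nm_ge0.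
have [->|a0] := eqVneq a 0; first by rewrite nm0 mul0r.
rewrite -ler_pdivlMl ?nm_gt0 //; apply: supP => [|x].
  by rewrite mulr_ge0 // invr_ge0 nm_ge0.
by rewrite -mulrA ler_pdivlMl ?nm_gt0 // -nmM -dualZ.
Qed.
Let norm0 f : dual_norm f = 0 -> f = 0.
Proof.
move=> /rc_inj h; apply: dual_ext_eq => x; apply: nm_le0.
by apply: (le_trans (ub f x)); rewrite h mul0r.
Qed.
HB.instance Definition _ := Lmodule_isNormed.Build K (Dual Y) normD normZ norm0.

Lemma nm_dual_ge phi y : nm (sval phi y) <= nm phi * nm y. Proof. exact: ub. Qed.
Lemma nm_dualP phi (c : R) : 0 <= c -> (forall y, nm (sval phi y) <= c * nm y) -> nm phi <= c.
Proof. exact: supP. Qed.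

Lemma dual_le_nm phi (c : K) : dual_le phi c -> nm phi <= nm c.
Proof.
move=> h; apply: nm_dualP => [|y]; first exact: nm_ge0.
have [h1 h2] := nmP (h y); apply: (le_trans h2); apply: (le_trans (re_le_nm _)).
by rewrite nmM {2}/nm normr_id.
Qed.
Lemma nm_dual_le' phi (c : R) : nm phi <= c -> dual_le phi (rc c).
Proof.
move=> h y; rewrite nmE nmE -rcM rc_le; apply: (le_trans (nm_dual_ge _ _)).
by apply: ler_wpM2r => //; exact: nm_ge0.
Qed.
Lemma dual_dist_nm phi psi (c : K) : dual_dist_le phi psi c -> nm (phi - psi) <= nm c.
Proof. by move=> h; apply: dual_le_nm => y; rewrite dualB; exact: h. Qed.
Lemma nm_dual_dist phi psi (c : R) : nm (phi - psi) <= c -> dual_dist_le phi psi (rc c).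
Proof. by move=> /nm_dual_le' h y; rewrite -dualB; exact: h. Qed.
Lemma dual_combE chi a phi psi : dual_comb chi a phi psi <-> chi = a *: phi + psi.
Proof.
split=> [h|-> y]; first by apply: dual_ext_eq => y; rewrite dualD dualZ; exact: h.
by rewrite dualD dualZ.
Qed.
Lemma dual_boundedP (B : set (Dual Y)) :
  dual_bounded B <-> exists c : R, forall phi, B phi -> nm phi <= c.
Proof.
split=> [[c hc]|[c hc]]; first by exists (nm c) => phi /hc/dual_le_nm.
by exists (rc c) => phi /hc/nm_dual_le'.
Qed.
Lemma wstar_convP (F : set_system (Dual Y)) phi0 : Filter F ->
  wstar_conv F phi0 <-> forall y (e : R), 0 < e -> F [set phi | nm (sval phi y - sval phi0 y) < e].
Proof.
move=> FF; split=> [h y e e0|h y].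
  by have /cvg_nmP/(_ e e0) := h y; apply: filterS => phi /=; rewrite nmBC.
by apply/cvg_nmP => e e0; apply: filterS (h y e e0) => phi /=; rewrite nmBC.
Qed.
Lemma dual_contP (W : completeNormedModType K) (g : Dual Y -> W) :
  dual_cont g <-> forall phi0 (e : R), 0 < e -> exists2 d : R, 0 < d &
    forall phi, nm (phi - phi0) <= d -> nm (g phi - g phi0) < e.
Proof.
split=> h phi0.
  move=> e e0; have [d [d0 hd]] := h phi0 (rc e) ltac:(by rewrite -rc0 rc_lt).
  have [r r0 dr] := rcK d0; exists r => // phi hp; rewrite -nm_lt; apply: hd.
  by rewrite dr; exact: nm_dual_dist.
move=> e e0; have [r r0 ->] := rcK e0; have [d d0 hd] := h phi0 r r0.
exists (rc d); split; first by rewrite -rc0 rc_lt.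
move=> phi /dual_dist_nm; rewrite nm_rc gtr0_norm // => /hd.
by rewrite nm_lt.
Qed.
Lemma dual_linearP (W : completeNormedModType K) (g : Dual Y -> W) :
  dual_linear g <-> lin g.
Proof.
split=> [h a phi psi|h a chi phi psi /dual_combE ->]; last exact: h.
by apply: h; apply/dual_combE.
Qed.

Lemma dual_norming (y : Y) : exists phi, nm phi <= 1 /\ sval phi y = rc (nm y).
Proof.
have [g [gl g1 gy]] := norming y.
have g1' z : nm (g z) <= 1 * nm z by rewrite mul1r.
by exists (mkdual gl g1'); split=> //; apply: nm_dualP.
Qed.
Lemma nm_by_dual (y : Y) (c : R) : (forall phi, nm phi <= 1 -> nm (sval phi y) <= c) -> nm y <= c.
Proof.
move=> h; have [phi [p1 py]] := dual_norming y.
by have := h phi p1; rewrite py nm_rc ger0_norm ?nm_ge0.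
Qed.
Lemma eq_by_dual (y z : Y) : (forall phi, sval phi y = sval phi z) -> y = z.
Proof.
move=> h; apply/eqP; rewrite -subr_eq0; apply/eqP; apply: nm_le0; apply: nm_by_dual => phi _.
by rewrite (lfunB (dual_lfun phi)) h subrr nm0.
Qed.
End DualSpace.

(** * The open mapping theorem *)

Section OpenMapping.
Context {R : realType}.
Local Notation K := (Cplx R).
Variables (X Z : completeNormedModType K) (q : X -> Z).
Hypotheses (ql : lin q) (qc : continuous q) (qs : forall z, exists x, q x = z).

(** Baire's argument by hand. If the image of no ball of radius n were dense in some ball of Z,
    nested balls of halving radius could be chosen, the n-th step staying away from the image of the
    n-ball. Their common point has a preimage x, and the step at an integer above the norm of x
    gives a contradiction. *)
Let baire : exists (n : nat) (z0 : Z) (r : R), 0 < r /\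
  forall z, nm (z - z0) <= r -> forall e : R, 0 < e -> exists2 x, nm x <= n%:R & nm (q x - z) <= e.
Proof.
apply: contrapT => hn.
have step (p : nat * (Z * R)) : exists w : Z * R, 0 < p.2.2 ->
    [/\ 0 < w.2, w.2 <= p.2.2 / 2, nm (w.1 - p.2.1) <= p.2.2 / 2 &
      forall x, nm x <= p.1%:R -> w.2 < nm (q x - w.1)].
  case: p => n [z0 r] /=; have [r0|nr] := ltP 0 r; last by exists (0, 0).
  have : ~ forall z, nm (z - z0) <= r / 2 -> forall e : R, 0 < e -> exists2 x, nm x <= n%:R & nm (q x - z) <= e.
    by move=> h; apply: hn; exists n, z0, (r / 2); split=> //; lra.
  move=> /existsNP[z /not_implyP[h1 /existsNP[e /not_implyP[e0 h2]]]].
  exists (z, Num.min (r / 2) (e / 2)) => _ /=; split=> //.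
  - by rewrite lt_min; apply/andP; split; lra.
  - by rewrite ge_min lexx.
  - move=> x xn; rewrite ltNge; apply/negP => h; apply: h2; exists x => //.
    by apply: (le_trans h); rewrite ge_min; apply/orP; right; lra.
have [F hF] := choice step.
pose u := fix u n := if n is m.+1 then F (m, u m) else (0, 1).
have u0 n : 0 < (u n).2.
  by elim: n => [|n IH] /=; [exact: ltr01|have [] := hF (n, u n) IH].
have ur n : (u n).2 <= (2^-1) ^+ n.
  elim: n => [|n IH] /=; first by rewrite expr0.
  by have [_ h _ _] := hF (n, u n) (u0 n); rewrite exprS /= in h *; lra.
have uc n : nm ((u n.+1).1 - (u n).1) <= 2^-1 * (2^-1) ^+ n.
  by have [_ _ h _] := hF (n, u n) (u0 n); have := ur n; rewrite /= in h *; lra.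
have [l hl] := geo_cvg (seqcompleteP (W := Z)) uc.
have close n k : nm ((u (n + k)%N).1 - (u n).1) <= (u n).2 - (u (n + k)%N).2.
  elim: k => [|k IH]; first by rewrite addn0 !subrr nm0.
  rewrite addnS; have [h0 h1 h2 _] := hF ((n + k)%N, u (n + k)%N) (u0 _).
  apply: (le_trans (nm_tri _ (u (n + k)%N).1 _)); move: h0 h1 h2 => /=; lra.
have lclose n : nm (l - (u n).1) <= (u n).2.
  apply/ler_addgt0Pr => e e0; have [k hk] := half_pow e0.
  apply: (le_trans (nm_tri _ (u (n + k)%N).1 _)).
  have := hl (n + k)%N; have := half_anti (leq_addl n k : (k <= n + k)%N) (R := R).
  by have := close n k; have := u0 (n + k)%N; lra.
have [x hx] := qs l.
pose N := Num.bound (nm x).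
have xN : nm x <= N%:R by apply/ltW/archi_boundP/nm_ge0.
have [_ _ _ /(_ x xN)] := hF (N, u N) (u0 N).
by rewrite hx /=; have := lclose N.+1; rewrite /= leNgt => /negP.
Qed.

(** Subtracting approximate preimages of z0 + z and z0 moves the ball given by [baire] to the
    origin; scaling gives all z. *)
Let approx : exists2 C : R, 0 < C & forall z (e : R), 0 < e ->
  exists2 x, nm x <= C * nm z & nm (q x - z) <= e.
Proof.
have [n [z0 [r [r0 h]]]] := baire.
have h0 z e : nm z <= r -> 0 < e -> exists2 x, nm x <= 2 * n%:R & nm (q x - z) <= e.
  move=> zr e0.
  have [x1 hx1 hz1] := h (z0 + z) ltac:(by rewrite addrC addKr) (e / 2) ltac:(lra).
  have [x2 hx2 hz2] := h z0 ltac:(by rewrite subrr nm0; lra) (e / 2) ltac:(lra).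
  exists (x1 - x2); first by apply: (le_trans (nmB _ _)); lra.
  rewrite linB // (_ : _ - z = (q x1 - (z0 + z)) - (q x2 - z0)).
    by apply: (le_trans (nmB _ _)); lra.
  by rewrite opprB opprD (addrC (- z0)) !addrA subrK addrAC.
exists ((2 * n%:R + 1) / r); first by apply: divr_gt0 => //; have : 0 <= n%:R :> R by []; lra.
move=> z e e0; have [->|z0'] := eqVneq z 0.
  by exists 0; rewrite ?nm0 ?mulr0 // lin0 // subrr nm0 ltW.
have nz := nm_gt0 z0'.
pose t := r / nm z; have t0 : 0 < t by exact: divr_gt0.
have [|x hx hz] := h0 (rc t *: z) (t * e) _ (mulr_gt0 t0 e0).
  by rewrite nmZ nm_rc gtr0_norm // /t divfK // lt0r_neq0.
have tV : 0 < t^-1 by rewrite invr_gt0.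
exists (rc t^-1 *: x).
  rewrite nmZ nm_rc gtr0_norm // /t invf_div.
  rewrite [leRHS](_ : _ = nm z / r * (2 * n%:R + 1)); last by field; exact: lt0r_neq0.
  apply: ler_wpM2l; last lra.
  by apply: divr_ge0; lra.
have -> : q (rc t^-1 *: x) - z = rc t^-1 *: (q x - rc t *: z).
  by rewrite linZ // scalerBr scalerA -rcM mulVf ?lt0r_neq0 // rc1 scale1r.
by rewrite nmZ nm_rc gtr0_norm // ler_pdivrMl.
Qed.

(** Each correction halves the error, and the geometric series of corrections doubles the
    constant. *)
Theorem open_mapping : exists2 C : R, 0 < C & forall z, exists2 x, q x = z & nm x <= C * nm z.
Proof.
have [C C0 h] := approx; exists (2 * C); first by lra.
move=> z; have [->|z0] := eqVneq z 0.
  by exists 0; rewrite ?lin0 // !nm0 mulr0.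
have nz := nm_gt0 z0.
have /choice[F hF] : forall p : nat * X, exists x, nm (z - q p.2) <= nm z * (2^-1) ^+ p.1 ->
    nm x <= C * nm z * (2^-1) ^+ p.1 /\ nm (z - q (p.2 + x)) <= nm z * (2^-1) ^+ p.1.+1.
  move=> [n s] /=; have [x h1 h2] := h (z - q s) (nm z * (2^-1) ^+ n.+1) (mulr_gt0 nz (halfX_gt0 _)).
  exists x => hs; split; first by apply: (le_trans h1); rewrite -mulrA ler_wpM2l // ltW.
  by rewrite linD // opprD addrA nmBC.
pose s := fix s n := if n is m.+1 then s m + F (m, s m) else 0.
have hs n : nm (z - q (s n)) <= nm z * (2^-1) ^+ n.
  elim: n => [|n IH]; first by rewrite /= lin0 // subr0 expr0 mulr1.
  by have [_] := hF (n, s n) IH.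
have sc n : nm (s n.+1 - s n) <= C * nm z * (2^-1) ^+ n.
  by rewrite /= addrC addKr; have [] := hF (n, s n) (hs n).
have [l hl] := geo_cvg (seqcompleteP (W := X)) sc.
exists l; last by have := hl 0%N; rewrite /= subr0 expr0; lra.
have [c c0 hc] := lin_bound ql qc.
apply/eqP; rewrite -subr_eq0; apply/eqP; apply: nm_small => e e0.
pose D := c * (2 * (C * nm z)) + nm z.
have D0 : 0 < D.
  by rewrite ltr_wpDl // mulr_ge0 ?(ltW c0) // mulr_ge0 // mulr_ge0 ?(ltW C0) ?(ltW nz).
have [n hn] := half_pow (divr_gt0 e0 D0); rewrite ltr_pdivlMr // in hn.
apply: (le_trans (nm_tri _ (q (s n)) _)); rewrite -linB // (nmBC _ z).
have h1 := hc (l - s n); have h2 := hl n; have h3 := hs n.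
have : c * nm (l - s n) <= c * (2 * (C * nm z) * 2^-1 ^+ n) by rewrite ler_wpM2l // ltW.
by rewrite /D in hn *; lra.
Qed.
End OpenMapping.

(** * Local factorization through finite-dimensional sup-norm spaces *)

Section LocalFactorization.
Context {R : realType}.
Local Notation K := (Cplx R).

Lemma rc_max (a b : R) : rc (Num.max a b) = Num.max (rc a) (rc b).
Proof. by rewrite !maxEle rc_le; case: ifP. Qed.

Lemma supnE (n : nat) (c : 'I_n -> K) : supn c = rc (\big[Num.max/0]_(k < n) nm (c k)).
Proof.
rewrite /supn (big_morph rc rc_max (rc0 (R := R))).
by apply: eq_bigr => k _; rewrite nmE.
Qed.

Lemma supn_ge0 (n : nat) (c : 'I_n -> K) : 0 <= \big[Num.max/0]_(k < n) nm (c k).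
Proof. exact: bigmax_ge_id. Qed.
Lemma supn_ge (n : nat) (c : 'I_n -> K) (k : 'I_n) : nm (c k) <= \big[Num.max/0]_(k < n) nm (c k).
Proof. exact: (le_bigmax_cond _ (fun k => nm (c k))). Qed.
Lemma supn_le (n : nat) (c : 'I_n -> K) (M : R) : 0 <= M -> (forall k, nm (c k) <= M) ->
  \big[Num.max/0]_(k < n) nm (c k) <= M.
Proof. by move=> M0 h; apply: bigmax_le => // k _; exact: h. Qed.

(* Every finite-dimensional subspace of Y is fixed by an operator of the form
   y |-> (p_k y)_k |-> \sum_k p_k y v_k through some l_infty^n, with norms
   bounded by 1 and lam. *)
Definition locfact (Y : completeNormedModType K) (lam : R) :=
  forall (m : nat) (e : 'I_m -> Y), exists (n : nat) (v : 'I_n -> Y) (p : 'I_n -> Dual Y),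
    [/\ forall k, nm (p k) <= 1,
        forall (c : 'I_n -> K) (M : R), 0 <= M -> (forall k, nm (c k) <= M) ->
          nm (\sum_(k < n) c k *: v k) <= lam * M &
        forall j, e j = \sum_(k < n) sval (p k) (e j) *: v k].

(** The adjoint of a map from l_infty^n takes values in l_1^n: test with coefficients of modulus 1
    that align the values of [phi]. *)
Lemma locfact_dual (Y : completeNormedModType K) (lam : R) (n : nat) (v : 'I_n -> Y) (phi : Dual Y) :
  (forall (c : 'I_n -> K) (M : R), 0 <= M -> (forall k, nm (c k) <= M) ->
    nm (\sum_(k < n) c k *: v k) <= lam * M) ->
  \sum_(k < n) nm (sval phi (v k)) <= nm phi * lam.
Proof.
move=> h; have /choice[c hc] : forall k, exists c : K, nm c = 1 /\ c * sval phi (v k) = rc (nm (sval phi (v k))).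
  by move=> k; exact: phase.
have h1 := h c 1 ler01 (fun k => eq_ind_r (fun x => x <= 1) (lexx 1) (proj1 (hc k))).
have := nm_dual_ge phi (\sum_(k < n) c k *: v k).
rewrite (lfun_sum (dual_lfun phi)).
under eq_bigr do rewrite (lfunZ (dual_lfun phi)) (proj2 (hc _)).
rewrite -rc_sum nm_rc ger0_norm; last by apply: sumr_ge0 => *; exact: nm_ge0.
move=> /le_trans; apply; rewrite mulr1 in h1.
by apply: ler_wpM2l => //; exact: nm_ge0.
Qed.

Lemma Linfty_locfact (Y : completeNormedModType K) : Linfty_space Y -> exists lam : R, locfact Y lam.
Proof.
move=> [lam [lam1 h]]; exists (re lam) => m e.
have [n [v [ev [a [b [a0 b0 ab hv]]]]]] := h m e.
have [r r0 ar] := rcK a0; have [s s0 bs] := rcK b0; subst a b.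
have rs : r * s <= re lam.
  have [lamE _] := K_ge0 (le_trans ler01 lam1).
  by rewrite -rc_le rcM -lamE.
have hv1 c k : nm (c k) <= r * nm (\sum_(k < n) c k *: v k).
  have [h1 _] := hv c; apply: (le_trans (supn_ge c k)).
  by rewrite -rc_le -supnE rcM -nmE.
have hv2 c : nm (\sum_(k < n) c k *: v k) <= s * \big[Num.max/0]_(k < n) nm (c k).
  by have [_] := hv c; rewrite supnE nmE -rcM rc_le.
have /choice[co hco] : forall y, exists c : 'I_n -> K, span_of v y -> y = \sum_(k < n) c k *: v k.
  by move=> y; have [[c ->]|ny] := pselect (span_of v y); [exists c | exists (fun=> 0)].
have inj c d : \sum_(k < n) c k *: v k = \sum_(k < n) d k *: v k -> forall k, c k = d k.
  move=> e1 k; apply/eqP; rewrite -subr_eq0; apply/eqP; apply: nm_le0.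
  have := hv1 (fun k => c k - d k) k.
  by under eq_bigr do rewrite scalerBl; rewrite sumrB e1 subrr nm0 mulr0.
have sl (a : K) x y : span_of v x -> span_of v y -> span_of v (a *: x + y).
  move=> [c ->] [d ->]; exists (fun k => a * c k + d k).
  under [RHS]eq_bigr do rewrite scalerDl -scalerA.
  by rewrite big_split scaler_sumr.
have s00 : span_of v 0 by exists (fun=> 0); rewrite big1 // => k _; rewrite scale0r.
have hk k : exists p : Dual Y, nm p <= r /\ forall c, sval p (\sum_(k < n) c k *: v k) = c k.
  have [|||g [gl gf gc]] := @hb_norm R Y (span_of v) (fun y => co y k) r s00 sl; last first.
  - exists (mkdual gl gc); split; first by apply: nm_dualP => //; exact: ltW.
    move=> c /=; rewrite gf; last by exists c.
    by apply: inj; rewrite -hco //; exists c.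
  - exact: ltW.
  - by move=> y /hco hy; rewrite [in leRHS]hy; exact: hv1.
  - move=> a x y sx sy; rewrite (inj (co (a *: x + y)) (fun k => a * co x k + co y k)) //.
    rewrite -hco; last exact: sl.
    under [RHS]eq_bigr do rewrite scalerDl -scalerA.
    by rewrite big_split /= -scaler_sumr -!hco.
have /choice[p hp] := hk.
(* Moving the factor r from the functionals to the vectors makes the former contractive and leaves
   the product of the two norms, hence the constant, unchanged. *)
exists n, (fun k => rc r *: v k), (fun k => rc r^-1 *: p k); split.
- move=> k; rewrite nmZ nm_rc gtr0_norm ?invr_gt0 // ler_pdivrMl // mulr1.
  by have [] := hp k.
- move=> c M M0 hc; have -> : \sum_(k < n) c k *: (rc r *: v k) = rc r *: \sum_(k < n) c k *: v k.
    by rewrite scaler_sumr; apply: eq_bigr => k _; rewrite !scalerA mulrC.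
  rewrite nmZ nm_rc gtr0_norm //.
  apply: (le_trans (ler_wpM2l (ltW r0) (hv2 c))); rewrite mulrA.
  apply: ler_pM => //; [by apply: mulr_ge0; exact: ltW|exact: supn_ge0|exact: supn_le].
- move=> j.
  have [c hc] : span_of v (e j).
    apply: ev; exists (fun i => (i == j)%:R).
    by rewrite (bigD1 j) //= eqxx scale1r big1 ?addr0 // => i /negbTE ->; rewrite scale0r.
  rewrite {1}hc; apply: eq_bigr => k _; rewrite dualZ hc (proj2 (hp k)) scalerA.
  by rewrite mulrAC -rcM mulVf ?lt0r_neq0 // rc1 mul1r.
Qed.

Section Exact.
Variables (Y X Z : completeNormedModType K) (i : Y -> X) (q : X -> Z).
Hypothesis ex : short_exact i q.

Lemma ex_il : lin i. Proof. by case: ex => [[]]. Qed.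
Lemma ex_ql : lin q. Proof. by case: ex => _ []. Qed.
Lemma ex_qi y : q (i y) = 0.
Proof. by case: ex => _ _ _ _ h; apply/h; exists y. Qed.
Lemma ex_ker x : q x = 0 -> exists y, i y = x.
Proof. by case: ex => _ _ _ _ h /h. Qed.
Lemma ex_inj : injective i. Proof. by case: ex. Qed.
Lemma ex_i_bound : exists2 c : R, 0 < c & forall x, nm (i x) <= c * nm x.
Proof. by apply: lin_bound; [exact: ex_il|case: ex => [[]]]. Qed.
Lemma ex_q_bound : exists2 c : R, 0 < c & forall x, nm (q x) <= c * nm x.
Proof. by apply: lin_bound; [exact: ex_ql|case: ex => _ []]. Qed.

Lemma ex_lift : exists2 C : R, 0 < C & forall z, exists2 x, q x = z & nm x <= C * nm z.
Proof. by apply: open_mapping; [exact: ex_ql|case: ex => _ []|case: ex]. Qed.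

(** The open mapping theorem for i onto its range. The range is the kernel of q, made into a Banach
    space as the functions on [unit] with values in that kernel. *)
Lemma ex_i_inverse_bound : exists2 C : R, 0 < C & forall y, nm y <= C * nm (i y).
Proof.
have [cq cq0 hq] := ex_q_bound; have [ci ci0 hi] := ex_i_bound.
pose S := [set f : unit -> X | q (f tt) = 0].
have hS : bs_ok S.
  split; first by rewrite /S /= (lin0 ex_ql).
    by move=> a f g; rewrite /S /= => h1 h2; rewrite ex_ql h1 h2 scaler0 addr0.
  move=> f h; apply: nm_small => e e0.
  have [g /= g0 hg] := h (e / cq) (divr_gt0 e0 cq0).
  rewrite -[q _]subr0 -g0 -(linB ex_ql); apply: (le_trans (hq _)).
  by rewrite mulrC -ler_pdivlMr.
pose V := bsp (seqcompleteP (W := X)) hS.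
have key y : S (fun=> i y) /\ exists c : R, forall x : unit, nm (i y) <= c.
  by split; [exact: ex_qi|exists (nm (i y))].
pose j y : V := exist _ (fun=> i y) (key y).
have nj y : nm (j y) = nm (i y).
  apply/eqP; rewrite eq_le (nm_bsp_ge (j y) tt) andbT.
  by apply: nm_bsp_le => //; exact: nm_ge0.
have jl : lin j by move=> a x y; apply: bsp_ext => -[] /=; exact: ex_il.
have jc : continuous j by apply: (lin_cont jl (c := ci)) => y; rewrite nj.
have js f : exists y, j y = f.
  have f0 : q (sval f tt) = 0 by exact: (@bspS _ _ _ _ (seqcompleteP (W := X)) hS f).
  have [y hy] := ex_ker f0.
  by exists y; apply: bsp_ext => -[].
have [C C0 h] := open_mapping (X := Y) (Z := V) jl jc js.
exists C => // y; have [y' hy' hn] := h (j y).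
have e : y = y' by apply: ex_inj; have /(congr1 (fun f => sval f tt)) := hy'.
by rewrite [in leLHS]e -nj.
Qed.

Lemma ex_extend : exists2 C : R, 0 < C & forall phi : Dual Y, exists psi : Dual X,
  (forall y, sval psi (i y) = sval phi y) /\ nm psi <= C * nm phi.
Proof.
have [C C0 hC] := ex_i_inverse_bound; exists C => // phi.
have /choice[inv hinv] : forall x, exists y, (exists y, i y = x) -> i y = x.
  by move=> x; have [[y hy]|n] := pselect (exists y, i y = x); [exists y|exists 0].
have invi y : inv (i y) = y by apply: ex_inj; apply: hinv; exists y.
have c0 : 0 <= C * nm phi by rewrite mulr_ge0 ?nm_ge0 // ltW.
have [|||||g [gl gf gc]] := @hb_norm R X [set x | exists y, i y = x] (fun x => sval phi (inv x)) (C * nm phi).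
- by exists 0; rewrite (lin0 ex_il).
- by move=> a _ _ [x <-] [y <-]; exists (a *: x + y); rewrite ex_il.
- by move=> a _ _ [x <-] [y <-]; rewrite -ex_il !invi (dual_lfun phi).
- move=> _ [y <-]; rewrite invi; apply: (le_trans (nm_dual_ge _ _)).
  by rewrite -mulrA mulrCA; apply: ler_wpM2l; [exact: nm_ge0|exact: hC].
- by [].
exists (mkdual gl gc); split; last exact: nm_dualP.
by move=> y /=; rewrite gf ?invi //; exists y.
Qed.
End Exact.

(** An element of [span_of v] killed by q is a combination of finitely many vectors i(y_j). A
    factorization fixing the y_j has its functionals extended from i(Y) to X; the resulting
    finite-rank operator on all of X inverts i on these elements. *)
Lemma locfact_splits (Y X Z : completeNormedModType K) (i : Y -> X) (q : X -> Z) (lam : R) :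
  locfact Y lam -> short_exact i q -> locally_splits i q.
Proof.
move=> hY ex; have [C C0 hC] := ex_extend ex.
(* [locfact] does not fix the sign of lam, while the splitting constant must be positive. *)
have lC : 0 < `|lam| * C + 1 by rewrite ltr_wpDl // mulr_ge0 // ltW.
exists (rc (`|lam| * C + 1)); split; first by rewrite -rc0 rc_lt.
move=> n v.
have [r [z [p [sz pb pz pe]]]] := fd_coord (fun j => q (v j)).
have /choice[x hx] : forall k, exists x, q x = z k /\ span_of v x.
  move=> k; have [c ->] := sz k; exists (\sum_(j < n) c j *: v j); split; last by exists c.
  by rewrite (lin_sum (ex_ql ex)); apply: eq_bigr => j _; rewrite (linZ (ex_ql ex)).
(* The lifts x_k of a basis of q(span v) are taken inside [span_of v]. Subtracting from v_j the
   matching combination of them leaves an element of the kernel of q. *)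
have /choice[y hy] : forall j, exists y, i y = v j - \sum_(k < r) p k (q (v j)) *: x k.
  move=> j; apply: (ex_ker ex); rewrite (linB (ex_ql ex)) (lin_sum (ex_ql ex)) {1}pe.
  apply/eqP; rewrite subr_eq0; apply/eqP; apply: eq_bigr => k _.
  by rewrite (linZ (ex_ql ex)) (proj1 (hx k)).
have [m [w [P [P1 Pw Py]]]] := hY n y.
have /choice[g hg] := fun k => hC (P k).
exists (fun x => \sum_(k < m) sval (g k) x *: w k); split.
- move=> a e f _ _; rewrite scaler_sumr -big_split /=; apply: eq_bigr => k _.
  by rewrite (dual_lfun (g k)) scalerDl scalerA.
- move=> e _; rewrite nmE nmE -rcM rc_le.
  apply: (le_trans (Pw _ (C * nm e) _ _)).
  + by rewrite mulr_ge0 ?nm_ge0 // ltW.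
  + move=> k; apply: (le_trans (nm_dual_ge _ _)); apply: ler_wpM2r; first exact: nm_ge0.
    by apply: (le_trans (proj2 (hg k))); rewrite -[leRHS]mulr1 ler_wpM2l // ltW.
  + rewrite mulrA; apply: ler_wpM2r; first exact: nm_ge0.
    by have := ler_norm lam; nra.
- move=> e [c he] [y0 hy0].
  have qe : q e = 0 by rewrite -hy0 (ex_qi ex).
  have : i y0 = i (\sum_(j < n) c j *: y j).
    rewrite hy0 (lin_sum (ex_il ex)).
    under eq_bigr do rewrite (linZ (ex_il ex)) hy scalerBr.
    rewrite sumrB -he.
    have -> : \sum_(j < n) c j *: (\sum_(k < r) p k (q (v j)) *: x k) = \sum_(k < r) p k (q e) *: x k.
      under eq_bigr do rewrite scaler_sumr.
      rewrite exchange_big /=; apply: eq_bigr => k _.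
      rewrite he (lin_sum (ex_ql ex)) (lfun_sum (proj1 (pb k))) scaler_suml.
      by apply: eq_bigr => j _; rewrite (linZ (ex_ql ex)) (lfunZ (proj1 (pb k))) scalerA.
    by rewrite qe big1 ?subr0 // => k _; rewrite (lfun0 (proj1 (pb k))) scale0r.
  move=> /(ex_inj ex) y0E; rewrite -hy0.
  under eq_bigr do rewrite (proj1 (hg _)).
  congr i; rewrite y0E.
  under eq_bigr do rewrite (lfun_sum (dual_lfun _)) scaler_suml.
  rewrite exchange_big /=; apply: eq_bigr => j _.
  rewrite [in RHS]Py scaler_sumr; apply: eq_bigr => k _.
  by rewrite (lfunZ (dual_lfun _)) scalerA.
Qed.
End LocalFactorization.

(** * From local factorization to the L_infty property *)

Section GramSchmidt.
Context {R : realType}.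
Local Notation K := (Cplx R).

Definition cj (z : K) : K := Complex (re z) (- im z).
Lemma re_cj z : re (cj z) = re z. Proof. by []. Qed.
Lemma im_cj z : im (cj z) = - im z. Proof. by []. Qed.
Lemma cjD x y : cj (x + y) = cj x + cj y.
Proof. by apply: Kext; rewrite ?(re_cj, im_cj, reD, imD) // opprD. Qed.
Lemma cjM x y : cj (x * y) = cj x * cj y.
Proof. by apply: Kext; rewrite ?(re_cj, im_cj, reM, imM); ring. Qed.
Lemma cj0 : cj 0 = 0. Proof. by apply: Kext; rewrite ?(re_cj, im_cj) ?im0 ?oppr0. Qed.
Lemma cjK x : cj (cj x) = x. Proof. by apply: Kext; rewrite ?(re_cj, im_cj) ?opprK. Qed.
Lemma cj_rc a : cj (rc a) = rc a. Proof. by apply: Kext; rewrite ?(re_cj, im_cj) ?im_rc ?oppr0. Qed.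
Lemma cj_sum (I : Type) (r : seq I) (P : pred I) (F : I -> K) :
  cj (\sum_(i <- r | P i) F i) = \sum_(i <- r | P i) cj (F i).
Proof. exact: (big_morph cj cjD cj0). Qed.
Lemma mulcj (z : K) : z * cj z = rc (nm z ^+ 2).
Proof. by rewrite nm_sqr; apply: Kext; rewrite ?(reM, imM, re_rc, im_rc, re_cj, im_cj); ring. Qed.
Lemma nm_cj z : nm (cj z) = nm z.
Proof.
have := nm_sqr (cj z); rewrite re_cj im_cj sqrrN -nm_sqr => /eqP.
by rewrite eqrXn2 ?nm_ge0 // => /eqP.
Qed.

Section fixed.
Variables (V : normedModType K) (n : nat) (p : 'I_n -> V -> K) (mu : 'I_n -> R).
Hypotheses (pl : forall k, lfun (p k)) (mu0 : forall k, 0 <= mu k).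

(** The inner product of l_2(mu) pulled back along the coordinates p_k. It is only semidefinite on
    V; definiteness on the relevant span is a hypothesis of the lemmas below. *)
Definition hform x y : K := \sum_(k < n) rc (mu k) * (p k x * cj (p k y)).
Definition qform x : R := \sum_(k < n) mu k * nm (p k x) ^+ 2.

Lemma hform_l : forall y, lfun (hform^~ y).
Proof.
move=> y a x1 x2; rewrite /hform mulr_sumr -big_split /=; apply: eq_bigr => k _.
by rewrite (pl k); ring.
Qed.
Lemma hform_cj x y : hform y x = cj (hform x y).
Proof.
rewrite /hform cj_sum; apply: eq_bigr => k _.
by rewrite !cjM cjK cj_rc [p k y * _]mulrC.
Qed.
Lemma hformxx x : hform x x = rc (qform x).
Proof. by rewrite /hform /qform rc_sum; apply: eq_bigr => k _; rewrite mulcj rcM. Qed.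

Lemma gram_schmidt (e : nat -> V) (m : nat) :
  (forall i, (i < m)%N -> ~ span_of (fun l : 'I_i => e l) (e i)) ->
  (forall x, span_of (fun l : 'I_m => e l) x -> x != 0 -> 0 < qform x) ->
  exists g : nat -> V, (forall i, (i < m)%N -> span_of (fun l : 'I_m => e l) (g i)) /\
    forall i j, (i < m)%N -> (j < m)%N -> hform (g i) (g j) = (i == j)%:R.
Proof.
move=> hind hpos.
have spS i x : span_of (fun l : 'I_i => e l) x -> span_of (fun l : 'I_i.+1 => e l) x.
  move=> [c ->]; exists (fun l => if insub (val l) is Some l' then c l' else 0).
  rewrite big_ord_recr /= insubF ?ltnn // scale0r addr0; apply: eq_bigr => l _ /=.
  by rewrite (valK l).
have spW i x : span_of (fun l : 'I_i => e l) x ->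
    forall j, (i <= j)%N -> span_of (fun l : 'I_j => e l) x.
  move=> h; elim=> [|j IH]; first by rewrite leqn0 => /eqP <-.
  by rewrite leq_eqVlt => /orP[/eqP <-//|]; rewrite ltnS => /IH/spS.
suff H j : (j <= m)%N -> exists g : nat -> V,
    (forall i, (i < j)%N -> span_of (fun l : 'I_j => e l) (g i)) /\
    forall i l, (i < j)%N -> (l < j)%N -> hform (g i) (g l) = (i == l)%:R by exact: H.
elim: j => [_|j IH jm]; first by exists (fun=> 0); split.
have [g [gs gh]] := IH (ltnW jm).
pose r := e j - \sum_(i < j) hform (e j) (g i) *: g i.
have sps : span_of (fun l : 'I_j => e l) (\sum_(i < j) hform (e j) (g i) *: g i).
  have /choice[c hc] : forall i : 'I_j, exists c : 'I_j -> K, g i = \sum_(l < j) c l *: e l.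
    by move=> i; exact: gs.
  exists (fun l => \sum_(i < j) hform (e j) (g i) * c i l).
  under [RHS]eq_bigr do rewrite scaler_suml.
  rewrite exchange_big /=; apply: eq_bigr => i _; rewrite {2}hc scaler_sumr.
  by apply: eq_bigr => l _; rewrite scalerA.
have r0 : r != 0.
  by apply/eqP => /eqP; rewrite subr_eq0 => /eqP h; apply: (hind j jm); rewrite h.
have spr : span_of (fun l : 'I_j.+1 => e l) r.
  have [c hc] := spS _ _ sps.
  exists (fun l => (l == ord_max)%:R - c l); rewrite /r hc.
  under [RHS]eq_bigr do rewrite scalerBl.
  rewrite sumrB; congr (_ - _); rewrite (bigD1 ord_max) //= eqxx scale1r big1 ?addr0 //.
  by move=> l /negbTE ->; rewrite scale0r.
have qr : 0 < qform r by apply: hpos => //; exact: spW spr _ jm.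
pose s := Num.sqrt (qform r); have s0 : 0 < s by rewrite sqrtr_gt0.
have hr i : (i < j)%N -> hform r (g i) = 0.
  move=> ij; rewrite /r (lfunB (hform_l _)) (lfun_sum (hform_l _)).
  rewrite (bigD1 (Ordinal ij)) //= (lfunZ (hform_l _)) gh // eqxx mulr1 big1 ?addr0 ?subrr //.
  move=> l lij; rewrite (lfunZ (hform_l _)) gh ?ltn_ord // (_ : (l == i :> nat) = false) ?mulr0 //.
  by apply/negbTE; apply: contraNneq lij => h; apply/eqP/val_inj.
pose g' i := if i == j then rc s^-1 *: r else g i.
have g'1 i : (i < j)%N -> g' i = g i by rewrite /g'; case: eqP => [->|//]; rewrite ltnn.
have g'j : g' j = rc s^-1 *: r by rewrite /g' eqxx.
have hjj : hform (g' j) (g' j) = 1.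
  rewrite g'j (lfunZ (hform_l _)) hform_cj (lfunZ (hform_l _)) cjM -hform_cj hformxx cj_rc -!rcM.
  rewrite -rc1; congr rc; rewrite -[qform r]sqr_sqrtr ?ltW // -/s.
  by field; exact: lt0r_neq0.
have hji i : (i < j)%N -> hform (g' j) (g' i) = 0.
  by move=> ij; rewrite g'j g'1 // (lfunZ (hform_l _)) hr // mulr0.
have cases i : (i < j.+1)%N -> (i < j)%N \/ i = j.
  by rewrite ltnS leq_eqVlt => /orP[/eqP|]; [right|left].
exists g'; split.
- move=> i /cases[ij|->]; first by rewrite g'1 //; apply: spS; exact: gs.
  rewrite g'j; have [c ->] := spr; exists (fun l => rc s^-1 * c l).
  by rewrite scaler_sumr; apply: eq_bigr => l _; rewrite scalerA.
- move=> i l /cases[ij|->] /cases[lj|->].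
  + by rewrite !g'1 // gh.
  + by rewrite hform_cj hji // cj0 (ltn_eqF ij).
  + by rewrite hji // gtn_eqF.
  + by rewrite hjj eqxx.
Qed.

(* A space on which the sup norm is dominated by the L2(mu) norm has
   dimension bounded by the total mass. *)
Lemma dim_le_mass (e : nat -> V) (m : nat) (eta : R) : 0 < eta ->
  (forall i, (i < m)%N -> ~ span_of (fun l : 'I_i => e l) (e i)) ->
  (forall x, span_of (fun l : 'I_m => e l) x -> x != 0 -> 0 < qform x) ->
  (forall x k, span_of (fun l : 'I_m => e l) x -> eta * nm (p k x) ^+ 2 <= qform x) ->
  eta * m%:R <= \sum_(k < n) mu k.
Proof.
move=> eta0 hind hpos hsup; have [g [gs gh]] := gram_schmidt hind hpos.
have hk k : eta * \sum_(i < m) nm (p k (g i)) ^+ 2 <= 1.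
  set s := \sum_(i < m) _.
  have s0 : 0 <= s by apply: sumr_ge0 => i _; exact: exprn_ge0 (nm_ge0 _).
  (* This x is the reproducing kernel at the coordinate k: both its k-th coordinate and its form
     equal s. The domination hypothesis then reads eta * s ^ 2 <= s. *)
  pose x := \sum_(i < m) cj (p k (g i)) *: g i.
  have px : p k x = rc s.
    rewrite /x (lfun_sum (pl k)) /s rc_sum; apply: eq_bigr => i _.
    by rewrite (lfunZ (pl k)) mulrC mulcj.
  have qx : qform x = s.
    apply: rc_inj; rewrite -hformxx /x (lfun_sum (hform_l _)) /s rc_sum; apply: eq_bigr => i _.
    rewrite (lfunZ (hform_l _)) hform_cj (lfun_sum (hform_l _)) (bigD1 i) //=.
    rewrite (lfunZ (hform_l _)) gh ?ltn_ord // eqxx mulr1 big1 => [|l li].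
      by rewrite addr0 mulcj nm_cj.
    by rewrite (lfunZ (hform_l _)) gh ?ltn_ord // (_ : (l == i :> nat) = false) ?mulr0 // (inj_eq val_inj) (negbTE li).
  have sx : span_of (fun l : 'I_m => e l) x.
    have /choice[c hc] : forall i : 'I_m, exists c : 'I_m -> K, g i = \sum_(l < m) c l *: e l.
      by move=> i; exact: gs.
    exists (fun l => \sum_(i < m) cj (p k (g i)) * c i l).
    under [RHS]eq_bigr do rewrite scaler_suml.
    rewrite exchange_big /=; apply: eq_bigr => i _; rewrite {2}hc scaler_sumr.
    by apply: eq_bigr => l _; rewrite scalerA.
  have := hsup x k sx; rewrite px qx nm_rc ger0_norm //.
  have [->|s1] := eqVneq s 0; first by rewrite mulr0.
  have s2 : 0 < s by rewrite lt_neqAle eq_sym s1.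
  by rewrite expr2 mulrA -ler_pdivlMr // mulfV.
(* Averaging over k with weights mu: each g_i has form 1, so the m vectors contribute eta * m in
   total. *)
have : \sum_(k < n) mu k * (eta * \sum_(i < m) nm (p k (g i)) ^+ 2) <= \sum_(k < n) mu k.
  by apply: ler_sum => k _; rewrite -[leRHS]mulr1; apply: ler_wpM2l.
suff -> : \sum_(k < n) mu k * (eta * \sum_(i < m) nm (p k (g i)) ^+ 2) = eta * m%:R by [].
under eq_bigr do rewrite mulrCA mulr_sumr.
rewrite -mulr_sumr exchange_big /=; congr (_ * _).
have q1 (i : 'I_m) : \sum_(k < n) mu k * nm (p k (g i)) ^+ 2 = 1.
  by apply: rc_inj; rewrite -/(qform (g i)) -hformxx gh ?ltn_ord // eqxx.
by under eq_bigr do rewrite q1; rewrite sumr_const card_ord.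
Qed.
End fixed.
End GramSchmidt.

(** * Independent sets in relations of small out-degree *)

Section IndependentSet.
Variables (T : finType) (bad : rel T) (d : nat).

(** The in-degrees also average to at most d, so some x has at most d predecessors. Removing x with
    its predecessors and successors costs at most 2 d + 1 elements, and the rest is handled by
    induction. *)
Lemma indep_set (N : nat) (S : {set T}) :
  (forall x, #|[set y in S | bad x y]| <= d)%N ->
  (N * (2 * d).+1 <= #|S|)%N ->
  exists s : seq T, [/\ uniq s, size s = N, (forall x, x \in s -> x \in S) &
    forall x y, x \in s -> y \in s -> x != y -> ~~ bad x y].
Proof.
elim: N S => [|N IH] S out cS; first by exists [::].
have [x xS hx] : exists2 x, x \in S & (#|[set y in S | bad y x]| <= d)%N.
  apply: contrapT => /forall2NP h.
  have h1 : (\sum_(x in S) d.+1 <= \sum_(x in S) #|[set y in S | bad y x]|)%N.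
    by apply: leq_sum => x xS; have [//|/negP] := h x; rewrite -ltnNge.
  have h2 : (\sum_(x in S) #|[set y in S | bad y x]| <= \sum_(x in S) d)%N.
    under eq_bigr do rewrite -sum1dep_card big_mkcondr /=.
    rewrite exchange_big /=; apply: leq_sum => y yS.
    rewrite -big_mkcondr /= sum1dep_card; apply: leq_trans (out y).
    by apply: subset_leq_card; apply/fintype.subsetP => z; rewrite !inE.
  have := leq_trans h1 h2; rewrite !sum_nat_const mulnS -[leqRHS]add0n leq_add2r leqn0 => /eqP S0.
  by rewrite S0 mulSn in cS.
pose S' := S :\: (x |: ([set y in S | bad y x] :|: [set y in S | bad x y])).
have cS' : (N * (2 * d).+1 <= #|S'|)%N.
  have : (#|x |: ([set y in S | bad y x] :|: [set y in S | bad x y])| <= (2 * d).+1)%N.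
    apply: (leq_trans (leq_card_setU _ _)); rewrite cards1 add1n ltnS.
    by apply: (leq_trans (leq_card_setU _ _)); rewrite mul2n -addnn leq_add.
  move=> h; rewrite cardsD; rewrite mulSn in cS.
  rewrite leq_subRL; last by apply: subset_leq_card; exact: subsetIl.
  apply: leq_trans cS; rewrite leq_add2r; apply: leq_trans h.
  by apply: subset_leq_card; exact: subsetIr.
have [|s [us ss sS' sb]] := IH S' _ cS'.
  move=> y; apply: leq_trans (out y); apply: subset_leq_card; apply/fintype.subsetP => z.
  by rewrite !inE => /andP[/andP[_ ->] ->].
have hS' y : y \in s -> [/\ y != x, y \in S, ~~ bad y x & ~~ bad x y].
  move=> /sS'; rewrite !inE !negb_or !negb_and => /andP[/andP[-> /andP[h1 h2]] yS].
  by rewrite yS /= in h1 h2; split.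
exists (x :: s); split.
- by rewrite /= us andbT; apply/negP => /hS'[]; rewrite eqxx.
- by rewrite /= ss.
- by move=> y; rewrite inE => /orP[/eqP ->//|/hS'[]].
- move=> y z; rewrite !inE => /orP[/eqP ->|ys] /orP[/eqP ->|zs].
  + by rewrite eqxx.
  + by move=> _; have [] := hS' z zs.
  + by move=> _; have [] := hS' y ys.
  + exact: sb.
Qed.
End IndependentSet.

(** * Almost disjoint functionals in a factored space *)

Section LinftyFromFactorization.
Context {R : realType}.
Local Notation K := (Cplx R).
Variable (Y : completeNormedModType K).

Definition infdim := forall m (e : 'I_m -> Y), exists y, ~ span_of e y.
Definition supbd (lam : R) (n : nat) (v : 'I_n -> Y) :=
  forall (c : 'I_n -> K) (M : R), 0 <= M -> (forall k, nm (c k) <= M) ->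
    nm (\sum_(k < n) c k *: v k) <= lam * M.

Lemma indep_seq : infdim -> exists e : nat -> Y, forall i, ~ span_of (fun l : 'I_i => e l) (e i).
Proof.
move=> hY; have /choice[F hF] : forall s : seq Y, exists y, ~ span_of (fun l : 'I_(size s) => nth 0 s l) y.
  by move=> s; exact: hY.
pose L := fix L n := if n is m.+1 then rcons (L m) (F (L m)) else [::].
have sL n : size (L n) = n by elim: n => [|n IH] //=; rewrite size_rcons IH.
have nL n i : (i < n)%N -> nth 0 (L n) i = F (L i).
  elim: n => [|n IH] //=; rewrite ltnS leq_eqVlt => /orP[/eqP ->|h].
    by rewrite nth_rcons sL ltnn eqxx.
  by rewrite nth_rcons sL h IH.
exists (fun n => F (L n)) => i [c hc]; apply: (hF (L i)).
exists (fun l => c (cast_ord (sL i) l)); rewrite hc.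
rewrite (reindex (cast_ord (sL i))) /=; last first.
  by exists (cast_ord (esym (sL i))) => x _; rewrite ?cast_ordK ?cast_ordKV.
by apply: eq_bigr => l _; rewrite nL // -{2}(sL i).
Qed.

Variable lam : R.
Hypothesis lam1 : 1 <= lam.

(** The stopping criterion of the greedy choice in [disjoint_blocks]: if no functional has mass
    above 1/4 on a block where the chosen ones have mass at most delta, then the sup norm is
    dominated by the l_2 norm of the measure mu_k = \sum_l |phi_l(v_k)|. Its mass is at most j *
    lam, and [dim_le_mass] bounds the dimension. *)
Lemma control_dim (e : nat -> Y) (m n : nat) (v : 'I_n -> Y) (p : 'I_n -> Dual Y)
    (j : nat) (phi : nat -> Dual Y) (delta : R) :
  (forall i, ~ span_of (fun l : 'I_i => e l) (e i)) ->
  (forall k, nm (p k) <= 1) -> supbd lam v ->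
  (forall i : 'I_m, e i = \sum_(k < n) sval (p k) (e i) *: v k) ->
  (forall i, (i < j)%N -> nm (phi i) <= 1) -> 0 < delta ->
  (forall (B : {set 'I_n}) (psi : Dual Y), nm psi <= 1 ->
    \sum_(l < j) \sum_(k in B) nm (sval (phi l) (v k)) <= delta ->
    \sum_(k in B) nm (sval psi (v k)) <= 4^-1) ->
  delta * (4 * lam)^-1 ^+ 2 * m%:R <= j%:R * lam.
Proof.
move=> hind p1 vb pe phi1 d0 stop.
have lam1' : 1 <= lam by exact: lam1.
have lam0 : 0 < lam by lra.
pose mu (k : 'I_n) : R := \sum_(l < j) nm (sval (phi l) (v k)).
have mu0 k : 0 <= mu k by apply: sumr_ge0 => l _; exact: nm_ge0.
pose t := (4 * lam)^-1 : R.
have t0 : 0 < t by rewrite /t invr_gt0 mulr_gt0.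
have eta0 : 0 < delta * t ^+ 2 by rewrite mulr_gt0 // exprn_gt0.
pose pf k := sval (p k).
have pl k : lfun (pf k) by exact: dual_lfun.
have px x : span_of (fun l : 'I_m => e l) x -> x = \sum_(k < n) pf k x *: v k.
  move=> [c ->]; under [RHS]eq_bigr do rewrite (lfun_sum (pl _)) scaler_suml.
  rewrite exchange_big /=; apply: eq_bigr => i _; rewrite {1}pe scaler_sumr.
  by apply: eq_bigr => k _; rewrite (lfunZ (pl k)) scalerA.
have key x : span_of (fun l : 'I_m => e l) x -> delta * t ^+ 2 * nm x ^+ 2 <= qform pf mu x.
  move=> sx; rewrite leNgt; apply/negP => hq.
  have [x0|x0] := eqVneq x 0.
    move: hq; rewrite x0 nm0 expr0n /= mulr0 ltNge => /negP; apply.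
    by apply: sumr_ge0 => k _; rewrite mulr_ge0 // exprn_ge0 // nm_ge0.
  have nx := nm_gt0 x0.
  have pk k : nm (pf k x) <= nm x.
    by apply: (le_trans (nm_dual_ge _ _)); rewrite -[leRHS]mul1r ler_wpM2r // ltW.
  (* B collects the large coordinates of x. If the form were small, Chebyshev's inequality would
     give mu(B) <= delta, so any functional of norm at most 1 would gain at most nm x / 4 on B; off
     B it gains at most t * lam * nm x, again nm x / 4. The norm of x would be at most half of
     itself. *)
  pose B := [set k | t * nm x < nm (pf k x)]%SET.
  have hB : \sum_(k in B) mu k <= delta.
    have tx : 0 < (t * nm x) ^+ 2 by rewrite exprn_gt0 // mulr_gt0.
    rewrite -(ler_pM2l tx) [leRHS](_ : _ = delta * t ^+ 2 * nm x ^+ 2); last by ring.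
    apply: le_trans (ltW hq); rewrite /qform mulr_sumr big_mkcond /=; apply: ler_sum => k _.
    rewrite inE; case: ifP => [h|_]; last by rewrite mulr_ge0 // exprn_ge0 // nm_ge0.
    rewrite mulrC ler_wpM2l // lerXn2r ?nnegrE ?nm_ge0 ?(ltW h) //.
    by rewrite mulr_ge0 // ltW.
  have : nm x <= nm x / 2.
    apply: nm_by_dual => psi psi1.
    rewrite {1}(px x sx) (lfun_sum (dual_lfun psi)); apply: (le_trans (nm_sum _ _ _)).
    have hs : \sum_(l < j) \sum_(k in B) nm (sval (phi l) (v k)) <= delta by rewrite exchange_big.
    have h1 := stop B psi psi1 hs.
    have h2 : \sum_(k < n) nm (sval psi (v k)) <= lam.
      apply: (le_trans (locfact_dual psi vb)); rewrite -[leRHS]mul1r.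
      by apply: ler_wpM2r => //; lra.
    have : \sum_(k < n) nm (sval psi (pf k x *: v k)) <=
       nm x * (\sum_(k in B) nm (sval psi (v k))) + t * nm x * \sum_(k < n) nm (sval psi (v k)).
      rewrite !mulr_sumr [X in _ <= X + _]big_mkcond /= -big_split /=; apply: ler_sum => k _.
      rewrite (lfunZ (dual_lfun psi)) nmM inE.
      have s0 := nm_ge0 (sval psi (v k)).
      case: ifP => [h|/negbT].
        have h3 : nm (pf k x) * nm (sval psi (v k)) <= nm x * nm (sval psi (v k)) by apply: ler_wpM2r.
        have h4 : 0 <= t * nm x * nm (sval psi (v k)) by rewrite !mulr_ge0 // ltW.
        by lra.
      by rewrite -leNgt => h *; rewrite add0r; apply: ler_wpM2r.
    move=> /le_trans; apply.
    have e1 : t * nm x * \sum_(k < n) nm (sval psi (v k)) <= t * nm x * lam.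
      by apply: ler_wpM2l => //; rewrite mulr_ge0 // ltW.
    have e2 : t * nm x * lam = nm x / 4 by rewrite /t; field; lra.
    by have : nm x * \sum_(k in B) nm (sval psi (v k)) <= nm x * 4^-1 by [apply: ler_wpM2l => //; exact: ltW]; lra.
  by lra.
apply: (le_trans (@dim_le_mass R Y n pf mu pl mu0 e m _ eta0 _ _ _)).
- by move=> i _; exact: hind.
- move=> x sx x0; apply: lt_le_trans (key x sx).
  by rewrite mulr_gt0 // exprn_gt0 // nm_gt0.
- move=> x k sx; apply: le_trans (key x sx); apply: ler_wpM2l; first exact: ltW.
  rewrite lerXn2r ?nnegrE ?nm_ge0 //.
  by apply: (le_trans (nm_dual_ge _ _)); rewrite -[leRHS]mul1r ler_wpM2r // nm_ge0.
rewrite /mu exchange_big /=; apply: le_trans (_ : \sum_(l < j) lam <= _); last first.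
  by rewrite sumr_const card_ord mulr_natl.
apply: ler_sum => l _; apply: (le_trans (locfact_dual _ vb)); rewrite -[leRHS]mul1r.
by apply: ler_wpM2r; [lra|exact: phi1].
Qed.

Hypotheses (hY : locfact Y lam) (inf : infdim).

(** Functionals and blocks are picked greedily, earlier functionals being small on later blocks.
    Cutting the later blocks out of each block makes them disjoint and costs at most 1/8 of the mass
    1/4. *)
Lemma disjoint_blocks (M : nat) :
  exists (n : nat) (v : 'I_n -> Y) (f : 'I_M -> 'I_n -> K) (phi : 'I_M -> Dual Y),
  [/\ supbd lam v, (forall i k, nm (f i k) <= 1),
      (forall i j k, i != j -> f i k = 0 \/ f j k = 0), (forall i, nm (phi i) <= 1) &
      forall i, 8^-1 <= nm (sval (phi i) (\sum_(k < n) f i k *: v k))].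
Proof.
have lam1' : 1 <= lam by exact: lam1.
have [e hind] := indep_seq inf.
(* At most M later blocks are cut out of a given one, each of mass at most delta: the loss stays
   below 1/8. *)
pose delta : R := (8 * M.+1%:R)^-1.
have M0 : 0 < M.+1%:R :> R by rewrite ltr0n.
have d0 : 0 < delta by rewrite invr_gt0 mulr_gt0.
have t0 : 0 < delta * (4 * lam)^-1 ^+ 2.
  by rewrite mulr_gt0 // exprn_gt0 // invr_gt0; lra.
(* With m so large, the conclusion of [control_dim] fails for every j < M, so the greedy choice
   cannot stop early. *)
pose m := Num.bound (M%:R * lam / (delta * (4 * lam)^-1 ^+ 2)).
have hm : M%:R * lam < delta * (4 * lam)^-1 ^+ 2 * m%:R.
  rewrite -ltr_pdivrMl // mulrC archi_boundP //.
  by apply: divr_ge0; [apply: mulr_ge0 => //; lra|exact: ltW].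
have [n [v [p [p1 vb pe]]]] := hY (fun i : 'I_m => e i).
have greedy j : (j <= M)%N -> exists (phi : nat -> Dual Y) (B : nat -> {set 'I_n}),
    forall i, (i < j)%N -> [/\ nm (phi i) <= 1,
      \sum_(l < i) \sum_(k in B i) nm (sval (phi l) (v k)) <= delta &
      4^-1 < \sum_(k in B i) nm (sval (phi i) (v k))].
  elim: j => [_|j IH jM]; first by exists (fun=> 0), (fun=> finset.set0).
  have [phi [B h]] := IH (ltnW jM).
  have : ~ (forall (C : {set 'I_n}) (psi : Dual Y), nm psi <= 1 ->
    \sum_(l < j) \sum_(k in C) nm (sval (phi l) (v k)) <= delta ->
    \sum_(k in C) nm (sval psi (v k)) <= 4^-1).
    move=> stop; have := control_dim hind p1 vb pe (fun i ij => let: And3 a _ _ := h i ij in a) d0 stop.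
    have : j%:R * lam <= M%:R * lam by rewrite ler_wpM2r ?ler_nat ?(ltnW jM) //; lra.
    by move: hm; lra.
  move=> /existsNP[C /existsNP[psi /not_implyP[psi1 /not_implyP[hC1 hC2]]]].
  exists (fun i => if i == j then psi else phi i), (fun i => if i == j then C else B i).
  move=> i; rewrite ltnS leq_eqVlt => /orP[/eqP ->|ij].
    rewrite eqxx; split=> //; last by rewrite ltNge; apply/negP.
    by under eq_bigr => l _ do rewrite (ltn_eqF (ltn_ord l)).
  rewrite (ltn_eqF ij); have [h1 h2 h3] := h i ij; split=> //.
  by under eq_bigr => l _ do rewrite (ltn_eqF (ltn_trans (ltn_ord l) ij)).
have [phi [B hB]] := greedy M (leqnn M).
(* Only later blocks are removed: smallness of phi_i is known on these and not on earlier ones. *)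
pose A (i : 'I_M) : {set 'I_n} := [set k in B i | [forall l : 'I_M, (i < l)%N ==> (k \notin B l)]]%SET.
have /choice[ph hph] : forall ik : 'I_M * 'I_n, exists c : K,
    nm c = 1 /\ c * sval (phi ik.1) (v ik.2) = rc (nm (sval (phi ik.1) (v ik.2))).
  by move=> ik; exact: phase.
exists n, v, (fun i k => if k \in A i then ph (i, k) else 0), (fun i => phi i); split=> //.
- by move=> i k; case: ifP => _; rewrite ?nm0 // (proj1 (hph _)).
- move=> i j k ij; case: ifP => [ki|_]; last by left.
  case: ifP => [kj|_]; last by right.
  move: ki kj; rewrite !inE => /andP[ki /forallP hi] /andP[kj /forallP hj].
  have [h|h|/val_inj h] := ltngtP i j; last by rewrite h eqxx in ij.
    by have := hi j; rewrite h kj.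
  by have := hj i; rewrite h ki.
- by move=> i; have [] := hB i (ltn_ord i).
- move=> i; rewrite (lfun_sum (dual_lfun _)).
  have -> : \sum_(k < n) sval (phi i) ((if k \in A i then ph (i, k) else 0) *: v k) =
      rc (\sum_(k in A i) nm (sval (phi i) (v k))).
    rewrite rc_sum [RHS]big_mkcond /=; apply: eq_bigr => k _.
    case: ifP => _; last by rewrite scale0r (lfun0 (dual_lfun _)).
    by rewrite (lfunZ (dual_lfun _)) (proj2 (hph (i, k))).
  rewrite nm_rc ger0_norm; last by apply: sumr_ge0 => *; exact: nm_ge0.
  have [_ _ h3] := hB i (ltn_ord i).
  have : \sum_(k in B i) nm (sval (phi i) (v k)) <= \sum_(k in A i) nm (sval (phi i) (v k)) +
      \sum_(l < M | (i < l)%N) \sum_(k in B l) nm (sval (phi i) (v k)).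
    rewrite big_mkcond /= [X in _ <= X + _]big_mkcond /=.
    under [X in _ <= _ + X]eq_bigr do rewrite big_mkcond /=.
    rewrite exchange_big /= -big_split /=; apply: ler_sum => k _.
    have s0 : 0 <= \sum_(l < M | (i < l)%N) (if k \in B l then nm (sval (phi i) (v k)) else 0).
      by apply: sumr_ge0 => l _; case: ifP => // _; exact: nm_ge0.
    rewrite inE; case: (boolP (k \in B i)) => /= kB; last by rewrite add0r.
    case: ifP => [_|/negbT]; first by rewrite lerDl.
    rewrite negb_forall => /existsP[l]; rewrite negb_imply negbK => /andP[il kl].
    rewrite add0r (bigD1 l) //= kl lerDl; apply: sumr_ge0 => l' _.
    by case: ifP => // _; exact: nm_ge0.
  have : \sum_(l < M | (i < l)%N) \sum_(k in B l) nm (sval (phi i) (v k)) <= \sum_(l < M) delta.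
    rewrite big_mkcond /=; apply: ler_sum => l _; case: ifP => [il|_]; last exact: ltW.
    have [_ h2 _] := hB l (ltn_ord l); apply: le_trans h2.
    rewrite (bigD1 (Ordinal il)) //= lerDl; apply: sumr_ge0 => l' _.
    by apply: sumr_ge0 => *; exact: nm_ge0.
  rewrite sumr_const card_ord -[delta *+ M]mulr_natl.
  have : M%:R * delta <= 8^-1.
    rewrite /delta invfM mulrCA -[leRHS]mulr1; apply: ler_wpM2l => //.
    by rewrite ler_pdivrMr // mul1r ler_nat.
  lra.
Qed.

(** Differences of two functionals with nearly equal values on the x_k almost annihilate them; such
    pairs come from the pigeonhole principle. Any functional of norm at most 1 is large on few of
    the disjointly supported vectors, so an independent set makes the rest nearly biorthogonal. The
    bound 16 is 2 for the difference times 8 for the normalization. *)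
Lemma selection (N : nat) (psi : 'I_N -> Dual Y) (x : 'I_N -> Y) (tau : R) :
  (forall k, nm (psi k) <= 1) -> 0 < tau ->
  exists (y : 'I_N -> Y) (rho : 'I_N -> Dual Y),
  [/\ supbd lam y, (forall i, nm (rho i) <= 16),
      (forall i j, nm (sval (rho i) (y j) - (i == j)%:R) <= tau),
      (forall k j, nm (sval (psi k) (y j)) <= tau) &
      (forall i k, nm (sval (rho i) (x k)) <= tau)].
Proof.
have lam1' : 1 <= lam by exact: lam1.
(* Two errors of size t are multiplied by the normalizing factor 8, which gives tau. *)
move=> psi1 tau0; pose t := tau / 16; have t0 : 0 < t by rewrite /t; lra.
(* The moduli of a functional of norm at most 1 on the block vectors sum to at most lam, so at most
   d of them exceed t. *)
pose d := Num.bound (lam / t).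
have hd (c : R) : c * t <= lam -> c < d%:R.
  move=> h; apply: le_lt_trans (archi_boundP _); first by rewrite ler_pdivlMr.
  by apply: divr_ge0; lra.
pose cx := \sum_(k < N) nm (x k).
have hcx k : nm (x k) <= cx.
  by rewrite /cx (bigD1 k) //= lerDl; apply: sumr_ge0 => *; exact: nm_ge0.
have cx0 : 0 <= cx by apply: sumr_ge0 => *; exact: nm_ge0.
have [s hs] := tbdd_disc cx (divr_gt0 t0 (ltr0n R 2)).
have /choice[r hr] : forall z : K, exists i : 'I_(size s), nm z <= cx -> nm (z - nth 0 s i : K) <= t / 2.
  have s0 : (0 < size s)%N.
    have [y ys _] : exists2 y : K^o, y \in s & nm ((0 : K^o) - y) <= t / 2 by apply: hs; rewrite /= nm0.
    by case: (s) ys.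
  move=> z; have [zc|n] := pselect (nm z <= cx); last by exists (Ordinal s0).
  have [y /(nthP 0)[i hi <-] h] := hs z zc.
  by exists (Ordinal hi).
pose Q := #|{ffun 'I_N -> 'I_(size s)}|.
(* In a colour class of this size, discarding the at most N * d indices on which some psi_k is large
   leaves enough for [indep_set] to return 2 N indices, that is N pairs. *)
pose q := (2 * N * (2 * d).+1 + N * d).+1.
pose M := (Q * q)%N.
have [n [v [f [phi [vb f1 fd phi1 phi8]]]]] := disjoint_blocks M.
pose y i := \sum_(k < n) f i k *: v k.
(* Supports are disjoint, so at each coordinate k at most one term survives and the coefficients
   keep their bound. *)
have yb : supbd lam y.
  move=> c M' M'0 hc.
  have -> : \sum_(i < M) c i *: y i = \sum_(k < n) (\sum_(i < M) c i * f i k) *: v k.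
    under eq_bigr do rewrite scaler_sumr.
    rewrite exchange_big /=; apply: eq_bigr => k _; rewrite scaler_suml.
    by apply: eq_bigr => i _; rewrite scalerA.
  apply: vb => // k.
  have [[i hi]|nk] := pselect (exists i, f i k != 0); last first.
    rewrite big1 ?nm0 // => i _; have [->|h] := eqVneq (f i k) 0; first by rewrite mulr0.
    by case: nk; exists i.
  rewrite (bigD1 i) //= big1 => [|j ji].
    rewrite addr0 nmM -[leRHS]mulr1; apply: ler_pM; rewrite ?nm_ge0 //.
  have [->|e0] := fd j i k ji; first by rewrite mulr0.
  by rewrite e0 eqxx in hi.
have rowsum (g : Dual Y) : nm g <= 1 -> \sum_(j < M) nm (sval g (y j)) <= lam.
  move=> g1; apply: (le_trans (locfact_dual g yb)); rewrite -[leRHS]mul1r.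
  by apply: ler_wpM2r => //; lra.
have few (g : Dual Y) (S : {set 'I_M}) : nm g <= 1 -> (#|[set j in S | (t < nm (sval g (y j)))%R]%SET| <= d)%N.
  move=> g1; rewrite -(ler_nat R); apply/ltW/hd.
  apply: le_trans (rowsum g g1); rewrite mulr_natl -sumr_const big_mkcond /=.
  apply: ler_sum => j _; rewrite inE; case: ifP => [/andP[_ /ltW//]|_]; exact: nm_ge0.
(* The colour of i records the values of phi_i on all x_k up to t / 2; equal colours give
   differences at most t. *)
pose col (i : 'I_M) : {ffun 'I_N -> 'I_(size s)} := [ffun k => r (sval (phi i) (x k))].
have [c hc] : exists c, (q <= #|[set i | col i == c]%SET|)%N.
  apply: contrapT => /forallNP h.
  have h1 : (M <= \sum_(c : {ffun 'I_N -> 'I_(size s)}) q.-1)%N.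
    rewrite -{1}(card_ord M) -sum1_card (partition_big col xpredT) //=.
    apply: leq_sum => c _; rewrite sum1dep_card.
    have /negP := h c; rewrite -ltnNge /q ltnS /=.
    by move=> hh; apply: leq_trans hh; apply: subset_leq_card; apply/fintype.subsetP => z; rewrite !inE.
  have Q0 : (0 < Q)%N.
    apply/card_gt0P; exists [ffun=> r 0]; by [].
  move: h1; rewrite sum_nat_const -/Q /M leqNgt => /negP; apply.
  by rewrite ltn_pmul2l // /q ltnSn.
pose D := [set j : 'I_M | [exists k : 'I_N, t < nm (sval (psi k) (y j))]]%SET.
have hD : (#|D| <= N * d)%N.
  apply: leq_trans (_ : \sum_(k < N) d <= _)%N; last by rewrite sum_nat_const card_ord.
  rewrite -sum1_card big_mkcond /=.
  apply: leq_trans (_ : \sum_(j < M) \sum_(k < N) (t < nm (sval (psi k) (y j)))%R <= _)%N.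
    apply: leq_sum => j _; rewrite inE; case: ifP => // /existsP[k hk].
    by rewrite (bigD1 k) //= hk.
  have -> : (\sum_(j < M) \sum_(k < N) (t < nm (sval (psi k) (y j)))%R =
    \sum_(k < N) \sum_(j < M) (t < nm (sval (psi k) (y j)))%R)%N by exact: exchange_big.
  apply: leq_sum => k _.
  apply: leq_trans (few (psi k) finset.setT (psi1 k)).
  rewrite -sum1_card [X in (_ <= X)%N]big_mkcond /=; apply: leq_sum => j _.
  by rewrite !inE /=; case: (_ < _)%R.
pose S := ([set i | col i == c] :\: D)%SET.
have cS : (2 * N * (2 * d).+1 <= #|S|)%N.
  rewrite cardsD leq_subRL; last by apply: subset_leq_card; exact: subsetIl.
  apply: leq_trans hc; rewrite addnC /q; apply: leqW; rewrite leq_add2l.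
  by apply: leq_trans hD; apply: subset_leq_card; exact: subsetIr.
have [|S' [uS sS SS SB]] := @indep_set _ (fun i j => t < nm (sval (phi i) (y j))) d (2 * N) S _ cS.
  by move=> i; exact: few.
(* Only for positive N is the selected list nonempty, and then it supplies the default index needed
   by [nth]. *)
have [N0|N0] := posnP N.
  subst N; exists (fun=> 0), (fun=> 0); split; try by case.
  by move=> c' M' M'0 _; rewrite big_ord0 nm0 mulr_ge0 //; lra.
have i0 : 'I_M.
  by case: S' sS {uS SS SB} => [|i _ _]; [rewrite /= => h; exfalso; move: N0; rewrite -(ltn_pmul2l (m := 2)) // muln0 -h|exact: i].
pose a (j : 'I_N) := nth i0 S' j; pose b (j : 'I_N) := nth i0 S' (N + j).
have aj (j : 'I_N) : (j < size S')%N by rewrite sS mul2n -addnn ltn_addr.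
have bj (j : 'I_N) : (N + j < size S')%N by rewrite sS mul2n -addnn ltn_add2l.
have aS j : a j \in S' by apply: mem_nth.
have bS j : b j \in S' by apply: mem_nth.
have ainj : injective a.
  by move=> j l /eqP; rewrite nth_uniq // => /eqP/val_inj.
have ab j l : b j != a l.
  by rewrite nth_uniq //; apply/eqP => h; have := ltn_ord l; rewrite -h ltnNge leq_addr.
pose z j := sval (phi (a j)) (y (a j)).
have z8 j : 8^-1 <= nm (z j) by exact: phi8.
have zV j : nm (z j)^-1 <= 8.
  have h := z8 j; have hp : 0 < nm (z j) by lra.
  by rewrite nmV -[leRHS]invrK lef_pV2 ?posrE ?invr_gt0.
have z0 j : z j != 0.
  by apply/eqP => h; have := z8 j; rewrite h nm0; lra.
pose rho j : Dual Y := (z j)^-1 *: (phi (a j) - phi (b j)).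
have rhoE j w : sval (rho j) w = (z j)^-1 * (sval (phi (a j)) w - sval (phi (b j)) w).
  by rewrite /rho dualZ dualB.
have t8 (w1 w2 : K) : nm w1 <= 8 -> nm w2 <= 2 * t -> nm (w1 * w2) <= tau.
  move=> h1 h2; rewrite nmM; apply: (le_trans (ler_pM (nm_ge0 _) (nm_ge0 _) h1 h2)).
  by rewrite /t; lra.
exists (fun j => y (a j)), rho; split.
- move=> c' M' M'0 hc'.
  pose c2 i := \sum_(j < N | a j == i) c' j.
  have -> : \sum_(j < N) c' j *: y (a j) = \sum_(i < M) c2 i *: y i.
    rewrite (partition_big a xpredT) //=; apply: eq_bigr => i _; rewrite scaler_suml.
    by apply: eq_bigr => j /eqP ->.
  apply: yb => // i; rewrite /c2.
  have [[j hj]|nj] := pselect (exists j, a j == i); last first.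
    rewrite big1 ?nm0 // => j hj; by case: nj; exists j.
  rewrite (bigD1 j) //= big1 ?addr0 // => l /andP[/eqP hl lj].
  by case/eqP: lj; apply: ainj; rewrite hl (eqP hj).
- move=> j; rewrite /rho nmZ.
  have : nm (phi (a j) - phi (b j)) <= 2 by apply: (le_trans (nmB _ _)); have := phi1 (a j); have := phi1 (b j); lra.
  by move=> h; have := ler_pM (nm_ge0 _) (nm_ge0 _) (zV j) h; lra.
- move=> i j; rewrite rhoE.
  have hb : nm (sval (phi (b i)) (y (a j))) <= t by rewrite leNgt; apply: SB => //; exact: ab.
  have [->|ij] := eqVneq i j.
    have -> : (z j)^-1 * (sval (phi (a j)) (y (a j)) - sval (phi (b j)) (y (a j))) - 1 =
        (z j)^-1 * - sval (phi (b j)) (y (a j)).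
      by rewrite mulrBr -/(z j) mulVf // mulrN addrAC subrr add0r.
    apply: t8 => //; rewrite nmN; have : nm (sval (phi (b j)) (y (a j))) <= t.
      by rewrite leNgt; apply: SB => //; exact: ab.
    by lra.
  rewrite subr0; apply: t8 => //; apply: (le_trans (nmB _ _)).
  have : nm (sval (phi (a i)) (y (a j))) <= t.
    by rewrite leNgt; apply: SB => //; rewrite (inj_eq ainj).
  lra.
- move=> k j; have := SS _ (aS j); rewrite !inE negb_exists => /andP[/forallP/(_ k)].
  by rewrite -leNgt => h _; apply: (le_trans h); rewrite /t; lra.
- move=> i k; rewrite rhoE; apply: t8 => //.
  have hcol j : nm (sval (phi j) (x k)) <= cx.
    apply: (le_trans (nm_dual_ge _ _)); apply: le_trans (hcx k).
    by rewrite -[leRHS]mul1r; apply: ler_wpM2r => //; exact: nm_ge0.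
  have hca := SS _ (aS i); have hcb := SS _ (bS i).
  have e1 : r (sval (phi (a i)) (x k)) = r (sval (phi (b i)) (x k)).
    move: hca hcb; rewrite !inE => /andP[_ /eqP ea] /andP[_ /eqP eb].
    by have := congr1 (fun g : {ffun _} => g k) (etrans ea (esym eb)); rewrite !ffunE.
  have h1 := hr _ (hcol (a i)); have h2 := hr _ (hcol (b i)); rewrite -e1 nmBC in h2.
  by apply: (le_trans (nm_tri _ (nth 0 s (r (sval (phi (a i)) (x k)))) _)); lra.
Qed.
End LinftyFromFactorization.

(** * The perturbed embedding of l_infty^n *)

Section LinftyMain.
Context {R : realType}.
Local Notation K := (Cplx R).

(** The whole space serves as F for every subspace, so the constant may depend on its basis. *)
Lemma findim_Linfty (Y : completeNormedModType K) (m : nat) (e : 'I_m -> Y) :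
  (forall y, span_of e y) -> Linfty_space Y.
Proof.
move=> he; have [n [v [p [vs pb pv pe]]]] := fd_coord e.
have pl k : lfun (p k) := proj1 (pb k).
have hv y : y = \sum_(k < n) p k y *: v k.
  have [c ->] := he y; under [RHS]eq_bigr do rewrite (lfun_sum (pl _)) scaler_suml.
  rewrite exchange_big /=; apply: eq_bigr => j _; rewrite {1}pe scaler_sumr.
  by apply: eq_bigr => k _; rewrite (lfunZ (pl k)) scalerA.
have /choice[cs hcs] : forall k, exists c : R, 0 < c /\ forall x, nm (p k x) <= c * nm x.
  by move=> k; have [_ [c c0 h]] := pb k; exists c.
pose a : R := 1 + \sum_(k < n) cs k; pose b : R := 1 + \sum_(k < n) nm (v k).
have a1 : 1 <= a by rewrite lerDl; apply: sumr_ge0 => k _; apply: ltW; exact: (proj1 (hcs k)).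
have b1 : 1 <= b by rewrite lerDl; apply: sumr_ge0 => k _; exact: nm_ge0.
have a0 : 0 < a by lra.
have b0 : 0 < b by lra.
exists (rc (a * b)); split; first by rewrite -rc1 rc_le -[leLHS]mulr1; apply: ler_pM.
move=> m' e'; exists n, v; split; first by move=> y _; exists (fun k => p k y).
exists (rc a), (rc b); split; rewrite -?rc0 ?rc_lt -?rcM ?rc_le // => c.
rewrite supnE nmE -!rcM !rc_le; split.
  apply: supn_le => [|k]; first by rewrite mulr_ge0 ?nm_ge0 // ltW.
  have pc : p k (\sum_(l < n) c l *: v l) = c k.
    rewrite (lfun_sum (pl k)) (bigD1 k) //= (lfunZ (pl k)) pv eqxx mulr1 big1 ?addr0 // => l lk.
    by rewrite (lfunZ (pl k)) pv eq_sym (negbTE lk) mulr0.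
  rewrite -{1}pc; apply: (le_trans (proj2 (hcs k) _)); apply: ler_wpM2r; first exact: nm_ge0.
  rewrite /a (bigD1 k) //=; have : 0 <= \sum_(i < n | i != k) cs i.
    by apply: sumr_ge0 => i _; apply: ltW; exact: (proj1 (hcs i)).
  lra.
apply: (le_trans (nm_sum _ _ _)); apply: le_trans (_ : \sum_(k < n) nm (v k) * \big[Num.max/0]_(k < n) nm (c k) <= _).
  by apply: ler_sum => k _; rewrite nmZ mulrC; apply: ler_wpM2l; [exact: nm_ge0|exact: supn_ge].
by rewrite -mulr_suml; apply: ler_wpM2r; [exact: supn_ge0|rewrite lerDr].
Qed.

Theorem locfact_Linfty (Y : completeNormedModType K) (lam0 : R) :
  locfact Y lam0 -> Linfty_space Y.
Proof.
move=> h0; have [inf|] := pselect (infdim Y); last first.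
  move=> /existsNP[m /existsNP[e /forallNP h]].
  by apply: (@findim_Linfty _ m e) => y; apply: contrapT; exact: h.
pose lam := Num.max lam0 1.
have lam1 : 1 <= lam by rewrite le_max lexx orbT.
have hY : locfact Y lam.
  move=> m e; have [n [v [p [p1 vb pe]]]] := h0 m e; exists n, v, p; split=> // c M M0 hc.
  apply: (le_trans (vb c M M0 hc)); apply: ler_wpM2r => //.
  by rewrite le_max lexx.
(* The upper bound of S: lam from the vectors v, and lam * (1 + lam) from the perturbation, whose
   coefficients have size at most 1 + lam. *)
pose b : R := lam * (2 + lam).
have b0 : 0 < b by rewrite mulr_gt0 //; lra.
have ab1 : 1 <= 34 * b by rewrite /b; nra.
exists (rc (34 * b)); split; first by rewrite -rc1 rc_le.
move=> m e; have [n [v [p [p1 vb pe]]]] := hY m e.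
(* Three error terms occur below, each at most n * (1 + lam) * tau times the sup of the
   coefficients; together they take at most half of it. *)
pose tau : R := (6 * n.+1%:R * (1 + lam))^-1.
have n0 : 0 < n.+1%:R :> R by rewrite ltr0n.
have tau0 : 0 < tau by rewrite invr_gt0 !mulr_gt0 //; lra.
have [y [rho [yb rho16 rhoy py rhov]]] := selection lam1 hY inf v p1 tau0.
(* D is 1 - u v on l_infty^n, where v sends c to \sum_k c_k v_k and u is given by the p_k; the y_k
   carry J, and the w_k below are the images of the unit vectors under S. *)
pose D (c : 'I_n -> K) k := c k - sval (p k) (\sum_(l < n) c l *: v l).
pose S (c : 'I_n -> K) := \sum_(k < n) c k *: v k + \sum_(k < n) D c k *: y k.
pose w k := v k + \sum_(j < n) ((j == k)%:R - sval (p j) (v k)) *: y j.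
have SE c : \sum_(k < n) c k *: w k = S c.
  rewrite /w /S; under eq_bigr do rewrite scalerDr scaler_sumr.
  rewrite big_split /=; congr (_ + _); rewrite exchange_big /=; apply: eq_bigr => j _.
  under eq_bigr do rewrite scalerA; rewrite -scaler_suml; congr (_ *: _).
  rewrite /D (lfun_sum (dual_lfun _)).
  under eq_bigr do rewrite mulrBr; rewrite sumrB; congr (_ - _).
    rewrite (bigD1 j) //= eqxx mulr1 big1 ?addr0 // => k kj.
    by rewrite eq_sym (negbTE kj) mulr0.
  by apply: eq_bigr => k _; rewrite (lfunZ (dual_lfun _)).
exists n, w; split.
  (* For x in the given subspace the coefficients p_k(x) reproduce x, so D vanishes on them and S
     returns x itself: the perturbation preserves the inclusion. *)
  move=> _ [c ->].
  have Sp : span_of w (S (fun k => sval (p k) (\sum_(j < m) c j *: e j))) by exists (fun k => sval (p k) (\sum_(j < m) c j *: e j)); rewrite SE.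
  have xE : \sum_(j < m) c j *: e j = \sum_(k < n) sval (p k) (\sum_(j < m) c j *: e j) *: v k.
    under [RHS]eq_bigr do rewrite (lfun_sum (dual_lfun _)) scaler_suml.
    rewrite exchange_big /=; apply: eq_bigr => j _; rewrite {1}pe scaler_sumr.
    by apply: eq_bigr => k _; rewrite (lfunZ (dual_lfun _)) scalerA.
  move: Sp; rewrite /S /D -xE.
  by rewrite [X in _ + X]big1 ?addr0 // => k _; rewrite subrr scale0r.
have Dc c (M : R) : 0 <= M -> (forall k, nm (c k) <= M) -> forall k, nm (D c k) <= (1 + lam) * M.
  move=> M0 hc k; apply: (le_trans (nmB _ _)); rewrite mulrDl mul1r; apply: lerD => //.
  apply: (le_trans (nm_dual_ge _ _)); apply: le_trans (vb c M M0 hc).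
  by rewrite -[leRHS]mul1r; apply: ler_wpM2r => //; exact: nm_ge0.
have small (g : 'I_n -> K) (c : 'I_n -> K) (M : R) : 0 <= M -> (forall k, nm (c k) <= M) -> (forall k, nm (g k) <= tau) ->
    nm (\sum_(k < n) c k * g k) <= n%:R * (M * tau).
  move=> M0 hc hg; apply: (le_trans (nm_sum _ _ _)).
  apply: le_trans (_ : \sum_(k < n) M * tau <= _); last by rewrite sumr_const card_ord mulr_natl.
  by apply: ler_sum => k _; rewrite nmM; apply: ler_pM; rewrite ?nm_ge0.
(* The functional p_i + rho_i has norm at most 17 and recovers c_i up to half of the supremum;
   absorbing that half doubles 17. *)
exists (rc 34), (rc b); split; rewrite -?rc0 ?rc_lt -?rcM ?rc_le // => c.
rewrite SE supnE nmE -!rcM !rc_le; set M := \big[Num.max/0]_(k < n) nm (c k).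
have M0 : 0 <= M by exact: supn_ge0.
have hc k : nm (c k) <= M by exact: supn_ge.
have hD := Dc c M M0 hc.
have M1 : 0 <= (1 + lam) * M by rewrite mulr_ge0 //; lra.
split; last first.
  apply: (le_trans (nmD _ _)); have := vb c M M0 hc; have := yb (D c) _ M1 hD.
  by rewrite /b; lra.
suff : M <= 17 * nm (S c) + M / 2 by lra.
apply: supn_le => [|i].
  by rewrite addr_ge0 ?mulr_ge0 ?nm_ge0 //; lra.
pose T := \sum_(k < n) c k *: v k.
pose J := \sum_(k < n) D c k *: y k.
have eT : sval (rho i) T = \sum_(k < n) c k * sval (rho i) (v k).
  by rewrite (lfun_sum (dual_lfun _)); apply: eq_bigr => k _; rewrite (lfunZ (dual_lfun _)).
have eJ (phi : Dual Y) : sval phi J = \sum_(k < n) D c k * sval phi (y k).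
  by rewrite (lfun_sum (dual_lfun _)); apply: eq_bigr => k _; rewrite (lfunZ (dual_lfun _)).
(* p_i sees c_i - D_i and rho_i sees D_i, up to the bracketed errors. These are small because
   [selection] made the y_k small under the p_i, the v_k small under rho_i, and rho nearly
   biorthogonal to y. *)
have main : c i = sval (p i) (S c) + sval (rho i) (S c) - (sval (p i) J + sval (rho i) T +
    \sum_(k < n) D c k * (sval (rho i) (y k) - (i == k)%:R)).
  have -> : \sum_(k < n) D c k * (sval (rho i) (y k) - (i == k)%:R) = sval (rho i) J - D c i.
    rewrite eJ; under eq_bigr do rewrite mulrBr; rewrite sumrB; congr (_ - _).
    rewrite (bigD1 i) //= eqxx mulr1 big1 ?addr0 // => k ki.
    by rewrite eq_sym (negbTE ki) mulr0.
  by rewrite /S -/T -/J !(lfunD (dual_lfun _)) /D -/T; ring.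
rewrite main; apply: (le_trans (nmB _ _)); apply: lerD.
  apply: (le_trans (nmD _ _)).
  have h1 := nm_dual_ge (p i) (S c); have h2 := nm_dual_ge (rho i) (S c).
  have h3 : nm (p i) * nm (S c) <= 1 * nm (S c) by apply: ler_wpM2r => //; exact: nm_ge0.
  have h4 : nm (rho i) * nm (S c) <= 16 * nm (S c) by apply: ler_wpM2r => //; exact: nm_ge0.
  by lra.
apply: (le_trans (nmD _ _)).
have h1 : nm (sval (p i) J) <= n%:R * ((1 + lam) * M * tau) by rewrite eJ; apply: small.
have h2 : nm (sval (rho i) T) <= n%:R * (M * tau) by rewrite eT; apply: small.
have h3 := small _ _ _ M1 hD (rhoy i).
have h4 := nmD (sval (p i) J) (sval (rho i) T).
have h5 : n%:R * (M * tau) <= n%:R * ((1 + lam) * M * tau).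
  by apply: ler_wpM2l => //; apply: ler_wpM2r; [exact: ltW|rewrite mulrDl mul1r lerDl mulr_ge0 //; lra].
have h6 : 3 * (n%:R * ((1 + lam) * M * tau)) <= M / 2.
  have -> : M / 2 = 3 * (n.+1%:R * ((1 + lam) * M * tau)).
    rewrite /tau; move: (n.+1%:R : R) n0 => N0 N00; field.
    by rewrite (lt0r_neq0 N00) lt0r_neq0 //; lra.
  by apply: ler_wpM2l => //; apply: ler_wpM2r; [rewrite mulr_ge0 // ltW|rewrite ler_nat].
lra.
Qed.
End LinftyMain.

(** * Each exactness or lifting property forces local factorization *)

Section Quotients.
Context {R : realType}.
Local Notation K := (Cplx R).

Definition submod {V : lmodType K} (N : set V) :=
  N 0 /\ forall (a : K) x y, N x -> N y -> N (a *: x + y).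

Lemma submod_span {V : normedModType K} n (v : 'I_n -> V) : submod (span_of v).
Proof.
split; first by exists (fun=> 0); rewrite big1 // => k _; rewrite scale0r.
move=> a _ _ [c ->] [d ->]; exists (fun k => a * c k + d k).
under [RHS]eq_bigr do rewrite scalerDl -scalerA.
by rewrite big_split scaler_sumr.
Qed.

Lemma submodZ {V : lmodType K} (N : set V) a x : submod N -> N x -> N (a *: x).
Proof. by move=> [N0 Nl] hx; rewrite -[_ *: _]addr0; exact: Nl. Qed.
Lemma submodD {V : lmodType K} (N : set V) x y : submod N -> N x -> N y -> N (x + y).
Proof. by move=> [N0 Nl] hx; rewrite -[x]scale1r; exact: Nl. Qed.
Lemma submod_sum {V : lmodType K} (N : set V) (I : Type) (r : seq I) (P : pred I) (F : I -> V) :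
  submod N -> (forall i, N (F i)) -> N (\sum_(i <- r | P i) F i).
Proof. by move=> sN hF; elim/big_ind: _ => //; [case: sN|move=> x y; exact: submodD]. Qed.

(** The gauge is the distance to N: the prescribed value on the line of x is dominated by it, and
    the extension vanishes on N because the gauge does. *)
Lemma dist_functional (X : normedModType K) (N : set X) (x : X) (d : R) :
  submod N -> 0 <= d -> (forall y, N y -> d <= nm (x - y)) ->
  exists g : X -> K, [/\ lfun g, (forall z, nm (g z) <= nm z), (forall y, N y -> g y = 0) & g x = rc d].
Proof.
move=> sN d0 hd; have [N0 Nl] := sN.
have [->|dn0] := eqVneq d 0.
  exists (fun=> 0); split=> //; first by move=> a u v; rewrite mulr0 addr0.
  by move=> z; rewrite nm0 nm_ge0.
have d1 : 0 < d by rewrite lt_neqAle eq_sym dn0.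
pose G (z : X) r := exists2 y, N y & nm (z - y) <= r.
have GD u v r s : G u r -> G v s -> G (u + v) (r + s).
  move=> [y Ny h1] [y' Ny' h2]; exists (y + y'); first exact: submodD.
  by rewrite opprD addrACA; apply: (le_trans (nmD _ _)); exact: lerD.
have GZ (a : K) u r : G u r -> G (a *: u) (nm a * r).
  move=> [y Ny h]; exists (a *: y); first exact: submodZ.
  by rewrite -scalerBr nmZ; apply: ler_wpM2l => //; exact: nm_ge0.
have x0 : x != 0 by apply/eqP => h; have := hd 0 N0; rewrite h subr0 nm0; lra.
pose L := [set y | exists c : K, y = c *: x].
have /choice[co hco] : forall y, exists c : K, L y -> y = c *: x.
  by move=> y; have [[c hc]|n] := pselect (L y); [exists c | exists 0].
have cox c : co (c *: x) = c.
  have /eqP := hco (c *: x) (ex_intro _ c erefl).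
  by rewrite -subr_eq0 -scalerBl scaler_eq0 subr_eq0 (negbTE x0) orbF => /eqP.
have L0 : L 0 by exists 0; rewrite scale0r.
have Ll (a : K) u v : L u -> L v -> L (a *: u + v).
  by move=> [c ->] [c' ->]; exists (a * c + c'); rewrite scalerDl scalerA.
have fl (a : K) u v : L u -> L v -> co (a *: u + v) * rc d = a * (co u * rc d) + co v * rc d.
  by move=> [c ->] [c' ->]; rewrite scalerA -scalerDl !cox; ring.
have [|g [gl gf gG]] := hahn_banach GD GZ L0 Ll fl.
  move=> _ r [c ->] [y Ny h]; rewrite cox nmM nm_rc ger0_norm //.
  have [->|c0] := eqVneq c 0; first by rewrite nm0 mul0r; apply: le_trans h; exact: nm_ge0.
  have nc := nm_gt0 c0.
  rewrite -ler_pdivlMl //; apply: (le_trans (hd (c^-1 *: y) _)); first exact: submodZ.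
  rewrite ler_pdivlMl // -nmZ scalerBr scalerA mulfV // scale1r //.
exists g; split=> //.
- by move=> z; apply: gG; exists 0 => //; rewrite subr0.
- by move=> y Ny; apply: nm_le0; apply: gG; exists y => //; rewrite subrr nm0.
- by rewrite gf; [rewrite -[in co x](scale1r x) cox mul1r | exists 1; rewrite scale1r].
Qed.

Section Quotient.
Variables (X : completeNormedModType K) (N : set X).
Hypotheses (sN : submod N) (cN : forall x, (forall e : R, 0 < e -> exists2 y, N y & nm (x - y) <= e) -> N x).

(** X / N is realized as the space of evaluation functions on the unit ball of the annihilator of N.
    [near0] says that a point with small evaluations is close to N. *)
Let G := {psi : Dual X | nm psi <= 1 /\ forall y, N y -> sval psi y = 0}.
Let S := [set f : G -> K^o | exists x, forall g, f g = sval (sval g) x].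

Let near0 (x : X) (e e' : R) : 0 <= e -> e < e' -> (forall g : G, nm (sval (sval g) x) <= e) ->
  exists2 y, N y & nm (x - y) <= e'.
Proof.
move=> e0 ee' h; apply: contrapT => /forall2NP hn.
have [|y Ny|g [gl g1 gN gx]] := @dist_functional X N x e' sN; first by lra.
  by have [//|/negP] := hn y; rewrite -ltNge => /ltW.
have g1' z : nm (g z) <= 1 * nm z by rewrite mul1r.
have gk : nm (mkdual gl g1') <= 1 /\ forall y, N y -> sval (mkdual gl g1') y = 0.
  by split=> //; apply: nm_dualP.
have := h (exist _ (mkdual gl g1') gk); rewrite /= gx nm_rc ger0_norm; lra.
Qed.

Let hS : bs_ok S.
Proof.
split.
- by exists 0 => g; rewrite (lfun0 (dual_lfun _)).
- by move=> a f f' [x hx] [x' hx']; exists (a *: x + x') => g; rewrite (dual_lfun (sval g)) hx hx'.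
move=> f hf.
have /choice[x hx] : forall n, exists x, forall g : G, nm (f g - sval (sval g) x) <= (2^-1) ^+ n.
  by move=> n; have [f' [x hx] h] := hf _ (halfX_gt0 n); exists x => g; rewrite -hx.
(* Consecutive approximants differ by little only modulo N. Subtracting the elements y_n of N, on
   which the functionals vanish, makes the sequence Cauchy in X itself. *)
have /choice[y hy] : forall n, exists y, N y /\ nm (x n.+1 - x n - y) <= 3 * (2^-1) ^+ n.
  move=> n; have h0 : 0 < (2^-1 : R) ^+ n := halfX_gt0 n.
  have [|||y Ny hy] := @near0 (x n.+1 - x n) (2 * (2^-1) ^+ n) (3 * (2^-1) ^+ n); [lra|lra| |by exists y].
  move=> g; rewrite (lfunB (dual_lfun _)); apply: (le_trans (nm_tri _ (f g) _)).
  by have := hx n g; have := hx n.+1 g; rewrite nmBC exprS; lra.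
pose s n := x n - \sum_(k < n) y k.
have sE n : s n.+1 - s n = x n.+1 - x n - y n.
  by rewrite /s big_ord_recr /= opprB opprD (addrC (- \sum_(_ < _) _)) !addrA subrK addrAC.
have [l hl] : exists l, forall n, nm (l - s n) <= 2 * 3 * (2^-1) ^+ n.
  by apply: geo_cvg (seqcompleteP (W := X)) _ => n; rewrite sE; exact: (proj2 (hy n)).
exists l => g; apply/eqP; rewrite -subr_eq0; apply/eqP.
apply: (@nm_small R K) => e e0.
have e7 : 0 < e / 7 by lra.
have [n hn] := half_pow e7.
have gs : sval (sval g) (s n) = sval (sval g) (x n).
  rewrite (lfunB (dual_lfun _)) (lfun_sum (dual_lfun _)) big1 ?subr0 // => k _.
  by apply: (proj2 (svalP g)); exact: (proj1 (hy k)).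
apply: (le_trans (nm_tri _ (sval (sval g) (x n)) _)).
rewrite -{2}gs -(lfunB (dual_lfun _)).
have h1 := nm_dual_ge (sval g) (s n - l); have h2 := proj1 (svalP g).
have h3 : nm (sval g) * nm (s n - l) <= 1 * nm (s n - l) by apply: ler_wpM2r => //; exact: nm_ge0.
by have h4 := hl n; have h5 := hx n g; rewrite nmBC in h4; lra.
Qed.

Lemma quotient_exists : exists (Z : completeNormedModType K) (q : X -> Z),
  [/\ lin q, (forall x, nm (q x) <= nm x), (forall z, exists x, q x = z) & forall x, q x = 0 <-> N x].
Proof.
have bd x : exists c : R, forall g : G, nm (sval (sval g) x : K^o) <= c.
  exists (nm x) => g; apply: (le_trans (nm_dual_ge _ _)).
  by rewrite -[leRHS]mul1r; apply: ler_wpM2r; [exact: nm_ge0|exact: (proj1 (svalP g))].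
have key x : S (fun g => sval (sval g) x) /\ exists c : R, forall g : G, nm (sval (sval g) x : K^o) <= c.
  by split=> //; exists x.
pose q x : bsp seqcomplete_K hS := exist _ (fun g : G => sval (sval g) x) (key x).
exists (bsp seqcomplete_K hS), q; split.
- by move=> a x y; apply: bsp_ext => g /=; rewrite (dual_lfun (sval g)).
- move=> x; apply: nm_bsp_le => [|g]; first exact: nm_ge0.
  apply: (le_trans (nm_dual_ge _ _)).
  by rewrite -[leRHS]mul1r; apply: ler_wpM2r; [exact: nm_ge0|exact: (proj1 (svalP g))].
- move=> z; have [x hx] := @bspS _ _ _ _ seqcomplete_K hS z; exists x.
  by apply: bsp_ext => g; rewrite hx.
- move=> x; split=> [h|Nx]; last by apply: bsp_ext => g /=; exact: (proj2 (svalP g)).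
  apply: cN => e e0; apply: (@near0 x 0) => // g.
  have /(congr1 (fun f => sval f g)) /= -> := h.
  by rewrite nm0.
Qed.
End Quotient.

Lemma sum_delta n (F : 'I_n -> K) j : \sum_(k < n) F k * (j == k)%:R = F j.
Proof.
rewrite (bigD1 j) //= eqxx mulr1 big1 ?addr0 // => k kj.
by rewrite eq_sym (negbTE kj) mulr0.
Qed.

(** The domination makes g a functional of the coordinates on their image in l_infty^n, bounded by
    C. After Hahn-Banach its coefficients have l_1 norm at most C, by testing on phases. *)
Lemma coord_ext (V : lmodType K) (H : set V) (n : nat) (psi : 'I_n -> V -> K) (g : V -> K) (C : R) :
  submod H -> (forall k, lfun (psi k)) -> lfun g -> 0 <= C ->
  (forall y, H y -> nm (g y) <= C * \big[Num.max/0]_(k < n) nm (psi k y)) ->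
  exists b : 'I_n -> K, (forall y, H y -> g y = \sum_(k < n) b k * psi k y) /\
    \sum_(k < n) nm (b k) <= C.
Proof.
move=> sH psil gl C0 hg; have [H0 Hl] := sH.
pose L := {ffun 'I_n -> K^o}.
pose N : set L := [set c | exists2 y, H y & forall k, c k = psi k y].
pose sup (c : L) := \big[Num.max/0]_(k < n) nm (c k : K).
pose G (c : L) (r : R) := C * sup c <= r.
have supD c d : sup (c + d) <= sup c + sup d.
  apply: supn_le => [|k]; first by apply: addr_ge0; exact: supn_ge0.
  rewrite ffunE; apply: (le_trans (nmD _ _)); apply: lerD.
    exact: (@supn_ge R n (fun k => c k)).
  exact: (@supn_ge R n (fun k => d k)).
have supZ (a : K) c : sup (a *: c) <= nm a * sup c.
  apply: supn_le => [|k]; first by apply: mulr_ge0; [exact: nm_ge0|exact: supn_ge0].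
  rewrite ffunE nmM; apply: ler_wpM2l; first exact: nm_ge0.
  exact: (@supn_ge R n (fun k => c k)).
have GD c d r s : G c r -> G d s -> G (c + d) (r + s).
  rewrite /G => h1 h2; have := supD c d => h3.
  have : C * sup (c + d) <= C * (sup c + sup d) by apply: ler_wpM2l.
  by lra.
have GZ (a : K) c r : G c r -> G (a *: c) (nm a * r).
  rewrite /G => h; apply: (le_trans (ler_wpM2l C0 (supZ a c))).
  by rewrite mulrCA; apply: ler_wpM2l => //; exact: nm_ge0.
have /choice[y hy] : forall c : L, exists y, N c -> H y /\ forall k, c k = psi k y.
  by move=> c; have [[y Hy h]|nc] := pselect (N c); [exists y|exists 0].
have N0 : N 0 by exists 0 => // k; rewrite ffunE (lfun0 (psil k)).
have Nl (a : K) c d : N c -> N d -> N (a *: c + d).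
  by move=> [u Hu hu] [v Hv hv]; exists (a *: u + v) => [|k]; [exact: Hl|rewrite !ffunE hu hv (psil k)].
have same u v : H u -> H v -> (forall k, psi k u = psi k v) -> g u = g v.
  move=> Hu Hv h; apply/eqP; rewrite -subr_eq0 -(lfunB gl); apply/eqP; apply: nm_le0.
  have Huv : H (u - v) by rewrite -scaleN1r addrC; exact: Hl.
  apply: (le_trans (hg _ Huv)); rewrite -[leRHS](mulr0 C); apply: ler_wpM2l => //.
  by apply: (@supn_le R n (fun k => psi k (u - v))) => // k; rewrite (lfunB (psil k)) h subrr nm0.
have fl (a : K) c d : N c -> N d -> g (y (a *: c + d)) = a * g (y c) + g (y d).
  move=> Nc Nd; have [h1 h2] := hy _ Nc; have [h3 h4] := hy _ Nd; have [h5 h6] := hy _ (Nl a c d Nc Nd).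
  rewrite -(gl a); apply: same => //; first exact: Hl.
  by move=> k; rewrite -h6 !ffunE (psil k) -h2 -h4.
have [|f [fl' fN fG]] := hahn_banach GD GZ N0 Nl fl.
  move=> c r Nc; apply: le_trans; have [h1 h2] := hy c Nc.
  apply: (le_trans (hg _ h1)); apply: ler_wpM2l => //.
  by under eq_bigr do rewrite -h2.
pose dl k : L := [ffun j => (j == k)%:R].
have evS (F : 'I_n -> L) j : (\sum_(k < n) F k) j = \sum_(k < n) (F k j : K).
  by apply: (big_morph (fun c : L => c j : K)) => [c d|]; rewrite ffunE.
have fE c : f c = \sum_(k < n) f (dl k) * c k.
  have dlE k j : (((c k : K) *: dl k) j : K) = (c k : K) * (j == k)%:R by rewrite !ffunE.
  have -> : f c = f (\sum_(k < n) (c k : K) *: dl k).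
    congr f; apply/ffunP => j; rewrite evS.
    by under eq_bigr do rewrite dlE; rewrite sum_delta.
  by rewrite (lfun_sum fl'); apply: eq_bigr => k _; rewrite (lfunZ fl') mulrC.
exists (fun k => f (dl k)); split.
  move=> u Hu; have Nu : N [ffun k => psi k u] by exists u => // k; rewrite ffunE.
  have [h1 h2] := hy _ Nu.
  rewrite (same u (y [ffun k => psi k u])) //; last by move=> k; rewrite -h2 ffunE.
  by rewrite -fN // fE; apply: eq_bigr => k _; rewrite ffunE.
have /choice[c hc] : forall k, exists c : K, nm c = 1 /\ c * f (dl k) = rc (nm (f (dl k))).
  by move=> k; exact: phase.
have : nm (f [ffun k => c k]) <= C.
  apply: fG; rewrite /G -[leRHS]mulr1; apply: ler_wpM2l => //.
  by apply: supn_le => // k; rewrite ffunE (proj1 (hc k)).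
rewrite fE; under eq_bigr do rewrite ffunE mulrC (proj2 (hc _)).
by rewrite -rc_sum nm_rc ger0_norm //; apply: sumr_ge0 => *; exact: nm_ge0.
Qed.

Lemma tbdd_fd_ball (V : normedModType K) (m : nat) (e : 'I_m -> V) (c : R) :
  tbdd [set y | span_of e y /\ nm y <= c].
Proof.
have [n [v [p [vs pb pv pe]]]] := fd_coord e.
have pl k : lfun (p k) := proj1 (pb k).
have /choice[cs hcs] : forall k, exists c : R, 0 < c /\ forall x, nm (p k x) <= c * nm x.
  by move=> k; have [_ [d d0 h]] := pb k; exists d.
pose D := \sum_(k < n) cs k * `|c|.
apply: tbdd_sub (tbdd_fd v D) => y [[a ya] yc]; subst y.
exists (fun k => p k (\sum_(j < m) a j *: e j)); split.
  move=> k; apply: (le_trans (proj2 (hcs k) _)).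
  rewrite /D (bigD1 k) //=; apply: ler_wpDr.
    apply: sumr_ge0 => i _. have [h _] := hcs i; by rewrite mulr_ge0 ?(ltW h).
  apply: ler_wpM2l; first by apply: ltW; exact: (proj1 (hcs k)).
  by apply: (le_trans yc); exact: ler_norm.
under [RHS]eq_bigr do rewrite (lfun_sum (pl _)) scaler_suml.
rewrite exchange_big /=; apply: eq_bigr => j _; rewrite {1}pe scaler_sumr.
by apply: eq_bigr => k _; rewrite (lfunZ (pl k)) scalerA.
Qed.

(** Norming functionals of a 1/4-net of the unit ball: a unit vector is within 1/4 of a net point of
    norm at least 3/4, so the functional of that point is at least 1/2 on it. *)
Lemma norming_net (Y : completeNormedModType K) (m : nat) (e : 'I_m -> Y) :
  exists n (psi : 'I_n -> Dual Y), (forall k, nm (psi k) <= 1) /\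
    forall y, span_of e y -> nm y <= 2 * \big[Num.max/0]_(k < n) nm (sval (psi k) y).
Proof.
have q0 : 0 < (4^-1 : R) by lra.
have [n [a [aA ha]]] := tbdd_in (tbdd_fd_ball e 1) q0.
have /choice[psi hpsi] := fun k => dual_norming (a k).
exists n, psi; split; first by move=> k; exact: (proj1 (hpsi k)).
move=> y sy; have [->|y0] := eqVneq y 0.
  by rewrite nm0 mulr_ge0 //; exact: supn_ge0.
have ny := nm_gt0 y0.
have r0 : 0 <= (nm y)^-1 by rewrite invr_ge0 ltW.
have [|k hk] := ha (rc (nm y)^-1 *: y).
  split; first by apply: submodZ => //; exact: submod_span.
  by rewrite nmZ nm_rc ger0_norm // mulVf // lt0r_neq0.
have h1 : nm (rc (nm y)^-1 *: y) = 1 by rewrite nmZ nm_rc ger0_norm // mulVf // lt0r_neq0.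
have h2 := nm_Bge (rc (nm y)^-1 *: y) (a k); rewrite h1 in h2.
have [p1 pa] := hpsi k.
have h3 : nm (sval (psi k) (rc (nm y)^-1 *: y - a k)) <= 4^-1.
  apply: (le_trans (nm_dual_ge _ _)); apply: le_trans hk.
  by rewrite -[leRHS]mul1r; apply: ler_wpM2r => //; exact: nm_ge0.
have h4 : nm (sval (psi k) (a k)) = nm (a k) by rewrite pa nm_rc ger0_norm // nm_ge0.
have h5 : 2^-1 <= nm (sval (psi k) (rc (nm y)^-1 *: y)).
  rewrite (lfunB (dual_lfun _)) in h3.
  have := nm_Bge (sval (psi k) (a k)) (sval (psi k) (rc (nm y)^-1 *: y)); rewrite nmBC h4; lra.
rewrite (lfunZ (dual_lfun _)) nmM nm_rc ger0_norm // ler_pdivlMl // in h5.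
have := supn_ge (fun k => sval (psi k) y) k; lra.
Qed.
End Quotients.

(** * Local factorization from splittings and from compact liftings *)

Section Converse.
Context {R : realType}.
Local Notation K := (Cplx R).

Lemma bs_okT (G : Type) (W : normedModType K) : bs_ok (@setT (G -> W)).
Proof. by split. Qed.

(** The consequence of the injectivity of l_infty that the converses use: functionals that norm H up
    to the factor 2 already let the embedding factor through l_infty^n. *)
Definition ext_prop (Y X : completeNormedModType K) (i : Y -> X) :=
  forall n (psi : 'I_n -> Dual Y) (H : set Y), submod H ->
    (forall y, H y -> nm y <= 2 * \big[Num.max/0]_(k < n) nm (sval (psi k) y)) ->
    exists w : 'I_n -> X,
      (forall (c : 'I_n -> K) (M : R), 0 <= M -> (forall k, nm (c k) <= M) ->
        nm (\sum_(k < n) c k *: w k) <= 2 * M) /\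
      forall y, H y -> i y = \sum_(k < n) sval (psi k) y *: w k.

Lemma bsp_sum (G : Type) (W : normedModType K) (S : set (G -> W)) (cW : seqcomplete W)
  (hS : bs_ok S) (n : nat) (F : 'I_n -> bsp cW hS) x :
  sval (\sum_(k < n) F k) x = \sum_(k < n) sval (F k) x.
Proof. exact: (big_morph (fun f : bsp cW hS => sval f x)). Qed.

Lemma linf_embed (Y : completeNormedModType K) :
  exists (X : completeNormedModType K) (i : Y -> X),
    [/\ lin i, (forall y, nm (i y) = nm y) & ext_prop i].
Proof.
pose G := {phi : Dual Y | nm phi <= 1}.
pose cK := @seqcomplete_K R; pose hT := @bs_okT G K^o.
have gle (g : G) y : nm (sval (sval g) y) <= nm y.
  apply: (le_trans (nm_dual_ge _ _)); rewrite -[leRHS]mul1r.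
  by apply: ler_wpM2r; [exact: nm_ge0|exact: (svalP g)].
have key y : setT (fun g : G => sval (sval g) y : K^o) /\
    exists c : R, forall g : G, nm (sval (sval g) y : K^o) <= c.
  by split=> //; exists (nm y) => g; exact: gle.
pose i y : bsp cK hT := exist _ (fun g : G => sval (sval g) y : K^o) (key y).
exists (bsp cK hT), i; split.
- by move=> a x y; apply: bsp_ext => g /=; rewrite (dual_lfun (sval g)).
- move=> y; apply/eqP; rewrite eq_le; apply/andP; split.
    by apply: nm_bsp_le => [|g]; [exact: nm_ge0|exact: gle].
  have [phi [p1 py]] := dual_norming y.
  have := nm_bsp_ge (i y) (exist _ phi p1 : G).
  by rewrite /= py nm_rc ger0_norm // nm_ge0.
move=> n psi H sH hH.
(* At each point g of the dual ball the functional g is expanded on H in the psi_k with coefficients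
   of l_1 norm at most 2. As functions of g these coefficients are the vectors w_k, and no
   regularity in g is required of bounded functions. *)
have /choice[b hb] : forall g : G, exists b : 'I_n -> K,
    (forall y, H y -> sval (sval g) y = \sum_(k < n) b k * sval (psi k) y) /\ \sum_(k < n) nm (b k) <= 2.
  move=> g; apply: (coord_ext sH) => //; try exact: dual_lfun.
    by move=> k; exact: dual_lfun.
  by move=> y Hy; apply: (le_trans (gle g y)); exact: hH.
have b2 g k : nm (b g k) <= 2.
  apply: le_trans (proj2 (hb g)); rewrite (bigD1 k) //= lerDl.
  by apply: sumr_ge0 => *; exact: nm_ge0.
have wk k : setT (fun g : G => b g k : K^o) /\ exists c : R, forall g : G, nm (b g k : K^o) <= c.
  by split=> //; exists 2 => g; exact: b2.
pose w k : bsp cK hT := exist _ (fun g : G => b g k : K^o) (wk k).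
exists w; split.
  move=> c M M0 hc; apply: nm_bsp_le => [|g]; first by rewrite mulr_ge0.
  rewrite bsp_sum; apply: (le_trans (nm_sum _ _ _)).
  apply: le_trans (_ : \sum_(k < n) nm (b g k) * M <= _).
    by apply: ler_sum => k _; rewrite bspZ nmM mulrC; apply: ler_wpM2l; [exact: nm_ge0|exact: hc].
  by rewrite -mulr_suml; apply: ler_wpM2r => //; exact: (proj2 (hb g)).
move=> y Hy; apply: bsp_ext => g; rewrite bsp_sum /= (proj1 (hb g) y Hy).
by apply: eq_bigr => k _; rewrite mulrC.
Qed.

Lemma linf_ses (Y : completeNormedModType K) :
  exists (X Z : completeNormedModType K) (i : Y -> X) (q : X -> Z),
    [/\ short_exact i q, (forall y, nm (i y) = nm y), (forall x, nm (q x) <= nm x) & ext_prop i].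
Proof.
have [X [i [il inm iext]]] := linf_embed Y.
pose N := [set x | exists y, i y = x].
have sN : submod N.
  split; first by exists 0; rewrite (lin0 il).
  by move=> a _ _ [x <-] [y <-]; exists (a *: x + y); rewrite il.
have cN x : (forall e : R, 0 < e -> exists2 y, N y & nm (x - y) <= e) -> N x.
  move=> h; have /choice[y hy] : forall n, exists y, nm (x - i y) <= (2^-1) ^+ n.
    by move=> n; have [_ [y <-] hy] := h _ (halfX_gt0 n); exists y.
  have [l hl] : exists l, forall n, nm (l - y n) <= 2 * 2 * (2^-1) ^+ n.
    apply: geo_cvg (seqcompleteP (W := Y)) _ => n.
    rewrite -inm (linB il); apply: (le_trans (nm_tri _ x _)); rewrite (nmBC _ x).
    have := hy n; have := hy n.+1; have : 0 < (2^-1 : R) ^+ n := halfX_gt0 n; rewrite exprS; lra.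
  exists l; apply/eqP; rewrite -subr_eq0; apply/eqP; apply: nm_small => e e0.
  have e5 : 0 < e / 5 by lra.
  have [n hn] := half_pow e5.
  apply: (le_trans (nm_tri _ (i (y n)) _)); rewrite -(linB il) inm (nmBC _ x).
  by have := hl n; have := hy n; lra.
have [Z [q [ql q1 qs qk]]] := quotient_exists sN cN.
exists X, Z, i, q; split=> //; split=> //.
- by split=> //; apply: (lin_cont il (c := 1)) => y; rewrite inm mul1r.
- by split=> //; apply: (lin_cont ql (c := 1)) => y; rewrite mul1r.
- move=> y y' h; apply/eqP; rewrite -subr_eq0; apply/eqP; apply: nm_le0.
  by rewrite -inm (linB il) h subrr nm0.
Qed.

Definition locfact_at (Y : completeNormedModType K) (lam : R) (m : nat) (e : 'I_m -> Y) :=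
  exists (n : nat) (v : 'I_n -> Y) (p : 'I_n -> Dual Y),
    [/\ forall k, nm (p k) <= 1,
        forall (c : 'I_n -> K) (M : R), 0 <= M -> (forall k, nm (c k) <= M) ->
          nm (\sum_(k < n) c k *: v k) <= lam * M &
        forall j, e j = \sum_(k < n) sval (p k) (e j) *: v k].

(** The local splitting is applied to the span of the vectors w_k of [ext_prop], which contains
    i(E); the images T(w_k) are the vectors of the factorization. *)
Lemma locally_splits_locfact (Y : completeNormedModType K) :
  (forall (X Z : completeNormedModType K) (i : Y -> X) (q : X -> Z),
    short_exact i q -> locally_splits i q) -> exists lam, locfact Y lam.
Proof.
move=> h; have [X [Z [i [q [ex inm q1 iext]]]]] := linf_ses Y.
have [lam [lam0 hl]] := h _ _ _ _ ex; have [r r0 lr] := rcK lam0; subst lam.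
exists (2 * r) => m e.
have [n [psi [p1 hpsi]]] := norming_net e.
have [w [wb we]] := iext n psi _ (submod_span e) hpsi.
have [T [Tl Tb Te]] := hl n w.
have Tb' x : span_of w x -> nm (T x) <= r * nm x.
  by move=> sx; have := Tb x sx; rewrite !nmE -rcM rc_le.
have T0 : T 0 = 0.
  have s0 := (submod_span w).1.
  by have := Tb' 0 s0; rewrite nm0 mulr0 => /nm_le0.
have sw k : span_of w (w k).
  exists (fun l => (l == k)%:R); rewrite (bigD1 k) //= eqxx scale1r big1 ?addr0 // => l /negbTE ->.
  by rewrite scale0r.
have Tsum c : T (\sum_(k < n) c k *: w k) = \sum_(k < n) c k *: T (w k).
  suff H (s : seq 'I_n) : T (\sum_(k <- s) c k *: w k) = \sum_(k <- s) c k *: T (w k) by exact: H.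
  elim: s => [|k s IH]; first by rewrite !big_nil.
  rewrite !big_cons Tl ?IH //.
  by apply: submod_sum => [|l]; [exact: submod_span|apply: submodZ => //; exact: submod_span].
have se j : span_of e (e j).
  exists (fun l => (l == j)%:R); rewrite (bigD1 j) //= eqxx scale1r big1 ?addr0 // => l /negbTE ->.
  by rewrite scale0r.
exists n, (fun k => T (w k)), psi; split=> //.
  move=> c M M0 hc; rewrite -Tsum; apply: (le_trans (Tb' _ _)); first by exists c.
  by rewrite [2 * r]mulrC -mulrA; apply: ler_wpM2l; [exact: ltW|exact: wb].
move=> j; rewrite -Tsum -we; last exact: se.
apply: (ex_inj ex); rewrite Te //; last by exists (e j).
by rewrite we //; exists (fun k => sval (psi k) (e j)).
Qed.

(** The constants 4^n outgrow the factor 2^n that is lost when the n-th glued piece is recovered;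
    [lt_2pow4] is the resulting comparison. *)
Lemma no_locfact (Y : completeNormedModType K) : ~ (exists lam, locfact Y lam) ->
  exists E : nat -> {m : nat & 'I_m -> Y}, forall n, ~ locfact_at (4 ^+ n) (projT2 (E n)).
Proof.
move=> h; have /choice[E hE] : forall n, exists E : {m : nat & 'I_m -> Y}, ~ locfact_at (4 ^+ n) (projT2 E).
  move=> n; apply: contrapT => /forallNP hn; apply: h; exists (4 ^+ n) => m e.
  by have := hn (existT _ m e) => /contrapT.
by exists E.
Qed.

Lemma lt_2pow4 (C : R) : exists n : nat, 2 + 2 ^+ n * C <= 4 ^+ n.
Proof.
have c0 : 0 < `|C| + 2 by have := normr_ge0 C; lra.
have cV : 0 < (`|C| + 2)^-1 by rewrite invr_gt0.
have [n hn] := half_pow cV; exists n.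
rewrite exprVn ltf_pV2 ?posrE ?exprn_gt0 // in hn.
have h1 : 1 <= 2 ^+ n :> R by apply: exprn_ege1; lra.
have -> : (4 : R) ^+ n = 2 ^+ n * 2 ^+ n by rewrite -exprMn; congr (_ ^+ _); lra.
have := ler_norm C; nra.
Qed.

Section Lifting.
Variables (Z : completeNormedModType K) (E : nat -> set Z).
Hypotheses (sE : forall n, submod (E n)) (bE : forall n (c : R), tbdd [set z | E n z /\ nm z <= c]).

(** [bs_ok] asks for stability under uniform limits, hence the closures; their balls are still
    totally bounded. *)
Let cl n : set Z := [set z | forall e : R, 0 < e -> exists2 x, E n x & nm (z - x) <= e].
Let clE n : E n `<=` cl n.
Proof. by move=> z h e e0; exists z => //; rewrite subrr nm0 ltW. Qed.
Let scl n : submod (cl n).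
Proof.
have [s0 sl] := sE n; split; first exact: clE.
move=> a x y hx hy e e0.
have a0 : 0 < nm a + 1 by have := nm_ge0 a; lra.
have e1 : 0 < e / 2 / (nm a + 1) by rewrite divr_gt0 //; lra.
have [x' Ex hx'] := hx _ e1; have [y' Ey hy'] := hy (e / 2) ltac:(lra).
exists (a *: x' + y'); first exact: sl.
rewrite opprD addrACA -scalerBr; apply: (le_trans (nmD _ _)); rewrite nmZ.
rewrite ler_pdivlMr // in hx'; have := nm_ge0 (x - x'); have := nm_ge0 a; nra.
Qed.
Let bcl n (c : R) : tbdd [set z | cl n z /\ nm z <= c].
Proof.
apply: tbdd_approx => e e0; exists [set z | E n z /\ nm z <= c + e]; split; first exact: bE.
move=> z [hz zc]; have [x Ex hx] := hz e e0; exists x => //; split=> //.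
by have := nm_Bge x z; rewrite nmBC; lra.
Qed.

Let S : set (nat -> Z) := [set f | forall n, cl n (f n)].
Let hS : bs_ok S.
Proof.
split.
- by move=> n; exact: (proj1 (scl n)).
- by move=> a f g hf hg n; exact: (proj2 (scl n)).
move=> f h n e e0; have [g Sg hg] := h (e / 2) ltac:(lra).
have [x Ex hx] := Sg n (e / 2) ltac:(lra); exists x => //.
by apply: (le_trans (nm_tri _ (g n) _)); have := hg n; lra.
Qed.
Let cZ := seqcompleteP (W := Z).

(* The spaces E n are glued into one Banach space V with a compact operator
   acting as 2^-n on the n-th summand, so that lifting it lifts all of them. *)
Lemma glue_compact (X : completeNormedModType K) (q : X -> Z) : lin q -> lifts q A_compact ->
  exists C : R, 0 <= C /\ forall n m (z : 'I_m -> Z), (forall k, E n (z k)) ->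
    exists x : 'I_m -> X, (forall k, q (x k) = z k) /\
      forall c : 'I_m -> K, nm (\sum_(k < m) c k *: x k) <= 2 ^+ n * C * nm (\sum_(k < m) c k *: z k).
Proof.
move=> ql lq.
pose V := bsp cZ hS.
pose part (z : V) N := \sum_(n < N) rc ((2^-1) ^+ n) *: sval z n.
have partS z N : part z N.+1 - part z N = rc ((2^-1) ^+ N) *: sval z N.
  by rewrite /part big_ord_recr /= addrAC subrr add0r.
have /choice[t ht] : forall z : V, exists l, forall N, nm (l - part z N) <= 2 * nm z * (2^-1) ^+ N.
  move=> z; apply: (geo_cvg cZ) => N; rewrite partS nmZ nm_rc ger0_norm; last exact/ltW/halfX_gt0.
  by rewrite mulrC; apply: ler_wpM2r; [exact/ltW/halfX_gt0|exact: (@nm_bsp_ge _ _ _ _ cZ hS)].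
have tuniq (z : V) l (D : R) : 0 <= D -> (forall N, nm (l - part z N) <= D * (2^-1) ^+ N) -> l = t z.
  move=> D0 h; apply/eqP; rewrite -subr_eq0; apply/eqP; apply: nm_small => e e0.
  have d0 : 0 < D + 2 * nm z + 1 by have := nm_ge0 z; lra.
  have [N hN] := half_pow (divr_gt0 e0 d0); rewrite ltr_pdivlMr // in hN.
  apply: (le_trans (nm_tri _ (part z N) _)); rewrite (nmBC _ (t z)).
  have := ht z N; have := h N; have : 0 < (2^-1 : R) ^+ N := halfX_gt0 N; nra.
have tl : lin t.
  move=> a x y; apply/esym; apply: (@tuniq _ _ (nm a * (2 * nm x) + 2 * nm y)).
    by apply: addr_ge0; rewrite !mulr_ge0 ?nm_ge0.
  move=> N; have -> : part (a *: x + y) N = a *: part x N + part y N.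
    rewrite /part scaler_sumr -big_split /=; apply: eq_bigr => n _.
    by rewrite scalerDr !scalerA mulrC.
  rewrite opprD addrACA -scalerBr; apply: (le_trans (nmD _ _)); rewrite nmZ mulrDl.
  by apply: lerD; [rewrite -mulrA; apply: ler_wpM2l; [exact: nm_ge0|exact: ht]|exact: ht].
have tb z : nm (t z) <= 2 * nm z.
  by have := ht z 0%N; rewrite /part big_ord0 subr0 expr0 mulr1.
(* Truncations approximate t uniformly on the unit ball, and each has its values in a finite sum of
   scaled balls of the [cl n]. *)
have tk : tbdd (t @` [set x : V | nm x <= 1]).
  apply: tbdd_approx => e e0.
  have e3 : 0 < e / 3 by lra.
  have [N hN] := half_pow e3.
  exists [set part z N | z in [set x : V | nm x <= 1]]; split; last first.
    move=> _ [z /= z1 <-]; exists (part z N); first by exists z.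
    by have := ht z N; have : 0 < (2^-1 : R) ^+ N := halfX_gt0 N; have := nm_ge0 z; nra.
  elim: {hN} N => [|N IH].
    by apply: tbdd_sub (tbdd_seq [:: 0]) => _ [z _ <-]; rewrite /part big_ord0 /= inE.
  have h1 : tbdd [set rc ((2^-1) ^+ N) *: z | z in [set z | cl N z /\ nm z <= 1]].
    apply: (@tbdd_lin R Z Z _ _ ((2^-1) ^+ N)) (bcl N 1).
      by move=> a x y; rewrite scalerDr !scalerA mulrC.
    by move=> x; rewrite nmZ nm_rc ger0_norm //; exact/ltW/halfX_gt0.
  apply: tbdd_sub (tbdd_add IH h1) => _ [z /= z1 <-].
  exists (part z N), (rc ((2^-1) ^+ N) *: sval z N); split.
  - by exists z.
  - exists (sval z N) => //; split; first exact: (@bspS _ _ _ _ cZ hS z N).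
    by apply: le_trans z1; exact: (@nm_bsp_ge _ _ _ _ cZ hS).
  - by rewrite -partS addrC subrK.
have ballE : [set x : V | `|x| <= 1] = [set x : V | nm x <= 1].
  by apply/funext => x; apply/propext; rewrite /= nmE -rc1 rc_le.
have [|T [[Tl Tc _] qT]] := lq V t.
  split; [exact: tl|exact: lin_cont tl tb|].
  by rewrite ballE; exact: tbdd_compact.
have [C C0 hC] := lin_bound Tl Tc.
exists C; split; first exact: ltW.
move=> n m z zE.
pose single (x : Z) k := if k == n then x else 0.
have skey x : E n x -> S (single x) /\ exists c : R, forall k, nm (single x k) <= c.
  move=> Ex; split.
    by move=> k; rewrite /single; case: eqP => [->|_]; [exact: clE|exact: (proj1 (scl k))].
  by exists (nm x) => k; rewrite /single; case: eqP => // _; rewrite nm0 nm_ge0.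
pose u k : V := exist _ (single (z k)) (skey _ (zE k)).
have usum (c : 'I_m -> K) k : sval (\sum_(l < m) c l *: u l : V) k = single (\sum_(l < m) c l *: z l) k.
  rewrite (@bsp_sum _ _ _ cZ hS); rewrite /single; case: eqP => kn.
    by apply: eq_bigr => l _; rewrite /= /single kn eqxx.
  by rewrite big1 // => l _; rewrite /= /single; case: eqP => // _; rewrite scaler0.
have tu k : t (u k) = rc ((2^-1) ^+ n) *: z k.
  have pE N : part (u k) N = if (n < N)%N then rc ((2^-1) ^+ n) *: z k else 0.
    rewrite /part; case: ltnP => nN.
      rewrite (bigD1 (Ordinal nN)) //= /single eqxx big1 ?addr0 // => l ln.
      case: eqP => // h; last by rewrite scaler0.
      by case/eqP: ln; apply: val_inj.
    rewrite big1 // => l _; rewrite /= /single; case: eqP => [h|_]; last by rewrite scaler0.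
    by have := ltn_ord l; rewrite h ltnNge nN.
  apply/esym; apply: (@tuniq _ _ (nm (z k))); first exact: nm_ge0.
  move=> N; rewrite pE; case: ltnP => nN.
    by rewrite subrr nm0 mulr_ge0 ?nm_ge0 //; exact/ltW/halfX_gt0.
  rewrite subr0 nmZ nm_rc ger0_norm; last exact/ltW/halfX_gt0.
  by rewrite mulrC; apply: ler_wpM2l; [exact: nm_ge0|exact: half_anti].
have p2 : rc (2 ^+ n) * rc ((2^-1) ^+ n) = 1 :> K.
  by rewrite -rcM -exprMn mulfV ?expr1n.
exists (fun k => rc (2 ^+ n) *: T (u k)); split.
  move=> k; rewrite (linZ ql) -[q (T _)]/((q \o T) (u k)) qT tu scalerA p2 scale1r //.
move=> c.
have -> : \sum_(k < m) c k *: (rc (2 ^+ n) *: T (u k)) = rc (2 ^+ n) *: T (\sum_(k < m) c k *: u k).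
  rewrite (lin_sum Tl) scaler_sumr; apply: eq_bigr => k _.
  by rewrite (linZ Tl) !scalerA mulrC.
rewrite nmZ nm_rc ger0_norm ?exprn_ge0 // -mulrA; apply: ler_wpM2l; first exact: exprn_ge0.
apply: (le_trans (hC _)); apply: ler_wpM2l; first exact: ltW.
apply: (@nm_bsp_le _ _ _ _ cZ hS) => [|k]; first exact: nm_ge0.
by rewrite usum /single; case: eqP => // _; rewrite nm0 nm_ge0.
Qed.
End Lifting.

(** Lifting the q(w_k) to vectors x_k of X gives w_k - x_k = i(v_k). On E_n the combination of the
    x_k vanishes, being controlled by q(i(y)) = 0, so the v_k factor the identity there. Their
    constant 2 + 2^n * 2 C is below 4^n for some n, a contradiction. *)
Lemma compact_lifts_locfact (Y : completeNormedModType K) :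
  (forall (X Z : completeNormedModType K) (i : Y -> X) (q : X -> Z),
    short_exact i q -> lifts q A_compact) -> exists lam, locfact Y lam.
Proof.
move=> h; apply: contrapT => /no_locfact[E hE].
have [X [Z [i [q [ex inm q1 iext]]]]] := linf_ses Y.
pose e n := projT2 (E n).
have /choice[D hD] : forall n, exists D : {N : nat & (('I_N -> Dual Y) * ('I_N -> X))%type},
  [/\ (forall k, nm ((projT2 D).1 k) <= 1),
      (forall (c : 'I_(projT1 D) -> K) (M : R), 0 <= M -> (forall k, nm (c k) <= M) ->
        nm (\sum_(k < projT1 D) c k *: (projT2 D).2 k) <= 2 * M) &
      forall y, span_of (e n) y -> i y = \sum_(k < projT1 D) sval ((projT2 D).1 k) y *: (projT2 D).2 k].
  move=> n; have [N [psi [p1 hpsi]]] := norming_net (e n).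
  have [w [wb we]] := iext N psi _ (submod_span (e n)) hpsi.
  by exists (existT _ N (psi, w)).
pose w n := (projT2 (D n)).2; pose psi n := (projT2 (D n)).1.
have ql := ex_ql ex.
have [C [C0 hC]] := @glue_compact Z (fun n => span_of (fun k => q (w n k)))
  (fun n => submod_span _) (fun n c => tbdd_fd_ball _ c) X q ql (h _ _ _ _ ex).
have [n hn] := lt_2pow4 (C * 2).
apply: (hE n); have [p1 wb we] := hD n.
have sw k : span_of (fun k => q (w n k)) (q (w n k)).
  exists (fun l => (l == k)%:R); rewrite (bigD1 k) //= eqxx scale1r big1 ?addr0 // => l /negbTE ->.
  by rewrite scale0r.
have [x [qx xb]] := hC n _ (fun k => q (w n k)) sw.
have /choice[v hv] : forall k, exists v, i v = w n k - x k.
  by move=> k; apply: (ex_ker ex); rewrite (linB ql) qx subrr.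
have iv c : i (\sum_k c k *: v k) = \sum_k c k *: w n k - \sum_k c k *: x k.
  rewrite (lin_sum (ex_il ex)) -sumrB; apply: eq_bigr => k _.
  by rewrite (linZ (ex_il ex)) hv scalerBr.
have qw c : nm (\sum_k c k *: x k) <= 2 ^+ n * C * nm (q (\sum_k c k *: w n k)).
  apply: (le_trans (xb c)); rewrite (lin_sum ql).
  by under [in leRHS]eq_bigr do rewrite (linZ ql).
exists _, v, (psi n); split=> //.
- move=> c M M0 hc; rewrite -inm iv; apply: (le_trans (nmB _ _)).
  have h1 := wb c M M0 hc; have h2 := qw c; have h3 := q1 (\sum_k c k *: w n k).
  have h4 : 2 ^+ n * C * nm (q (\sum_k c k *: w n k)) <= 2 ^+ n * C * (2 * M).
    by apply: ler_wpM2l; [rewrite mulr_ge0 ?exprn_ge0|exact: le_trans h3 h1].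
  have h5 : (2 + 2 ^+ n * (C * 2)) * M <= 4 ^+ n * M by apply: ler_wpM2r.
  rewrite -/(w n) in h1 *; lra.
- move=> j.
  have se : span_of (e n) (e n j).
    exists (fun l => (l == j)%:R); rewrite (bigD1 j) //= eqxx scale1r big1 ?addr0 // => l /negbTE ->.
    by rewrite scale0r.
  apply: (ex_inj ex); rewrite iv -(we _ se) -[LHS]subr0; congr (_ - _).
  apply/esym/nm_le0; apply: (le_trans (qw _)); rewrite -(we _ se) (ex_qi ex) nm0 mulr0 //.
Qed.
End Converse.

(** * Local factorization from exactness of the injective tensor product *)

Section TensorConverse.
Context {R : realType}.
Local Notation K := (Cplx R).

Lemma sub_ses (X : completeNormedModType K) (N : set X) : submod N ->
  (forall x, (forall e : R, 0 < e -> exists2 y, N y & nm (x - y) <= e) -> N x) ->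
  exists (A C : completeNormedModType K) (a : A -> X) (q : X -> C),
    short_exact a q /\ forall x, q x = 0 <-> N x.
Proof.
move=> sN cN; have [C [q [ql q1 qs qk]]] := quotient_exists sN cN.
pose S := [set f : unit -> X | N (f tt)].
have hS : bs_ok S.
  split; first exact: (proj1 sN).
    by move=> a f g; exact: (proj2 sN).
  by move=> f h; apply: cN => e e0; have [g Sg hg] := h e e0; exists (g tt).
pose cX := seqcompleteP (W := X).
pose a (f : bsp cX hS) := sval f tt.
have al : lin a by [].
exists (bsp cX hS), C, a, q; split=> //; split=> //.
- split=> //; apply: (lin_cont al (c := 1)) => f; rewrite mul1r.
  exact: (@nm_bsp_ge _ _ _ _ cX hS).
- by split=> //; apply: (lin_cont ql (c := 1)) => y; rewrite mul1r.
- by move=> f g h; apply: bsp_ext => -[].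
- move=> x; rewrite qk; split=> [Nx|[f <-]]; last exact: (@bspS _ _ _ _ cX hS f).
  have key : S (fun=> x) /\ exists c : R, forall u : unit, nm x <= c by split=> //; exists (nm x).
  by exists (exist _ (fun=> x) key : bsp cX hS).
Qed.

Lemma factor_functional (A B C : completeNormedModType K) (a : A -> B) (b : B -> C) (chi : Dual B) :
  short_exact a b -> (forall x, sval chi (a x) = 0) ->
  exists th : Dual C, forall x, sval th (b x) = sval chi x.
Proof.
move=> ex h0; have [D D0 hD] := ex_lift ex.
have /choice[s hs] : forall z, exists x, b x = z /\ nm x <= D * nm z.
  by move=> z; have [x h1 h2] := hD z; exists x.
have same x y : b x = b y -> sval chi x = sval chi y.
  move=> h; have : b (x - y) = 0 by rewrite (linB (ex_ql ex)) h subrr.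
  move=> /(ex_ker ex)[u hu]; apply/eqP; rewrite -subr_eq0 -(lfunB (dual_lfun chi)) -hu.
  by rewrite h0.
have fl : lfun (fun z => sval chi (s z)).
  move=> c z z'; rewrite -(dual_lfun chi); apply: same.
  by rewrite (ex_ql ex) !(proj1 (hs _)).
have fb z : nm (sval chi (s z)) <= (nm chi * D) * nm z.
  apply: (le_trans (nm_dual_ge _ _)); rewrite -mulrA; apply: ler_wpM2l; first exact: nm_ge0.
  exact: (proj2 (hs z)).
exists (mkdual fl fb) => x; apply: same.
exact: (proj1 (hs _)).
Qed.

Lemma inj_tensor_l (Y W : completeNormedModType K) (u : Dual Y -> Dual W -> K) th :
  inj_tensor u -> lfun (u^~ th).
Proof. by move=> [h _ _] a phi psi; apply: h; apply/dual_combE. Qed.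
Lemma inj_tensor_r (Y W : completeNormedModType K) (u : Dual Y -> Dual W -> K) phi :
  inj_tensor u -> lfun (u phi).
Proof. by move=> [_ h _] a th psi; apply: h; apply/dual_combE. Qed.
Lemma inj_tensor_approx (Y W : completeNormedModType K) (u : Dual Y -> Dual W -> K) (r : R) :
  inj_tensor u -> 0 < r -> exists n (ys : 'I_n -> Y) (ws : 'I_n -> W), forall phi th,
    nm phi <= 1 -> nm th <= 1 -> nm (u phi th - \sum_(k < n) sval phi (ys k) * sval th (ws k)) <= r.
Proof.
move=> [_ _ h] r0; have [n [ys [ws hn]]] := h (rc r) ltac:(by rewrite -rc0 rc_lt).
exists n, ys, ws => phi th p1 t1.
have := hn phi th; rewrite -rc1 => /(_ (nm_dual_le' p1) (nm_dual_le' t1)).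
by rewrite nmE rc_le.
Qed.

Lemma lfun_unit_bound (V : normedModType K) (g : V -> K) (c : R) : lfun g ->
  (forall x, nm x <= 1 -> nm (g x) <= c) -> forall x, nm (g x) <= c * nm x.
Proof.
move=> gl h x; have [->|x0] := eqVneq x 0; first by rewrite (lfun0 gl) !nm0 mulr0.
have nx := nm_gt0 x0; have := h (rc (nm x)^-1 *: x).
rewrite (lfunZ gl) nmZ nmM !nm_rc !ger0_norm ?invr_ge0 ?nm_ge0 //.
rewrite mulVf ?lt0r_neq0 // ler_pdivrMl // mulrC; exact.
Qed.

Lemma bilin_bound (V W : normedModType K) (u : V -> W -> K) (C : R) :
  (forall th, lfun (u^~ th)) -> (forall phi, lfun (u phi)) ->
  (forall phi th, nm phi <= 1 -> nm th <= 1 -> nm (u phi th) <= C) ->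
  forall phi th, nm (u phi th) <= C * nm phi * nm th.
Proof.
move=> ul ur h phi; apply: lfun_unit_bound => // th t1.
by apply: (lfun_unit_bound (ul th)) => {}phi p1; exact: h.
Qed.

(** For fixed th, u is a uniform limit on the dual ball of evaluations at elements of Y. As the dual
    ball norms Y, these elements form a Cauchy sequence. *)
Lemma inj_tensor_repr (Y W : completeNormedModType K) (u : Dual Y -> Dual W -> K) th :
  inj_tensor u -> nm th <= 1 -> exists y, forall phi : Dual Y, sval phi y = u phi th.
Proof.
move=> hu t1.
have /choice[y hy] : forall j, exists y, forall phi, nm phi <= 1 -> nm (u phi th - sval phi y) <= (2^-1) ^+ j.
  move=> j; have [n [ys [ws h]]] := inj_tensor_approx hu (halfX_gt0 j).
  exists (\sum_(k < n) sval th (ws k) *: ys k) => phi p1.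
  apply: le_trans (h phi th p1 t1); rewrite (lfun_sum (dual_lfun phi)).
  by under eq_bigr do rewrite (lfunZ (dual_lfun phi)) mulrC.
have [l hl] : exists l, forall n, nm (l - y n) <= 2 * 2 * (2^-1) ^+ n.
  apply: geo_cvg (seqcompleteP (W := Y)) _ => n; apply: nm_by_dual => phi p1.
  rewrite (lfunB (dual_lfun phi)); apply: (le_trans (nm_tri _ (u phi th) _)).
  have h1 := hy n phi p1; have h2 := hy n.+1 phi p1; rewrite nmBC in h2.
  have : 0 < (2^-1 : R) ^+ n := halfX_gt0 n; rewrite exprS in h2; lra.
exists l => phi; apply/eqP; rewrite -subr_eq0; apply/eqP; apply: (@nm_small R K) => e e0.
have D0 : 0 < 5 * (nm phi + 1) by have := nm_ge0 phi; lra.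
have [n hn] := half_pow (divr_gt0 e0 D0); rewrite ltr_pdivlMr // in hn.
have gl : lfun (fun phi : Dual Y => sval phi l - u phi th).
  by move=> a f g; rewrite (inj_tensor_l th hu) dualD dualZ; ring.
have := lfun_unit_bound gl (c := 5 * (2^-1) ^+ n) _ phi.
have : 0 < (2^-1 : R) ^+ n := halfX_gt0 n; have := nm_ge0 phi => np h0 h1.
apply: (le_trans (h1 _)); last by nra.
move=> psi p1; apply: (le_trans (nm_tri _ (sval psi (y n)) _)).
rewrite -(lfunB (dual_lfun psi)); have := hy n psi p1; rewrite nmBC => h2.
have h3 := nm_dual_ge psi (l - y n); have h4 := hl n.
have h5 : nm psi * nm (l - y n) <= 1 * nm (l - y n) by apply: ler_wpM2r => //; exact: nm_ge0.
lra.
Qed.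

(** The n-th block of C is the quotient of l_1 by the annihilator of E_n, a copy of the dual of E_n.
    The tensor w sends phi to the sequence of 2^-n times its restrictions to E_n, and is a limit of
    finite-rank truncations. The n-th block of a lift of w consists of finitely many vectors of Y;
    multiplied by 2^n they factor the identity of E_n with constant 2^n times the norm of the lift,
    which contradicts 4^n. *)
Lemma tensor_locfact (Y : completeNormedModType K) : tensor_functor_exact Y ->
  exists lam, locfact Y lam.
Proof.
move=> tex; apply: contrapT => /no_locfact[E hE].
pose e n := projT2 (E n).
have /choice[D hD] : forall n, exists D : {N : nat & 'I_N -> Dual Y},
  (forall k, nm (projT2 D k) <= 1) /\
    forall y, span_of (e n) y -> nm y <= 2 * \big[Num.max/0]_(k < projT1 D) nm (sval (projT2 D k) y).
  by move=> n; have [N [psi [p1 hpsi]]] := norming_net (e n); exists (existT _ N psi).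
pose N n := projT1 (D n); pose psi n : 'I_(N n) -> Dual Y := projT2 (D n).
(* B is the l_infty-sum of the spaces l_1^(N n), presented as functions on the
   unit balls of l_infty^(N n) *)
pose G := {g : {n : nat & 'I_(N n) -> K} | forall k, nm (projT2 g k) <= 1}.
have dkey n (k : 'I_(N n)) : forall l, nm (projT2 (existT (fun n => 'I_(N n) -> K) n (fun l => (l == k)%:R)) l) <= 1.
  by move=> l /=; case: eqP => _; rewrite ?nm1 ?nm0.
pose dl n k : G := exist _ (existT _ n (fun l => (l == k)%:R)) (dkey n k).
(* Such a function is linear on each ball, and its values at the unit vectors [dl] are its l_1
   coordinates; the sup norm over a ball of l_infty is their l_1 norm. *)
pose S : set (G -> K^o) := [set f | forall g : G,
  f g = \sum_k (f (dl (projT1 (sval g)) k) : K) * projT2 (sval g) k].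
have hS : bs_ok S.
  split.
  - by move=> g; rewrite big1 // => k _; rewrite mul0r.
  - move=> a f f' hf hf' g; rewrite hf hf' scaler_sumr -big_split /=; apply: eq_bigr => k _.
    by rewrite -[a *: _]/(a * _) -[a *: f _]/(a * f _) mulrDl mulrA.
  - move=> f h g; apply/eqP; rewrite -subr_eq0; apply/eqP; apply: (@nm_small R K) => r r0.
    have n0 : 0 < (N (projT1 (sval g)))%:R + 1 :> R by have : 0 <= (N (projT1 (sval g)))%:R :> R by []; lra.
    have [f' Sf' hf'] := h _ (divr_gt0 r0 n0).
    have -> : (f g : K) - \sum_k (f (dl (projT1 (sval g)) k) : K) * projT2 (sval g) k =
       (f g - f' g) - \sum_k (((f (dl (projT1 (sval g)) k) : K) - (f' (dl (projT1 (sval g)) k) : K)) * projT2 (sval g) k).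
      by under [in RHS]eq_bigr do rewrite mulrBl; rewrite sumrB -Sf'; ring.
    apply: (le_trans (nmB _ _)).
    apply: le_trans (_ : r / ((N (projT1 (sval g)))%:R + 1) + \sum_(k < N (projT1 (sval g))) r / ((N (projT1 (sval g)))%:R + 1) <= _).
      apply: lerD; first exact: hf'.
      apply: (le_trans (nm_sum _ _ _)); apply: ler_sum => k _; rewrite nmM -[leRHS]mulr1.
      by apply: ler_pM; rewrite ?nm_ge0 //; exact: (svalP g).
    rewrite sumr_const card_ord; move: n0; set M := (N (projT1 (sval g)))%:R + 1 => n0.
    have : r / M + r / M *+ N (projT1 (sval g)) = r; last by move=> ->.
    by rewrite -mulr_natr; transitivity (r / M * M); [rewrite /M; ring|rewrite divfK // lt0r_neq0].
pose cK := @seqcomplete_K R.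
pose B := bsp cK hS.
pose co (f : B) n (k : 'I_(N n)) : K := sval f (dl n k).
have coD a (f g : B) n k : co (a *: f + g) n k = a * co f n k + co g n k by [].
have coS (f : B) g : sval f g = \sum_k co f (projT1 (sval g)) k * projT2 (sval g) k :> K.
  exact: (@bspS _ _ _ _ cK hS f g).
have mk (be : forall n, 'I_(N n) -> K) (c : R) : 0 <= c -> (forall n, \sum_k nm (be n k) <= c) ->
    exists f : B, nm f <= c /\ forall n k, co f n k = be n k.
  move=> c0 hbe; pose f (g : G) : K^o := \sum_k be (projT1 (sval g)) k * projT2 (sval g) k.
  have fb g : nm (f g : K^o) <= c.
    apply: (le_trans (nm_sum _ _ _)); apply: le_trans (hbe (projT1 (sval g))).
    apply: ler_sum => k _; rewrite nmM -[leRHS]mulr1.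
    by apply: ler_wpM2l; [exact: nm_ge0|exact: (svalP g)].
  have fd n k : f (dl n k) = be n k.
    rewrite /f /= (bigD1 k) //= eqxx mulr1 big1 ?addr0 // => l lk.
    by rewrite (negbTE lk) mulr0.
  have key : S f /\ exists c : R, forall g, nm (f g : K^o) <= c.
    by split; [move=> g; rewrite {1}/f; apply: eq_bigr => k _; rewrite fd|exists c].
  exists (exist _ f key); split; last by move=> n k; exact: fd.
  exact: (@nm_bsp_le _ _ _ _ cK hS).
(* Modulo [Nn], the n-th block of f is remembered only through the functional \sum_k f_k psi_k on
   E_n. *)
pose Nn : set B := [set f | forall n y, span_of (e n) y -> \sum_k co f n k * sval (psi n k) y = 0].
have sN : submod Nn.
  split; first by move=> n y _; rewrite big1 // => k _; rewrite mul0r.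
  move=> a f g hf hg n y sy.
  rewrite (eq_bigr (fun k => a * (co f n k * sval (psi n k) y) + co g n k * sval (psi n k) y)).
    by rewrite big_split /= -mulr_sumr hf // hg // mulr0 addr0.
  by move=> k _; rewrite coD; ring.
have cob (f : B) n k : nm (co f n k) <= nm f by exact: (@nm_bsp_ge _ _ _ _ cK hS).
have cN f : (forall r : R, 0 < r -> exists2 g, Nn g & nm (f - g) <= r) -> Nn f.
  move=> h n y sy; apply: (@nm_small R K) => r r0.
  pose t := \sum_k nm (sval (psi n k) y) + 1.
  have t0 : 0 < t by rewrite ltr_wpDl //; apply: sumr_ge0 => *; exact: nm_ge0.
  have [g Ng hg] := h _ (divr_gt0 r0 t0).
  have -> : \sum_k co f n k * sval (psi n k) y = \sum_k co (f - g) n k * sval (psi n k) y.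
    rewrite [RHS](eq_bigr (fun k => co f n k * sval (psi n k) y - co g n k * sval (psi n k) y)).
      by rewrite sumrB Ng // subr0.
    by move=> k _; rewrite -mulrBl /co (@bspB _ _ _ _ cK hS).
  apply: (le_trans (nm_sum _ _ _)); apply: le_trans (_ : \sum_k r / t * nm (sval (psi n k) y) <= _).
    apply: ler_sum => k _; rewrite nmM; apply: ler_wpM2r; first exact: nm_ge0.
    exact: le_trans (cob _ _ _) hg.
  rewrite -mulr_sumr mulrAC ler_pdivrMr //; apply: ler_wpM2l; first exact: ltW.
  by rewrite lerDl.
have [A [C [a [q [ex qk]]]]] := sub_ses sN cN.
have ql := ex_ql ex.
have qeq (f g : B) : (forall n y, span_of (e n) y ->
    \sum_k co f n k * sval (psi n k) y = \sum_k co g n k * sval (psi n k) y) -> q f = q g.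
  move=> h; apply/eqP; rewrite -subr_eq0 -(linB ql); apply/eqP/qk => n y sy.
  rewrite (eq_bigr (fun k => co f n k * sval (psi n k) y - co g n k * sval (psi n k) y)).
    by rewrite sumrB h // subrr.
  by move=> k _; rewrite -mulrBl /co (@bspB _ _ _ _ cK hS).
have gex (phi : Dual Y) n : exists g : 'I_(N n) -> K,
    (forall y, span_of (e n) y -> sval phi y = \sum_k g k * sval (psi n k) y) /\
    \sum_k nm (g k) <= 2 * nm phi.
  apply: (coord_ext (submod_span (e n))).
  - by move=> k; exact: dual_lfun.
  - exact: dual_lfun.
  - by apply: mulr_ge0 => //; exact: nm_ge0.
  - move=> y sy; apply: (le_trans (nm_dual_ge _ _)); rewrite [2 * _]mulrC -mulrA.
    by apply: ler_wpM2l; [exact: nm_ge0|exact: (proj2 (hD n))].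
pose g phi n := sval (cid (gex phi n)).
have gy phi n y : span_of (e n) y -> \sum_k g phi n k * sval (psi n k) y = sval phi y.
  by move=> sy; have [h _] := svalP (cid (gex phi n)); rewrite (h y sy).
have g2 phi n : \sum_k nm (g phi n k) <= 2 * nm phi by have [] := svalP (cid (gex phi n)).
(* P selects the blocks that are kept: all of them, those below N0, a single one, or the tail. The
   last case needs the explicit bound c. *)
have bex (phi : Dual Y) (P : nat -> bool) (c : R) : 0 <= c -> (forall n, P n -> (2^-1) ^+ n <= c) ->
    exists f : B, nm f <= c * (2 * nm phi) /\
      forall n k, co f n k = if P n then rc ((2^-1) ^+ n) * g phi n k else 0.
  move=> c0 hc; have p0 : 0 <= 2 * nm phi by rewrite mulr_ge0 // nm_ge0.
  apply: mk; first exact: mulr_ge0.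
  move=> n; case: (boolP (P n)) => [Pn|_]; last first.
    by rewrite big1 => [|k _]; [exact: mulr_ge0|rewrite nm0].
  apply: le_trans (_ : (2^-1) ^+ n * \sum_k nm (g phi n k) <= _).
    rewrite mulr_sumr; apply: ler_sum => k _; by rewrite nmM nm_rc ger0_norm.
  by apply: ler_pM => //; [apply: sumr_ge0 => *; exact: nm_ge0|exact: hc].
have p1 (P : nat -> bool) n : P n -> (2^-1) ^+ n <= 1 :> R.
  by move=> _; have := half_anti (leq0n n) (R := R); rewrite expr0.
have /choice[bb0 hbb] : forall z : Dual Y * (nat -> bool), exists f : B, nm f <= 2 * nm z.1 /\
    forall n k, co f n k = if z.2 n then rc ((2^-1) ^+ n) * g z.1 n k else 0.
  move=> [phi P] /=; have [f [h1 h2]] := bex phi P 1 ler01 (p1 P).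
  by exists f; split=> //; rewrite mul1r in h1.
pose bb phi P := bb0 (phi, P).
have bbn phi P : nm (bb phi P) <= 2 * nm phi := proj1 (hbb (phi, P)).
have bbc phi P n k : co (bb phi P) n k = if P n then rc ((2^-1) ^+ n) * g phi n k else 0.
  exact: (proj2 (hbb (phi, P))).
pose pr n y (f : B) := \sum_k co f n k * sval (psi n k) y.
have prl n y : lfun (pr n y).
  move=> t f f'; rewrite /pr mulr_sumr -big_split; apply: eq_bigr => k _.
  transitivity ((t * co f n k + co f' n k) * sval (psi n k) y) => //=; ring.
have bby phi P n y : span_of (e n) y ->
    pr n y (bb phi P) = if P n then rc ((2^-1) ^+ n) * sval phi y else 0.
  move=> sy; rewrite /pr; under eq_bigr do rewrite bbc.
  case: (P n); last by rewrite big1 // => k _; rewrite mul0r.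
  by under eq_bigr do rewrite -mulrA; rewrite -mulr_sumr gy.
(* The coefficients [g] are chosen arbitrarily, so [bb] is not linear in phi; its class modulo [Nn]
   depends only on the values of phi on the E_n and is linear. *)
have qbl t phi phi' P : q (bb (t *: phi + phi') P) = t *: q (bb phi P) + q (bb phi' P).
  rewrite -ql; apply: qeq => n y sy; rewrite -!/(pr n y _) prl !bby //.
  by case: (P n); rewrite ?mulr0 ?addr0 // dualD dualZ; ring.
(* Truncations have finite rank: on E_N0, phi is determined by its values at a basis, and the blocks
   of the coordinate functionals are the matching elements of C. *)
have fin N0 : exists s : seq (Y * C), forall phi : Dual Y,
    q (bb phi (fun n => n < N0)%N) = \sum_(z <- s) sval phi z.1 *: z.2.
  elim: N0 => [|N0 [s hs]].
    exists [::] => phi; rewrite big_nil -(lin0 ql); apply: qeq => n y sy.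
    by rewrite -!/(pr n y _) bby // (lfun0 (prl n y)).
  have [m [v [p [vs pb pv pe]]]] := fd_coord (e N0).
  have /choice[P hP] : forall k, exists P : Dual Y, sval P = p k.
    by move=> k; have [pl [c c0 hc]] := pb k; exists (mkdual pl hc).
  have yE y : span_of (e N0) y -> y = \sum_(k < m) sval (P k) y *: v k.
    move=> [c ->]; under [RHS]eq_bigr do rewrite (lfun_sum (dual_lfun _)) scaler_suml.
    rewrite exchange_big /=; apply: eq_bigr => j _; rewrite {1}pe scaler_sumr.
    by apply: eq_bigr => k _; rewrite (lfunZ (dual_lfun _)) scalerA hP.
  exists (s ++ [seq (v k, q (bb (P k) (pred1 N0))) | k <- index_enum 'I_m]) => phi.
  rewrite big_cat /= -hs big_map /=.
  have hsum (F : 'I_m -> B) : \sum_k sval phi (v k) *: q (F k) = q (\sum_k sval phi (v k) *: F k).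
    by rewrite (lin_sum ql); apply: eq_bigr => k _; rewrite (linZ ql).
  rewrite hsum -(linD ql); apply: qeq => n y sy.
  rewrite -!/(pr n y _) (lfunD (prl n y)) (lfun_sum (prl n y)) !bby //.
  under eq_bigr do rewrite (lfunZ (prl n y)) bby //.
  have [nN|nN|nN] := ltngtP n N0.
  - rewrite ltnS (ltnW nN) big1 ?addr0 // => k _; rewrite /= (ltn_eqF nN) mulr0 //.
  - rewrite ltnS leqNgt nN /= add0r big1 // => k _; rewrite /= (gtn_eqF nN) mulr0 //.
  - subst n; rewrite ltnSn add0r /= eqxx.
    rewrite {1}(yE y sy) (lfun_sum (dual_lfun _)) mulr_sumr; apply: eq_bigr => k _.
    by rewrite (lfunZ (dual_lfun _)); ring.
pose w (phi : Dual Y) (th : Dual C) := sval th (q (bb phi xpredT)).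
have [cq cq0 hcq] := ex_q_bound ex.
have wt : inj_tensor w.
  split.
  - by move=> t chi phi phi' th /dual_combE ->; rewrite /w qbl (dual_lfun th).
  - by move=> t phi chi th th' /dual_combE ->; rewrite /w dualD dualZ.
  move=> eps eps0; have [r r0 ->] := rcK eps0.
  have d0 : 0 < cq * 2 + 1 by rewrite ltr_wpDl // mulr_ge0 // ltW.
  have [N0 hN0] := half_pow (divr_gt0 r0 d0); rewrite ltr_pdivlMr // in hN0.
  have [s hs] := fin N0.
  exists (size s), (fun k => (nth (0, 0) s k).1), (fun k => (nth (0, 0) s k).2) => phi th.
  move=> /dual_le_nm; rewrite nm1 => ph1 /dual_le_nm; rewrite nm1 => th1.
  have -> : \sum_(k < size s) sval phi (nth (0, 0) s k).1 * sval th (nth (0, 0) s k).2 =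
      sval th (q (bb phi (fun n => n < N0)%N)).
    rewrite hs (lfun_sum (dual_lfun th)) (big_nth (0, 0)) big_mkord.
    by apply: eq_bigr => k _; rewrite (lfunZ (dual_lfun th)).
  rewrite nmE rc_le /w -(lfunB (dual_lfun th)) -(linB ql).
  have [||f [fn fc]] := bex phi (fun n => N0 <= n)%N ((2^-1) ^+ N0).
  - exact: (ltW (halfX_gt0 N0)).
  - by move=> n; exact: half_anti.
  have -> : bb phi xpredT - bb phi (fun n => n < N0)%N = f.
    apply: bsp_ext => z; rewrite (@bspB _ _ _ _ cK hS) !coS -sumrB; apply: eq_bigr => k _.
    rewrite -mulrBl !bbc fc /= ltnNge; case: (N0 <= _)%N; by rewrite /= ?subr0 ?subrr.
  have h1 := nm_dual_ge th (q f); have h2 := hcq f.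
  have h3 : nm th * nm (q f) <= 1 * nm (q f) by apply: ler_wpM2r => //; exact: nm_ge0.
  have h4 : cq * nm f <= cq * ((2^-1) ^+ N0 * 2).
    apply: ler_wpM2l; first exact: ltW.
    apply: (le_trans fn); apply: ler_wpM2l; first exact: (ltW (halfX_gt0 N0)).
    by lra.
  have : 0 < (2^-1 : R) ^+ N0 := halfX_gt0 N0; lra.
have [_ _ /(_ w wt)[v [vt vw]]] := tex A B C a q ex.
have [n1 [ys [ws hv1]]] := inj_tensor_approx vt ltr01.
pose Cv := 1 + \sum_(k < n1) nm (ys k) * nm (ws k).
have Cvb phi th : nm phi <= 1 -> nm th <= 1 -> nm (v phi th) <= Cv.
  move=> ph1 th1; have := hv1 phi th ph1 th1 => h.
  have h2 := nm_Bge (v phi th) (\sum_(k < n1) sval phi (ys k) * sval th (ws k)).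
  have : nm (\sum_(k < n1) sval phi (ys k) * sval th (ws k)) <= \sum_(k < n1) nm (ys k) * nm (ws k).
    apply: (le_trans (nm_sum _ _ _)); apply: ler_sum => k _; rewrite nmM; apply: ler_pM; rewrite ?nm_ge0 //.
      by apply: (le_trans (nm_dual_ge _ _)); rewrite -[leRHS]mul1r; apply: ler_wpM2r => //; exact: nm_ge0.
    by apply: (le_trans (nm_dual_ge _ _)); rewrite -[leRHS]mul1r; apply: ler_wpM2r => //; exact: nm_ge0.
  by rewrite /Cv; lra.
have Cv0 : 0 <= Cv by rewrite addr_ge0 //; apply: sumr_ge0 => *; rewrite mulr_ge0 ?nm_ge0.
have vb := bilin_bound (fun th => inj_tensor_l th vt) (fun phi => inj_tensor_r phi vt) Cvb.
have chl n k : lfun (fun f : B => co f n k) by move=> t f f'; exact: coD.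
have chb n k (f : B) : nm (co f n k) <= 1 * nm f by rewrite mul1r.
pose chi n k : Dual B := mkdual (chl n k) (chb n k).
have chi1 n k : nm (chi n k) <= 1 by apply: nm_dualP => // f; exact: chb.
have chisum n (c : 'I_(N n) -> K) (f : B) : sval (\sum_k c k *: chi n k) f = \sum_k c k * co f n k.
  by rewrite (big_morph (fun ch : Dual B => sval ch f) (id1 := 0) (op1 := +%R)).
have /choice[y hy] : forall nk : {n : nat & 'I_(N n)}, exists y, forall phi : Dual Y, sval phi y = v phi (chi (projT1 nk) (projT2 nk)).
  by move=> nk; apply: (inj_tensor_repr vt); exact: chi1.
have [n hn] := lt_2pow4 Cv.
apply: (hE n).
pose V k := rc (2 ^+ n) *: y (existT (fun n => 'I_(N n)) n k).
have Vphi (c : 'I_(N n) -> K) (phi : Dual Y) : sval phi (\sum_k c k *: V k) = rc (2 ^+ n) * v phi (\sum_k c k *: chi n k).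
  rewrite (lfun_sum (dual_lfun phi)) (lfun_sum (inj_tensor_r phi vt)) mulr_sumr.
  apply: eq_bigr => k _; rewrite /V scalerA (lfunZ (dual_lfun phi)) hy (lfunZ (inj_tensor_r phi vt)) /=.
  by ring.
have p2 : 0 <= 2 ^+ n :> R by rewrite exprn_ge0.
exists _, V, (psi n); split.
- exact: (proj1 (hD n)).
- move=> c M M0 hc.
  have hchi : nm (\sum_k c k *: chi n k) <= M.
    apply: nm_dualP => // f; rewrite chisum.
    have [M1|M1] := eqVneq M 0.
      rewrite big1 ?nm0 ?M1 ?mul0r // => k _.
      have := hc k; rewrite M1 => /nm_le0 ->; by rewrite mul0r.
    have M2 : 0 < M by rewrite lt_neqAle eq_sym M1.
    have ckey : forall k, nm (projT2 (existT (fun n => 'I_(N n) -> K) n (fun l => rc M^-1 * c l)) k) <= 1.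
      by move=> k /=; rewrite nmM nm_rc ger0_norm ?invr_ge0 // ler_pdivrMl // mulr1.
    have := @nm_bsp_ge _ _ _ _ cK hS f (exist _ _ ckey).
    rewrite coS /=; under eq_bigr do rewrite mulrCA [co _ _ _ * _]mulrC.
    by rewrite -mulr_sumr nmM nm_rc ger0_norm ?invr_ge0 // ler_pdivrMl.
  apply: nm_by_dual => phi ph1; rewrite Vphi nmM nm_rc ger0_norm //.
  have h1 := vb phi (\sum_k c k *: chi n k).
  have h2 : Cv * nm phi * nm (\sum_k c k *: chi n k) <= Cv * 1 * M.
    by apply: ler_pM; rewrite ?mulr_ge0 ?nm_ge0 //; apply: ler_wpM2l.
  have h3 : 2 ^+ n * nm (v phi (\sum_k c k *: chi n k)) <= 2 ^+ n * (Cv * 1 * M).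
    by apply: ler_wpM2l => //; exact: le_trans h1 h2.
  apply: (le_trans h3); rewrite mulr1 mulrA; apply: ler_wpM2r => //; lra.
- move=> j; apply: eq_by_dual => phi.
  have se : span_of (e n) (e n j).
    exists (fun l => (l == j)%:R); rewrite (bigD1 j) //= eqxx scale1r big1 ?addr0 // => l /negbTE ->.
    by rewrite scale0r.
  rewrite Vphi; set ch := \sum_k _.
  (* This combination of coordinate functionals vanishes on the kernel [Nn], so it comes from C,
     where the lift may be replaced by w. *)
  have ch0 x : sval ch (a x) = 0.
    have : Nn (a x) by apply/qk; exact: (ex_qi ex).
    by move=> /(_ n _ se) h; rewrite /ch chisum -[RHS]h; apply: eq_bigr => k _; rewrite mulrC.
  have [th hth] := factor_functional ex ch0.
  have -> : v phi ch = w phi th by rewrite (vw phi th ch) // => x; rewrite hth.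
  rewrite /w hth /ch chisum; under eq_bigr do rewrite mulrC.
  rewrite -/(pr n (e n j) _) bby //= mulrA -rcM -exprMn mulfV // expr1n rc1 mul1r //.
Qed.
End TensorConverse.

(** * Lifting compact maps and polynomials *)

Section CompactLifting.
Context {R : realType}.
Local Notation K := (Cplx R).

Section Gauge.
Variables (X : lmodType K) (A : set X).

(* r bounds the Minkowski gauge of the absolutely convex hull of A at x *)
Definition gauge (x : X) (r : R) := exists s : seq (K * X),
  [/\ (forall z, z \in s -> A z.2), \sum_(z <- s) nm z.1 <= r & x = \sum_(z <- s) z.1 *: z.2].

Lemma gaugeD x y r s : gauge x r -> gauge y s -> gauge (x + y) (r + s).
Proof.
move=> [u [uA ur ->]] [v [vA vs ->]]; exists (u ++ v); split; last by rewrite big_cat.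
  by move=> z; rewrite mem_cat => /orP[/uA|/vA].
by rewrite big_cat; exact: lerD.
Qed.
Lemma gaugeZ (a : K) x r : gauge x r -> gauge (a *: x) (nm a * r).
Proof.
move=> [u [uA ur ->]]; exists [seq (a * z.1, z.2) | z <- u]; split.
- by move=> _ /mapP[z /uA zA ->].
- rewrite big_map /=; apply: le_trans (ler_wpM2l (nm_ge0 a) ur).
  by rewrite mulr_sumr; apply: ler_sum => z _; rewrite nmM.
- by rewrite big_map scaler_sumr; apply: eq_bigr => z _; rewrite scalerA.
Qed.
Lemma gauge_ge0 x r : gauge x r -> 0 <= r.
Proof. by move=> [u [_ ur _]]; apply: le_trans ur; apply: sumr_ge0 => *; exact: nm_ge0. Qed.
Lemma gauge_mono x r s : gauge x r -> r <= s -> gauge x s.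
Proof. by move=> [u [uA ur xE]] rs; exists u; split=> //; exact: le_trans ur rs. Qed.
Lemma gauge0 : gauge 0 0.
Proof. by exists [::]; rewrite !big_nil. Qed.
Lemma gauge_in x : A x -> gauge x 1.
Proof.
move=> Ax; exists [:: (1, x)]; rewrite !big_seq1 nm1 scale1r; split=> //.
by move=> z; rewrite inE => /eqP ->.
Qed.
Lemma gauge_aconv x : gauge x 1 -> aconv A x.
Proof.
move=> [s [sA s1 ->]]; exists (size s), (fun k => (nth (0, 0) s k).1), (fun k => (nth (0, 0) s k).2).
split.
- by move=> k; apply: sA; apply: mem_nth.
- by move: s1; rewrite (big_nth (0, 0)) big_mkord.
- by rewrite (big_nth (0, 0)) big_mkord.
Qed.
Definition aspan := [set x | exists r, gauge x r].
Lemma submod_aspan : submod aspan.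
Proof.
split; first by exists 0; exact: gauge0.
by move=> a x y [r hr] [s hs]; exists (nm a * r + s); apply: gaugeD => //; exact: gaugeZ.
Qed.
Lemma aspan_in x : A x -> aspan x.
Proof. by move=> /gauge_in; exists 1. Qed.
End Gauge.

(* Successive approximation: the error of a finite-rank extension of T is again
   compact on N, and local factorization extends its finite-rank part with norm
   at most lam times the size of the error. *)
Lemma compact_extension (X : lmodType K) (A : set X) (Y : completeNormedModType K) (lam : R)
    (N : set X) (T : X -> Y) :
  locfact Y lam -> submod N ->
  (forall (a : K) x y, N x -> N y -> T (a *: x + y) = a *: T x + T y) ->
  tbdd [set T x | x in [set x | N x /\ gauge A x 1]] ->
  exists S : X -> Y,
    [/\ (forall (a : K) x y, aspan A x -> aspan A y -> S (a *: x + y) = a *: S x + S y),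
        (forall x, N x -> aspan A x -> S x = T x) &
        tbdd [set S x | x in [set x | gauge A x 1]]].
Proof.
move=> hY sN Tl Tk; have [N0 Nl] := sN.
(* The sign of lam is not part of [locfact]; the estimates need a nonnegative constant. *)
pose lm := Num.max lam 0.
have lm0 : 0 <= lm by rewrite le_max lexx orbT.
have T0 : T 0 = 0.
  by have := Tl 1 0 0 N0 N0; rewrite !scale1r addr0 => /eqP; rewrite -subr_eq0 opprD addNKr oppr_eq0 => /eqP.
have TZ a x : N x -> T (a *: x) = a *: T x.
  by move=> Nx; have := Tl a x 0 Nx N0; rewrite T0 !addr0.
have homog (F : X -> Y) (c : R) : 0 <= c ->
    (forall a x, N x -> F (a *: x) = a *: F x) -> (forall x, N x -> gauge A x 1 -> nm (F x) <= c) ->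
    forall x r, N x -> gauge A x r -> nm (F x) <= c * r.
  move=> c0 FZ Fc x r Nx hr.
  (* The gauge value r may be 0, so x is rescaled by a slightly larger positive number and the
     surplus is absorbed by e. *)
  apply/ler_addgt0Pr => e e0; have r0 := gauge_ge0 hr.
  have d0 : 0 < r + e / (c + 1) by rewrite ltr_wpDl // divr_gt0 //; lra.
  have := Fc (rc (r + e / (c + 1))^-1 *: x) (submodZ _ sN Nx).
  rewrite FZ // nmZ nm_rc gtr0_norm ?invr_gt0 // ler_pdivrMl // => h.
  have h1 : (r + e / (c + 1)) * c <= c * r + e.
    rewrite mulrDl mulrC lerD2l mulrAC ler_pdivrMr; last by lra.
    by rewrite ler_wpM2l //; lra.
  apply: le_trans h1; apply: h; apply: gauge_mono (gaugeZ _ hr) _.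
  rewrite nm_rc gtr0_norm ?invr_gt0 // ler_pdivrMl // mulr1 lerDl.
  by apply: divr_ge0; lra.
have step (c e : R) (F : X -> Y) : 0 < c -> 0 < e -> lin F ->
    tbdd [set F x | x in [set x | gauge A x 1]] ->
    (forall x, N x -> gauge A x 1 -> nm (T x - F x) <= c) ->
    exists F' : X -> Y, [/\ lin F', tbdd [set F' x | x in [set x | gauge A x 1]],
      (forall x, gauge A x 1 -> nm (F' x - F x) <= lm * c) &
      forall x, N x -> gauge A x 1 -> nm (T x - F' x) <= e].
  move=> c0 e0 Fl Fk Fc.
  pose D x := T x - F x.
  have Dl (a : K) x y : N x -> N y -> D (a *: x + y) = a *: D x + D y.
    by move=> Nx Ny; rewrite /D Tl // Fl scalerBr opprD addrACA.
  have DZ a x : N x -> D (a *: x) = a *: D x.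
    by move=> Nx; rewrite /D TZ // (linZ Fl) scalerBr.
  have Dk : tbdd [set D x | x in [set x | N x /\ gauge A x 1]].
    have h1 : tbdd [set - y | y in [set F x | x in [set x | gauge A x 1]]].
      by apply: (@tbdd_lin R Y Y _ _ 1) Fk => [a x y|x]; rewrite ?nmN ?mul1r // opprD scalerN.
    apply: tbdd_sub (tbdd_add Tk h1) => _ [x /= [Nx hx] <-].
    by exists (T x), (- F x); split=> //; [exists x|exists (F x) => //; exists x].
  have e1 : 0 < e / (1 + lm) by rewrite divr_gt0 //; lra.
  have [m [y [yD hy]]] := tbdd_in Dk e1.
  have [n [v [p [p1 vb pe]]]] := hY m y.
  have vb' (b : 'I_n -> K) (M : R) : 0 <= M -> (forall k, nm (b k) <= M) -> nm (\sum_(k < n) b k *: v k) <= lm * M.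
    move=> M0 hb; apply: (le_trans (vb b M M0 hb)); apply: ler_wpM2r => //.
    by rewrite le_max lexx.
  have /choice[g hg] : forall k, exists g : X -> K, [/\ (forall (a : K) x y, g (a *: x + y) = a * g x + g y),
      (forall x, N x -> g x = sval (p k) (D x)) & (forall x, gauge A x 1 -> nm (g x) <= c)].
    (* Hahn-Banach with the gauge scaled by c, the size of the error on N. Outside [aspan A] no
       radius is admissible and nothing is demanded. *)
    move=> k; pose G x r := gauge A x (r / c).
    have GD x y' r s : G x r -> G y' s -> G (x + y') (r + s).
      by rewrite /G mulrDl; exact: gaugeD.
    have GZ (a : K) x r : G x r -> G (a *: x) (nm a * r).
      by rewrite /G -mulrA; exact: gaugeZ.
    have [||g [gl gN gG]] := hahn_banach (f := fun x => sval (p k) (D x)) GD GZ N0 Nl.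
    - by move=> a x y' Nx Ny; rewrite Dl // (dual_lfun (p k)).
    - move=> x r Nx hr; apply: (le_trans (nm_dual_ge _ _)).
      have h := homog D c (ltW c0) DZ Fc x (r / c) Nx hr.
      rewrite [c * _]mulrC divfK ?lt0r_neq0 // in h.
      apply: le_trans h; rewrite -[leRHS]mul1r.
      by apply: ler_wpM2r; [exact: nm_ge0|exact: p1].
    exists g; split=> // x hx; apply: gG; rewrite /G divff //; exact: lt0r_neq0.
  pose F1 x := \sum_(k < n) g k x *: v k.
  have F1l : lin F1.
    move=> a x y'; rewrite /F1 scaler_sumr -big_split /=; apply: eq_bigr => k _.
    by have [-> _ _] := hg k; rewrite scalerDl scalerA.
  have F1b x : gauge A x 1 -> nm (F1 x) <= lm * c.
    by move=> hx; apply: vb'; [exact: ltW|move=> k; have [_ _] := hg k; exact].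
  have F1k : tbdd [set F1 x | x in [set x | gauge A x 1]].
    apply: tbdd_sub (tbdd_fd v c) => _ [x hx <-]; exists (fun k => g k x); split=> // k.
    by have [_ _] := hg k; exact.
  have Pe y' : nm (\sum_(k < n) sval (p k) y' *: v k) <= lm * nm y'.
    apply: vb'; first exact: nm_ge0.
    move=> k; apply: (le_trans (nm_dual_ge _ _)); rewrite -[leRHS]mul1r.
    by apply: ler_wpM2r; [exact: nm_ge0|exact: p1].
  have near x : N x -> gauge A x 1 -> nm (D x - F1 x) <= e.
    move=> Nx hx; have [|j hj] := hy (D x); first by exists x.
    have -> : F1 x = \sum_(k < n) sval (p k) (D x) *: v k.
      by apply: eq_bigr => k _; have [_ hk _] := hg k; rewrite hk.
    (* The finite-rank operator fixes the net point y_j, so the error is 1 minus that operator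
       applied to the small vector D x - y_j. *)
    have -> : D x - \sum_(k < n) sval (p k) (D x) *: v k =
      (D x - y j) - \sum_(k < n) sval (p k) (D x - y j) *: v k.
      rewrite [in RHS](eq_bigr (fun k => sval (p k) (D x) *: v k - sval (p k) (y j) *: v k)).
        by rewrite sumrB -pe opprB addrA subrK.
      by move=> k _; rewrite (lfunB (dual_lfun _)) scalerBl.
    apply: (le_trans (nmB _ _)); apply: le_trans (_ : e / (1 + lm) + lm * (e / (1 + lm)) <= _).
      apply: lerD => //; apply: (le_trans (Pe _)); exact: ler_wpM2l.
    rewrite -{1}[e / _]mul1r -mulrDl mulrC divfK // lt0r_neq0 //; lra.
  exists (fun x => F x + F1 x); split.
  - by move=> a x y'; rewrite Fl F1l scalerDr addrACA.
  - apply: tbdd_sub (tbdd_add Fk F1k) => _ [x hx <-].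
    by exists (F x), (F1 x); split=> //; exists x.
  - by move=> x hx; rewrite addrC addKr; exact: F1b.
  - by move=> x Nx hx; rewrite opprD addrA; exact: near.
have [c0 c00 hc0] := tbdd_bdd Tk.
pose ok n (F : X -> Y) := [/\ lin F, tbdd [set F x | x in [set x | gauge A x 1]] &
   forall x, N x -> gauge A x 1 -> nm (T x - F x) <= c0 * (2^-1) ^+ n].
have /choice[nx hnx] : forall z : nat * (X -> Y), exists F', ok z.1 z.2 ->
    ok z.1.+1 F' /\ forall x, gauge A x 1 -> nm (F' x - z.2 x) <= lm * (c0 * (2^-1) ^+ z.1).
  move=> [n F] /=; have [[Fl Fk Fc]|nok] := pselect (ok n F); last by exists F.
  have [||F' [h1 h2 h3 h4]] := step _ (c0 * (2^-1) ^+ n.+1) F _ _ Fl Fk Fc.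
  - by rewrite mulr_gt0 // halfX_gt0.
  - by rewrite mulr_gt0 // halfX_gt0.
  by exists F'.
pose F := fix F n := if n is m.+1 then nx (m, F m) else (fun=> 0 : Y).
have okF n : ok n (F n).
  elim: n => [|n IH] /=; last by have [] := hnx (n, F n) IH.
  split.
  - by move=> a x y; rewrite scaler0 addr0.
  - by apply: tbdd_sub (tbdd_seq [:: 0]) => _ [x _ <-]; rewrite /= inE.
  - by move=> x Nx hx; rewrite subr0 expr0 mulr1; apply: hc0; exists x.
have dF n x : gauge A x 1 -> nm (F n.+1 x - F n x) <= lm * c0 * (2^-1) ^+ n.
  by move=> hx; have [_ h] := hnx (n, F n) (okF n); rewrite -mulrA; exact: h.
have dF' n x r : gauge A x r -> 0 < r -> nm (F n.+1 x - F n x) <= lm * c0 * r * (2^-1) ^+ n.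
  move=> hx r0; have [Fl _ _] := okF n; have [Fl' _ _] := okF n.+1.
  have := dF n (rc r^-1 *: x); rewrite (linZ Fl) (linZ Fl') -scalerBr nmZ nm_rc gtr0_norm ?invr_gt0 //.
  rewrite ler_pdivrMl // => h; rewrite mulrAC [_ * r]mulrC; apply: h.
  have := gaugeZ (rc r^-1) hx; rewrite nm_rc gtr0_norm ?invr_gt0 // mulVf //; exact: lt0r_neq0.
have /choice[S hS] : forall x, exists l, aspan A x -> exists c, forall n, nm (l - F n x) <= c * (2^-1) ^+ n.
  move=> x; have [[r hr]|nx0] := pselect (aspan A x); last by exists 0.
  have r1 : 0 < r + 1 by have := gauge_ge0 hr; lra.
  have [|l hl] := geo_cvg (seqcompleteP (W := Y)) (s := fun n => F n x) (c := lm * c0 * (r + 1)).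
    by move=> n; apply: dF' => //; apply: gauge_mono hr _; lra.
  by exists l => _; exists (2 * (lm * c0 * (r + 1))).
have small (y : Y) (c : R) : (forall n, nm y <= c * (2^-1) ^+ n) -> y = 0.
  move=> h; apply: nm_small => e e0.
  have d0 : 0 < `|c| + 1 by have := normr_ge0 c; lra.
  have [n hn] := half_pow (divr_gt0 e0 d0); rewrite ltr_pdivlMr // in hn.
  have := h n; have := ler_norm c; have : 0 < (2^-1 : R) ^+ n := halfX_gt0 n; nra.
exists S; split.
- move=> a x y sx sy; have sxy : aspan A (a *: x + y) by apply: (submod_aspan A).2.
  have [c1 h1] := hS _ sx; have [c2 h2] := hS _ sy; have [c3 h3] := hS _ sxy.
  apply/eqP; rewrite -subr_eq0; apply/eqP; apply: (small _ (c3 + nm a * c1 + c2)) => n.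
  have [Fl _ _] := okF n.
  apply: (le_trans (nm_tri _ (F n (a *: x + y)) _)); rewrite !mulrDl -addrA; apply: lerD => //.
  rewrite nmBC Fl opprD addrACA -scalerBr; apply: (le_trans (nmD _ _)); rewrite nmZ -mulrA.
  by apply: lerD => //; apply: ler_wpM2l; [exact: nm_ge0|exact: h1].
- move=> x Nx sx; have [c1 h1] := hS _ sx; have [r hr] := sx.
  apply/eqP; rewrite -subr_eq0; apply/eqP; apply: (small _ (c1 + c0 * r)) => n.
  have [Fl _ Fc] := okF n.
  apply: (le_trans (nm_tri _ (F n x) _)); rewrite mulrDl; apply: lerD => //.
  rewrite nmBC mulrAC; apply: (homog (fun x => T x - F n x)) => //.
    by rewrite mulr_ge0 ?ltW // halfX_gt0.
  by move=> a x' Nx'; rewrite TZ // (linZ Fl) scalerBr.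
- apply: tbdd_approx => e e0.
  have d0 : 0 < 2 * (lm * c0) + 1 by rewrite ltr_wpDl // !mulr_ge0 // ltW.
  have [n hn] := half_pow (divr_gt0 e0 d0); rewrite ltr_pdivlMr // in hn.
  exists [set F n x | x in [set x | gauge A x 1]]; split; first by have [] := okF n.
  move=> _ [x /= hx <-]; exists (F n x); first by exists x.
  have [|l hl] := geo_cvg (seqcompleteP (W := Y)) (s := fun n => F n x) (c := lm * c0).
    by move=> k; exact: dF.
  have [c1 h1] := hS x (ex_intro _ 1 hx).
  have -> : S x = l.
    apply/eqP; rewrite -subr_eq0; apply/eqP; apply: (small _ (c1 + 2 * (lm * c0))) => k.
    apply: (le_trans (nm_tri _ (F k x) _)); rewrite mulrDl; apply: lerD => //.
    by rewrite nmBC.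
  have := hl n; have : 0 < (2^-1 : R) ^+ n := halfX_gt0 n; lra.
Qed.

(** A point is written as a telescoping sum of net points. At each level the differences take
    finitely many values, so their lifts give finite images, and the norms decay geometrically, so
    finite images approximate the lift uniformly. *)
Lemma lift_tbdd (X Z : completeNormedModType K) (q : X -> Z) (C : R) (Q : set Z) :
  lin q -> continuous q -> 0 < C -> (forall z, exists2 x, q x = z & nm x <= C * nm z) -> tbdd Q ->
  exists s : Z -> X, (forall z, Q z -> q (s z) = z) /\ tbdd (s @` Q).
Proof.
move=> ql qc C0 hC hQ.
have /choice[sel hsel] : forall z, exists x, q x = z /\ nm x <= C * nm z.
  by move=> z; have [x h1 h2] := hC z; exists x.
have /choice[net hnet] : forall n : nat, exists s : seq Z, forall x, Q x -> exists y, y \in s /\ nm (x - y) <= (2^-1) ^+ n.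
  by move=> n; have [s hs] := hQ _ (halfX_gt0 n); exists s => x /hs[y ys h]; exists y.
have /choice[a ha] : forall nz : nat * Z, exists y, Q nz.2 -> y \in net nz.1 /\ nm (nz.2 - y) <= (2^-1) ^+ nz.1.
  by move=> [n z]; have [/(hnet n)[y h]|nQ] := pselect (Q z); [exists y|exists 0].
pose S n z := sel (a (0%N, z)) + \sum_(k < n) sel (a (k.+1, z) - a (nat_of_ord k, z)).
have Sk n : tbdd (S n @` Q).
  elim: n => [|n IH].
    apply: tbdd_sub (tbdd_seq [seq sel y | y <- net 0%N]) => _ [z Qz <-].
    by rewrite /S big_ord0 addr0 /=; apply: map_f; exact: (proj1 (ha (0%N, z) Qz)).
  apply: tbdd_sub (tbdd_add IH (tbdd_seq [seq sel (y - y') | y <- net n.+1, y' <- net n])) => _ [z Qz <-].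
  exists (S n z), (sel (a (n.+1, z) - a (n, z))); split; first by exists z.
    apply/allpairsP; exists (a (n.+1, z), a (n, z)); split=> //.
      exact: (proj1 (ha (n.+1, z) Qz)).
    exact: (proj1 (ha (n, z) Qz)).
  by rewrite /S big_ord_recr /= addrA.
have Sq n z : q (S n z) = a (n, z).
  elim: n => [|n IH]; first by rewrite /S big_ord0 addr0 (proj1 (hsel _)).
  have -> : S n.+1 z = S n z + sel (a (n.+1, z) - a (n, z)) by rewrite /S big_ord_recr /= addrA.
  by rewrite (linD ql) IH (proj1 (hsel _)) addrC subrK.
have dS n z : Q z -> nm (S n.+1 z - S n z) <= C * 2 * (2^-1) ^+ n.
  move=> Qz; have -> : S n.+1 z - S n z = sel (a (n.+1, z) - a (n, z)).
    have -> : S n.+1 z = S n z + sel (a (n.+1, z) - a (n, z)) by rewrite /S big_ord_recr /= addrA.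
    by rewrite addrAC subrr add0r.
  apply: (le_trans (proj2 (hsel _))); rewrite -mulrA; apply: ler_wpM2l; first exact: ltW.
  apply: (le_trans (nm_tri _ z _)); rewrite (nmBC _ z).
  have := proj2 (ha (n.+1, z) Qz); have := proj2 (ha (n, z) Qz) => /= h1; rewrite exprS => h2.
  have : 0 < (2^-1 : R) ^+ n := halfX_gt0 n; lra.
have /choice[s hs] : forall z, exists l, Q z -> forall n, nm (l - S n z) <= 2 * (C * 2) * (2^-1) ^+ n.
  move=> z; have [Qz|nQ] := pselect (Q z); last by exists 0.
  have [|l hl] := geo_cvg (seqcompleteP (W := X)) (s := fun n => S n z) (c := C * 2).
    by move=> n; exact: dS.
  by exists l.
have [cq cq0 hcq] := lin_bound ql qc.
exists s; split.
  move=> z Qz; apply/eqP; rewrite -subr_eq0; apply/eqP; apply: nm_small => e e0.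
  have d0 : 0 < cq * (2 * (C * 2)) + 1 by rewrite ltr_wpDl // !mulr_ge0 // ltW.
  have [n hn] := half_pow (divr_gt0 e0 d0); rewrite ltr_pdivlMr // in hn.
  apply: (le_trans (nm_tri _ (q (S n z)) _)); rewrite -(linB ql) Sq (nmBC _ z).
  have h1 := hcq (s z - S n z); have h2 := hs z Qz n; have h3 := proj2 (ha (n, z) Qz).
  have h4 : cq * nm (s z - S n z) <= cq * (2 * (C * 2) * (2^-1) ^+ n) by apply: ler_wpM2l => //; exact: ltW.
  rewrite /= in h3; lra.
apply: tbdd_approx => e e0.
have d0 : 0 < 2 * (C * 2) by rewrite !mulr_gt0.
have [n hn] := half_pow (divr_gt0 e0 d0); rewrite ltr_pdivlMr // in hn.
exists (S n @` Q); split=> // _ [z Qz <-]; exists (S n z); first by exists z.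
by have := hs z Qz n; lra.
Qed.

(** The section s of [lift_tbdd] is not linear. Extending the inverse of i from i(Y) to a map S on
    [aspan A], the map u - i(S u) vanishes on i(Y), hence depends only on q(u) and is linear there;
    compactness of S keeps the image of Q totally bounded. *)
Theorem compact_lifting (Y X Z : completeNormedModType K) (i : Y -> X) (q : X -> Z) (lam : R) (Q : set Z) :
  locfact Y lam -> short_exact i q -> tbdd Q ->
  exists l : Z -> X,
    [/\ (forall (a : K) x y, aspan Q x -> aspan Q y -> l (a *: x + y) = a *: l x + l y),
        (forall z, aspan Q z -> q (l z) = z) & tbdd (l @` Q)].
Proof.
move=> hY ex hQ; have ql := ex_ql ex; have il := ex_il ex.
have qc : continuous q by case: ex => _ [].
have [C C0 hC] := ex_lift ex.
have [s [qs sk]] := lift_tbdd ql qc C0 hC hQ.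
have [D D0 hD] := ex_i_inverse_bound ex.
pose A := s @` Q; pose N := [set x | exists y, i y = x].
have sN : submod N.
  split; first by exists 0; rewrite (lin0 il).
  by move=> a _ _ [x <-] [y <-]; exists (a *: x + y); rewrite il.
have /choice[inv hinv] : forall x, exists y, N x -> i y = x.
  by move=> x; have [[y hy]|n] := pselect (N x); [exists y|exists 0].
have invi y : inv (i y) = y by apply: (ex_inj ex); apply: hinv; exists y.
have invl (a : K) x y : N x -> N y -> inv (a *: x + y) = a *: inv x + inv y.
  by move=> [x' <-] [y' <-]; rewrite -il !invi.
have invk : tbdd [set inv x | x in [set x | N x /\ gauge A x 1]].
  apply: (@tbdd_img R X Y _ _ D).
    by apply: tbdd_sub (tbdd_aconv sk) => x [_ /gauge_aconv].
  move=> _ _ [[x <-] _] [[y <-] _]; rewrite !invi.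
  by rewrite -(linB il).
have [S [Sl SN Sk]] := compact_extension hY sN invl invk.
have /choice[x hx] : forall z, exists x, aspan Q z -> aspan A x /\ q x = z.
  move=> z; have [[r [u [uQ _ ->]]]|nz] := pselect (aspan Q z); last by exists 0.
  exists (\sum_(w <- u) w.1 *: s w.2) => _; split.
    exists (\sum_(w <- u) nm w.1), [seq (w.1, s w.2) | w <- u]; split.
    - by move=> _ /mapP[w /uQ wQ ->] /=; exists w.2.
    - by rewrite big_map.
    - by rewrite big_map.
  rewrite (lin_sum ql) big_seq [RHS]big_seq; apply: eq_bigr => w /uQ wQ.
  by rewrite (linZ ql) qs.
pose l z := x z - i (S (x z)).
have lE z u : aspan Q z -> aspan A u -> q u = z -> l z = u - i (S u).
  move=> Qz Au qu; have [Ax qx] := hx z Qz.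
  have [y hy] : exists y, i y = x z - u by apply: (ex_ker ex); rewrite (linB ql) qx qu subrr.
  have Axu : aspan A (x z - u).
    by rewrite -scaleN1r addrC; apply: (submod_aspan A).2.
  have : S (x z - u) = inv (x z - u) by apply: SN => //; exists y.
  have -> : S (x z - u) = S (x z) - S u.
    by have := Sl (-1) u (x z) Au Ax; rewrite scaleN1r addrC => ->; rewrite scaleN1r addrC.
  rewrite -hy invi => e1; rewrite /l; have : i (S (x z)) - i (S u) = x z - u by rewrite -(linB il) e1.
  move=> /eqP; rewrite subr_eq => /eqP ->; rewrite opprD opprB addrA.
  by rewrite [x z + _]addrC subrK.
exists l; split.
- move=> a z z' Qz Qz'; have [Ax qx] := hx z Qz; have [Ax' qx'] := hx z' Qz'.
  rewrite (@lE _ (a *: x z + x z')); last by rewrite ql qx qx'.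
  + rewrite Sl // il opprD addrACA -scalerN -scalerDr; congr (_ + _).
  + by apply: (submod_aspan Q).2.
  + by apply: (submod_aspan A).2.
- move=> z Qz; have [Ax qx] := hx z Qz.
  by rewrite /l (linB ql) (ex_qi ex) subr0.
- have h1 : tbdd [set - i y | y in [set S x | x in [set x | gauge A x 1]]].
    have [c c0 hc] := ex_i_bound ex.
    apply: (@tbdd_lin R Y X _ _ c) Sk => [a y y'|y]; last by rewrite nmN.
    by rewrite il opprD scalerN.
  apply: tbdd_sub (tbdd_add sk h1) => _ [z Qz <-].
  have As : A (s z) by exists z.
  exists (s z), (- i (S (s z))); split => //.
    by exists (S (s z)) => //; exists (s z) => //; exact: gauge_in.
  by rewrite (@lE z (s z)) //; [exact: aspan_in|exact: aspan_in|exact: qs].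
Qed.
End CompactLifting.

(** * Multilinear maps, symmetrization and polarization *)

Section Multilinear.
Context {R : realType}.
Local Notation K := (Cplx R).

Definition fcons {T : Type} n (v : T) (x : 'I_n -> T) : 'I_n.+1 -> T :=
  fun i => oapp x v (unlift ord0 i).

Section Fcons.
Context {T : Type} {n : nat}.
Implicit Types (v w : T) (x : 'I_n -> T).
Lemma fcons0 v x : fcons v x ord0 = v.
Proof. by rewrite /fcons unlift_none. Qed.
Lemma fconsS v x j : fcons v x (lift ord0 j) = x j.
Proof. by rewrite /fcons liftK. Qed.
Lemma fconsE (y : 'I_n.+1 -> T) : y = fcons (y ord0) (fun j => y (lift ord0 j)).
Proof. by apply: funext => i; case: (unliftP ord0 i) => [j|] ->; rewrite ?fcons0 ?fconsS. Qed.
Lemma upd_fcons0 v w x : upd (fcons v x) ord0 w = fcons w x.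
Proof.
apply: funext => i; rewrite /upd /=; case: (unliftP ord0 i) => [j|] ->.
  by rewrite !fconsS eq_sym (negbTE (neq_lift _ _)).
by rewrite eqxx fcons0.
Qed.
Lemma upd_fconsS v w x j : upd (fcons v x) (lift ord0 j) w = fcons v (upd x j w).
Proof.
apply: funext => i; rewrite /upd /=; case: (unliftP ord0 i) => [k|] ->.
  by rewrite (inj_eq lift_inj) !fconsS.
by rewrite !fcons0.
Qed.
Lemma upd_same (x : 'I_n -> T) j v : upd x j v j = v.
Proof. by rewrite /upd eqxx. Qed.
End Fcons.

(** The notion of [multilinear] for arbitrary modules, so that it also covers forms on [Dual Y]. *)
Definition mlin {V W : lmodType K} n (A : ('I_n -> V) -> W) :=
  forall j x (a : K) u w, A (upd x j (a *: u + w)) = a *: A (upd x j u) + A (upd x j w).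

Section Mlin.
Context {V W : lmodType K}.

Lemma mlin_tail n (A : ('I_n.+1 -> V) -> W) v : mlin A -> mlin (fun x => A (fcons v x)).
Proof. by move=> mA j x a u w; rewrite -!upd_fconsS mA. Qed.
Lemma mlin_head n (A : ('I_n.+1 -> V) -> W) x : mlin A -> lin (fun v => A (fcons v x)).
Proof. by move=> mA a u w; have := mA ord0 (fcons 0 x) a u w; rewrite !upd_fcons0. Qed.

Lemma mlin_expand n N (A : ('I_n -> V) -> W) (c : 'I_n -> 'I_N -> K) (x : 'I_n -> 'I_N -> V) : mlin A ->
  A (fun j => \sum_(k < N) c j k *: x j k) =
  \sum_(f : {ffun 'I_n -> 'I_N}) (\prod_j c j (f j)) *: A (fun j => x j (f j)).
Proof.
elim: n A c x => [|n IH] A c x mA.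
  have f0 : {ffun 'I_0 -> 'I_N} by apply: finfun; case.
  rewrite (bigD1 f0) //= big_ord0 scale1r big1 ?addr0.
    by congr A; apply: funext => -[].
  by move=> f /eqP; case; apply/ffunP => -[].
rewrite [in LHS](fconsE (fun j => _)) /= (lin_sum (mlin_head _ mA)).
pose h (p : 'I_N * {ffun 'I_n -> 'I_N}) : {ffun 'I_n.+1 -> 'I_N} := [ffun i => fcons p.1 p.2 i].
rewrite (reindex h) /=; last first.
  exists (fun f : {ffun 'I_n.+1 -> 'I_N} => (f ord0, [ffun j => f (lift ord0 j)])).
    move=> [k f] _; rewrite /h ffunE fcons0; congr (_, _).
    by apply/ffunP => j; rewrite !ffunE fconsS.
  move=> f _; apply/ffunP => i; rewrite ffunE [in RHS](fconsE f) /=.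
  by congr (fcons _ _ i); apply: funext => j; rewrite ffunE.
rewrite -(pair_bigA _ (fun k f => (\prod_j c j (h (k, f) j)) *: A (fun j => x j (h (k, f) j)))) /=.
apply: eq_bigr => k _; rewrite (linZ (mlin_head _ mA)).
rewrite (IH (fun y => A (fcons (x ord0 k) y)) _ _ (mlin_tail _ mA)) scaler_sumr; apply: eq_bigr => f _.
rewrite scalerA big_ord_recl ffunE fcons0; congr (_ *: A _).
  by congr (_ * _); apply: eq_bigr => j _; rewrite ffunE fconsS.
rewrite [RHS]fconsE ffunE fcons0; congr (fcons _ _).
by apply: funext => j; rewrite ffunE fconsS.
Qed.

Lemma mlinZ n (A : ('I_n -> V) -> W) (c : 'I_n -> K) (x : 'I_n -> V) : mlin A ->
  A (fun j => c j *: x j) = (\prod_j c j) *: A x.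
Proof.
elim: n A c x => [|n IH] A c x mA.
  by rewrite big_ord0 scale1r; congr A; apply: funext => -[].
rewrite [in LHS](fconsE (fun j => _)) (linZ (mlin_head _ mA)) big_ord_recl -scalerA; congr (_ *: _).
by rewrite (IH (fun y => A (fcons (x ord0) y)) _ _ (mlin_tail _ mA)) -fconsE.
Qed.

Lemma mlin_diagZ n (A : ('I_n -> V) -> W) (c : K) (x : V) : mlin A ->
  A (fun=> c *: x) = c ^+ n *: A (fun=> x).
Proof. by move=> mA; rewrite (mlinZ (fun=> c) (fun=> x) mA) prodr_const card_ord. Qed.

Definition sgn (b : bool) : K := (-1) ^+ b.
Lemma sgnN b : sgn (~~ b) = - sgn b.
Proof. by case: b; rewrite /sgn ?expr0 ?expr1 ?opprK. Qed.
Lemma sgn_sqr b : sgn b * sgn b = 1.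
Proof. by case: b; rewrite /sgn ?expr0 ?expr1 ?mulrNN mulr1. Qed.

(** If f misses an index k0, flipping the sign at k0 changes the first product but not the second,
    so the sum equals its own negative. For a bijection every term is 1. *)
Lemma sgn_sum n (f : {ffun 'I_n -> 'I_n}) :
  \sum_(e : {ffun 'I_n -> bool}) (\prod_k sgn (e k)) * \prod_j sgn (e (f j)) =
  if injectiveb f then (2 ^ n)%:R else 0.
Proof.
case: injectiveP => [finj|ninj].
  rewrite (eq_bigr (fun=> 1)) => [|e _].
    by rewrite sumr_const card_ffun card_bool card_ord.
  rewrite [X in X * _](reindex f) /=; last by apply: onW_bij; exact: injF_bij.
  by rewrite -big_split big1 // => j _; exact: sgn_sqr.
have [k0 hk0] : exists k0, k0 \notin codom f.
  apply/existsP; apply: contraT; rewrite negb_exists => /forallP h.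
  case: ninj; apply/injectiveP; rewrite /injectiveb /dinjectiveb.
  apply/card_uniqP; rewrite size_map -cardE.
  by apply: eq_card => k; have := h k; rewrite negbK inE => ->.
pose fl (e : {ffun 'I_n -> bool}) := [ffun k => if k == k0 then ~~ e k else e k].
have flK : involutive fl by move=> e; apply/ffunP => k; rewrite !ffunE; case: eqP => // _; rewrite negbK.
set s := LHS; suff : s = - s.
  move=> /eqP; rewrite -subr_eq0 opprK -mulr2n mulrn_eq0 /= => /eqP //.
rewrite {1}/s (reindex_inj (inv_inj flK)) /= -sumrN; apply: eq_bigr => e _.
rewrite -mulNr; congr (_ * _).
  rewrite (bigD1 k0) //= [in RHS](bigD1 k0) //= ffunE eqxx sgnN -mulNr; congr (_ * _).
  by apply: eq_bigr => k /negbTE hk; rewrite ffunE hk.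
apply: eq_bigr => j _; rewrite ffunE; case: eqP => // hj.
by move: hk0; rewrite -hj codom_f.
Qed.

Definition msym n (A : ('I_n -> V) -> W) (x : 'I_n -> V) : W :=
  (n`!)%:R^-1 *: \sum_(f : {ffun 'I_n -> 'I_n} | injectiveb f) A (fun j => x (f j)).

Lemma msym_mlin n (A : ('I_n -> V) -> W) : mlin A -> mlin (msym A).
Proof.
move=> mA j x a u w; rewrite /msym scalerA mulrC -scalerA -scalerDr; congr (_ *: _).
rewrite scaler_sumr -big_split; apply: eq_bigr => f /injectiveP finj.
have [g fg gf] := injF_bij finj.
have E t : (fun i => upd x j t (f i)) = upd (fun i => x (f i)) (g j) t.
  by apply: funext => i; rewrite /upd -(inj_eq finj i) gf.
by rewrite !E mA.
Qed.

Lemma msym_diag n (A : ('I_n -> V) -> W) x : msym A (fun=> x) = A (fun=> x).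
Proof.
rewrite /msym sumr_const -[X in A _ *+ X]/(#|_|).
have -> : #|[pred f : {ffun 'I_n -> 'I_n} | injectiveb f]| = n`!.
  by have := card_inj_ffuns 'I_n 'I_n; rewrite !card_ord ffactnn => <-; rewrite cardsE; apply: eq_card.
rewrite -[X in _ *: X]scaler_nat scalerA mulVf ?scale1r // pnatr_eq0 -lt0n.
Qed.

(** Expanding the diagonal values by multilinearity and summing over signs, [sgn_sum] leaves exactly
    the injective index maps, which are the permutations. *)
Lemma polarization n (A : ('I_n -> V) -> W) (x : 'I_n -> V) : mlin A ->
  msym A x = ((2 ^ n * n`!)%:R^-1 : K) *:
    \sum_(e : {ffun 'I_n -> bool}) (\prod_k sgn (e k)) *: A (fun=> \sum_k sgn (e k) *: x k).
Proof.
move=> mA.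
under eq_bigr => e _ do rewrite (mlin_expand (fun=> fun k => sgn (e k)) (fun=> x) mA) scaler_sumr.
rewrite exchange_big /=.
under eq_bigr => f _.
  under eq_bigr => e _ do rewrite scalerA.
  rewrite -scaler_suml sgn_sum.
  over.
have n2 : (2 ^ n)%:R != 0 :> K by rewrite pnatr_eq0 expn_eq0.
rewrite /msym natrM invfM [_^-1 * _]mulrC -scalerA; congr (_ *: _).
rewrite big_mkcond /= scaler_sumr; apply: eq_bigr => f _.
case: ifP => _; last by rewrite scale0r scaler0.
by rewrite scalerA mulVf ?scale1r.
Qed.
End Mlin.

Section MlinBound.
Context {V W : normedModType K}.

Definition mbound n (A : ('I_n -> V) -> W) (C : R) :=
  forall x, (forall j, nm (x j) <= 1) -> nm (A x) <= C.

Lemma mbound_prod n (A : ('I_n -> V) -> W) C x : mlin A -> mbound A C ->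
  nm (A x) <= C * \prod_j nm (x j).
Proof.
move=> mA hC.
have /choice[u hu] : forall j, exists u, nm u <= 1 /\ x j = rc (nm (x j)) *: u.
  move=> j; have [/nm_eq0 ->|n0] := eqVneq (nm (x j)) 0.
    by exists 0; rewrite scaler0 nm0.
  have p : 0 < nm (x j) by rewrite lt_neqAle eq_sym n0 nm_ge0.
  exists (rc (nm (x j))^-1 *: x j); rewrite nmZ nm_rc gtr0_norm ?invr_gt0 // mulVf // scalerA -rcM mulfV //.
  by rewrite rc1 scale1r.
have xE : x = (fun j => rc (nm (x j)) *: u j) by apply: funext => j; have [_] := hu j.
rewrite {1}xE (mlinZ _ _ mA) nmZ mulrC; apply: ler_pM; try exact: nm_ge0.
  by apply: hC => j; have [] := hu j.
rewrite (big_morph (@nm R K^o) (id1 := 1) (op1 := *%R)); last 2 first.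
- by move=> a b; rewrite nmM.
- exact: nm1.
rewrite le_eqVlt; apply/orP; left; apply/eqP; apply: eq_bigr => j _.
by rewrite nm_rc ger0_norm // nm_ge0.
Qed.

Lemma mbound_tail n (A : ('I_n.+1 -> V) -> W) C v : mlin A -> mbound A C ->
  mbound (fun x => A (fcons v x)) (C * nm v).
Proof.
move=> mA hC x hx; apply: (le_trans (mbound_prod _ mA hC)); rewrite big_ord_recl fcons0.
have C0 : 0 <= C by apply: le_trans (nm_ge0 _) (hC (fun=> 0) _) => j; rewrite nm0.
apply: ler_wpM2l => //; rewrite -[leRHS]mulr1; apply: ler_wpM2l; first exact: nm_ge0.
by apply: prodr_ile1 => j _; rewrite fconsS nm_ge0 hx.
Qed.

Lemma mbound_pow n (A : ('I_n -> V) -> W) C x r : mlin A -> mbound A C ->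
  (forall j, nm (x j) <= r) -> nm (A x) <= C * r ^+ n.
Proof.
move=> mA hC hx; apply: (le_trans (mbound_prod _ mA hC)).
have C0 : 0 <= C by apply: le_trans (nm_ge0 _) (hC (fun=> 0) _) => j; rewrite nm0.
apply: ler_wpM2l => //; rewrite -[X in _ ^+ X]card_ord -prodr_const.
by apply: ler_prod => j _; rewrite nm_ge0 hx.
Qed.

(** Induction that splits off the first argument; r >= 1 lets all powers of r be bounded by the
    highest one. *)
Lemma mlin_diff1 n (A : ('I_n -> V) -> W) C x h r d : mlin A -> mbound A C ->
  1 <= r -> 0 <= d -> (forall j, nm (x j) <= r) -> (forall j, nm (x j + h j) <= r) ->
  (forall j, nm (h j) <= d) ->
  nm (A (fun j => x j + h j) - A x) <= n%:R * C * r ^+ n * d.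
Proof.
elim: n A C x h => [|n IH] A C x h mA hC r1 d0 hx hxh hh.
  have -> : (fun j => x j + h j) = x by apply: funext => -[].
  by rewrite subrr nm0 !mul0r.
have C0 : 0 <= C by apply: le_trans (nm_ge0 _) (hC (fun=> 0) _) => j; rewrite nm0.
pose x' j := x (lift ord0 j); pose h' j := h (lift ord0 j).
have -> : A (fun j => x j + h j) - A x =
  (A (fcons (x ord0) (fun j => x' j + h' j)) - A (fcons (x ord0) x')) + A (fcons (h ord0) (fun j => x' j + h' j)).
  rewrite {1}(fconsE (fun j => x j + h j)) (linD (mlin_head _ mA)) -fconsE.
  by rewrite addrAC.
apply: (le_trans (nmD _ _)).
have rn : 0 <= r ^+ n by rewrite exprn_ge0 //; lra.
have rn1 : r ^+ n <= r ^+ n.+1 by rewrite exprS ler_peMl.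
have h1 := IH _ _ x' h' (mlin_tail (x ord0) mA) (mbound_tail (x ord0) mA hC) r1 d0
  (fun j => hx _) (fun j => hxh _) (fun j => hh _).
have h2 := mbound_pow (mlin_tail (h ord0) mA) (mbound_tail (h ord0) mA hC) (fun j => hxh (lift ord0 j)).
have e1 : n%:R * (C * nm (x ord0)) * r ^+ n * d <= n%:R * C * r ^+ n.+1 * d.
  rewrite exprS !mulrA; apply: ler_wpM2r => //; apply: ler_wpM2r => //.
  by apply: ler_wpM2l => //; apply: mulr_ge0.
have e2 : C * nm (h ord0) * r ^+ n <= C * r ^+ n.+1 * d.
  rewrite -!mulrA; apply: ler_wpM2l => //; rewrite mulrC; apply: ler_pM => //; exact: nm_ge0.
apply: (le_trans (lerD (le_trans h1 e1) (le_trans h2 e2))).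
by rewrite -[n.+1%:R]natr1 !mulrDl mul1r.
Qed.

(** After removal of the linear part the first argument leaves a first-order difference, so the
    coefficient grows by n at each step: n^2 + n <= (n + 1)^2. *)
Lemma mlin_diff2 n (A : ('I_n -> V) -> W) C x h r d : mlin A -> mbound A C ->
  1 <= r -> 0 <= d -> (forall j, nm (x j) <= r) -> (forall j, nm (x j + h j) <= r) ->
  (forall j, nm (h j) <= d) ->
  nm (A (fun j => x j + h j) - A x - \sum_j A (upd x j (h j))) <= (n ^ 2)%:R * C * r ^+ n * d ^+ 2.
Proof.
elim: n A C x h => [|n IH] A C x h mA hC r1 d0 hx hxh hh.
  have -> : (fun j => x j + h j) = x by apply: funext => -[].
  by rewrite big_ord0 !subrr nm0 !mul0r.
have C0 : 0 <= C by apply: le_trans (nm_ge0 _) (hC (fun=> 0) _) => j; rewrite nm0.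
pose x' j := x (lift ord0 j); pose h' j := h (lift ord0 j).
have -> : A (fun j => x j + h j) - A x - \sum_j A (upd x j (h j)) =
  (A (fcons (x ord0) (fun j => x' j + h' j)) - A (fcons (x ord0) x') -
     \sum_j A (fcons (x ord0) (upd x' j (h' j)))) +
  (A (fcons (h ord0) (fun j => x' j + h' j)) - A (fcons (h ord0) x')).
  rewrite {1}(fconsE (fun j => x j + h j)) (linD (mlin_head _ mA)) -fconsE big_ord_recl.
  rewrite [in A (upd x ord0 _)](fconsE x) upd_fcons0.
  rewrite (eq_bigr (fun j => A (fcons (x ord0) (upd x' j (h' j))))).
    rewrite opprD !addrA; set a := A _; set b := A _; set c := A x; set e := A _; set f := \sum_j _.
    by rewrite -!addrA; congr (_ + _); rewrite addrCA; congr (_ + _); rewrite addrA addrC.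
  by move=> j _; rewrite {1}(fconsE x) upd_fconsS.
apply: (le_trans (nmD _ _)).
have rn : 0 <= r ^+ n by rewrite exprn_ge0 //; lra.
have rn1 : r ^+ n <= r ^+ n.+1 by rewrite exprS ler_peMl.
have h1 := IH _ _ x' h' (mlin_tail (x ord0) mA) (mbound_tail (x ord0) mA hC) r1 d0
  (fun j => hx _) (fun j => hxh _) (fun j => hh _).
have h2 := mlin_diff1 (mlin_tail (h ord0) mA) (mbound_tail (h ord0) mA hC) r1 d0
  (fun j => hx (lift ord0 j)) (fun j => hxh _) (fun j => hh _).
have e1 : (n ^ 2)%:R * (C * nm (x ord0)) * r ^+ n * d ^+ 2 <= (n ^ 2)%:R * C * r ^+ n.+1 * d ^+ 2.
  rewrite [r ^+ n.+1]exprS !mulrA; do 3!apply: ler_wpM2r => //.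
  by apply: ler_wpM2l => //; apply: mulr_ge0.
have e2 : n%:R * (C * nm (h ord0)) * r ^+ n * d <= n%:R * C * r ^+ n.+1 * d ^+ 2.
  rewrite expr2 !mulrA; apply: ler_wpM2r => //; rewrite -!mulrA; apply: ler_wpM2l => //.
  apply: ler_wpM2l => //; rewrite mulrC; apply: ler_pM => //; exact: nm_ge0.
apply: (le_trans (lerD (le_trans h1 e1) (le_trans h2 e2))).
rewrite -!mulrDl -natrD; apply: ler_wpM2r; first by rewrite exprn_ge0.
apply: ler_wpM2r; first by rewrite exprn_ge0 //; lra.
apply: ler_wpM2r => //; by rewrite ler_nat -!mulnn addnC -mulnS leq_mul2r leqnSn orbT.
Qed.

(** The points \sum_k +-x_k in the polarization formula have norm at most n; homogeneity gives n^n,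
    and averaging over the signs leaves 1 / n!. *)
Lemma mlin_diag_bound n (A : ('I_n -> V) -> W) M : mlin A ->
  (forall x, nm x <= 1 -> nm (A (fun=> x)) <= M) -> mbound (msym A) (n%:R ^+ n / n`!%:R * M).
Proof.
move=> mA hM x hx; have M0 : 0 <= M by apply: le_trans (nm_ge0 _) (hM 0 _); rewrite nm0.
rewrite (polarization _ mA) nmZ.
have -> : nm ((2 ^ n * n`!)%:R^-1 : K) = (2 ^ n)%:R^-1 * n`!%:R^-1.
  by rewrite -rc_nat -rcV nm_rc ger0_norm ?invr_ge0 // natrM invfM.
rewrite -[leLHS]mulrA ler_pdivrMl ?ltr0n ?expn_gt0 //.
apply: le_trans (_ : n`!%:R^-1 * \sum_(e : {ffun 'I_n -> bool}) (n%:R ^+ n * M) <= _); last first.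
  rewrite sumr_const card_ffun card_bool card_ord -[X in _ * X]mulr_natl mulrCA.
  by rewrite [X in _ <= _ * (X * _)]mulrC -[X in _ <= _ * X]mulrA.
apply: ler_wpM2l; first by rewrite invr_ge0.
apply: (le_trans (nm_sum _ _ _)); apply: ler_sum => e _.
have sg b : nm (sgn b) = 1 by case: b; rewrite /sgn ?expr0 ?expr1 ?nmN nm1.
rewrite nmZ (big_morph (@nm R K^o) (id1 := 1) (op1 := *%R)); last 2 first.
- by move=> a b; rewrite nmM.
- exact: nm1.
rewrite big1 ?mul1r => [|k _]; last exact: sg.
case: n A x hx mA hM e => [|n] A x hx mA hM e.
  by rewrite expr0 mul1r; apply: hM; rewrite big_ord0 nm0.
set y := \sum_k _.
have ny : nm y <= n.+1%:R.
  apply: (le_trans (nm_sum _ _ _)); rewrite -[n.+1 in leRHS]card_ord -sumr_const.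
  by apply: ler_sum => k _; rewrite nmZ sg mul1r.
have -> : y = rc n.+1%:R *: (rc n.+1%:R^-1 *: y).
  by rewrite scalerA -rcM mulfV ?rc1 ?scale1r // pnatr_eq0.
rewrite (mlin_diagZ _ _ mA) nmZ nmX nm_rc ger0_norm //; apply: ler_wpM2l; first exact: exprn_ge0.
by apply: hM; rewrite nmZ nm_rc ger0_norm ?invr_ge0 // ler_pdivrMl ?ltr0n // mulr1.
Qed.

End MlinBound.
End Multilinear.

(** * Lifting compact polynomials and operators *)

Section PolyLift.
Context {R : realType}.
Local Notation K := (Cplx R).

Lemma unit_ballE (V : normedModType K) : [set x : V | `|x| <= 1] = [set x : V | nm x <= 1].
Proof. by apply/seteqP; split=> x /=; rewrite -rc1 nm_le. Qed.

Lemma diag_aspan (V W : normedModType K) n (A : ('I_n -> V) -> W) (Q : set W) d y : mlin A -> 0 < d ->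
  (forall x, nm x <= d -> Q (A (fun=> x))) -> aspan Q (A (fun=> y)).
Proof.
move=> mA d0 hQ; pose r := (nm y + 1) / d.
have r0 : 0 < r by rewrite divr_gt0 //; have := nm_ge0 y; lra.
have -> : y = rc r *: (rc r^-1 *: y) by rewrite scalerA -rcM mulfV ?rc1 ?scale1r // lt0r_neq0.
rewrite (mlin_diagZ _ _ mA); apply: (submodZ _ (submod_aspan Q)); apply: aspan_in; apply: hQ.
rewrite nmZ nm_rc gtr0_norm ?invr_gt0 // ler_pdivrMl // /r divfK ?lt0r_neq0 //; lra.
Qed.

Lemma msym_aspan (V W : normedModType K) n (A : ('I_n -> V) -> W) (Q : set W) d x : mlin A -> 0 < d ->
  (forall x, nm x <= d -> Q (A (fun=> x))) -> aspan Q (msym A x).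
Proof.
move=> mA d0 hQ; rewrite (polarization _ mA); apply: (submodZ _ (submod_aspan Q)).
apply: (submod_sum _ _ (submod_aspan Q)) => e; apply: (submodZ _ (submod_aspan Q)).
exact: diag_aspan mA d0 hQ.
Qed.

Lemma mlin_comp (V W W' : lmodType K) n (A : ('I_n -> V) -> W) (l : W -> W') (N : set W) :
  mlin A -> (forall (a : K) x y, N x -> N y -> l (a *: x + y) = a *: l x + l y) ->
  (forall x, N (A x)) -> mlin (fun x => l (A x)).
Proof. by move=> mA ll hN j x a u w; rewrite mA ll. Qed.

Lemma diag_cont (V W : normedModType K) n (A : ('I_n -> V) -> W) (M : R) : mlin A ->
  (forall x, nm x <= 1 -> nm (A (fun=> x)) <= M) -> continuous (fun x => A (fun=> x)).
Proof.
move=> mA hM; apply/cont_nmP => x e e0.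
have mS := msym_mlin mA; have bS := mlin_diag_bound mA hM; set C := _ * M in bS.
have C0 : 0 <= C by apply: le_trans (nm_ge0 _) (bS (fun=> 0) _) => j; rewrite nm0.
pose r := nm x + 1; have r1 : 1 <= r by rewrite /r; have := nm_ge0 x; lra.
pose D := n%:R * C * r ^+ n; have D0 : 0 <= D by apply: mulr_ge0; [apply: mulr_ge0|apply: exprn_ge0; exact: le_trans r1].
exists (Num.min 1 (e / (D + 1))) => [|y].
  by rewrite lt_min ltr01 divr_gt0 //; lra.
rewrite lt_min nmBC => /andP[h1 h2]; rewrite nmBC.
have := mlin_diff1 (x := fun=> x) (h := fun=> y - x) mS bS r1 (nm_ge0 (y - x)) _ _ _.
rewrite (_ : (fun=> x + (y - x)) = (fun=> y)); last by apply: funext => _; rewrite addrC subrK.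
have xr : nm x <= r by rewrite /r lerDl.
have yr : nm (x + (y - x)) <= r.
  by rewrite addrC subrK; have := nm_tri y x 0; rewrite !subr0 /r; lra.
rewrite !msym_diag => /(_ (fun=> xr) (fun=> yr) (fun=> lexx _)); rewrite -/D => h.
apply: (le_lt_trans h); clear h; rewrite ltr_pdivlMr in h2; last by lra.
by have := nm_ge0 (y - x); nra.
Qed.

(** Off-diagonal values of A need not lie in the span of Q, where the lift is linear, whereas those
    of [msym A] do by polarization. Both agree on the diagonal. *)
Lemma poly_lifting (Y X Z : completeNormedModType K) (i : Y -> X) (q : X -> Z) (lam : R)
  (V : normedModType K) n (A : ('I_n -> V) -> Z) :
  locfact Y lam -> short_exact i q -> mlin A ->
  tbdd [set A (fun=> x) | x in [set x | nm x <= 1]] ->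
  exists B : ('I_n -> V) -> X, [/\ mlin B, (forall x, q (B (fun=> x)) = A (fun=> x)) &
    tbdd [set B (fun=> x) | x in [set x | nm x <= 1]]].
Proof.
move=> hY ex mA hQ; have [l [ll ql lk]] := compact_lifting hY ex hQ.
set Q := [set _ | x in _] in ll ql lk.
have Qin x : nm x <= 1 -> Q (A (fun=> x)) by exists x.
have sQ x : aspan Q (msym A x) := msym_aspan x mA ltr01 Qin.
exists (fun x => l (msym A x)); split.
- by apply: (mlin_comp (msym_mlin mA) ll).
- by move=> x; rewrite ql // msym_diag.
- apply: tbdd_sub lk => _ [x hx <-]; exists (msym A (fun=> x)) => //.
  by rewrite msym_diag; exact: Qin.
Qed.

Lemma locfact_lifts_poly (Y X Z : completeNormedModType K) (i : Y -> X) (q : X -> Z) (lam : R) n :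
  locfact Y lam -> short_exact i q -> lifts q (@A_poly R n).
Proof.
move=> hY ex V t [[tc [A [mA tA]]]]; rewrite unit_ballE => /compact_tbdd tk.
have tE : t = (fun x => A (fun=> x)) by exact: funext.
have [|B [mB qB Bk]] := poly_lifting hY ex (mA : mlin A); first by rewrite -tE.
have [c c0 hc] := tbdd_bdd Bk.
exists (fun x => B (fun=> x)); split; last by apply: funext => x /=; rewrite qB tA.
split; last by rewrite unit_ballE; exact: tbdd_compact.
split; last by exists B.
by apply: (diag_cont (M := c) mB) => x hx; apply: hc; exists x.
Qed.

Lemma locfact_lifts_compact (Y X Z : completeNormedModType K) (i : Y -> X) (q : X -> Z) (lam : R) :
  locfact Y lam -> short_exact i q -> lifts q (@A_compact R).
Proof.
move=> hY ex V t [tl tc]; rewrite unit_ballE => /compact_tbdd tk.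
have [l [ll ql lk]] := compact_lifting hY ex tk.
set Q := t @` _ in ll ql lk.
have sQ x : aspan Q (t x).
  have mA : mlin (fun x : 'I_1 -> V => t (x ord0)).
    by move=> j y a u w; rewrite !ord1 !upd_same tl.
  by apply: (diag_aspan x mA ltr01) => y hy; exists y.
have Tl : lin (l \o t) by move=> a x y; rewrite /= tl ll.
have [c c0 hc] := tbdd_bdd lk.
exists (l \o t); split; last by apply: funext => x /=; rewrite ql.
split=> //; last first.
  rewrite unit_ballE; apply: tbdd_compact; apply: tbdd_sub lk => _ [x hx <-].
  by exists (t x) => //; exists x.
apply: (lin_cont (c := c) Tl) => x.
have [/nm_eq0 ->|n0] := eqVneq (nm x) 0; first by rewrite (lin0 Tl) !nm0 mulr0.
have p : 0 < nm x by rewrite lt_neqAle eq_sym n0 nm_ge0.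
have := hc (l (t (rc (nm x)^-1 *: x))).
have := linZ Tl (rc (nm x)^-1) x => /= ->; rewrite nmZ nm_rc gtr0_norm ?invr_gt0 // ler_pdivrMl // mulrC; apply.
exists (t (rc (nm x)^-1 *: x)); last by have := linZ Tl (rc (nm x)^-1) x.
by exists (rc (nm x)^-1 *: x) => //=; rewrite nmZ nm_rc gtr0_norm ?invr_gt0 // mulVf.
Qed.
End PolyLift.

(** * The Cauchy estimate *)

Section Cauchy.
Context {R : realType}.
Local Notation K := (Cplx R).
Local Notation ii := (iu : K).
Implicit Types (f g : K -> K) (p q c w z : K).

Lemma iu_sqr : ii * ii = -1.
Proof. by apply: Kext; rewrite ?reM ?imM ?reN ?imN re_iu im_iu ?re1 ?im1; ring. Qed.

(* Trapezoidal sums of f over the segment [p, q] at dyadic level n. All contour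
   sums below are of this kind, so that no integral is needed: Cauchy's theorem
   becomes a statement about sums of a large level. *)
Fixpoint trap n f p q : K :=
  if n is m.+1 then trap m f p ((p + q) / 2) + trap m f ((p + q) / 2) q
  else (f p + f q) / 2 * (q - p).

Lemma trap_rev n f p q : trap n f q p = - trap n f p q.
Proof.
elim: n p q => [|n IH] p q /=; first by rewrite (addrC (f q)) -mulrN opprB.
by rewrite (addrC q) (IH _ q) (IH p) opprD [RHS]addrC.
Qed.
Lemma trapD n f g p q : trap n (fun z => f z + g z) p q = trap n f p q + trap n g p q.
Proof.
elim: n p q => [|n IH] p q /=; first by rewrite -mulrDl -mulrDl addrACA.
by rewrite !IH addrACA.
Qed.
Lemma trapZ n a f p q : trap n (fun z => a * f z) p q = a * trap n f p q.
Proof.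
elim: n p q => [|n IH] p q /=; first by rewrite -mulrDr !mulrA.
by rewrite !IH mulrDr.
Qed.
Lemma trap_rot n a f p q : trap n f (a * p) (a * q) = a * trap n (fun z => f (a * z)) p q.
Proof.
elim: n p q => [|n IH] p q /=; first by rewrite -mulrBr mulrCA.
by rewrite -mulrDr -mulrA !IH mulrDr.
Qed.
(** The trapezoidal rule is exact on affine functions, so their sums over a closed square vanish at
    every level; this takes the place of a primitive in Goursat's argument. *)
Lemma trap_aff n a b p q : trap n (fun z => a * z + b) p q = a / 2 * (q * q - p * p) + b * (q - p).
Proof.
elim: n p q => [|n IH] p q /=; first by field.
by rewrite !IH; field.
Qed.
Lemma trap_le n f p q (P : set K) (B : R) : P p -> P q ->
  (forall x y, P x -> P y -> P ((x + y) / 2)) -> (forall z, P z -> nm (f z) <= B) ->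
  nm (trap n f p q) <= B * nm (q - p).
Proof.
move=> Pp Pq Pm fB.
have nm2 : nm (2 : K) = 2 by rewrite -rc_nat nm_rc ger0_norm.
elim: n p q Pp Pq => [|n IH] p q Pp Pq /=.
  rewrite !nmM nmV nm2; apply: ler_wpM2r; first exact: nm_ge0.
  rewrite ler_pdivrMr //; apply: (le_trans (nmD _ _)); have := fB _ Pp; have := fB _ Pq; lra.
have Pr := Pm _ _ Pp Pq.
apply: (le_trans (nmD _ _)); apply: (le_trans (lerD (IH _ _ Pp Pr) (IH _ _ Pr Pq))).
have -> : (p + q) / 2 - p = (q - p) / 2 by field.
have -> : q - (p + q) / 2 = (q - p) / 2 by field.
by rewrite !nmM nmV nm2; lra.
Qed.

(** The corners of the square with centre 0 and side 2, counterclockwise from 1 + i. *)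
Definition corner (k : nat) : K := ii ^+ k * (1 + ii).
Lemma corner0 : corner 0 = 1 + ii. Proof. by rewrite /corner expr0 mul1r. Qed.
Lemma corner1 : corner 1 = -1 + ii.
Proof. by rewrite /corner expr1 mulrDr mulr1 iu_sqr addrC. Qed.
Lemma corner2 : corner 2 = -1 - ii.
Proof. by rewrite /corner expr2 iu_sqr mulN1r opprD. Qed.
Lemma corner3 : corner 3 = 1 - ii.
Proof. by rewrite /corner exprS expr2 iu_sqr mulrN1 mulNr mulrDr mulr1 iu_sqr opprD opprK addrC. Qed.
Definition cornerE := (corner0, corner1, corner2, corner3).
Lemma nm_corner k : nm (corner k) ^+ 2 = 2.
Proof.
by rewrite /corner nmM nmX nm_iu expr1n mul1r nm_sqr reD imD re1 im1 re_iu im_iu; ring.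
Qed.
Lemma nm_corner_le k : nm (corner k) <= 3 / 2.
Proof. by have := nm_corner k; have := nm_ge0 (corner k); nra. Qed.

Definition sqr_int n f c w : K :=
  trap n f (c + w * corner 0) (c + w * corner 1) + trap n f (c + w * corner 1) (c + w * corner 2) +
  trap n f (c + w * corner 2) (c + w * corner 3) + trap n f (c + w * corner 3) (c + w * corner 0).

Lemma sqr_intE n f c w p0 p1 p2 p3 : c + w * corner 0 = p0 -> c + w * corner 1 = p1 ->
  c + w * corner 2 = p2 -> c + w * corner 3 = p3 ->
  sqr_int n f c w = trap n f p0 p1 + trap n f p1 p2 + trap n f p2 p3 + trap n f p3 p0.
Proof. by rewrite /sqr_int => -> -> -> ->. Qed.

(** The identity is exact: a level n + 1 sum over a side splits at its midpoint into two level n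
    sums, and the inner edges are run through in both directions. *)
Lemma sqr_int_sub n f c w : sqr_int n.+1 f c w =
  \sum_(k < 4) sqr_int n f (c + w / 2 * corner k) (w / 2).
Proof.
rewrite !big_ord_recl big_ord0 /= /bump /= !add1n.
pose G x y := c + w * (x + y * ii).
rewrite (@sqr_intE n f (c + w / 2 * corner 0) _ (G 1 1) (G 0 1) (G 0 0) (G 1 0)); last 4 first;
  try by rewrite !cornerE /G; field.
rewrite (@sqr_intE n f (c + w / 2 * corner 1) _ (G 0 1) (G (-1) 1) (G (-1) 0) (G 0 0)); last 4 first;
  try by rewrite !cornerE /G; field.
rewrite (@sqr_intE n f (c + w / 2 * corner 2) _ (G 0 0) (G (-1) 0) (G (-1) (-1)) (G 0 (-1))); last 4 first;
  try by rewrite !cornerE /G; field.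
rewrite (@sqr_intE n f (c + w / 2 * corner 3) _ (G 1 0) (G 0 0) (G 0 (-1)) (G 1 (-1))); last 4 first;
  try by rewrite !cornerE /G; field.
rewrite (@sqr_intE n.+1 f c _ (G 1 1) (G (-1) 1) (G (-1) (-1)) (G 1 (-1))); last 4 first;
  try by rewrite !cornerE /G; ring.
rewrite /=.
have -> : (G 1 1 + G (-1) 1) / 2 = G 0 1 by rewrite /G; field.
have -> : (G (-1) 1 + G (-1) (-1)) / 2 = G (-1) 0 by rewrite /G; field.
have -> : (G (-1) (-1) + G 1 (-1)) / 2 = G 0 (-1) by rewrite /G; field.
have -> : (G 1 (-1) + G 1 1) / 2 = G 1 0 by rewrite /G; field.
rewrite (trap_rev _ _ (G 0 1) (G 0 0)) (trap_rev _ _ (G (-1) 0) (G 0 0)).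
rewrite (trap_rev _ _ (G 0 0) (G 0 (-1))) (trap_rev _ _ (G 0 0) (G 1 0)).
ring.
Qed.

Lemma sqr_intD n f g c w : sqr_int n (fun z => f z + g z) c w = sqr_int n f c w + sqr_int n g c w.
Proof. by rewrite /sqr_int !trapD; ring. Qed.
Lemma sqr_intZ n a f c w : sqr_int n (fun z => a * f z) c w = a * sqr_int n f c w.
Proof. by rewrite /sqr_int !trapZ; ring. Qed.
Lemma sqr_int_aff n a b c w : sqr_int n (fun z => a * z + b) c w = 0.
Proof. by rewrite /sqr_int !trap_aff; field. Qed.

Lemma nm_edge c w k l : nm ((c + w * corner k) - (c + w * corner l)) = nm w * nm (corner k - corner l).
Proof. by rewrite opprD addrACA subrr add0r -mulrBr nmM. Qed.

Lemma nm_cornerS k : nm (corner k.+1 - corner k) = 2.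
Proof.
have -> : corner k.+1 - corner k = ii ^+ k * (-2).
  have e : ii * (1 + ii) = ii - 1 by rewrite mulrDr mulr1 iu_sqr.
  by rewrite /corner exprSr -mulrA -mulrBr e; congr (_ * _); ring.
by rewrite nmM nmX nm_iu expr1n mul1r nmN -rc_nat nm_rc ger0_norm.
Qed.
Lemma nm_corner03 : nm (corner 0 - corner 3) = 2.
Proof.
have -> : corner 0 - corner 3 = 2 * ii by rewrite !cornerE; ring.
by rewrite nmM nm_iu mulr1 -rc_nat nm_rc ger0_norm.
Qed.

Lemma sqr_int_ball n f c w (z0 : K) (d B : R) : (forall k, nm (c + w * corner k - z0) <= d) ->
  (forall z, nm (z - z0) <= d -> nm (f z) <= B) -> nm (sqr_int n f c w) <= 8 * B * nm w.
Proof.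
move=> hc fB; have nm2 : nm (2 : K) = 2 by rewrite -rc_nat nm_rc ger0_norm.
pose P : set K := [set z | nm (z - z0) <= d].
have Pm x y : P x -> P y -> P ((x + y) / 2).
  rewrite /P /= => hx hy; have -> : (x + y) / 2 - z0 = ((x - z0) + (y - z0)) / 2 by field.
  by rewrite nmM nmV nm2 ler_pdivrMr //; apply: (le_trans (nmD _ _)); lra.
have B1 k l : nm (corner k - corner l) = 2 ->
    nm (trap n f (c + w * corner l) (c + w * corner k)) <= 2 * B * nm w.
  move=> e; apply: (le_trans (@trap_le n f _ _ P B (hc l) (hc k) Pm fB)).
  by rewrite nm_edge e; lra.
rewrite /sqr_int.
have h0 := B1 1%N 0%N (nm_cornerS 0); have h1 := B1 2 1%N (nm_cornerS 1).
have h2 := B1 3 2 (nm_cornerS 2); have h3 := B1 0%N 3 nm_corner03.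
apply: (le_trans (nmD _ _)); apply: le_trans (lerD _ h3) _; last first.
  2: apply: (le_trans (nmD _ _)); apply: lerD h2; apply: (le_trans (nmD _ _)); exact: lerD h0 h1.
lra.
Qed.

Definition cder g z (d : K) := forall e : R, 0 < e -> exists2 r : R, 0 < r &
  forall h, nm h < r -> nm (g (z + h) - g z - d * h) <= e * nm h.

(* If the level-n sums over a square do not become small relative to its area,
   the same happens on one of its quarters. *)
Definition goursat_bad f c (w : R) (eta : R) := forall N : nat, exists n, (N <= n)%N /\ eta * w ^+ 2 < nm (sqr_int n f c (rc w)).

Lemma bad_sub f c (w eta : R) : goursat_bad f c w eta -> exists k, goursat_bad f (c + rc (w / 2) * corner k) (w / 2) eta.
Proof.
move=> hb; apply: contrapT => nb.
have /choice[N hN] : forall k, exists N, forall n, (N <= n)%N ->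
    nm (sqr_int n f (c + rc (w / 2) * corner k) (rc (w / 2))) <= eta * (w / 2) ^+ 2.
  move=> k; have /existsNP[N hN] : ~ goursat_bad f (c + rc (w / 2) * corner k) (w / 2) eta by move=> h; apply: nb; exists k.
  exists N => n Nn; rewrite leNgt; apply/negP => h; apply: hN; exists n; split=> //.
have [n [Nn]] := hb (\sum_(k < 4) N k).+1.
case: n Nn => // n; rewrite ltnS => Nn; rewrite sqr_int_sub ltNge => /negP; apply.
have -> : rc w / 2 = rc (w / 2) by rewrite rcM rcV rc_nat.
rewrite !big_ord_recl big_ord0 /= /bump /= !add1n addr0.
have hh k : (k < 4)%N -> nm (sqr_int n f (c + rc (w / 2) * corner k) (rc (w / 2))) <= eta * (w / 2) ^+ 2.
  by move=> k4; apply: hN; apply: leq_trans Nn; rewrite (bigD1 (Ordinal k4)) //= leq_addr.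
have := hh 0%N isT; have := hh 1%N isT; have := hh 2 isT; have := hh 3 isT => h3 h2 h1 h0.
have -> : eta * w ^+ 2 = eta * (w / 2) ^+ 2 + (eta * (w / 2) ^+ 2 + (eta * (w / 2) ^+ 2 + eta * (w / 2) ^+ 2)) by field.
by do 3![apply: (le_trans (nmD _ _)); apply: lerD => //].
Qed.

(** Nested bad quarters shrink to a point z. Near z the function is affine up to a small multiple of
    the distance, and affine functions contribute 0. *)
Lemma goursat f c (w : R) (eta : R) : 0 < w -> 0 < eta ->
  (forall z, nm (z - c) <= 3 / 2 * w -> exists d, cder f z d) ->
  exists N, forall n, (N <= n)%N -> nm (sqr_int n f c (rc w)) <= eta * w ^+ 2.
Proof.
move=> w0 eta0 fd; apply: contrapT => nN.
have hb : goursat_bad f c w eta.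
  move=> N; apply: contrapT => h; apply: nN; exists N => n Nn; rewrite leNgt; apply/negP => h1.
  by apply: h; exists n.
pose wj j : R := w * (2^-1) ^+ j.
have wj0 j : 0 < wj j by rewrite mulr_gt0 // halfX_gt0.
have wjS j : wj j / 2 = wj j.+1 by rewrite /wj exprS; lra.
have /choice[nx hnx] : forall jc : nat * K, exists c', goursat_bad f jc.2 (wj jc.1) eta ->
    goursat_bad f c' (wj jc.1.+1) eta /\ nm (c' - jc.2) <= 3 / 4 * wj jc.1.
  move=> [j c1] /=; have [hj|] := pselect (goursat_bad f c1 (wj j) eta); last by exists 0.
  have [k hk] := bad_sub hj; exists (c1 + rc (wj j / 2) * corner k) => _.
  rewrite -wjS; split=> //; rewrite addrAC subrr add0r nmM nm_rc gtr0_norm ?divr_gt0 //.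
  have := nm_corner_le k; have := wj0 j; nra.
pose cj := fix cj n := if n is m.+1 then nx (m, cj m) else c.
have badj j : goursat_bad f (cj j) (wj j) eta.
  elim: j => [|j IH]; first by rewrite /wj expr0 mulr1.
  by have [] := hnx (j, cj j) IH.
have [|z hz] := geo_cvg (W := K^o) (s := cj) (c := 3 / 4 * w) (@seqcomplete_K R).
  by move=> n; have [_] := hnx (n, cj n) (badj n); rewrite /= /wj mulrA.
have hz' j : nm (z - cj j) <= 3 / 2 * wj j.
  by apply: (le_trans (hz j)); rewrite /wj; lra.
have [d hd] : exists d, cder f z d by apply: fd; have := hz' 0%N; rewrite /wj expr0 mulr1.
(* The j-th square lies within three times its half-side of z, and [sqr_int_ball] has the factor 8:
   8 * 3 / 32 is below 1. *)
have [r r0 hr] := hd (eta / 32) ltac:(lra).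
have rw : 0 < r / (4 * w) by rewrite divr_gt0 // mulr_gt0.
have [j hj] := half_pow rw; rewrite ltr_pdivlMr ?mulr_gt0 // in hj.
have [n [_]] := badj j 0%N; rewrite ltNge => /negP; apply.
have -> : f = (fun u => (d * u + (f z - d * z)) + (f u - f z - d * (u - z))).
  by apply: funext => u; ring.
rewrite sqr_intD sqr_int_aff add0r.
have wjr : 3 * wj j < r by have := wj0 j; rewrite /wj; lra.
have := @sqr_int_ball n (fun u => f u - f z - d * (u - z)) (cj j) (rc (wj j)) z (3 * wj j) (eta / 32 * (3 * wj j)).
rewrite nm_rc gtr0_norm // => h; apply: (le_trans (h _ _)) => [k|u hu|].
- have -> : cj j + rc (wj j) * corner k - z = rc (wj j) * corner k - (z - cj j) by ring.
  apply: (le_trans (nmB _ _)); rewrite nmM nm_rc gtr0_norm //.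
  by have := hz' j; have := nm_corner_le k; have := wj0 j; nra.
- have := hr (u - z) (le_lt_trans hu wjr); rewrite [z + _]addrC subrK => h1; apply: (le_trans h1).
  by apply: ler_wpM2l => //; lra.
- have := wj0 j; nra.
Qed.
End Cauchy.

(** * Annuli around the origin and the kernel 1/z^2 *)

Section Cauchy1.
Context {R : realType}.
Local Notation K := (Cplx R).
Local Notation ii := (iu : K).
Implicit Types (f g : K -> K).

Lemma rc_half (x : R) : rc x / 2 = rc (x / 2).
Proof. by rewrite rcM rcV rc_nat. Qed.
Lemma half_rc : (2 : K)^-1 = rc 2^-1.
Proof. by rewrite rcV rc_nat. Qed.

Lemma cornerSS k : corner k.+2 = - corner k :> K.
Proof. by rewrite /corner !exprS mulrA iu_sqr mulN1r mulNr. Qed.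

(** Cutting a square twice gives cells centred at multiples of 2 * corner k + corner l. Those with l
    = k + 2 modulo 4 are the four touching the origin; all other centres keep a distance twice the
    radius 3/2 required by [goursat]. *)
Lemma corner_far k l : (k < 4)%N -> (l < 4)%N -> l != ((k + 2) %% 4)%N ->
  3 <= nm (2 * corner k + corner l : K).
Proof.
have h (z : K) : 9 <= re z ^+ 2 + im z ^+ 2 -> 3 <= nm z.
  by rewrite -nm_sqr; have := nm_ge0 z; nra.
have E1 : (2 : K) = rc 2 by rewrite rc_nat.
by move: k l => [|[|[|[|k]]]] [|[|[|[|l]]]] //= _ _ _; apply: h; rewrite !cornerE E1;
  rewrite !(reD, imD, reM, imM, reN, imN, re_rc, im_rc, re1, im1, re_iu, im_iu); lra.
Qed.

(** Of the sixteen cells of the large square, four make up the half-size square and the other twelve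
    fall under [goursat]. Two subdivisions against one explain the shift of level by 1. *)
Lemma annulus f (w eta : R) : 0 < w -> 0 < eta -> (forall z, z != 0 -> exists d, cder f z d) ->
  exists N, forall n, (N <= n)%N ->
    nm (sqr_int n.+1 f 0 (rc w) - sqr_int n f 0 (rc (w / 2))) <= eta.
Proof.
move=> w0 eta0 fd; pose v := w / 4; have v0 : 0 < v by rewrite divr_gt0.
pose c k l : K := rc v * (2 * corner k + corner l).
pose eta' := eta / (16 * v ^+ 2).
have e0 : 0 < eta' by rewrite divr_gt0 // mulr_gt0 // exprn_gt0.
have ev : eta' * v ^+ 2 = eta / 16.
  by rewrite /eta'; field; rewrite lt0r_neq0.
have /choice[N hN] : forall kl : 'I_4 * 'I_4, exists N, (kl.2 : nat) != ((kl.1 + 2) %% 4)%N -> forall n, (N <= n)%N ->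
    nm (sqr_int n f (c kl.1 kl.2) (rc v)) <= eta / 16.
  move=> [k l] /=; have [->|hkl] := eqVneq (l : nat) ((k + 2) %% 4)%N; first by exists 0%N.
  have [z hz|N hN] := goursat (f := f) (c := c k l) v0 e0.
    apply: fd; apply: contraTneq hz => ->; rewrite sub0r nmN /c nmM nm_rc gtr0_norm // -ltNge.
    by have := corner_far (ltn_ord k) (ltn_ord l) hkl; nra.
  by exists N => _ n /hN; rewrite ev.
(* The level must be at least 1 for the large square to be subdivided twice and the small one
   once. *)
exists (\sum_kl N kl).+1 => -[//|n]; rewrite ltnS => Nn.
rewrite !sqr_int_sub.
have E1 : rc w / 2 = rc (2 * v) by rewrite rc_half /v; congr rc; field.
have E2 : rc (w / 2) / 2 = rc v by rewrite rc_half /v; congr rc; field.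
have E3 : rc (2 * v) / 2 = rc v by rewrite rc_half; congr rc; field.
rewrite E1 E2 -sumrB; apply: (le_trans (nm_sum _ _ _)).
have -> : eta = \sum_(k < 4) (eta / 4) by rewrite sumr_const card_ord -mulr_natr; field.
apply: ler_sum => k _; rewrite sqr_int_sub E3.
pose ok : 'I_4 := Ordinal (ltn_pmod (k + 2) (isT : (0 < 4)%N)).
rewrite (bigD1 ok) //=.
have -> : 0 + rc (2 * v) * corner k + rc v * corner ((k + 2) %% 4)%N = 0 + rc v * corner k.
  rewrite add0r add0r; have -> : corner ((k + 2) %% 4)%N = - corner k :> K.
    case: k {ok} => [[|[|[|[|//]]]] /= _].
    - by rewrite [LHS](corner2 : corner (0 + 2 %% 4)%N = _) corner0; ring.
    - by rewrite [LHS](corner3 : corner ((1 + 2) %% 4)%N = _) corner1; ring.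
    - by rewrite [LHS](corner0 : corner ((2 + 2) %% 4)%N = _) corner2; ring.
    - by rewrite [LHS](corner1 : corner ((3 + 2) %% 4)%N = _) corner3; ring.
  by rewrite rcM rc_nat; ring.
rewrite addrAC subrr add0r; apply: (le_trans (nm_sum _ _ _)).
apply: le_trans (_ : \sum_(l < 4) eta / 16 <= _); last by rewrite sumr_const card_ord -mulr_natr; lra.
rewrite big_mkcond /=; apply: ler_sum => l _; case: ifP => [hl|_]; last by rewrite divr_ge0 // ltW.
have := hN (k, l) hl n; rewrite /c /= rcM rc_nat add0r => h.
have -> : 2 * rc v * corner k + rc v * corner l = rc v * (2 * corner k + corner l) :> K by ring.
by apply: h; apply: leq_trans Nn; rewrite (bigD1 (k, l)) //= leq_addr.
Qed.

Lemma annuli f (w eta : R) j : 0 < w -> 0 < eta -> (forall z, z != 0 -> exists d, cder f z d) ->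
  exists N, forall n, (N <= n)%N ->
    nm (sqr_int (n + j) f 0 (rc w) - sqr_int n f 0 (rc (w * (2^-1) ^+ j))) <= eta.
Proof.
move=> w0 e0 fd; elim: j w eta w0 e0 => [|j IH] w eta w0 e0.
  by exists 0%N => n _; rewrite addn0 expr0 mulr1 subrr nm0 ltW.
have w2 : 0 < w / 2 by rewrite divr_gt0.
have e2 : 0 < eta / 2 by rewrite divr_gt0.
have [N hN] := IH _ _ w2 e2; have [N' hN'] := annulus w0 e2 fd.
exists (N + N')%N => n Nn; apply: (le_trans (nm_tri _ (sqr_int (n + j) f 0 (rc (w / 2))) _)).
have -> : eta = eta / 2 + eta / 2 by lra.
apply: lerD; first by rewrite addnS; apply: hN'; apply: leq_trans (leq_trans (leq_addl N _) Nn) (leq_addr _ _).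
by rewrite exprS mulrA; apply: hN; apply: leq_trans (leq_addr _ _) Nn.
Qed.

(** The four sides are the rotations of the top side by powers of i. *)
Lemma sqr_int_rot n f (w : K) : sqr_int n f 0 w =
  \sum_(k < 4) ii ^+ k * trap n (fun z => f (ii ^+ k * z)) (w * corner 0) (w * corner 1).
Proof.
have E k l : ii ^+ k * (w * corner l) = w * corner (k + l).
  by rewrite /corner exprD; ring.
rewrite !big_ord_recl big_ord0 /= /bump /= !add1n addr0 -!trap_rot !E /sqr_int !add0r !addrA.
by rewrite -(opprK (corner 0)) -!cornerSS.
Qed.

Lemma nm_iuX k : nm (ii ^+ k) = 1.
Proof. by rewrite nmX nm_iu expr1n. Qed.

Lemma sqr_int_edge n f (r B : R) : 0 < r -> (forall z, r <= nm z -> nm z <= 2 * r -> nm (f z) <= B) ->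
  nm (sqr_int n f 0 (rc r)) <= 8 * B * r.
Proof.
move=> r0 fB; rewrite sqr_int_rot; apply: (le_trans (nm_sum _ _ _)).
have -> : 8 * B * r = \sum_(k < 4) (2 * B * r) by rewrite sumr_const card_ord -mulr_natr; ring.
have nm2 : nm (2 : K) = 2 by rewrite -rc_nat nm_rc ger0_norm.
apply: ler_sum => k _; rewrite nmM nm_iuX mul1r.
(* After rotation only the top side matters; its points have imaginary part r, hence modulus at
   least r, and modulus at most 2 r. *)
pose P : set K := [set z | im z = r /\ nm z <= 2 * r].
have Pc j : (j < 2)%N -> P (rc r * corner j).
  move=> j2; split; last by rewrite nmM nm_rc gtr0_norm //; have := nm_corner_le j (R := R); nra.
  by case: j j2 => [|[|//]] _; rewrite !cornerE !(reD, imD, reM, imM, reN, imN, re_rc, im_rc, re1, im1, re_iu, im_iu); ring.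
have := @trap_le R n (fun z => f (ii ^+ k * z)) _ _ P B (Pc 0%N isT) (Pc 1%N isT).
rewrite -mulrBr nmM nm_rc gtr0_norm // nm_cornerS => h; apply: (le_trans (h _ _)); last by lra.
- move=> x y [hx hx'] [hy hy']; split.
    rewrite half_rc imM imD re_rc im_rc hx hy; lra.
  by rewrite nmM nmV nm2 ler_pdivrMr //; apply: (le_trans (nmD _ _)); lra.
- move=> z [z1 z2]; apply: fB; rewrite nmM nm_iuX mul1r //.
  by rewrite -z1 im_le_nm.
Qed.

(** By the rotation formula the sum carries the factor \sum_k i^k i^(-2k) = 0, so it vanishes
    exactly at every level. *)
Lemma sqr_int_inv2 n (w : K) : sqr_int n (fun z => z^-1 * z^-1) 0 w = 0.
Proof.
rewrite sqr_int_rot.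
rewrite (eq_bigr (fun k : 'I_4 => (ii ^+ k * ((ii ^+ k)^-1 * (ii ^+ k)^-1)) *
    trap n (fun z => z^-1 * z^-1) (w * corner 0) (w * corner 1))); last first.
  move=> k _; rewrite -mulrA -[in RHS]trapZ; congr (_ * trap _ _ _ _).
  by apply: funext => z; rewrite invfM; ring.
rewrite -mulr_suml; suff -> : \sum_(k < 4) ii ^+ k * ((ii ^+ k)^-1 * (ii ^+ k)^-1) = 0 by rewrite mul0r.
have iV : ii^-1 = - ii by apply: mulr1_eq; rewrite mulrN iu_sqr opprK.
rewrite !big_ord_recl big_ord0 /= /bump /= !add1n !exprS expr0 !invfM iV !mulr1 invr1.
rewrite !(mulrN, mulNr, mulrA, iu_sqr, mulr1, mul1r, opprK, invr1); ring.
Qed.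

Lemma inv_edge (r s : R) : 0 < r -> (rc r * (rc s + ii))^-1 = rc (r * (1 + s ^+ 2))^-1 * (rc s - ii).
Proof.
move=> r0; apply: mulr1_eq.
have p : r * (1 + s ^+ 2) != 0 by apply: lt0r_neq0; have := sqr_ge0 s; nra.
have -> : rc r * (rc s + ii) * (rc (r * (1 + s ^+ 2))^-1 * (rc s - ii)) =
  rc (r * (1 + s ^+ 2))^-1 * (rc r * (rc s * rc s - ii * ii)) by ring.
rewrite iu_sqr opprK -rc1 -!rcM -rcD -!rcM; congr rc.
by rewrite -expr2 [s ^+ 2 + 1]addrC mulVf.
Qed.

Lemma trap0E f p q : trap 0 f p q = (f p + f q) / 2 * (q - p).
Proof. by []. Qed.
Lemma trapSE n f p q : trap n.+1 f p q = trap n f p ((p + q) / 2) + trap n f ((p + q) / 2) q.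
Proof. by []. Qed.

(** On the top side the integrand contributes 1 / (r * (1 + s^2)) to the imaginary part, which is at
    least 1 / (2 r). *)
Lemma trap_inv n (r s t : R) : 0 < r -> -1 <= t -> t <= s -> s <= 1 ->
  (s - t) / 2 <= im (trap n (fun z => z^-1) (rc r * (rc s + ii)) (rc r * (rc t + ii))).
Proof.
move=> r0; elim: n s t => [|n IH] s t t1 ts s1; rewrite ?trapSE ?trap0E.  rewrite -mulrBr opprD addrACA subrr addr0 -rcB -rcM !inv_edge // half_rc.
  rewrite !(imM, reM, imD, re_rc, im_rc, imN, im_iu) !mulr0 !mul0r !add0r !addr0.
  have h x : -1 <= x -> x <= 1 -> (r * (1 + x ^+ 2))^-1 >= (2 * r)^-1.
    move=> x1 x2; have h := sqr_ge0 x; have h' : x ^+ 2 <= 1 by nra.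
    have p : 0 < r * (1 + x ^+ 2) by apply: mulr_gt0 => //; lra.
    have p2 : 0 < 2 * r by lra.
    rewrite lef_pV2 ?posrE // mulrC; apply: ler_wpM2r; [exact: ltW|lra].
  have hs := h s ltac:(lra) s1; have ht := h t t1 ltac:(lra).
  move: hs ht; set a := (r * (1 + s ^+ 2))^-1; set b := (r * (1 + t ^+ 2))^-1 => hs ht.
  have e : (2 * r)^-1 * r = 2^-1 by rewrite invfM -mulrA mulVf ?mulr1 // lt0r_neq0.
  have ha : 2^-1 <= a * r by rewrite -e; apply: ler_wpM2r => //; exact: ltW.
  have hb : 2^-1 <= b * r by rewrite -e; apply: ler_wpM2r => //; exact: ltW.
  have -> : (a * - 1 + b * - 1) / 2 * (r * (t - s)) = (a * r + b * r) / 2 * (s - t) by ring.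
  have : 0 <= s - t by lra.
  nra.
have -> : (rc r * (rc s + ii) + rc r * (rc t + ii)) / 2 = rc r * (rc ((s + t) / 2) + ii).
  by rewrite [rc (_ / _)]rcM rcD rcV rc_nat; field.
have h1 := IH s ((s + t) / 2) ltac:(lra) ltac:(lra) s1.
have h2 := IH ((s + t) / 2) t t1 ltac:(lra) ltac:(lra).
by rewrite imD; lra.
Qed.

(** A lower bound in place of the value 2 pi i: each of the four sides contributes the same number,
    of imaginary part at least 1. *)
Lemma sqr_int_inv n (r : R) : 0 < r -> 4 <= nm (sqr_int n (fun z => z^-1) 0 (rc r) : K).
Proof.
move=> r0; rewrite sqr_int_rot.
rewrite (eq_bigr (fun k : 'I_4 => trap n (fun z => z^-1) (rc r * corner 0) (rc r * corner 1))); last first.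
  move=> k _; rewrite (_ : (fun z => _) = (fun z => (ii ^+ k)^-1 * z^-1)).
    by rewrite trapZ mulrA mulfV ?mul1r // expf_neq0 //; apply/eqP => h; have := @nm_iu R; rewrite h nm0 => h1; lra.
  by apply: funext => z; rewrite invfM.
rewrite sumr_const card_ord -[X in nm X]mulr_natl nmM -rc_nat nm_rc ger0_norm //.
apply: le_trans (_ : 4 * 1 <= _); first lra.
apply: ler_wpM2l => //; apply: le_trans (im_le_nm _).
have := @trap_inv n r 1 (-1) r0; rewrite rc1 rcN rc1 !cornerE => h; apply: le_trans (h _ _ _); lra.
Qed.

Lemma cder_mul f g z (d e : K) : cder f z d -> cder g z e -> cder (fun u => f u * g u) z (d * g z + f z * e).
Proof.
move=> hf hg eps eps0.
pose A := nm (f z) + nm (g z) + 1; pose B := (nm d + 1) * (nm e + 1).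
have A0 : 0 < A by have := nm_ge0 (f z); have := nm_ge0 (g z); rewrite /A; lra.
have B0 : 0 < B by apply: mulr_gt0; [have := nm_ge0 d|have := nm_ge0 e]; lra.
have e1 : 0 < eps / (2 * A) by rewrite divr_gt0 // mulr_gt0.
have [r1 r10 h1] := hf _ e1; have [r2 r20 h2] := hg _ e1.
have [r3 r30 h3] := hf _ ltr01; have [r4 r40 h4] := hg _ ltr01.
pose r := Num.min (Num.min r1 r2) (Num.min (Num.min r3 r4) (eps / (2 * B))).
exists r => [|h]; first by rewrite !lt_min r10 r20 r30 r40 divr_gt0 // mulr_gt0.
rewrite !lt_min => /andP[/andP[k1 k2] /andP[/andP[k3 k4] k5]].
have := h1 h k1; have := h2 h k2; have := h3 h k3; have := h4 h k4.
set a := f (z + h); set b := g (z + h) => q4 q3 q2 q1.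
have -> : a * b - f z * g z - (d * g z + f z * e) * h =
  (a - f z) * (b - g z) + ((a - f z - d * h) * g z + f z * (b - g z - e * h)) by ring.
have p1 : nm (a - f z) <= (nm d + 1) * nm h.
  have -> : a - f z = (a - f z - d * h) + d * h by rewrite subrK.
  by apply: (le_trans (nmD _ _)); rewrite nmM; lra.
have p2 : nm (b - g z) <= (nm e + 1) * nm h.
  have -> : b - g z = (b - g z - e * h) + e * h by rewrite subrK.
  by apply: (le_trans (nmD _ _)); rewrite nmM; lra.
apply: (le_trans (nmD _ _)); have -> : eps * nm h = eps / 2 * nm h + eps / 2 * nm h by lra.
apply: lerD.
  rewrite nmM; apply: (le_trans (ler_pM (nm_ge0 _) (nm_ge0 _) p1 p2)).
  have B2 : 0 < 2 * B by lra.
  rewrite mulrACA -/B; rewrite ltr_pdivlMr // in k5.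
  by have := nm_ge0 h; nra.
apply: (le_trans (nmD _ _)); rewrite !nmM.
have t1 : nm (a - f z - d * h) * nm (g z) <= eps / (2 * A) * nm h * nm (g z) by apply: ler_wpM2r => //; exact: nm_ge0.
have t2 : nm (f z) * nm (b - g z - e * h) <= nm (f z) * (eps / (2 * A) * nm h) by apply: ler_wpM2l => //; exact: nm_ge0.
apply: (le_trans (lerD t1 t2)).
have -> : eps / (2 * A) * nm h * nm (g z) + nm (f z) * (eps / (2 * A) * nm h) = eps / (2 * A) * nm h * (nm (f z) + nm (g z)) by ring.
have -> : eps / 2 * nm h = eps / (2 * A) * nm h * A by field; rewrite lt0r_neq0.
apply: ler_wpM2l; last by rewrite /A; lra.
by apply: mulr_ge0; [exact: ltW|exact: nm_ge0].
Qed.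

Lemma cder_inv (z : K) : z != 0 -> cder (fun u => u^-1) z (- (z^-1 * z^-1)).
Proof.
move=> z0 e e0; have n0 := nm_gt0 z0.
exists (Num.min (nm z / 2) (e * nm z ^+ 3 / 2)) => [|h].
  by rewrite lt_min !divr_gt0 // mulr_gt0 // exprn_gt0.
rewrite lt_min => /andP[h1 h2].
have zh : nm z / 2 <= nm (z + h) by have := nm_Bge z (- h); rewrite nmN opprK; lra.
have zh0 : z + h != 0 by apply/eqP => hz; move: zh; rewrite hz nm0; lra.
have -> : (z + h)^-1 - z^-1 - - (z^-1 * z^-1) * h = (h * h) * (z^-1 * z^-1 * (z + h)^-1).
  by field; rewrite z0 zh0.
rewrite !nmM !nmV -mulrA [e * _]mulrC; apply: ler_wpM2l; first exact: nm_ge0.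
rewrite -!invfM -expr2 ler_pdivrMr; last by rewrite mulr_gt0 ?exprn_gt0 //; lra.
have : e * nm z ^+ 3 / 2 = e * (nm z ^+ 2 * (nm z / 2)) by rewrite exprSr; ring.
move=> e1; apply: (le_trans (ltW h2)); rewrite e1; apply: ler_wpM2l; first exact: ltW.
by apply: ler_wpM2l => //; exact: sqr_ge0.
Qed.

(** Write g(z) / z^2 as g(0) / z^2 + d / z plus a remainder of order o(1) / |z|. Over a small square
    the first term gives 0, the second at least 4 |d|, the third little. [annuli] compares with the
    square of size r, whose sum is at most 8 M / r. *)
Theorem cauchy_estimate g (d : K) (M r : R) : 0 < r -> (forall z, exists d, cder g z d) ->
  (forall z, nm z <= 2 * r -> nm (g z) <= M) -> cder g 0 d -> nm d <= 2 * M / r.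
Proof.
move=> r0 gd gM hd; apply/ler_addgt0Pr => e e0.
(* The remainder costs eight times this amount and the annuli once, in all 4 e, against 4 |d| on the
   left. *)
have e9 : 0 < e * 4 / 9 by lra.
have [dl dl0 hdl] := hd _ e9.
have q0 : 0 < dl / (2 * r) by rewrite divr_gt0 // mulr_gt0.
have [j hj] := half_pow q0; rewrite ltr_pdivlMr ?mulr_gt0 // in hj.
pose s := r * (2^-1) ^+ j; have s0 : 0 < s by rewrite mulr_gt0 // halfX_gt0.
pose f z := g z * (z^-1 * z^-1).
have fd z : z != 0 -> exists d, cder f z d.
  move=> z0; have [dg hg] := gd z; have hi := cder_inv z0.
  by eexists; apply: (cder_mul hg (cder_mul hi hi)).
have [N hN] := annuli j r0 e9 fd; have := hN N (leqnn _); rewrite -/s => h1.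
have h2 : nm (sqr_int (N + j) f 0 (rc r)) <= 8 * (M / r ^+ 2) * r.
  apply: sqr_int_edge => // z z1 z2; rewrite /f !nmM !nmV -invfM -expr2.
  have M0 : 0 <= M by apply: le_trans (nm_ge0 _) (gM 0 _); rewrite nm0; lra.
  apply: ler_pM; [exact: nm_ge0|by rewrite invr_ge0 sqr_ge0|exact: gM|].
  by rewrite lef_pV2 ?posrE ?exprn_gt0 //; [rewrite ler_sqr ?nnegrE //; lra|lra].
have h3 : nm (sqr_int N (fun z => (g z - g 0 - d * z) * (z^-1 * z^-1)) 0 (rc s)) <= 8 * (e * 4 / 9 / s) * s.
  apply: sqr_int_edge => // z z1 z2; have n0 : 0 < nm z by lra.
  have zdl : nm z < dl by apply: (le_lt_trans z2); move: hj; rewrite /s; lra.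
  have := hdl z zdl; rewrite add0r => h; rewrite !nmM !nmV.
  apply: (le_trans (ler_wpM2r _ h)); first by rewrite mulr_ge0 // invr_ge0 ltW.
  rewrite -[leLHS]mulrA mulVKf ?lt0r_neq0 //; apply: ler_wpM2l; first exact: ltW.
  by rewrite lef_pV2 ?posrE.
(* At z = 0 the inverse is 0 by convention, and both sides vanish. *)
have fE : f = (fun z => (g 0 * (z^-1 * z^-1) + d * z^-1) + (g z - g 0 - d * z) * (z^-1 * z^-1)).
  apply: funext => z; rewrite /f; have [->|z0] := eqVneq z 0; last by field.
  by rewrite invr0 !mulr0 !addr0.
have h4 : nm d * 4 <= 8 * (M / r ^+ 2) * r + 8 * (e * 4 / 9 / s) * s + e * 4 / 9.
  apply: le_trans (_ : nm (d * sqr_int N (fun z => z^-1) 0 (rc s)) <= _).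
    by rewrite nmM; apply: ler_wpM2l; [exact: nm_ge0|exact: sqr_int_inv].
  have : sqr_int N f 0 (rc s) = d * sqr_int N (fun z => z^-1) 0 (rc s) + sqr_int N (fun z => (g z - g 0 - d * z) * (z^-1 * z^-1)) 0 (rc s).
    by rewrite fE sqr_intD sqr_intD !sqr_intZ sqr_int_inv2 mulr0 add0r.
  move=> h; have -> : d * sqr_int N (fun z => z^-1) 0 (rc s) = sqr_int N f 0 (rc s) - sqr_int N (fun z => (g z - g 0 - d * z) * (z^-1 * z^-1)) 0 (rc s).
    by rewrite h addrK.
  apply: (le_trans (nmB _ _)).
  have := nm_tri (sqr_int N f 0 (rc s)) (sqr_int (N + j) f 0 (rc r)) 0; rewrite !subr0 nmBC => h5.
  lra.
have e1 : 8 * (M / r ^+ 2) * r = 8 * (M / r) by field; rewrite lt0r_neq0.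
have e2 : 8 * (e * 4 / 9 / s) * s = 8 * (e * 4 / 9) by rewrite -mulrA divfK // lt0r_neq0.
rewrite e1 e2 in h4; rewrite -mulrA; lra.
Qed.
End Cauchy1.

(** * Entire maps of bounded type and their Taylor series *)

Section MeanValue.
Context {R : realType}.
Local Notation K := (Cplx R).

Lemma pow_diff_ge (m : nat) (a b : R) : 0 <= a -> a <= b -> m.+1%:R * a ^+ m * (b - a) <= b ^+ m.+1 - a ^+ m.+1.
Proof.
move=> a0 ab; elim: m => [|m IH]; first by rewrite expr0 !expr1; lra.
have -> : b ^+ m.+2 - a ^+ m.+2 = b * (b ^+ m.+1 - a ^+ m.+1) + (b - a) * a ^+ m.+1 by rewrite !exprS; ring.
have h1 : b * (m.+1%:R * a ^+ m * (b - a)) <= b * (b ^+ m.+1 - a ^+ m.+1) by apply: ler_wpM2l => //; lra.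
apply: le_trans (lerD h1 (lexx _)).
have p : 0 <= m.+1%:R * a ^+ m * (b - a).
  by apply: mulr_ge0; [apply: mulr_ge0 => //; exact: exprn_ge0|lra].
rewrite -[m.+2%:R]natr1 exprS.
have -> : (m.+1%:R + 1) * (a * a ^+ m) * (b - a) = a * (m.+1%:R * a ^+ m * (b - a)) + (b - a) * (a * a ^+ m) by ring.
by apply: lerD => //; apply: ler_wpM2r.
Qed.

Lemma pow_diff_le (m : nat) (a b : R) : 0 <= a <= 1 -> 0 <= b <= 1 -> b ^+ m - a ^+ m <= m%:R * `|b - a|.
Proof.
move=> /andP[a0 a1] /andP[b0 b1]; elim: m => [|m IH]; first by rewrite !expr0 subrr mul0r.
have -> : b ^+ m.+1 - a ^+ m.+1 = b * (b ^+ m - a ^+ m) + (b - a) * a ^+ m by rewrite !exprS; ring.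
have am : a ^+ m <= 1 by rewrite exprn_ile1.
have am0 : 0 <= a ^+ m by rewrite exprn_ge0.
have := ler_norm (b - a); have := normr_ge0 (b - a); move: (`|b - a|) IH => d IH d0 hd.
rewrite -[m.+1%:R]natr1 [leRHS]mulrDl mul1r.
have q : 0 <= m%:R * d by rewrite mulr_ge0.
move: q IH; set u := m%:R * d; set v := b ^+ m - a ^+ m => q IH.
have [v0|v0] := leP 0 v; nra.
Qed.

Definition wder {W : normedModType K} (F : K -> W) (z : K) (d : W) := forall e : R, 0 < e ->
  exists2 r : R, 0 < r & forall h, nm h < r -> nm (F (z + h) - F z - h *: d) <= e * nm h.

(* The power of t in the bound produces the factorials of Taylor's formula. *)
Lemma mean_value (W : normedModType K) (F : K -> W) (dF : R -> W) (c : R) (m : nat) :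
  (forall t, 0 <= t <= 1 -> wder F (rc t) (dF t)) ->
  (forall t, 0 <= t <= 1 -> nm (dF t) <= c * t ^+ m) -> nm (F 1 - F 0) <= c / m.+1%:R.
Proof.
move=> Fd dFb; rewrite leNgt; apply/negP => hlt.
have h01 : 0 <= (1 : R) <= 1 by rewrite ler01 lexx.
have c0 : 0 <= c by have := dFb 1 h01; rewrite expr1n mulr1; exact: le_trans (nm_ge0 _).
pose k (t : R) := c / m.+1%:R * t ^+ m.+1; pose h (t : R) := F (rc t).
pose ep := (nm (F 1 - F 0) - c / m.+1%:R) / 2.
have ep0 : 0 < ep by rewrite divr_gt0 ?subr_gt0.
(* The slack ep * (b - a) is additive, so a bad interval has a bad half. Bisection closes in on a
   point t, where differentiability contradicts badness; k is the primitive of c * t ^+ m. *)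
pose bad a b := [/\ 0 <= a, b <= 1 & k b - k a + ep * (b - a) < nm (h b - h a)].
have /choice[nx hnx] : forall ja : nat * R, exists a', bad ja.2 (ja.2 + (2^-1) ^+ ja.1) ->
    bad a' (a' + (2^-1) ^+ ja.1.+1) /\ `|a' - ja.2| <= 2^-1 * (2^-1) ^+ ja.1.
  move=> [j a] /=; have [[a0 b1 hab]|nb] := pselect (bad a (a + (2^-1) ^+ j)); last by exists 0.
  have d0 : 0 < (2^-1 : R) ^+ j := halfX_gt0 j.
  pose mid := a + (2^-1) ^+ j.+1; have e2 : a + (2^-1) ^+ j = mid + (2^-1) ^+ j.+1 by rewrite /mid exprS; lra.
  have [hl|hl] := ltP (k mid - k a + ep * (mid - a)) (nm (h mid - h a)).
    exists a => _; split; last by rewrite subrr normr0 mulr_ge0 // ltW.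
    split=> //; rewrite exprS; lra.
  exists mid => _; split; last by rewrite /mid addrC addKr exprS ger0_norm // mulr_ge0 // ltW.
  split; [by rewrite /mid exprS; lra|by rewrite -e2|].
  rewrite -e2; have := nm_tri (h (a + (2^-1) ^+ j)) (h mid) (h a); lra.
pose aj := fix aj n := if n is p.+1 then nx (p, aj p) else 0.
have badj j : bad (aj j) (aj j + (2^-1) ^+ j).
  elim: j => [|j IH] /=; last by have [] := hnx (j, aj j) IH.
  split; [exact: lexx|by rewrite expr0 add0r|].
  rewrite expr0 add0r /h rc1 rc0 /k expr1n expr0n /= mulr0 mulr1 !subr0 mulr1.
  rewrite -ltrBrDl /ep ltr_pdivrMr // mulr_natr mulr2n ltrDl subr_gt0 //.
have [|z hz] := geo_cvg (W := K^o) (s := fun n => rc (aj n)) (c := 2^-1) (@seqcomplete_K R).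
  by move=> n; rewrite -rcB nm_rc; have [_] := hnx (n, aj n) (badj n).
pose t := re z.
have ht j : `|t - aj j| <= (2^-1) ^+ j.
  have := hz j; rewrite mulfV ?mul1r // => h1; apply: le_trans h1.
  by have := abs_re_le_nm (z - rc (aj j)); rewrite reD reN re_rc.
have t01 : 0 <= t <= 1.
  apply/andP; split; apply/ler_addgt0Pr => e e0; have [n hn] := half_pow e0;
    have := ht n; rewrite ler_norml => /andP[h1 h2]; have [h3 h4 _] := badj n;
    have := halfX_gt0 n (R := R); lra.
have [r r0 hr] := Fd t t01 (ep / 6) ltac:(lra).
pose mc := m%:R * c + 1; have mc0 : 0 < mc by rewrite ltr_wpDl // mulr_ge0.
have q0 : 0 < Num.min (r / 2) (ep / (2 * mc)) by rewrite lt_min; apply/andP; split; [lra|apply: divr_gt0 => //; lra].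
have [j] := half_pow q0; rewrite lt_min => /andP[j1]; rewrite ltr_pdivlMr ?mulr_gt0 // => j2.
have [a0 b1] := badj j; rewrite ltNge => /negP; apply.
have d0 : 0 < (2^-1 : R) ^+ j := halfX_gt0 j.
set a := aj j in a0 b1 *; set d := (2^-1) ^+ j in d0 j1 j2 b1 *; set b := a + d in b1 *.
have ta : `|t - a| <= d := ht j.
have hta : `|a - t| <= d by rewrite distrC.
have htb : `|b - t| <= 2 * d.
  by rewrite /b addrAC; apply: (le_trans (ler_normD _ _)); rewrite [`|d|]gtr0_norm //; lra.
have ha := hr (rc (a - t)); have hb := hr (rc (b - t)).
rewrite nm_rc -rcD in ha; rewrite nm_rc -rcD in hb.
have ea : t + (a - t) = a by rewrite addrC subrK.
have eb : t + (b - t) = b by rewrite addrC subrK.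
rewrite ea in ha; rewrite eb in hb.
have {}ha := ha ltac:(lra); have {}hb := hb ltac:(lra).
have e1 : h b - h a = (F (rc b) - F (rc t) - rc (b - t) *: dF t) - (F (rc a) - F (rc t) - rc (a - t) *: dF t) + rc (b - a) *: dF t.
  have -> : rc (b - a) = rc (b - t) - rc (a - t) by rewrite -rcB; congr rc; ring.
  rewrite scalerBl /h; set u := _ *: dF t; set v := _ *: dF t.
  by rewrite addrAC addrA subrK opprD addrACA subrr addr0 opprD addrACA subrr addr0.
have ba : b - a = d by rewrite /b addrAC subrr add0r.
have h1 : nm (h b - h a) <= ep / 6 * (2 * d) + ep / 6 * d + d * (c * t ^+ m).
  rewrite e1; apply: (le_trans (nmD _ _)); apply: lerD; last first.
    by rewrite ba nmZ nm_rc gtr0_norm //; apply: ler_wpM2l; [exact: ltW|exact: dFb].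
  apply: (le_trans (nmB _ _)); apply: lerD.
    by apply: (le_trans hb); apply: ler_wpM2l => //; lra.
  by apply: (le_trans ha); apply: ler_wpM2l => //; lra.
apply: (le_trans h1); rewrite ba.
have k1 : d * (c * a ^+ m) <= k b - k a.
  have := pow_diff_ge m a0 (_ : a <= b) => /(_ ltac:(rewrite /b; lra)); rewrite ba => h2.
  rewrite /k -mulrBr mulrAC ler_pdivlMr ?ltr0n //.
  by apply: le_trans (ler_wpM2l c0 h2); rewrite le_eqVlt; apply/orP; left; apply/eqP; ring.
have k2 : c * t ^+ m <= c * a ^+ m + c * (m%:R * d).
  rewrite -mulrDr; apply: ler_wpM2l => //.
  have := pow_diff_le m (_ : 0 <= a <= 1) t01 => /(_ _) h2.
  have h3 : m%:R * `|t - a| <= m%:R * d by apply: ler_wpM2l.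
  have := h2 ltac:(apply/andP; split => //; rewrite /b in b1; lra); lra.
have k3 : c * (m%:R * d) <= ep / 2.
  have -> : c * (m%:R * d) = d * (m%:R * c) by ring.
  by move: j2; rewrite /mc; have : 0 <= d := ltW d0; move: (m%:R * c) => x; lra.
have : d * (c * t ^+ m) <= d * (c * a ^+ m + ep / 2) by apply: ler_wpM2l; [exact: ltW|lra].
lra.
Qed.
End MeanValue.

(** * Frechet derivatives and Cauchy estimates on normed spaces *)

Section Frechet.
Context {R : realType}.
Local Notation K := (Cplx R).

Lemma wder_lfun {W : normedModType K} (F : K -> W) (z : K) (d : W) (g : W -> K) (c : R) : lfun g -> 0 < c ->
  (forall y, nm (g y) <= c * nm y) -> wder F z d -> cder (fun u => g (F u)) z (g d).
Proof.
move=> gl c0 gc h e e0; have [r r0 hr] := h (e / c) (divr_gt0 e0 c0); exists r => // u /hr hu.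
have -> : g (F (z + u)) - g (F z) - g d * u = g (F (z + u) - F z - u *: d).
  by rewrite !(lfunB gl) (lfunZ gl) [u * _]mulrC.
apply: (le_trans (gc _)); rewrite mulrC -ler_pdivlMr //; apply: (le_trans hu).
by rewrite mulrAC.
Qed.

Lemma cauchy_wder {W : normedModType K} (F : K -> W) (d : W) (M r : R) : 0 < r ->
  (forall z, exists d, wder F z d) -> (forall z, nm z <= 2 * r -> nm (F z) <= M) -> wder F 0 d ->
  nm d <= 2 * M / r.
Proof.
move=> r0 Fd FM hd; have [g [gl g1 gd]] := norming d.
have g1' y : nm (g y) <= 1 * nm y by rewrite mul1r.
have hg z e : wder F z e -> cder (fun u => g (F u)) z (g e) by exact: wder_lfun gl ltr01 g1'.
have := @cauchy_estimate R (fun u => g (F u)) (g d) M r r0 _ _ (hg _ _ hd).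
rewrite gd nm_rc ger0_norm ?nm_ge0 //; apply.
- by move=> z; have [e he] := Fd z; exists (g e); exact: hg.
- by move=> z /FM; exact: le_trans.
Qed.

(** Boundedness of L is obtained afterwards, from [cauchy_derivative_ball]. *)
Definition frechet {V W : normedModType K} (f : V -> W) (x : V) (L : V -> W) := lin L /\
  forall e : R, 0 < e -> exists2 r : R, 0 < r & forall h, nm h < r -> nm (f (x + h) - f x - L h) <= e * nm h.

Definition bounded_on_balls {V W : normedModType K} (f : V -> W) := forall r : R, exists M : R, forall x, nm x <= r -> nm (f x) <= M.

Definition entire {V W : normedModType K} (f : V -> W) := forall x, exists L, frechet f x L.

Section Basic.
Context {V W : normedModType K}.
Implicit Types (f g : V -> W) (L : V -> W) (x h : V).

Lemma frechet_line f x h z L : frechet f (x + z *: h) L -> wder (fun u => f (x + u *: h)) z (L h).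
Proof.
move=> [Ll hL] e e0.
have n0 : 0 < nm h + 1 by have := nm_ge0 h; lra.
have [r r0 hr] := hL _ (divr_gt0 e0 n0); exists (r / (nm h + 1)) => [|u]; first exact: divr_gt0.
rewrite ltr_pdivlMr // => hu.
have uh : nm (u *: h) <= nm u * (nm h + 1) by rewrite nmZ; apply: ler_wpM2l; [exact: nm_ge0|lra].
rewrite scalerDl addrA -(linZ Ll); apply: (le_trans (hr _ (le_lt_trans uh hu))).
rewrite mulrAC ler_pdivrMr // -mulrA; apply: ler_wpM2l => //; exact: ltW.
Qed.

Lemma frechet_uniq f x L L' h : frechet f x L -> frechet f x L' -> L h = L' h.
Proof.
move=> [Ll hL] [Ll' hL']; apply/eqP; rewrite -subr_eq0; apply/eqP; apply: nm_small => e e0.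
have n0 : 0 < nm h + 1 by have := nm_ge0 h; lra.
have e1 : 0 < e / (2 * (nm h + 1)) by rewrite divr_gt0 // mulr_gt0.
have [r r0 hr] := hL _ e1; have [r' r'0 hr'] := hL' _ e1.
pose s := Num.min r r' / (2 * (nm h + 1)).
have s0 : 0 < s by rewrite divr_gt0 ?mulr_gt0 // lt_min r0.
have nsh : nm (rc s *: h) = s * nm h by rewrite nmZ nm_rc gtr0_norm.
have sh : nm (rc s *: h) < Num.min r r'.
  have : s * (2 * (nm h + 1)) = Num.min r r' by rewrite divfK // lt0r_neq0 // mulr_gt0.
  have : 0 <= s * nm h by apply: mulr_ge0; [exact: ltW|exact: nm_ge0].
  rewrite nsh; move: s0; move: (Num.min r r') (s) => m u u0 u1 u2; lra.
move: (sh); rewrite lt_min => /andP[/hr h1 /hr' h2].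
have E : rc s *: (L h - L' h) = (f (x + rc s *: h) - f x - L' (rc s *: h)) - (f (x + rc s *: h) - f x - L (rc s *: h)).
  by rewrite scalerBr -(linZ Ll) -(linZ Ll') opprD addrACA subrr add0r opprK addrC.
have : s * nm (L h - L' h) <= 2 * (e / (2 * (nm h + 1)) * (s * nm h)).
  rewrite -[leLHS](_ : nm (rc s *: (L h - L' h)) = _); last by rewrite nmZ nm_rc gtr0_norm.
  by rewrite E; apply: (le_trans (nmB _ _)); rewrite nsh in h1 h2; lra.
have -> : 2 * (e / (2 * (nm h + 1)) * (s * nm h)) = s * (e * (nm h / (nm h + 1))) by field; rewrite lt0r_neq0.
rewrite ler_pM2l // => h3; apply: (le_trans h3); rewrite -[leRHS]mulr1; apply: ler_wpM2l; first exact: ltW.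
by rewrite ler_pdivrMr // mul1r; lra.
Qed.

Lemma frechetD f g x L L' : frechet f x L -> frechet g x L' -> frechet (fun y => f y + g y) x (fun h => L h + L' h).
Proof.
move=> [Ll hL] [Ll' hL']; split=> [a u v|e e0]; first by rewrite Ll Ll' scalerDr addrACA.
have e2 : 0 < e / 2 by lra.
have [r r0 hr] := hL _ e2; have [r' r'0 hr'] := hL' _ e2.
exists (Num.min r r') => [|h]; first by rewrite lt_min r0.
rewrite lt_min => /andP[/hr h1 /hr' h2]; rewrite [- (f x + _)]opprD (addrACA (f _)) [- (L h + _)]opprD (addrACA (f _ - f _)).
by apply: (le_trans (nmD _ _)); lra.
Qed.

Lemma frechetZ f x L (a : K) : frechet f x L -> frechet (fun y => a *: f y) x (fun h => a *: L h).
Proof.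
move=> [Ll hL]; split=> [b u v|e e0]; first by rewrite Ll scalerDr !scalerA mulrC.
have n0 : 0 < nm a + 1 by have := nm_ge0 a; lra.
have [r r0 hr] := hL _ (divr_gt0 e0 n0); exists r => // h /hr h1.
rewrite -!scalerBr nmZ; have := ler_wpM2l (nm_ge0 a) h1.
rewrite mulrA => h2; apply: (le_trans h2); apply: ler_wpM2r; first exact: nm_ge0.
by rewrite mulrA ler_pdivrMr // mulrC ler_wpM2l ?ltW //; lra.
Qed.

Lemma frechet_shift f x c L : frechet f (x + c) L -> frechet (fun y => f (y + c)) x L.
Proof.
move=> [Ll hL]; split=> // e e0; have [r r0 hr] := hL _ e0; exists r => // h /hr.
by rewrite [x + c + h]addrAC.
Qed.

Lemma frechet_cst (c : W) x : frechet (fun=> c : W) x (fun=> 0 : W).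
Proof.
split=> [a u v|e e0]; first by rewrite scaler0 addr0.
by exists 1 => // h _; rewrite !subrr nm0 mulr_ge0 ?nm_ge0 // ltW.
Qed.

Lemma cauchy_line f x h (M r : R) L : 0 < r -> entire f ->
  (forall z, nm z <= 2 * r -> nm (f (x + z *: h)) <= M) -> frechet f x L -> nm (L h) <= 2 * M / r.
Proof.
move=> r0 fd fM fL; apply: (@cauchy_wder W (fun u => f (x + u *: h)) (L h) M r r0) => //.
- by move=> z; have [L' hL'] := fd (x + z *: h); exists (L' h); exact: frechet_line hL'.
- by apply: frechet_line; rewrite scale0r addr0.
Qed.

Lemma mvt_line f x h (M : R) : entire f ->
  (forall (t : R) L, 0 <= t <= 1 -> frechet f (x + rc t *: h) L -> nm (L h) <= M) -> nm (f (x + h) - f x) <= M.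
Proof.
move=> fd hM; have /choice[D hD] := fd.
have := @mean_value R W (fun u => f (x + u *: h)) (fun t => D (x + rc t *: h) h) M 0.
rewrite scale1r scale0r addr0 divr1; apply=> t t01; first exact: frechet_line.
by rewrite expr0 mulr1; apply: hM (hD _).
Qed.

Lemma entireB f g : entire f -> entire g -> entire (fun y => f y - g y).
Proof.
move=> hf hg x; have [L hL] := hf x; have [L' hL'] := hg x; exists (fun h => L h + -1 *: L' h).
have := frechetD hL (frechetZ (-1) hL').
by rewrite (_ : (fun y => f y + -1 *: g y) = (fun y => f y - g y)) //; apply: funext => y; rewrite scaleN1r.
Qed.

Lemma entire_shift f c : entire f -> entire (fun y => f (y + c)).
Proof. by move=> hf x; have [L hL] := hf (x + c); exists L; exact: frechet_shift. Qed.

(** The variation of the derivative in direction h is the derivative of the increment of f along s *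
    h. The mean value inequality with one Cauchy estimate bounds that increment by 2 M / r, a second
    Cauchy estimate bounds its derivative, and integration along h gives the remainder. The radii
    add up to at most 2 r + r + 2 r = 5 r. *)
Lemma cauchy2_line f x h (M r : R) L : 1 <= r -> entire f ->
  (forall z, nm z <= 5 * r -> nm (f (x + z *: h)) <= M) -> frechet f x L ->
  nm (f (x + h) - f x - L h) <= 4 * M / r ^+ 2.
Proof.
move=> r1 fd fM fL; have r0 : 0 < r by lra.
have /choice[D hD] := fd.
have M0 : 0 <= M by apply: le_trans (nm_ge0 _) (fM 0 _); rewrite nm0; lra.
have d1 (z : K) : nm z <= 3 * r -> nm (D (x + z *: h) h) <= 2 * M / r.
  move=> hz; apply: (cauchy_line (f := f) (x := x + z *: h) r0 fd) => // u hu.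
  by rewrite -addrA -scalerDl; apply: fM; apply: (le_trans (nmD _ _)); lra.
have d2 (s : R) : 0 <= s <= 1 -> nm (D (x + rc s *: h) h - L h) <= 4 * M / r ^+ 2.
  move=> /andP[s0 s1].
  have -> : 4 * M / r ^+ 2 = 2 * (2 * M / r) / r by field; rewrite lt0r_neq0.
  pose G y := f (y + rc s *: h) - f y.
  have Gd : entire G by apply: entireB => //; exact: entire_shift.
  apply: (cauchy_line (f := G) (x := x) (L := fun k => D (x + rc s *: h) k - L k) r0 Gd); last first.
    have := frechetD (frechet_shift (hD (x + rc s *: h))) (frechetZ (-1) fL).
    rewrite (_ : (fun y => _ + _) = G); last by apply: funext => y; rewrite scaleN1r.
    by rewrite (_ : (fun h0 => _ + _) = (fun k => D (x + rc s *: h) k - L k)) //; apply: funext => k; rewrite scaleN1r.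
  move=> z hz; rewrite /G; apply: (mvt_line (f := f)) => // t L' /andP[t0 t1] hL'.
  have -> : L' (rc s *: h) = D (x + z *: h + rc t *: (rc s *: h)) (rc s *: h) by apply: frechet_uniq hL' (hD _).
  have [Dl _] := hD (x + z *: h + rc t *: (rc s *: h)).
  rewrite (linZ Dl) nmZ nm_rc ger0_norm // scalerA -addrA -scalerDl -rcM.
  apply: le_trans (_ : 1 * (2 * M / r) <= _); last by rewrite mul1r.
  apply: ler_pM => //; first exact: nm_ge0.
  apply: d1; apply: (le_trans (nmD _ _)); rewrite nm_rc ger0_norm ?mulr_ge0 //.
  have ts : t * s <= 1 by nra.
  lra.
have := @mean_value R W (fun u => f (x + u *: h) - u *: L h) (fun t => D (x + rc t *: h) h - L h) (4 * M / r ^+ 2) 0.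
rewrite !scale1r !scale0r addr0 subr0 divr1 [f (x + h) - _ - _]addrAC => H; apply: H => t t01; last first.
  by rewrite expr0 mulr1; exact: d2.
move=> e e0; have [q q0 hq] := frechet_line (hD (x + rc t *: h)) e0; exists q => // u /hq.
set A := f _; set B := f _; set C := D _ _.
suff -> : A - (rc t + u) *: L h - (B - rc t *: L h) - u *: (C - L h) = A - B - u *: C by [].
rewrite scalerDl scalerBr; set a := rc t *: L h; set b := u *: L h; set c := u *: C.
by rewrite (addrC a) [- (b + a)]opprD addrA [- (B - a)]opprB addrA subrK [A - b - B]addrAC [- (c - b)]opprB addrA subrK.
Qed.

Lemma cauchy_derivative_ball f x (M : R) L h : entire f -> (forall y, nm (y - x) <= 2 -> nm (f y) <= M) ->
  frechet f x L -> nm (L h) <= 2 * M * nm h.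
Proof.
move=> fd fM fL; have [->|h0] := eqVneq h 0; first by rewrite (lin0 fL.1) !nm0 mulr0.
have n0 := nm_gt0 h0; have n1 : 0 < (nm h)^-1 by rewrite invr_gt0.
have := cauchy_line n1 fd (M := M) (x := x) (h := h) _ fL; rewrite invrK; apply=> z hz.
apply: fM; rewrite addrAC subrr add0r nmZ.
by rewrite -ler_pdivlMr.
Qed.

(** The line estimate with r = 1 / nm h; the condition r >= 1 becomes nm h <= 1. *)
Lemma cauchy_remainder_ball f x (M : R) L h : entire f -> (forall y, nm (y - x) <= 5 -> nm (f y) <= M) ->
  frechet f x L -> nm h <= 1 -> nm (f (x + h) - f x - L h) <= 4 * M * nm h ^+ 2.
Proof.
move=> fd fM fL h1; have [->|h0] := eqVneq h 0.
  by rewrite (lin0 fL.1) addr0 subrr subr0 !nm0 expr0n mulr0.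
have n0 := nm_gt0 h0; have n1 : 1 <= (nm h)^-1 by rewrite -[leLHS]invr1 lef_pV2 ?posrE.
have := cauchy2_line n1 fd (M := M) (x := x) (h := h) _ fL; rewrite exprVn invrK; apply=> z hz.
apply: fM; rewrite addrAC subrr add0r nmZ.
by rewrite -ler_pdivlMr.
Qed.
End Basic.
End Frechet.

(** * Limits and derivatives of entire maps of bounded type *)

Section Entire.
Context {R : realType}.
Local Notation K := (Cplx R).

Lemma binomial_le n m : ('C(n, m) <= 2 ^ n)%N.
Proof.
elim: n m => [|n IH] [|m]; rewrite ?bin0 ?bin0n ?expn_gt0 //.
by rewrite binS expnS mul2n -addnn leq_add.
Qed.

(** n^n is at most the falling factorial of 2 n of length n, which is a binomial coefficient times
    n!. Powers n^n coming from radii divided by n thus cost only a geometric factor. *)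
Lemma pow_le_fact n : (n ^ n <= 4 ^ n * n`!)%N.
Proof.
apply: leq_trans (_ : (n + n) ^_ n <= _)%N.
  have -> : (n ^ n)%N = (\prod_(i < n) n)%N by rewrite prod_nat_const card_ord.
  rewrite ffact_prod; apply: leq_prod => i _; rewrite -addnBA; first exact: leq_addr.
  exact: ltnW.
rewrite -bin_ffact leq_mul2r; apply/orP; right.
by apply: leq_trans (binomial_le _ _) _; rewrite addnn -mul2n expnM.
Qed.

(* entire maps of bounded type *)
Definition entire_bt {V W : normedModType K} (f : V -> W) := entire f /\ bounded_on_balls f.

Section Ops.
Context {V W : normedModType K}.
Implicit Types (f g : V -> W).

Lemma entire_btD f g : entire_bt f -> entire_bt g -> entire_bt (fun y => f y + g y).
Proof.
move=> [hf bf] [hg bg]; split=> [x|r].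
  by have [L hL] := hf x; have [L' hL'] := hg x; eexists; exact: frechetD hL hL'.
have [M hM] := bf r; have [M' hM'] := bg r; exists (M + M') => x hx.
by apply: (le_trans (nmD _ _)); apply: lerD; [exact: hM|exact: hM'].
Qed.
Lemma entire_btZ (a : K) f : entire_bt f -> entire_bt (fun y => a *: f y).
Proof.
move=> [hf bf]; split=> [x|r]; first by have [L hL] := hf x; eexists; exact: frechetZ hL.
have [M hM] := bf r; exists (nm a * M) => x /hM h; rewrite nmZ; apply: ler_wpM2l => //; exact: nm_ge0.
Qed.
Lemma entire_btB f g : entire_bt f -> entire_bt g -> entire_bt (fun y => f y - g y).
Proof.
move=> hf hg; have := entire_btD hf (entire_btZ (-1) hg).
by rewrite (_ : (fun y => f y + -1 *: g y) = (fun y => f y - g y)) //; apply: funext => y; rewrite scaleN1r.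
Qed.
Lemma entire_bt_shift f c : entire_bt f -> entire_bt (fun y => f (y + c)).
Proof.
move=> [hf bf]; split; first exact: entire_shift.
move=> r; have [M hM] := bf (r + nm c); exists M => x hx; apply: hM; apply: (le_trans (nmD _ _)); lra.
Qed.
Lemma entire_bt_cst (c : W) : entire_bt (fun _ : V => c).
Proof. by split=> [x|r]; [eexists; exact: frechet_cst|exists (nm c)]. Qed.
Lemma entire_bt_sum (I : Type) (s : seq I) (F : I -> V -> W) : (forall i, entire_bt (F i)) ->
  entire_bt (fun y => \sum_(i <- s) F i y).
Proof.
move=> hF; elim: s => [|i s IH].
  by rewrite (_ : (fun y => _) = fun=> 0); [exact: entire_bt_cst|apply: funext => y; rewrite big_nil].
rewrite (_ : (fun y => _) = fun y => F i y + \sum_(j <- s) F j y); first exact: entire_btD.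
by apply: funext => y; rewrite big_cons.
Qed.

Definition Df f (x : V) : V -> W := xget (fun=> 0) [set L | frechet f x L].
Lemma DfP f x : entire f -> frechet f x (Df f x).
Proof. by move=> /(_ x)[L hL]; rewrite /Df; case: xgetP => [L' _ //|/(_ L)]. Qed.
Lemma DfE f x L h : frechet f x L -> Df f x h = L h.
Proof.
move=> hL; apply: (frechet_uniq (f := f) (x := x)) => //.
by rewrite /Df; case: xgetP => [L' _ //|/(_ L)].
Qed.
Lemma Df_lin f x : entire f -> lin (Df f x).
Proof. by move=> /(DfP x)[]. Qed.
Lemma Df_comb f g (a : K) x h : entire f -> entire g -> Df (fun y => a *: f y + g y) x h = a *: Df f x h + Df g x h.
Proof. by move=> hf hg; rewrite (DfE h (frechetD (frechetZ a (DfP x hf)) (DfP x hg))). Qed.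

End Ops.

Section Limits.
Context {V : normedModType K} {W : completeNormedModType K}.

(** Weierstrass' theorem: the derivatives converge by the first Cauchy estimate, and the
    second-order estimate bounds the remainders independently of n, so the bound passes to the
    limit. *)
Lemma entire_bt_limit (f : V -> W) (fn : nat -> V -> W) : (forall n, entire_bt (fn n)) ->
  (forall r e, 0 < e -> exists N, forall n, (N <= n)%N -> forall x, nm x <= r -> nm (f x - fn n x) <= e) ->
  entire_bt f.
Proof.
move=> hfn hn.
have bf : bounded_on_balls f.
  move=> r; have [N hN] := hn r 1 ltr01; have [M hM] := (hfn N).2 r; exists (M + 1) => x hx.
  by have := nm_tri (f x) (fn N x) 0; have := hN N (leqnn _) x hx; have := hM x hx; rewrite !subr0; lra.
have E (a g b p : W) : a - g - (b - p) = a - b - (g - p).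
  by rewrite !opprB addrACA [RHS]addrACA (addrC (- g)).
split=> // x; pose L n := Df (fn n) x.
have hL n : frechet (fn n) x (L n) by apply: DfP; exact: (hfn n).1.
have cau (e : R) : 0 < e -> exists N, forall m n, (N <= m)%N -> (N <= n)%N -> forall h, nm (L m h - L n h) <= e * nm h.
  move=> e0; have e4 : 0 < e / 4 by lra.
  have [N hN] := hn (nm x + 2) _ e4; exists N => m n Nm Nn h.
  have := @cauchy_derivative_ball R V W (fun y => fn m y - fn n y) x (e / 2) (fun h => L m h + -1 *: L n h) h.
  rewrite scaleN1r => H; have -> : e = 2 * (e / 2) by lra.
  apply: H.
  - by apply: entireB; [exact: (hfn m).1|exact: (hfn n).1].
  - move=> y hy; have yr : nm y <= nm x + 2 by have := nm_tri y x 0; rewrite !subr0; lra.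
    have := nm_tri (fn m y) (f y) (fn n y); have := hN m Nm y yr; have := hN n Nn y yr; rewrite (nmBC (fn m y) (f y)); lra.
  - have := frechetD (hL m) (frechetZ (-1) (hL n)).
    by rewrite (_ : (fun y => fn m y + -1 *: fn n y) = (fun y => fn m y - fn n y)) //; apply: funext => y; rewrite scaleN1r.
have /choice[l hl] : forall h, exists l, forall e : R, 0 < e -> exists N, forall n, (N <= n)%N -> nm (L n h - l) <= e.
  move=> h; apply: (seqcompleteP (W := W)) => e e0; have p : 0 < nm h + 1 by have := nm_ge0 h; lra.
  have [N hN] := cau _ (divr_gt0 e0 p); exists N => m n Nm Nn; apply: (le_trans (hN m n Nm Nn h)).
  by rewrite mulrAC ler_pdivrMr // ler_wpM2l ?ltW //; lra.
have ucv (e : R) : 0 < e -> exists N, forall n, (N <= n)%N -> forall h, nm (l h - L n h) <= e * nm h.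
  move=> e0; have [N hN] := cau e e0; exists N => n Nn h; rewrite nmBC.
  apply: (lim_nm_le (u := fun m => L n h - L m h) (N := N)) => [e1 e10|m Nm]; last exact: hN.
  have [N1 hN1] := hl h e1 e10; exists N1 => m /hN1; rewrite nmBC.
  by rewrite opprB addrACA [- L m h + _]addrC -addrACA subrr add0r addrC.
exists l; split.
  move=> a u v; apply/eqP; rewrite -subr_eq0; apply/eqP; apply: nm_small => e e0.
  pose c := nm (a *: u + v) + nm a * nm u + nm v + 1.
  have c1 : 0 < c by rewrite /c; have := nm_ge0 (a *: u + v); have := nm_ge0 v; have := mulr_ge0 (nm_ge0 a) (nm_ge0 u); lra.
  have [N hN] := ucv _ (divr_gt0 e0 c1).
  have -> : l (a *: u + v) - (a *: l u + l v) = (l (a *: u + v) - L N (a *: u + v)) - (a *: (l u - L N u) + (l v - L N v)).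
    by rewrite scalerBr (addrACA (a *: l u)) -opprD -(hL N).1 opprB addrA subrK.
  apply: (le_trans (nmB _ _)); have h1 := hN N (leqnn _) (a *: u + v); have h2 := hN N (leqnn _) u; have h3 := hN N (leqnn _) v.
  have h4 := nmD (a *: (l u - L N u)) (l v - L N v); rewrite nmZ in h4.
  have h5 := ler_wpM2l (nm_ge0 a) h2.
  have h6 : e / c * (nm (a *: u + v) + nm a * nm u + nm v) <= e.
    by rewrite mulrAC ler_pdivrMr // ler_wpM2l ?ltW // /c; lra.
  lra.
move=> e e0; have [M0 hM0] := bf (nm x + 5); have [N1 hN1] := hn (nm x + 5) 1 ltr01.
have M00 : 0 <= M0 by apply: le_trans (nm_ge0 _) (hM0 0 _); rewrite nm0; have := nm_ge0 x; lra.
have key h : nm h <= 1 -> nm (f (x + h) - f x - l h) <= 4 * (M0 + 1) * nm h ^+ 2.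
  move=> h1; apply/ler_addgt0Pr => d d0; have d4 : 0 < d / 4 by lra.
  have [N2 hN2] := hn (nm x + 5) _ d4; have [N3 hN3] := ucv _ d4.
  pose n := (N1 + (N2 + N3))%N.
  have n1 : (N1 <= n)%N by exact: leq_addr.
  have n2 : (N2 <= n)%N by rewrite /n addnCA leq_addr.
  have n3 : (N3 <= n)%N by rewrite /n addnA leq_addl.
  have xb : nm x <= nm x + 5 by lra.
  have xhb : nm (x + h) <= nm x + 5 by apply: (le_trans (nmD _ _)); lra.
  have := cauchy_remainder_ball (f := fn n) (x := x) (M := M0 + 1) (h := h) (hfn n).1 _ (hL n) h1 => /(_ _) H.
  have {}H : nm (fn n (x + h) - fn n x - L n h) <= 4 * (M0 + 1) * nm h ^+ 2.
    apply: H => y hy; have yr : nm y <= nm x + 5 by have := nm_tri y x 0; rewrite !subr0; lra.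
    by have := nm_tri (fn n y) (f y) 0; have := hN1 n n1 y yr; have := hM0 y yr; rewrite !subr0 (nmBC (fn n y) (f y)); lra.
  have -> : f (x + h) - f x - l h = (fn n (x + h) - fn n x - L n h) + ((f (x + h) - fn n (x + h)) - (f x - fn n x) - (l h - L n h)).
    by rewrite (E (f (x + h))) (E _ _ (l h)) [RHS]addrC subrK.
  apply: (le_trans (nmD _ _)); apply: lerD => //.
  have k1 := hN2 n n2 _ xb; have k2 := hN2 n n2 _ xhb; have k3 := hN3 n n3 h.
  have k4 : d / 4 * nm h <= d / 4 by rewrite ler_piMr // ltW.
  by apply: (le_trans (nmB _ _)); have := nmB (f (x + h) - fn n (x + h)) (f x - fn n x); lra.
pose C := 4 * (M0 + 1); have C0 : 0 < C by rewrite /C; lra.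
exists (Num.min 1 (e / C)) => [|h]; first by rewrite lt_min ltr01 divr_gt0.
rewrite lt_min => /andP[h1 h2]; apply: (le_trans (key h (ltW h1))); rewrite -/C.
rewrite ltr_pdivlMr // in h2; rewrite expr2 mulrA; apply: ler_wpM2r; first exact: nm_ge0.
by rewrite mulrC ltW.
Qed.

(** Difference quotients with step 2^-n are entire and converge uniformly on balls, at the rate
    given by the second-order Cauchy estimate. *)
Lemma entire_bt_Df (f : V -> W) h : entire_bt f -> entire_bt (fun x => Df f x h).
Proof.
move=> [fd bf]; pose hv n : R := (2^-1) ^+ n.
have hv0 n : 0 < hv n by exact: halfX_gt0.
apply: (@entire_bt_limit _ (fun n x => rc (hv n)^-1 *: (f (x + rc (hv n) *: h) - f x))).
  by move=> n; apply: entire_btZ; apply: entire_btB => //; exact: entire_bt_shift.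
move=> r e e0; have [M hM] := bf (Num.max r 0 + 5).
pose c := nm h + 4 * `|M| * nm h ^+ 2 + 1.
have c1 : 0 < c by rewrite /c; have := nm_ge0 h; have := mulr_ge0 (normr_ge0 M) (sqr_ge0 (nm h)); lra.
have q0 : 0 < Num.min (c^-1) (e / c) by rewrite lt_min invr_gt0 c1 divr_gt0.
have [N] := half_pow q0; rewrite lt_min => /andP[N1 N2]; exists N => n Nn x hx.
have hn : hv n <= (2^-1) ^+ N := half_anti Nn.
have n1 : hv n * c < 1 by rewrite -ltr_pdivlMr // div1r; exact: le_lt_trans hn N1.
have n2 : hv n * c < e by rewrite -ltr_pdivlMr //; exact: le_lt_trans hn N2.
have P1 : 0 <= hv n * (4 * `|M| * nm h ^+ 2).
  by apply: mulr_ge0; [exact: ltW|apply: mulr_ge0; [apply: mulr_ge0|exact: sqr_ge0]].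
have P2 : 0 <= hv n * nm h by apply: mulr_ge0; [exact: ltW|exact: nm_ge0].
rewrite {1}/c !mulrDr in n1; rewrite {1}/c !mulrDr in n2; have P3 := hv0 n.
have kn : nm (rc (hv n) *: h) = hv n * nm h by rewrite nmZ nm_rc gtr0_norm.
have M0 : 0 <= M.
  apply: le_trans (nm_ge0 _) (hM 0 _); rewrite nm0; apply: addr_ge0 => //.
  by rewrite le_max lexx orbT.
have := cauchy_remainder_ball (f := f) (x := x) (M := M) (h := rc (hv n) *: h) fd _ (DfP x fd).
rewrite kn => H.
have {}H : nm (f (x + rc (hv n) *: h) - f x - Df f x (rc (hv n) *: h)) <= 4 * M * (hv n * nm h) ^+ 2.
  apply: H; last lra.
  move=> y hy; apply: hM; have := nm_tri y x 0; rewrite !subr0.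
  have : r <= Num.max r 0 by rewrite le_max lexx.
  lra.
rewrite nmBC; have -> : Df f x h = rc (hv n)^-1 *: Df f x (rc (hv n) *: h).
  by rewrite (linZ (Df_lin x fd)) scalerA -rcM mulVf ?rc1 ?scale1r // lt0r_neq0.
rewrite -scalerBr nmZ nm_rc gtr0_norm ?invr_gt0 // ler_pdivrMl //; apply: (le_trans H).
have -> : 4 * M * (hv n * nm h) ^+ 2 = hv n * (hv n * (4 * M * nm h ^+ 2)) by ring.
apply: ler_wpM2l; first exact: ltW.
rewrite (ger0_norm M0) in n2 P1; lra.
Qed.
End Limits.
End Entire.

(** * Taylor forms and the remainder estimate *)

Section Taylor.
Context {R : realType}.
Local Notation K := (Cplx R).

Section WderOps.
Context {W : normedModType K}.
Implicit Types (F G : K -> W) (z : K).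

Lemma frechet_wder F z d : wder F z d -> frechet (F : K^o -> W) z (fun h : K^o => (h : K) *: d).
Proof. by move=> h; split=> // a u v; rewrite scalerDl scalerA. Qed.
Lemma wder_frechet F z L d : frechet (F : K^o -> W) z L -> L 1 = d -> wder F z d.
Proof.
move=> [Ll hL] Ld e e0; have [r r0 hr] := hL e e0; exists r => // h /hr.
by have := linZ Ll h (1 : K^o); rewrite Ld => <-; rewrite /GRing.scale /= mulr1.
Qed.
Lemma wderD F G z d e : wder F z d -> wder G z e -> wder (fun u => F u + G u) z (d + e).
Proof.
move=> /frechet_wder hF /frechet_wder hG.
by apply: wder_frechet (frechetD hF hG) _; rewrite !scale1r.
Qed.
Lemma wderZ F z d (a : K) : wder F z d -> wder (fun u => a *: F u) z (a *: d).
Proof. by move=> /frechet_wder hF; apply: wder_frechet (frechetZ a hF) _; rewrite scale1r. Qed.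
Lemma wder_sum n (F : nat -> K -> W) z (d : nat -> W) : (forall m, (m < n)%N -> wder (F m) z (d m)) ->
  wder (fun u => \sum_(m < n) F m u) z (\sum_(m < n) d m).
Proof.
elim: n => [|n IH] h.
  rewrite big_ord0 (_ : (fun u => _) = (fun=> 0)); last by apply: funext => u; rewrite big_ord0.
  by apply: (wder_frechet (frechet_cst (V := K^o) 0 z)).
rewrite big_ord_recr /= (_ : (fun u => _) = fun u => \sum_(m < n) F m u + F n u).
  by apply: wderD; [apply: IH => m mn; apply: h; exact: ltnW|exact: h].
by apply: funext => u; rewrite big_ord_recr.
Qed.
Lemma wder_scale (g : K -> K) z d (w : W) : cder g z d -> wder (fun u => g u *: w) z (d *: w).
Proof.
move=> h e e0; have p : 0 < nm w + 1 by have := nm_ge0 w; lra.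
have [r r0 hr] := h _ (divr_gt0 e0 p); exists r => // u /hr hu.
rewrite scalerA -!scalerBl nmZ [u * d]mulrC.
apply: (le_trans (ler_wpM2r (nm_ge0 w) hu)); rewrite mulrAC; apply: ler_wpM2r; first exact: nm_ge0.
by rewrite mulrAC ler_pdivrMr // ler_wpM2l ?ltW //; lra.
Qed.
End WderOps.

Lemma cder_pow (a z : K) m : cder (fun u => (u * a) ^+ m) z (m%:R * (z * a) ^+ m.-1 * a).
Proof.
have lin1 : cder (fun u => u * a) z a.
  move=> e e0; exists 1 => // h _.
  have -> : (z + h) * a - z * a - a * h = 0 by ring.
  by rewrite nm0 mulr_ge0 ?nm_ge0 // ltW.
elim: m => [|m IH].
  by move=> e e0; exists 1 => // h _; rewrite !expr0 !mul0r subrr subr0 nm0 mulr_ge0 ?nm_ge0 // ltW.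
have := cder_mul lin1 IH; rewrite (_ : (fun u => _) = (fun u => (u * a) ^+ m.+1)).
  rewrite (_ : _ + _ = m.+1%:R * (z * a) ^+ m.+1.-1 * a) //=.
  by case: m {IH} => [|m] /=; rewrite -?[in RHS]natr1 ?exprS; ring.
by apply: funext => u; rewrite exprS.
Qed.

(** The recursion differentiates f first and passes the derivative on, so proofs generalize over f
    and rest on [entire_bt_Df]. *)
Fixpoint iter_Df {V W : normedModType K} m : (V -> W) -> ('I_m -> V) -> V -> W :=
  if m is p.+1 then fun f h => iter_Df (fun x => Df f x (h ord0)) (fun j => h (lift ord0 j))
  else fun f _ => f.

Section DitTheory.
Context {V : normedModType K} {W : completeNormedModType K}.
Implicit Types (f g : V -> W).

Lemma iter_Df_fcons m f v (h : 'I_m -> V) : iter_Df f (fcons v h) = iter_Df (fun x => Df f x v) h.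
Proof. by rewrite /= fcons0; congr iter_Df; apply: funext => j; rewrite fconsS. Qed.

Lemma iter_Df_comb m f g (a : K) (h : 'I_m -> V) x : entire_bt f -> entire_bt g ->
  iter_Df (fun y => a *: f y + g y) h x = a *: iter_Df f h x + iter_Df g h x.
Proof.
elim: m f g h => [|m IH] f g h hf hg //=.
rewrite -IH; try exact: entire_bt_Df.
by congr (iter_Df _ _ _); apply: funext => y; rewrite Df_comb //; [exact: hf.1|exact: hg.1].
Qed.

Lemma iter_Df_mlin m f x : entire_bt f -> mlin (fun h : 'I_m -> V => iter_Df f h x).
Proof.
elim: m f => [|m IH] f hf j h a u w; first by case: j.
rewrite [h]fconsE; case: (unliftP ord0 j) => [k|] ->.
  by rewrite !upd_fconsS !iter_Df_fcons; apply: (IH _ (entire_bt_Df _ hf)).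
rewrite !upd_fcons0 !iter_Df_fcons -iter_Df_comb; try exact: entire_bt_Df.
congr (iter_Df _ _ _); apply: funext => y; exact: (Df_lin y hf.1).
Qed.

(** Each of the m derivatives costs a Cauchy estimate of radius r, hence a factor 2 / r and an
    enlargement of the ball by 2 r. *)
Lemma iter_Df_bound m f (r rho M : R) (h : 'I_m -> V) x : entire_bt f -> 0 < r ->
  (forall y, nm y <= rho + 2 * r * m%:R -> nm (f y) <= M) ->
  nm x <= rho -> (forall k, nm (h k) <= 1) -> nm (iter_Df f h x) <= (2 / r) ^+ m * M.
Proof.
move=> hf r0; elim: m f M h hf => [|m IH] f M h hf hM hx hh.
  by rewrite expr0 mul1r; apply: hM; rewrite mulr0 addr0.
rewrite exprSr -mulrA; apply: IH => //; first exact: entire_bt_Df.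
move=> y hy; have := cauchy_line (f := f) (x := y) (h := h ord0) (M := M) r0 hf.1 _ (DfP y hf.1).
rewrite mulrAC; apply => z hz; apply: hM; apply: (le_trans (nmD _ _)).
have : nm (z *: h ord0) <= 2 * r.
  by rewrite nmZ -[leRHS]mulr1; apply: ler_pM => //; exact: nm_ge0.
by rewrite -[m.+1%:R]natr1; lra.
Qed.

Definition taylor_form f m (h : 'I_m -> V) : W := (m`!)%:R^-1 *: iter_Df f h 0.
Definition taylor_term f m x := taylor_form f (fun _ : 'I_m => x).

Lemma taylor_form_mlin f m : entire_bt f -> mlin (@taylor_form f m).
Proof.
move=> hf j x a u w; rewrite /taylor_form (iter_Df_mlin 0 hf) scalerDr !scalerA; congr (_ + _).
by rewrite mulrC.
Qed.

Lemma nm_natV n : nm (n%:R^-1 : K) = n%:R^-1.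
Proof. by rewrite -rc_nat -rcV nm_rc ger0_norm ?invr_ge0. Qed.

Lemma taylor_form_bound f m (rho M : R) : entire_bt f -> 0 < rho -> (forall y, nm y <= rho -> nm (f y) <= M) ->
  mbound (@taylor_form f m) ((16 / rho) ^+ m * M).
Proof.
move=> hf r0 hM h hh; rewrite /taylor_form nmZ nm_natV.
have M0 : 0 <= M by apply: le_trans (nm_ge0 _) (hM 0 _); rewrite nm0 ltW.
case: m h hh => [|m] h hh.
  by rewrite fact0 invr1 mul1r expr0 mul1r /=; apply: hM; rewrite nm0 ltW.
(* The radius rho is shared equally by the m + 1 derivatives; the resulting (m + 1)^(m + 1) is
   absorbed by the factorial through [pow_le_fact], turning 4 into 16. *)
pose r := rho / (2 * m.+1%:R); have rr : 0 < r by rewrite divr_gt0 // mulr_gt0.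
have := iter_Df_bound (f := f) (rho := 0) (x := 0) hf rr (M := M) (h := h) => /(_ _ _ hh).
have G' (c : R) : c != 0 -> 0 + 2 * (rho / (2 * c)) * c = rho by move=> c0; field.
have -> : 0 + 2 * r * m.+1%:R = rho by apply: G'; rewrite pnatr_eq0.
rewrite nm0 => /(_ hM (lexx _)) h1.
have f0 : 0 < (m.+1)`!%:R :> R by rewrite ltr0n fact_gt0.
rewrite ler_pdivrMl //; apply: (le_trans h1); rewrite mulrA; apply: ler_wpM2r => //.
have G (c : R) : c != 0 -> rho != 0 -> 2 / (rho / (2 * c)) = c * (4 / rho).
  by move=> c0 q0; field; rewrite c0 q0.
have -> : 2 / r = m.+1%:R * (4 / rho) by apply: G; rewrite ?pnatr_eq0 ?lt0r_neq0.
have -> : 16 / rho = 4 * (4 / rho) by lra.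
have : 0 <= 4 / rho by rewrite divr_ge0 // ltW.
move: (4 / rho) => u u0; rewrite !exprMn mulrA; apply: ler_wpM2r; first exact: exprn_ge0.
by rewrite -!natrX -natrM ler_nat mulnC pow_le_fact.
Qed.

Lemma taylor_termS f m x : m.+1%:R *: taylor_term f m.+1 x = taylor_term (fun y => Df f y x) m x.
Proof.
by rewrite /taylor_term /taylor_form scalerA /= factS natrM invfM mulrA mulfV ?mul1r // pnatr_eq0.
Qed.

(** Differentiating the remainder of f along x gives the remainder of the derivative, with one term
    less; [mean_value] integrates the power t^N and produces the factorial. *)
Lemma taylor_seg N f (B : R) x : entire_bt f ->
  (forall t : R, 0 <= t <= 1 -> nm (iter_Df f (fun _ : 'I_N => x) (rc t *: x)) <= B) ->
  forall t : R, 0 <= t <= 1 ->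
  nm (f (rc t *: x) - \sum_(m < N) rc t ^+ m *: taylor_term f m x) <= B * t ^+ N / N`!%:R.
Proof.
elim: N f => [|N IH] f hf hB t t01.
  by rewrite big_ord0 subr0 expr0 mulr1 fact0 divr1; exact: hB.
have /andP[t0 t1] := t01; pose g y := Df f y x; have hg : entire_bt g := entire_bt_Df x hf.
have IHg := IH g hg hB.
pose F (u : K) := f (0 + u *: (rc t *: x)) - \sum_(m < N.+1) (u * rc t) ^+ m *: taylor_term f m x.
pose dF (s : R) := rc t *: (g (rc (s * t) *: x) - \sum_(m < N) rc (s * t) ^+ m *: taylor_term g m x).
have B0 : 0 <= B by apply: le_trans (nm_ge0 _) (hB 0 _); rewrite lexx ler01.
have st (s : R) : 0 <= s <= 1 -> 0 <= s * t <= 1.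
  by move=> /andP[s0 s1]; rewrite mulr_ge0 //= -[leRHS]mulr1; apply: ler_pM.
have := @mean_value R W F dF (B * t ^+ N.+1 / N`!%:R) N.
have -> : F 1 = f (rc t *: x) - \sum_(m < N.+1) rc t ^+ m *: taylor_term f m x.
  by rewrite /F add0r scale1r mul1r.
have -> : F 0 = 0.
  rewrite /F scale0r addr0 big_ord_recl big1 => [|m _]; last by rewrite mul0r exprS mul0r scale0r.
  by rewrite addr0 expr0 scale1r /taylor_term /taylor_form fact0 invr1 scale1r /= subrr.
rewrite subr0 => H; apply: (le_trans (H _ _)) => [s s01|s s01|].
- have hF : wder (fun u => f (0 + u *: (rc t *: x))) (rc s) (Df f (rc (s * t) *: x) (rc t *: x)).
    by apply: frechet_line; rewrite add0r scalerA -rcM; exact: DfP hf.1.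
  have hS := wder_sum (n := N.+1) (F := fun m u => (u * rc t) ^+ m *: taylor_term f m x) (z := rc s)
     (fun m _ => wder_scale (taylor_term f m x) (cder_pow (rc t) (rc s) m)).
  have := wderD hF (wderZ (-1) hS).
  rewrite (_ : (fun u => _ + _) = F); last by apply: funext => u; rewrite scaleN1r.
  rewrite (_ : _ + _ = dF s) // scaleN1r (linZ (Df_lin _ hf.1)) /dF scalerBr; congr (_ - _).
  rewrite big_ord_recl !mul0r scale0r add0r scaler_sumr; apply: eq_bigr => m _ /=.
  by rewrite /bump /= add1n -taylor_termS !scalerA rcM; congr (_ *: _); ring.
- have := IHg _ (st s s01); rewrite /dF nmZ nm_rc ger0_norm // => h1.
  apply: (le_trans (ler_wpM2l t0 h1)); rewrite exprMn exprS.
  by rewrite le_eqVlt; apply/orP; left; apply/eqP; ring.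
- by rewrite factS natrM invfM; rewrite le_eqVlt; apply/orP; left; apply/eqP; ring.
Qed.

Lemma taylor f N (rho M : R) x : entire_bt f -> 0 < rho -> (forall y, nm y <= 65 * rho -> nm (f y) <= M) ->
  nm x <= rho -> nm (f x - \sum_(m < N) taylor_term f m x) <= (4^-1) ^+ N * M.
Proof.
move=> hf r0 hM hx.
have M0 : 0 <= M by apply: le_trans (nm_ge0 _) (hM 0 _); rewrite nm0; lra.
case: N => [|N]; first by rewrite big_ord0 subr0 expr0 mul1r; apply: hM; lra.
(* The N + 1 Cauchy estimates use 2 r (N + 1) = 64 rho beyond the ball of radius rho, hence 65. The
   bound ((N + 1) / 16)^(N + 1) / (N + 1)! is at most 4^-(N + 1). *)
pose r := 32 * rho / N.+1%:R; have rr : 0 < r by rewrite divr_gt0 // mulr_gt0.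
have := @taylor_seg N.+1 f ((2 / r) ^+ N.+1 * M * rho ^+ N.+1) x hf.
move=> /(_ _ 1); rewrite rc1 scale1r expr1n mulr1 => H.
rewrite (eq_bigr (fun m : 'I_N.+1 => 1 ^+ m *: taylor_term f m x)); last by move=> m _; rewrite expr1n scale1r.
apply: (le_trans (H _ _)) => [t /andP[t0 t1]||]; last 2 first.
- by rewrite ler01 lexx.
- have f0 : 0 < (N.+1)`!%:R :> R by rewrite ltr0n fact_gt0.
  rewrite ler_pdivrMr // mulrAC -exprMn.
  have G (c : R) : c != 0 -> rho != 0 -> 2 / (32 * rho / c) * rho = c * 16^-1.
    by move=> c0 q0; field; rewrite c0 q0.
  have -> : 2 / r * rho = N.+1%:R * 16^-1 by apply: G; rewrite ?pnatr_eq0 ?lt0r_neq0.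
  rewrite [leRHS]mulrAC; apply: ler_wpM2r => //.
  have -> : (4^-1 : R) ^+ N.+1 = 4 ^+ N.+1 * 16^-1 ^+ N.+1 by rewrite -exprMn; congr (_ ^+ _); field.
  rewrite exprMn mulrAC; apply: ler_wpM2r; first by rewrite exprn_ge0 // invr_ge0.
  by rewrite -!natrX -natrM ler_nat pow_le_fact.
- apply: (mbound_pow (iter_Df_mlin _ hf) _ (fun _ => hx)) => h hh.
  apply: (iter_Df_bound (rho := rho) hf rr) => // [y|].
    have G (c : R) : c != 0 -> rho + 2 * (32 * rho / c) * c = 65 * rho by move=> c0; field.
    have -> : rho + 2 * r * N.+1%:R = 65 * rho by apply: G; rewrite pnatr_eq0.
    exact: hM.
  by rewrite nmZ nm_rc ger0_norm // -[leRHS]mul1r; apply: ler_pM => //; exact: nm_ge0.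
Qed.

Lemma entire_bt_diag n (A : ('I_n -> V) -> W) (C : R) : mlin A -> mbound A C -> entire_bt (fun x => A (fun=> x)).
Proof.
move=> mA hC; have C0 : 0 <= C by apply: le_trans (nm_ge0 _) (hC (fun=> 0) _) => j; rewrite nm0.
split=> [x|r]; last first.
  by exists (C * r ^+ n) => x hx; apply: (mbound_pow mA hC).
exists (fun h => \sum_j A (upd (fun=> x) j h)); split.
  by move=> a u v; rewrite scaler_sumr -big_split; apply: eq_bigr => j _; exact: mA.
move=> e e0; pose r := nm x + 1; have r1 : 1 <= r by rewrite /r; have := nm_ge0 x; lra.
pose D := (n ^ 2)%:R * C * r ^+ n + 1.
have D0 : 0 < D by rewrite ltr_wpDl //; apply: mulr_ge0; [apply: mulr_ge0|apply: exprn_ge0; exact: le_trans r1].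
exists (Num.min 1 (e / D)) => [|h]; first by rewrite lt_min ltr01 divr_gt0.
rewrite lt_min => /andP[h1 h2]; rewrite ltr_pdivlMr // in h2.
have xr : nm x <= r by rewrite /r lerDl.
have yr : nm (x + h) <= r by apply: (le_trans (nmD _ _)); rewrite /r; lra.
apply: (le_trans (mlin_diff2 (x := fun=> x) (h := fun=> h) mA hC r1 (nm_ge0 h) (fun=> xr) (fun=> yr) (fun=> lexx _))).
rewrite expr2 mulrA; apply: ler_wpM2r; first exact: nm_ge0.
by rewrite /D in h2; have := nm_ge0 h; lra.
Qed.
End DitTheory.
End Taylor.

(** * Lifting holomorphic maps *)

Section HoloLift.
Context {R : realType}.
Local Notation K := (Cplx R).

Lemma differentiable_frechet (V W : completeNormedModType K) (f : V -> W) x :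
  differentiable f x -> exists L, frechet f x L.
Proof.
move=> /diff_locallyP[_ /eqaddoP h]; exists ('d f x); split; first by move=> a u v; rewrite linearP.
move=> e e0; have e0' : 0 < rc e by rewrite -rc0 rc_lt.
have /nbhs_nmP[r r0 hr] := h _ e0'; exists r => // u hu.
have := hr u; rewrite sub0r nmN => /(_ hu).
rewrite -[X in `|X| <= _]/(f (u + x) - (f x + 'd f x u)) [u + x]addrC !nmE -rcM rc_le.
by rewrite opprD addrA.
Qed.

Lemma frechet_differentiable (V W : completeNormedModType K) (f : V -> W) x L (c : R) :
  frechet f x L -> (forall h, nm (L h) <= c * nm h) -> differentiable f x.
Proof.
move=> [Ll hL] Lc; pose L' : {linear V -> W} := HB.pack L (GRing.isLinear.Build K V W *:%R L Ll).
have Lcont : continuous L' by exact: (lin_cont Ll Lc).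
have o : f \o shift x = cst (f x) + L' +o_ 0 id.
  apply/eqaddoP => e e0; have [e' e'0 ->] := rcK e0.
  have [r r0 hr] := hL e' e'0; apply/nbhs_nmP; exists r => // u.
  rewrite sub0r nmN => /hr; rewrite -[X in `|X| <= _]/(f (u + x) - (f x + L u)) !nmE -rcM rc_le.
  by rewrite [u + x]addrC opprD addrA.
by apply/diff_locallyP; rewrite (diff_unique Lcont o).
Qed.

Lemma bounded_on_balls_bdd (V W : completeNormedModType K) (f : V -> W) : bounded_on_balls f <-> bdd_on_bdd f.
Proof.
split=> h r.
  have [M hM] := h (re r); exists (rc M) => x /nmP[_ xr]; rewrite nm_le; exact: hM.
have [M hM] := h (rc r); exists (re M) => x xr.
by have /hM/nmP[] : `|x| <= rc r by rewrite nm_le.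
Qed.

(** The limit is chosen before the constant: its tail estimate holds for every admissible c, so
    limits picked pointwise still obey bounds uniform on balls. *)
Lemma geo_lim (W : normedModType K) (s : nat -> W) : seqcomplete W ->
  (exists c : R, forall n, nm (s n.+1 - s n) <= c * (2^-1) ^+ n) ->
  exists l, forall c : R, (forall n, nm (s n.+1 - s n) <= c * (2^-1) ^+ n) ->
    forall n, nm (l - s n) <= 2 * c * (2^-1) ^+ n.
Proof.
move=> cW [c0 h0]; have [l hl] := geo_cvg cW h0; exists l => c hc n.
have c00 : 0 <= c0 by have := h0 0%N; rewrite expr0 mulr1; apply: le_trans; exact: nm_ge0.
apply/ler_addgt0Pr => e e0; have p : 0 < 2 * c0 + 1 by lra.
have [k] := half_pow (divr_gt0 e0 p); rewrite ltr_pdivlMr // => hk.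
apply: (le_trans (nm_tri _ (s (n + k)%N) _)); rewrite addrC; apply: lerD.
  exact: (geo_tail hc (leq_addr _ _)).
apply: (le_trans (hl _)); have := half_anti (R := R) (leq_addl n k); have := halfX_gt0 k (R := R); nra.
Qed.

Section TbddForms.
Context {V Z : completeNormedModType K}.

(* Difference quotients with a fixed small step approximate the derivative
   uniformly, by the second-order Cauchy estimate. *)
Lemma tbdd_Df (F : set (V -> Z)) (d : R) : 0 < d -> (forall g, F g -> entire_bt g) ->
  (forall r : R, exists M : R, forall g, F g -> forall x, nm x <= r -> nm (g x) <= M) ->
  tbdd [set z | exists g x, [/\ F g, nm x <= d & z = g x]] ->
  tbdd [set z | exists g h x, [/\ F g, nm h <= 1, nm x <= d / 2 & z = Df g x h]].
Proof.
move=> d0 FE FM Fk; have [M0 hM0] := FM (d / 2 + 5); pose M := Num.max M0 0.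
have M00 : 0 <= M by rewrite le_max lexx orbT.
have hM g x : F g -> nm x <= d / 2 + 5 -> nm (g x) <= M by move=> Fg hx; rewrite le_max (hM0 g Fg x hx).
apply: tbdd_approx => e e0.
have p : 0 < 4 * M + 1 by lra.
have q : 0 < Num.min (Num.min 1 (d / 2)) (e / (4 * M + 1)) by rewrite !lt_min ltr01 !divr_gt0.
have [n] := half_pow q; rewrite !lt_min [_ < e / _]ltr_pdivlMr // => /andP[/andP[s1 s2] s3].
pose s : R := (2^-1) ^+ n; have s0 : 0 < s by exact: halfX_gt0.
set T := [set z | _] in Fk.
have T1 : tbdd [set - y | y in T].
  by apply: (@tbdd_lin R Z Z _ _ 1) Fk => [a x y|x]; rewrite ?nmN ?mul1r // opprD scalerN.
have T2 := tbdd_add Fk T1.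
exists [set rc s^-1 *: y | y in [set z | exists x y, [/\ T x, [set - y | y in T] y & z = x + y]]]; split.
  apply: (@tbdd_lin R Z Z _ _ s^-1) T2 => [a x y|x]; first by rewrite scalerDr !scalerA mulrC.
  by rewrite nmZ nm_rc gtr0_norm ?invr_gt0.
move=> _ [g [h [x [Fg h1 hx ->]]]].
have sh : nm (rc s *: h) <= s.
  by rewrite nmZ nm_rc gtr0_norm // -[leRHS]mulr1; apply: ler_wpM2l => //; exact: ltW.
exists (rc s^-1 *: (g (x + rc s *: h) - g x)).
  exists (g (x + rc s *: h) - g x) => //; exists (g (x + rc s *: h)), (- g x); split=> //.
    by exists g, (x + rc s *: h); split=> //; apply: (le_trans (nmD _ _)); rewrite /s in sh *; lra.
  by exists (g x) => //; exists g, x; split=> //; lra.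
have -> : Df g x h = rc s^-1 *: Df g x (rc s *: h).
  by rewrite (linZ (Df_lin x (FE _ Fg).1)) scalerA -rcM mulVf ?rc1 ?scale1r // lt0r_neq0.
rewrite nmBC -scalerBr nmZ nm_rc gtr0_norm ?invr_gt0 // ler_pdivrMl //.
have := cauchy_remainder_ball (f := g) (x := x) (M := M) (h := rc s *: h) (FE _ Fg).1 _ (DfP x (FE _ Fg).1) => H.
apply: (le_trans (H _ _)); last first.
- have n0 := nm_ge0 (rc s *: h); have : nm (rc s *: h) ^+ 2 <= s ^+ 2 by rewrite ler_sqr ?nnegrE // ltW.
  move=> h2; have h3 := ler_wpM2l (mulr_ge0 (ler0n _ 4) M00) h2; apply: (le_trans h3).
  have -> : 4 * M * s ^+ 2 = s * (4 * M * s) by ring.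
  have s3' : s * (4 * M + 1) < e := s3.
  apply: ler_wpM2l; first exact: ltW.
  by clear h3 h2 H; move: (s) (M) s0 s3' => u v u0 u1; lra.
- by apply: (le_trans sh); rewrite /s; exact: ltW.
- by move=> y hy; apply: hM => //; have := nm_tri y x 0; rewrite !subr0; lra.
Qed.

(** The induction runs over families of maps, because the derivatives in all unit directions form
    the family for the next step. The radius halves each time, which is harmless as only the origin
    is needed at the end. *)
Lemma tbdd_iter_Df m (F : set (V -> Z)) (d : R) : 0 < d -> (forall g, F g -> entire_bt g) ->
  (forall r : R, exists M : R, forall g, F g -> forall x, nm x <= r -> nm (g x) <= M) ->
  tbdd [set z | exists g x, [/\ F g, nm x <= d & z = g x]] ->
  tbdd [set z | exists g (h : 'I_m -> V), [/\ F g, forall k, nm (h k) <= 1 & z = iter_Df g h 0]].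
Proof.
elim: m F d => [|m IH] F d d0 FE FM Fk.
  apply: tbdd_sub Fk => _ [g [h [Fg _ ->]]]; exists g, 0; split=> //; by rewrite nm0 ltW.
pose F' := [set g' | exists g h, [/\ F g, nm h <= 1 & g' = fun x => Df g x h]].
have d2 : 0 < d / 2 by lra.
apply: (tbdd_sub _ (IH F' _ d2 _ _ _)).
- move=> _ [g [h [Fg h1 ->]]]; exists (fun x => Df g x (h ord0)), (fun j => h (lift ord0 j)); split=> //.
  by exists g, (h ord0); split.
- by move=> _ [g [h [Fg h1 ->]]]; apply: entire_bt_Df; exact: FE.
- move=> r; have [M hM] := FM (r + 2); exists (2 * Num.max M 0) => _ [g [h [Fg h1 ->]]] x hx.
  have := @cauchy_derivative_ball R V Z g x (Num.max M 0) _ h (FE _ Fg).1 _ (DfP x (FE _ Fg).1) => H.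
  apply: (le_trans (H _)) => [y hy|].
    by rewrite le_max (hM g Fg) //; have := nm_tri y x 0; rewrite !subr0; lra.
  have : 0 <= Num.max M 0 by rewrite le_max lexx orbT.
  by move: (Num.max M 0) => w w0; have := nm_ge0 h; nra.
- apply: tbdd_sub (tbdd_Df d0 FE FM Fk) => _ [_ [x [[g [h [Fg h1 ->]]] hx ->]]].
  by exists g, h, x; split.
Qed.
End TbddForms.

Lemma tbdd_bigU (W : normedModType K) (N : nat) (A : nat -> set W) : (forall m, tbdd (A m)) ->
  tbdd [set x | exists m, (m < N)%N /\ A m x].
Proof.
move=> hA; elim: N => [|N IH]; first by apply: tbdd_sub (tbdd_seq [::]) => x [m []].
apply: tbdd_sub (tbdd_setU IH (hA N)) => x [m []]; rewrite ltnS leq_eqVlt => /orP[/eqP ->|mN] Ax; first by right.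
by left; exists m.
Qed.

Lemma sup_bound (T : Type) (f : T -> R) (M : R) (P : set T) : (exists x, P x) -> (forall x, P x -> 0 <= f x <= M) ->
  exists c : R, [/\ 0 <= c, (forall x, P x -> f x <= c) & forall M', (forall x, P x -> f x <= M') -> c <= M'].
Proof.
move=> [x0 Px0] hM; pose S : set R := [set f x | x in P].
have S0 : S !=set0 by exists (f x0), x0.
have Su : has_ubound S by exists M => _ [x Px <-]; case/andP: (hM x Px).
have ub x : P x -> f x <= sup S by move=> Px; apply: ub_le_sup => //; exists x.
exists (sup S); split => //; first by apply: le_trans (ub x0 Px0); case/andP: (hM x0 Px0).
by move=> M' hM'; apply: ge_sup => // _ [x Px <-]; exact: hM'.
Qed.

(* The [c m] satisfy the Cauchy estimates of [f] for all radii at once, so the series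
   converges uniformly on every ball although the [B m] grow geometrically. *)
Lemma taylor_series (V : normedModType K) (X Z : completeNormedModType K) (f : V -> Z) (q : X -> Z)
    (B : forall m, ('I_m -> V) -> X) (b k : R) (c : nat -> R) :
  entire_bt f -> 0 <= b -> 0 <= k -> (forall m, mlin (B m)) -> (forall m, mbound (B m) (b * k ^+ m * c m)) ->
  (forall m (rho M : R), 0 < rho -> (forall y, nm y <= rho -> nm (f y) <= M) -> c m <= (16 / rho) ^+ m * M) ->
  lin q -> continuous q -> (forall m x, q (B m (fun=> x)) = taylor_term f m x) ->
  exists T : V -> X, [/\ entire_bt T, (forall x, q (T x) = f x) & forall r e : R, 0 < e -> exists N, forall n, (N <= n)%N ->
    forall x, nm x <= r -> nm (T x - \sum_(m < n) B m (fun=> x)) <= e].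
Proof.
move=> fEB b0 k0 Bm Bb hc ql qc qB.
pose T_ n (x : V) := \sum_(m < n) B m (fun=> x).
have T_EB n : entire_bt (T_ n) by apply: entire_bt_sum => m; exact: entire_bt_diag (Bm m) (Bb m).
have step (r : R) : exists C : R, forall x, nm x <= r -> forall n, nm (T_ n.+1 x - T_ n x) <= C * (2^-1) ^+ n.
  pose r' := Num.max r 1; have r1 : 1 <= r' by rewrite le_max lexx orbT.
  have rr : r <= r' by rewrite le_max lexx.
  (* With this radius the Cauchy estimate for [c n] brings the ratio k * r' * 16 / rho below 1/2. *)
  pose rho := 32 * (k + 1) * r'; have rho0 : 0 < rho by rewrite !mulr_gt0 //; lra.
  have [M hM] := fEB.2 rho; exists (b * M) => x hx n.
  have M0 : 0 <= M by apply: le_trans (nm_ge0 _) (hM 0 _); rewrite nm0 ltW.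
  have -> : T_ n.+1 x - T_ n x = B n (fun=> x) by rewrite /T_ big_ord_recr /= addrAC subrr add0r.
  apply: (le_trans (mbound_pow (Bm n) (Bb n) (fun=> le_trans hx rr))).
  have p : 0 <= b * k ^+ n * r' ^+ n.
    by apply: mulr_ge0; [apply: mulr_ge0 => //; exact: exprn_ge0|apply: exprn_ge0; lra].
  have := ler_wpM2l p (hc n rho M rho0 hM).
  have -> : b * k ^+ n * r' ^+ n * ((16 / rho) ^+ n * M) = b * M * (k * r' * (16 / rho)) ^+ n.
    by rewrite !exprMn; ring.
  have -> : b * k ^+ n * r' ^+ n * c n = b * k ^+ n * c n * r' ^+ n by ring.
  move=> h; apply: (le_trans h); apply: ler_wpM2l; first exact: mulr_ge0.
  have p2 : 0 <= k * r' by apply: mulr_ge0 => //; lra.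
  apply: lerXn2r; rewrite ?nnegrE; [by rewrite mulr_ge0 // divr_ge0 // ltW|lra|].
  by rewrite mulrA ler_pdivrMr // /rho; nra.
have /choice[T hT] : forall x, exists l, forall C : R, (forall n, nm (T_ n.+1 x - T_ n x) <= C * (2^-1) ^+ n) ->
    forall n, nm (l - T_ n x) <= 2 * C * (2^-1) ^+ n.
  move=> x; apply: (geo_lim (s := fun n => T_ n x) (seqcompleteP (W := X))).
  by have [C hC] := step (nm x); exists C => n; exact: hC.
have unif (r e : R) : 0 < e -> exists N, forall n, (N <= n)%N -> forall x, nm x <= r -> nm (T x - T_ n x) <= e.
  move=> e0; have [C hC] := step r; have p : 0 < 2 * `|C| + 1 by have := normr_ge0 C; lra.
  have [N] := half_pow (divr_gt0 e0 p); rewrite ltr_pdivlMr // => hN.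
  exists N => n Nn x hx; apply: (le_trans (hT x C (hC x hx) n)).
  have := half_anti (R := R) Nn; have := halfX_gt0 n (R := R); have := ler_norm C; have := normr_ge0 C; nra.
exists T; split=> //; first by apply: entire_bt_limit T_EB _ => r e e0; exact: unif.
move=> x; apply/eqP; rewrite -subr_eq0; apply/eqP; apply: nm_small => e e0.
have [cq cq0 hcq] := lin_bound ql qc.
have [N1 h1] := unif (nm x) (e / 2 / cq) ltac:(by rewrite !divr_gt0).
pose r := nm x + 1; have r0 : 0 < r by rewrite /r; have := nm_ge0 x; lra.
have [M hM] := fEB.2 (65 * r); have p : 0 < 2 * (`|M| + 1) by have := normr_ge0 M; lra.
have [N2] := half_pow (divr_gt0 e0 p); rewrite ltr_pdivlMr // => h2.
pose n := (N1 + N2)%N; have h3 := h1 n (leq_addr _ _) x (lexx _).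
have qTn : q (T_ n x) = \sum_(m < n) taylor_term f m x.
  by rewrite /T_ (lin_sum ql); apply: eq_bigr => m _; rewrite qB.
apply: (le_trans (nm_tri _ (q (T_ n x)) _)).
have h4 : nm (q (T x) - q (T_ n x)) <= e / 2.
  by rewrite -(linB ql); apply: (le_trans (hcq _)); rewrite mulrC -ler_pdivlMr.
have h5 : nm (q (T_ n x) - f x) <= e / 2.
  rewrite qTn nmBC; apply: (le_trans (taylor n fEB r0 hM _)); first by rewrite /r; lra.
  have q1 : (4^-1 : R) ^+ n <= (2^-1) ^+ n by apply: lerXn2r; rewrite ?nnegrE; lra.
  have q2 := half_anti (R := R) (leq_addl N1 N2).
  have q3 : 0 <= (4^-1 : R) ^+ n by rewrite exprn_ge0 // invr_ge0.
  have := ler_norm M; have := normr_ge0 M; rewrite -/n in q2; nra.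
lra.
Qed.

(** Taylor forms of all degrees, normalized and weighted by 2^-m, lie in one totally bounded set, so
    a single linear lift serves every degree. Undoing the weights costs 2^m, which [taylor_series]
    tolerates. *)
Theorem locfact_lifts_holo (Y X Z : completeNormedModType K) (i : Y -> X) (q : X -> Z) (lam : R) :
  locfact Y lam -> short_exact i q -> lifts q (@A_holo R).
Proof.
move=> hY ex V t [td tb tk].
have tEB : entire_bt t by split; [move=> x; exact: differentiable_frechet|exact/bounded_on_balls_bdd].
have [d d0 dk] : exists2 d : R, 0 < d & tbdd [set t x | x in [set x | nm x <= d]].
  have [U [/nbhs_nmP[r r0 hr] /compact_tbdd Uk]] := tk 0; exists (r / 2); first lra.
  by apply: tbdd_sub Uk => _ [x /= hx <-]; exists x => //; apply: hr; rewrite sub0r nmN; lra.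
pose unit m := [set h : 'I_m -> V | forall k, nm (h k) <= 1].
have fk m : tbdd [set taylor_form t h | h in unit m].
  have : tbdd [set z | exists g (h : 'I_m -> V), [/\ [set t] g, forall k, nm (h k) <= 1 & z = iter_Df g h 0]].
    apply: (@tbdd_iter_Df V Z m [set t] d d0) => [_ -> //|r|].
      by have [M hM] := tEB.2 r; exists M => _ -> x; exact: hM.
    by apply: tbdd_sub dk => _ [_ [x [-> hx ->]]]; exists x.
  move=> h; have := @tbdd_lin R Z Z _ (fun z => (m`!)%:R^-1 *: z) (nm ((m`!)%:R^-1 : K)) _ _ h => H.
  apply: tbdd_sub (H _ _) => [_ [u hu <-]|a x y|x]; last 2 first.
  - by rewrite scalerDr !scalerA mulrC.
  - by rewrite nmZ.
  by exists (iter_Df t u 0) => //; exists t, u.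
have /choice[c hc] : forall m, exists c : R, [/\ 0 <= c, (forall h, unit m h -> nm (taylor_form t h) <= c) &
    forall M', (forall h, unit m h -> nm (taylor_form t h) <= M') -> c <= M'].
  move=> m; have [M hM] := tEB.2 1; apply: (sup_bound (M := (16 / 1) ^+ m * M)).
    by exists (fun=> 0) => k; rewrite nm0.
  by move=> h hh; rewrite nm_ge0; apply: (taylor_form_bound tEB).
(* When [c m] is 0 the form vanishes on the unit ball, and the inverse of 0 being 0 makes the weight
   0. *)
pose w m : R := (2^-1) ^+ m * (c m)^-1.
pose Q := [set z | exists m (h : 'I_m -> V), unit m h /\ z = rc (w m) *: taylor_form t h].
have c0 m : 0 <= c m by have [] := hc m.
have w0 m : 0 <= w m by rewrite mulr_ge0 ?invr_ge0 // ltW // halfX_gt0.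
have Qk : tbdd Q.
  apply: tbdd_approx => e e0; have [N hN] := half_pow e0.
  pose A m := [set rc (w m) *: z | z in [set taylor_form t h | h in unit m]].
  have Ak m : tbdd (A m).
    by apply: (@tbdd_lin R Z Z _ _ (w m)) (fk m) => [a x y|x]; [rewrite scalerDr !scalerA mulrC|rewrite nmZ nm_rc ger0_norm].
  exists ([set x | exists m, (m < N)%N /\ A m x] `|` [set x | x \in [:: 0]]); split.
    by apply: tbdd_setU (tbdd_seq _); exact: tbdd_bigU.
  move=> _ [m [h [hh ->]]]; have [mN|Nm] := ltnP m N.
    exists (rc (w m) *: taylor_form t h); last by rewrite subrr nm0 ltW.
    by left; exists m; split=> //; exists (taylor_form t h) => //; exists h.
  exists 0; first by right; rewrite /= inE.
  rewrite subr0 nmZ nm_rc ger0_norm //; have [_ h1 _] := hc m.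
  apply: le_trans (_ : (2^-1) ^+ m <= _); last by apply: le_trans (half_anti Nm) (ltW hN).
  rewrite /w -mulrA -[leRHS]mulr1; apply: ler_wpM2l; first by rewrite ltW // halfX_gt0.
  have [->|cn0] := eqVneq (c m) 0; first by rewrite invr0 mul0r.
  by rewrite ler_pdivrMl ?mulr1 ?h1 // lt_neqAle eq_sym cn0 c0.
have [l [ll ql lk]] := compact_lifting hY ex Qk.
have [b b0 hb] := tbdd_bdd lk.
have sQ := submod_aspan Q.
have l0 : l 0 = 0.
  by have := ll 1 0 0 sQ.1 sQ.1; rewrite !scale1r addr0 => /eqP; rewrite -subr_eq0 opprD addNKr oppr_eq0 => /eqP.
have lZ a z : aspan Q z -> l (a *: z) = a *: l z.
  by move=> Qz; have := ll a z 0 Qz sQ.1; rewrite l0 !addr0.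
have funit m (h : 'I_m -> V) : unit m h -> exists z, Q z /\ taylor_form t h = rc (2 ^+ m * c m) *: z.
  move=> hh; exists (rc (w m) *: taylor_form t h); split; first by exists m, h.
  rewrite scalerA -rcM; have [cE|cn0] := eqVneq (c m) 0.
    have [_ h1 _] := hc m; have := h1 h hh; rewrite cE => /nm_le0 ->; by rewrite scaler0.
  have -> : 2 ^+ m * c m * w m = 1.
    by rewrite /w mulrACA -exprMn mulfV // expr1n mulfV // mulr1.
  by rewrite rc1 scale1r.
have fspan m (h : 'I_m -> V) : aspan Q (taylor_form t h).
  pose r k := nm (h k) + 1.
  have r0 k : 0 < r k by rewrite /r; have := nm_ge0 (h k); lra.
  have -> : h = (fun k => rc (r k) *: (rc (r k)^-1 *: h k)).
    by apply: funext => k; rewrite scalerA -rcM mulfV ?rc1 ?scale1r // lt0r_neq0.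
  rewrite (mlinZ _ _ (taylor_form_mlin tEB)); apply: (submodZ _ sQ).
  have [|z [Qz ->]] := funit m (fun k => rc (r k)^-1 *: h k).
    by move=> k; rewrite nmZ nm_rc gtr0_norm ?invr_gt0 // ler_pdivrMl // mulr1 /r; lra.
  by apply: (submodZ _ sQ); exact: aspan_in.
pose B m (h : 'I_m -> V) := l (taylor_form t h).
have Bm m : mlin (B m) by apply: (mlin_comp (taylor_form_mlin tEB) ll).
have Bb m : mbound (B m) (b * 2 ^+ m * c m).
  move=> h hh; have [z [Qz hz]] := funit m h hh.
  rewrite /B hz lZ; last exact: aspan_in.
  have p : 0 <= 2 ^+ m * c m by rewrite mulr_ge0 // exprn_ge0.
  rewrite nmZ nm_rc ger0_norm //; have -> : b * 2 ^+ m * c m = 2 ^+ m * c m * b by ring.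
  by apply: ler_wpM2l => //; apply: hb; exists z.
have hcr m (rho M : R) : 0 < rho -> (forall y, nm y <= rho -> nm (t y) <= M) -> c m <= (16 / rho) ^+ m * M.
  by move=> hr hM; have [_ _ h] := hc m; apply: h => h hh; apply: (taylor_form_bound tEB hr hM).
have qB m x : q (B m (fun=> x)) = taylor_term t m x by rewrite /B ql.
have qc : continuous q by case: ex => _ [].
have [T [TEB qT unif]] := taylor_series tEB (ltW b0) (ler0n R 2) Bm Bb hcr (ex_ql ex) qc qB.
pose T_ n (x : V) := \sum_(m < n) B m (fun=> x).
have Tk (r : R) : tbdd [set T x | x in [set x | nm x <= r]].
  have Bk m : tbdd [set B m (fun=> x) | x in [set x | nm x <= r]].
    pose r' := Num.max r 1; have r1 : 1 <= r' by rewrite le_max lexx orbT.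
    have rr : r <= r' by rewrite le_max lexx.
    pose s := r' ^+ m * (2 ^+ m * c m).
    have H : tbdd [set rc s *: z | z in l @` Q].
      by apply: (@tbdd_lin R X X _ _ `|s|) lk => [a x y|x]; [rewrite scalerDr !scalerA mulrC|rewrite nmZ nm_rc].
    apply: tbdd_sub H => _ [x /= hx <-].
    have [|z [Qz hz]] := funit m (fun=> rc r'^-1 *: x).
      move=> k; rewrite nmZ nm_rc gtr0_norm ?invr_gt0 ?ler_pdivrMl ?mulr1 //; lra.
    exists (l z); first by exists z.
    have -> : x = rc r' *: (rc r'^-1 *: x) by rewrite scalerA -rcM mulfV ?rc1 ?scale1r // lt0r_neq0 //; lra.
    rewrite (mlin_diagZ _ _ (Bm m)) {1}/B hz lZ; last exact: aspan_in.
    by rewrite scalerA -rcX -rcM.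
  have Tnk n : tbdd [set T_ n x | x in [set x | nm x <= r]].
    elim: n => [|n IH]; first by apply: tbdd_sub (tbdd_seq [:: 0]) => _ [x _ <-]; rewrite /T_ big_ord0 /= inE.
    apply: tbdd_sub (tbdd_add IH (Bk n)) => _ [x hx <-]; exists (T_ n x), (B n (fun=> x)); split.
    - by exists x.
    - by exists x.
    - by rewrite /T_ big_ord_recr.
  apply: tbdd_approx => e e0; have [N hN] := unif r e e0.
  exists [set T_ N x | x in [set x | nm x <= r]]; split=> // _ [x hx <-].
  by exists (T_ N x); [exists x|exact: hN].
exists T; split; last by apply: funext => x /=.
split.
- move=> x; have [L hL] := TEB.1 x; have [M hM] := TEB.2 (nm x + 2).
  apply: (frechet_differentiable (c := 2 * M) hL) => h.
  apply: (cauchy_derivative_ball h TEB.1 _ hL) => y hy; apply: hM.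
  by have := nm_tri y x 0; rewrite !subr0; lra.
- by apply/bounded_on_balls_bdd; exact: TEB.2.
- move=> x; exists [set y | nm (x - y) < 1]; split; first by apply/nbhs_nmP; exists 1.
  apply: tbdd_compact; apply: tbdd_sub (Tk (nm x + 1)) => _ [y /= hy <-]; exists y => //=.
  by have := nm_tri y x 0; rewrite !subr0 (nmBC y); lra.
Qed.
End HoloLift.

(** * The functors on weak*-continuous maps *)

Section WeakStar.
Context {R : realType}.
Local Notation K := (Cplx R).

Lemma ultra_lim (I : Type) (U : set_system I) (f : I -> K) (r : R) : UltraFilter U ->
  (forall i, nm (f i) <= r) -> exists l : K, forall e : R, 0 < e -> U [set i | nm (f i - l) <= e].
Proof.
move=> UU fr.
have ultra_seq (s : seq K) (e : R) : U [set i | exists2 y, y \in s & nm (f i - y) <= e] ->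
    exists y, U [set i | nm (f i - y) <= e].
  elim: s => [h|z s IH h].
    by have : U set0 by [apply: filterS h => x [y]]; move=> /filter_not_empty.
  have [h1|h1] := in_ultra_setVsetC [set i | nm (f i - z) <= e] UU; first by exists z.
  apply: IH; apply: filterS2 h h1 => x [y]; rewrite inE => /orP[/eqP -> h2 /(_ h2)//|ys h2 _].
  by exists y.
have /choice[z hz] : forall n, exists y, U [set i | nm (f i - y) <= (2^-1) ^+ n].
  move=> n; have [s hs] := @tbdd_disc R r _ (halfX_gt0 n); apply: (ultra_seq s).
  by apply: filterE => i /=; have [y ys h] := hs (f i) (fr i); exists y.
have [|l hl] := geo_cvg (W := K^o) (s := z) (c := 2) (@seqcomplete_K R).
  move=> n; have [i [/= h1 h2]] := filter_ex (filterI (hz n) (hz n.+1)).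
  apply: (le_trans (nm_tri _ (f i : K^o) _)); rewrite (nmBC (z n.+1)).
  by move: h1 h2; rewrite exprS => h1 h2; have := halfX_gt0 n (R := R); lra.
exists l => e e0; have e5 : 0 < e / 5 by lra.
have [n hn] := half_pow e5; apply: filterS (hz n) => i /= hi.
have h1 := hl n; rewrite nmBC in h1.
by apply: (le_trans (nm_tri _ (z n : K^o) _)); apply: (le_trans (lerD hi h1)); lra.
Qed.

(* Uniform weak*-continuity on balls; equivalent to [wstar_norm_cont_bdd] because
   balls of the dual are weak*-compact. *)
Definition wunif {Y W : completeNormedModType K} (g : Dual Y -> W) := forall r e : R, 0 < e ->
  exists (E : seq Y) (d : R), 0 < d /\ forall phi phi' : Dual Y, nm phi <= r -> nm phi' <= r ->
    (forall y, y \in E -> nm (sval phi y - sval phi' y) <= d) -> nm (g phi - g phi') <= e.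

Lemma wunif_wstar_norm_cont (Y W : completeNormedModType K) (g : Dual Y -> W) : wunif g -> wstar_norm_cont_bdd g.
Proof.
move=> hg B /dual_boundedP[c hc] phi0 B0 F FF FB hF.
apply/cvg_nmP => e e0; have e2 : 0 < e / 2 by lra.
have [E [d [d0 hE]]] := hg c _ e2.
have FE : F [set phi | forall y, y \in E -> nm (sval phi y - sval phi0 y) <= d].
  elim: E {hE} => [|y E IH]; first by apply: filterE.
  have FF' : Filter F by exact: _.
  have h := (proj1 (wstar_convP phi0 FF')) hF y d d0.
  apply: filterS2 IH h => phi /= h1 h2 z; rewrite inE => /orP[/eqP ->|/h1 //]; exact: ltW.
apply: filterS2 FB FE => phi /= Bp hp; rewrite nmBC.
by have := hE phi phi0 (hc _ Bp) (hc _ B0) hp; lra.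
Qed.

(* Otherwise, along an ultrafilter on the pairs (finite set, tolerance), two nets
   of functionals have the same weak* limit but images at distance more than e. *)
Lemma wstar_norm_cont_wunif (Y W : completeNormedModType K) (g : Dual Y -> W) : wstar_norm_cont_bdd g -> wunif g.
Proof.
move=> hg r e e0; apply: contrapT => hn.
have /choice[p hp] : forall i : seq Y * nat, exists p : Dual Y * Dual Y, [/\ nm p.1 <= r, nm p.2 <= r,
    forall y, y \in i.1 -> nm (sval p.1 y - sval p.2 y) <= (2^-1) ^+ i.2 & e < nm (g p.1 - g p.2)].
  move=> [E n] /=; apply: contrapT => hnp; apply: hn; exists E, ((2^-1) ^+ n); split; first exact: halfX_gt0.
  move=> phi phi' h1 h2 h3; rewrite leNgt; apply/negP => h4; apply: hnp.
  by exists (phi, phi').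
pose base (i0 : seq Y * nat) := [set i : seq Y * nat | {subset i0.1 <= i.1} /\ (i0.2 <= i.2)%N].
pose F := filter_from setT base.
(* Larger finite sets and smaller tolerances refine each other, so the pairs are directed; the
   ultrafilter U lives on the indices and makes all scalar values converge. *)
have FF : ProperFilter F.
  apply: filter_from_proper; last by move=> i _; exists i; split.
  apply: filter_from_filter; first by exists ([::], 0%N).
  move=> [E n] [E' n'] _ _; exists (E ++ E', maxn n n') => // i [/= h1 h2]; split; split=> /=.
  - by move=> y yE; apply: h1; rewrite mem_cat yE.
  - by apply: leq_trans h2; exact: leq_maxl.
  - by move=> y yE; apply: h1; rewrite mem_cat yE orbT.
  - by apply: leq_trans h2; exact: leq_maxr.
have [U [UU FU]] := ultraFilterLemma FF.
have Ub i0 : U (base i0) by apply: FU; exists i0.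
have r0 : 0 <= r by have [h _ _ _] := hp ([::], 0%N); exact: le_trans (nm_ge0 _) h.
have /choice[l hl] : forall y, exists l : K, forall d : R, 0 < d -> U [set i | nm (sval (p i).1 y - l) <= d].
  move=> y; apply: (ultra_lim (r := r * nm y) UU) => i; have [h _ _ _] := hp i.
  by apply: (le_trans (nm_dual_ge _ _)); apply: ler_wpM2r => //; exact: nm_ge0.
have ll : lfun l.
  move=> a x y; apply/eqP; rewrite -subr_eq0; apply/eqP; apply: (@nm_small R K^o) => d d0.
  have q0 : 0 < d / (nm a + 2) by rewrite divr_gt0 //; have := nm_ge0 a; lra.
  have [i [[/= h1 h2] h3]] := filter_ex (filterI (filterI (hl x _ q0) (hl y _ q0)) (hl (a *: x + y) _ q0)).
  rewrite (dual_lfun (p i).1) in h3.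
  have -> : l (a *: x + y) - (a * l x + l y) = a * (sval (p i).1 x - l x) + (sval (p i).1 y - l y)
     - (a * sval (p i).1 x + sval (p i).1 y - l (a *: x + y)) by ring.
  apply: (le_trans (nmB _ _)); have h4 := nmD (a * (sval (p i).1 x - l x)) (sval (p i).1 y - l y).
  rewrite nmM in h4; have h5 := ler_wpM2l (nm_ge0 a) h1.
  have : d = nm a * (d / (nm a + 2)) + 2 * (d / (nm a + 2)) by field; rewrite lt0r_neq0 //; have := nm_ge0 a; lra.
  move=> h6; rewrite [leRHS]h6; lra.
have lb y : nm (l y) <= r * nm y.
  apply/ler_addgt0Pr => d d0; have [i /= hi] := filter_ex (hl y d d0).
  have [h _ _ _] := hp i; have h2 := nm_dual_ge (p i).1 y.
  have h3 : nm (p i).1 * nm y <= r * nm y by apply: ler_wpM2r => //; exact: nm_ge0.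
  have := nm_Bge (l y : K^o) (sval (p i).1 y : K^o); rewrite nmBC; lra.
pose ph := mkdual ll lb.
have phr : nm ph <= r by apply: nm_dualP.
pose B := [set phi : Dual Y | nm phi <= r].
have Bb : dual_bounded B by apply/dual_boundedP; exists r.
have cv (s : seq Y * nat -> Dual Y) : (forall i, nm (s i) <= r) ->
    (forall y (d : R), 0 < d -> U [set i | nm (sval (s i) y - l y) <= d]) -> U [set i | nm (g ph - g (s i)) < e / 2].
  move=> sr sl.
  have FB : U (s @^-1` B) by apply: filterE => i; exact: sr.
  have cvs : wstar_conv (s @ U) ph.
    apply/wstar_convP => y d d0; have d2 : 0 < d / 2 by lra.
    by apply: (@filterS _ U _ _ _ _ (sl y _ d2)) => i /= h; lra.
  have /cvg_nmP H : g @ (s @ U) --> g ph by exact: (hg B Bb ph phr (s @ U) _ FB cvs).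
  by apply: H; lra.
have h1 := cv (fun i => (p i).1) (fun i => let: And4 h _ _ _ := hp i in h) hl.
have h2 : U [set i | nm (g ph - g (p i).2) < e / 2].
  apply: cv => [i|y d d0]; first by have [] := hp i.
  have d2 : 0 < d / 2 by lra.
  have [n hn2] := half_pow d2.
  apply: filterS2 (hl y _ d2) (Ub ([:: y], n)) => i /= hi [hE hN].
  have [_ _ h3 _] := hp i; have := h3 y (hE y (mem_head _ _)).
  have h4 := half_anti (R := R) hN; rewrite /= in h4.
  rewrite nmBC => h5; apply: (le_trans (nm_tri _ (sval (p i).1 y : K^o) _)).
  by apply: (le_trans (lerD h5 hi)); rewrite /=; lra.
have [i [/= h3 h4]] := filter_ex (filterI h1 h2).
have [_ _ _] := hp i; have := nm_tri (g (p i).1) (g ph) (g (p i).2); rewrite (nmBC (g (p i).1) (g ph)); lra.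
Qed.

Section Closure.
Context {Y W : completeNormedModType K}.
Implicit Types g h : Dual Y -> W.

Lemma wunifD g h : wunif g -> wunif h -> wunif (fun p => g p + h p).
Proof.
move=> hg hh r e e0; have e2 : 0 < e / 2 by lra.
have [E [d [d0 hE]]] := hg r _ e2; have [E' [d' [d'0 hE']]] := hh r _ e2.
exists (E ++ E'), (Num.min d d'); split; first by rewrite lt_min d0.
move=> p p' p1 p2 hp; rewrite opprD addrACA; apply: (le_trans (nmD _ _)).
have h1 := hE p p' p1 p2; have h2 := hE' p p' p1 p2.
have -> : e = e / 2 + e / 2 by lra.
apply: lerD; [apply: h1 => y yE|apply: h2 => y yE].
  by have := hp y; rewrite mem_cat yE le_min => /(_ isT)/andP[].
by have := hp y; rewrite mem_cat yE orbT le_min => /(_ isT)/andP[].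
Qed.
Lemma wunif_lip (W' : completeNormedModType K) g (h : Dual Y -> W') (c : R) : wunif g ->
  (forall p p', nm (h p - h p') <= c * nm (g p - g p')) -> wunif h.
Proof.
move=> hg hc r e e0; have q0 : 0 < e / (`|c| + 1) by rewrite divr_gt0 //; have := normr_ge0 c; lra.
have [E [d [d0 hE]]] := hg r _ q0; exists E, d; split=> // p p' p1 p2 hp.
apply: (le_trans (hc _ _)); have h1 := hE p p' p1 p2 hp.
apply: le_trans (_ : (`|c| + 1) * (e / (`|c| + 1)) <= _); last first.
  by rewrite mulrC divfK // lt0r_neq0 //; have := normr_ge0 c; lra.
have := ler_norm c; have := normr_ge0 c; have := nm_ge0 (g p - g p'); nra.
Qed.
Lemma wunif_cst (c : W) : wunif (fun _ : Dual Y => c).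
Proof. by move=> r e e0; exists [::], 1; split=> // p p' _ _ _; rewrite subrr nm0 ltW. Qed.
Lemma wunif_sum (I : Type) (s : seq I) (F : I -> Dual Y -> W) : (forall i, wunif (F i)) ->
  wunif (fun y => \sum_(i <- s) F i y).
Proof.
move=> hF; elim: s => [|i s IH].
  by rewrite (_ : (fun y => _) = fun=> 0); [exact: wunif_cst|apply: funext => y; rewrite big_nil].
rewrite (_ : (fun y => _) = fun y => F i y + \sum_(j <- s) F j y); first exact: wunifD.
by apply: funext => y; rewrite big_cons.
Qed.
Lemma wunif_lim g : (forall r e : R, 0 < e -> exists h, wunif h /\ forall p, nm p <= r -> nm (g p - h p) <= e) ->
  wunif g.
Proof.
move=> hg r e e0; have e3 : 0 < e / 3 by lra.
have [h [hh hr]] := hg r _ e3; have [E [d [d0 hE]]] := hh r _ e3.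
exists E, d; split=> // p p' p1 p2 hp; have h1 := hE p p' p1 p2 hp.
apply: (le_trans (nm_tri _ (h p) _)); have := nm_tri (h p) (h p') (g p').
by have := hr p p1; have := hr p' p2; rewrite (nmBC (h p') (g p')); lra.
Qed.
Lemma wunif_mul g y : wunif g -> bounded_on_balls g -> wunif (fun p => sval p y *: g p).
Proof.
move=> hg bg r e e0; have [M hM] := bg r.
pose M' := Num.max M 0; have M0 : 0 <= M' by rewrite le_max lexx orbT.
have hM' p : nm p <= r -> nm (g p) <= M' by move=> /hM h; rewrite le_max h.
pose c := `|r| * nm y + 1; have c0 : 0 < c by rewrite ltr_wpDl // mulr_ge0 ?nm_ge0.
have q0 : 0 < e / (2 * c) by rewrite divr_gt0 // mulr_gt0.
have [E [d [d0 hE]]] := hg r _ q0.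
have q1 : 0 < e / (2 * (M' + 1)) by rewrite divr_gt0 // mulr_gt0 //; lra.
exists (y :: E), (Num.min d (e / (2 * (M' + 1)))); split; first by rewrite lt_min d0.
move=> p p' p1 p2 hp.
have -> : sval p y *: g p - sval p' y *: g p' = sval p y *: (g p - g p') + (sval p y - sval p' y) *: g p'.
  by rewrite scalerBr scalerBl addrA subrK.
apply: (le_trans (nmD _ _)); rewrite !nmZ; have -> : e = e / 2 + e / 2 by lra.
apply: lerD.
  have h1 : nm (g p - g p') <= e / (2 * c).
    by apply: hE => // z zE; have := hp z; rewrite inE zE orbT le_min => /(_ isT)/andP[].
  have h2 : nm (sval p y) <= c.
    apply: (le_trans (nm_dual_ge _ _)); rewrite /c.
    have : nm p * nm y <= `|r| * nm y by apply: ler_wpM2r; [exact: nm_ge0|exact: le_trans p1 (ler_norm r)].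
    lra.
  apply: (le_trans (ler_pM (nm_ge0 _) (nm_ge0 _) h2 h1)).
  by rewrite le_eqVlt; apply/orP; left; apply/eqP; field; rewrite lt0r_neq0.
have h1 : nm (sval p y - sval p' y) <= e / (2 * (M' + 1)).
  by have := hp y; rewrite mem_head le_min => /(_ isT)/andP[].
apply: (le_trans (ler_pM (nm_ge0 _) (nm_ge0 _) h1 (hM' _ p2))).
have : e / (2 * (M' + 1)) * (M' + 1) = e / 2 by field; rewrite lt0r_neq0 //; lra.
lra.
Qed.
Lemma wunif_prod m (u : 'I_m -> Y) (x : W) : wunif (fun p : Dual Y => (\prod_j sval p (u j)) *: x) /\
  bounded_on_balls (fun p : Dual Y => (\prod_j sval p (u j)) *: x).
Proof.
elim: m u => [|m IH] u.
  rewrite (_ : (fun p => _) = fun=> x); last by apply: funext => p; rewrite big_ord0 scale1r.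
  by split; [exact: wunif_cst|move=> r; exists (nm x)].
have [h1 h2] := IH (fun j => u (lift ord0 j)).
rewrite (_ : (fun p => _) = fun p : Dual Y => sval p (u ord0) *: ((\prod_(j < m) sval p (u (lift ord0 j))) *: x)).
  split; first exact: wunif_mul.
  move=> r; have [M hM] := h2 r; exists (`|r| * nm (u ord0) * M) => p pr; rewrite nmZ.
  apply: ler_pM; [exact: nm_ge0|exact: nm_ge0| |exact: hM].
  apply: (le_trans (nm_dual_ge _ _)); apply: ler_wpM2r; first exact: nm_ge0.
  exact: le_trans pr (ler_norm r).
by apply: funext => p; rewrite big_ord_recl scalerA.
Qed.
Lemma wunif_cont g : wunif g -> dual_cont g.
Proof.
move=> hg; apply/dual_contP => phi0 e e0; have e2 : 0 < e / 2 by lra.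
have [E [d [d0 hE]]] := hg (nm phi0 + 1) _ e2.
pose c := \sum_(y <- E) nm y + 1.
have c0 : 0 < c by rewrite ltr_wpDl //; apply: sumr_ge0 => *; exact: nm_ge0.
exists (Num.min 1 (d / c)) => [|phi]; first by rewrite lt_min ltr01 divr_gt0.
rewrite le_min => /andP[h1 h2]; rewrite ler_pdivlMr // in h2.
apply: (le_lt_trans (hE phi phi0 _ _ _)) => [||y yE|]; last lra.
- by have := nm_tri phi phi0 0; rewrite !subr0; lra.
- by lra.
rewrite -dualB; apply: (le_trans (nm_dual_ge _ _)); apply: le_trans h2.
apply: ler_wpM2l; first exact: nm_ge0.
rewrite /c (big_rem y yE) /= -addrA lerDl addr_ge0 //.
by apply: sumr_ge0 => *; exact: nm_ge0.
Qed.
End Closure.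

Section FiniteRank.
Context {Y : completeNormedModType K}.
Variables (lam : R) (hY : locfact Y lam).

(* The adjoint of y |-> \sum_k p_k y v_k, hence a uniformly bounded family of
   weak*-continuous finite-rank operators on the dual. *)
Definition fdproj n (v : 'I_n -> Y) (p : 'I_n -> Dual Y) (phi : Dual Y) : Dual Y :=
  \sum_(k < n) sval phi (v k) *: p k.

Lemma fdprojE n (v : 'I_n -> Y) p phi y : sval (fdproj v p phi) y = sval phi (\sum_k sval (p k) y *: v k).
Proof.
rewrite /fdproj (big_morph (fun ch : Dual Y => sval ch y) (id1 := 0) (op1 := +%R)) //.
rewrite (lfun_sum (dual_lfun phi)); apply: eq_bigr => k _.
by rewrite dualZ (lfunZ (dual_lfun phi)) mulrC.
Qed.
Lemma fdproj_lin n (v : 'I_n -> Y) p : lin (fdproj v p).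
Proof. by move=> a x y; apply: dual_ext_eq => z; rewrite dualD dualZ !fdprojE. Qed.

Definition adapted n (v : 'I_n -> Y) (p : 'I_n -> Dual Y) := (forall k, nm (p k) <= 1) /\
  forall (c : 'I_n -> K) (M : R), 0 <= M -> (forall k, nm (c k) <= M) -> nm (\sum_(k < n) c k *: v k) <= lam * M.

Lemma fdproj_bound n (v : 'I_n -> Y) p phi : 0 <= lam -> adapted v p -> nm (fdproj v p phi) <= lam * nm phi.
Proof.
move=> lam0 [p1 vb]; apply: nm_dualP => [|y]; first by rewrite mulr_ge0 ?nm_ge0.
rewrite fdprojE; apply: (le_trans (nm_dual_ge _ _)); rewrite [lam * _]mulrC -mulrA.
apply: ler_wpM2l; first exact: nm_ge0.
apply: vb; first exact: nm_ge0.
move=> k; apply: (le_trans (nm_dual_ge _ _)); rewrite -[leRHS]mul1r.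
by apply: ler_wpM2r; [exact: nm_ge0|exact: p1].
Qed.

Lemma fdproj_seq (E : seq Y) : exists n (v : 'I_n -> Y) (p : 'I_n -> Dual Y), adapted v p /\
  forall phi y, y \in E -> sval (fdproj v p phi) y = sval phi y.
Proof.
have [n [v [p [p1 vb pe]]]] := hY (fun k : 'I_(size E) => tnth (in_tuple E) k).
exists n, v, p; split=> // phi y yE; rewrite fdprojE.
by have /tnthP[j ->] : y \in in_tuple E by []; rewrite -pe.
Qed.

(** phi and its projection agree on the finite set E and both lie in the ball of radius lam * r, on
    which [wunif] is applied. *)
Lemma fdproj_approx (W : completeNormedModType K) (g : Dual Y -> W) (r e : R) : 1 <= lam -> 0 <= r -> wunif g -> 0 < e ->
  exists n (v : 'I_n -> Y) (p : 'I_n -> Dual Y), adapted v p /\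
    forall phi, nm phi <= r -> nm (g phi - g (fdproj v p phi)) <= e.
Proof.
move=> lam1 r0 hg e0; have [E [d [d0 hE]]] := hg (lam * r) e e0.
have lam0 : 0 <= lam by exact: le_trans ler01 lam1.
have [n [v [p [gd hp]]]] := fdproj_seq E; exists n, v, p; split=> // phi pr.
apply: hE => [||y yE].
- by apply: (le_trans pr); rewrite ler_peMl.
- by apply: (le_trans (fdproj_bound _ lam0 gd)); apply: ler_wpM2l.
- by rewrite hp // subrr (@nm0 R K^o) ltW.
Qed.
End FiniteRank.
End WeakStar.

(** * Exactness for weak*-continuous polynomials *)

Section PolyExact.
Context {R : realType}.
Local Notation K := (Cplx R).

Lemma nm_prod (I : finType) (F : I -> K) : nm (\prod_i F i) = \prod_i nm (F i).
Proof.
rewrite (big_morph (@nm R K^o) (id1 := 1) (op1 := *%R)) //; first by move=> a b; rewrite nmM.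
exact: nm1.
Qed.

Lemma locfact_ge1 (Y : completeNormedModType K) (lam : R) : locfact Y lam -> exists lam', 1 <= lam' /\ locfact Y lam'.
Proof.
move=> hY; exists (Num.max lam 1); split; first by rewrite le_max lexx orbT.
move=> m e; have [n [v [p [p1 vb pe]]]] := hY m e; exists n, v, p; split=> // c M M0 hc.
by apply: (le_trans (vb c M M0 hc)); apply: ler_wpM2r => //; rewrite le_max lexx.
Qed.

Lemma mlin_lim (V W : normedModType K) m (S : nat -> ('I_m -> V) -> W) (B : ('I_m -> V) -> W) :
  (forall n, mlin (S n)) -> (forall q, exists c : R, forall n, nm (B q - S n q) <= c * (2^-1) ^+ n) -> mlin B.
Proof.
move=> Sm hB j q a u w.
have [c1 h1] := hB (upd q j (a *: u + w)); have [c2 h2] := hB (upd q j u); have [c3 h3] := hB (upd q j w).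
apply/eqP; rewrite -subr_eq0; apply/eqP; apply: nm_small => e e0.
pose c := `|c1| + nm a * `|c2| + `|c3| + 1.
have c0 : 0 < c by rewrite ltr_wpDl // !addr_ge0 // mulr_ge0 ?nm_ge0.
have [n hn] := half_pow (divr_gt0 e0 c0); rewrite ltr_pdivlMr // in hn.
have -> : B (upd q j (a *: u + w)) - (a *: B (upd q j u) + B (upd q j w)) =
  (B (upd q j (a *: u + w)) - S n (upd q j (a *: u + w))) -
    (a *: (B (upd q j u) - S n (upd q j u)) + (B (upd q j w) - S n (upd q j w))).
  by rewrite scalerBr (addrACA (a *: B _)) -opprD -(Sm n) opprB addrA subrK.
apply: (le_trans (nmB _ _)).
have k1 := h1 n; have k2 := ler_wpM2l (nm_ge0 a) (h2 n); have k3 := h3 n.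
have := nmD (a *: (B (upd q j u) - S n (upd q j u))) (B (upd q j w) - S n (upd q j w)); rewrite nmZ => k4.
have d0 : 0 <= (2^-1 : R) ^+ n := ltW (halfX_gt0 n).
have l1 := ler_wpM2r d0 (ler_norm c1); have l2 := ler_wpM2l (nm_ge0 a) (ler_wpM2r d0 (ler_norm c2)); have l3 := ler_wpM2r d0 (ler_norm c3).
rewrite /c in hn; lra.
Qed.

Lemma ex_section (A B C : completeNormedModType K) (a : A -> B) (b : B -> C) : short_exact a b ->
  exists inv : B -> A, [/\ (forall y, inv (a y) = y), (forall x, b x = 0 -> a (inv x) = x),
    (forall (k : K) x y, b x = 0 -> b y = 0 -> inv (k *: x + y) = k *: inv x + inv y) &
    exists D : R, forall x y, b x = 0 -> b y = 0 -> nm (inv x - inv y) <= D * nm (x - y)].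
Proof.
move=> ex; have al := ex_il ex.
have /choice[inv hinv] : forall x, exists y, b x = 0 -> a y = x.
  by move=> x; have [/(ex_ker ex)[y hy]|n] := pselect (b x = 0); [exists y|exists 0].
exists inv; split=> //.
- by move=> y; apply: (ex_inj ex); apply: hinv; exact: (ex_qi ex).
- move=> k x y hx hy; apply: (ex_inj ex); rewrite al !hinv //.
  by rewrite (ex_ql ex) hx hy scaler0 addr0.
- have [D D0 hD] := ex_i_inverse_bound ex; exists D => x y hx hy.
  by apply: (le_trans (hD _)); rewrite (linB al) !hinv.
Qed.

Section FiniteForms.
Context {Y W : completeNormedModType K}.

Definition finite_form n m (v : 'I_n -> Y) (x : {ffun 'I_m -> 'I_n} -> W) (q : 'I_m -> Dual Y) : W :=
  \sum_(f : {ffun 'I_m -> 'I_n}) (\prod_j sval (q j) (v (f j))) *: x f.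

Lemma finite_form_mlin n m (v : 'I_n -> Y) (x : {ffun 'I_m -> 'I_n} -> W) : mlin (finite_form v x).
Proof.
move=> j q a u w; rewrite /finite_form scaler_sumr -big_split; apply: eq_bigr => f _ /=.
rewrite scalerA -scalerDl; congr (_ *: _).
have E t : \prod_k sval (upd q j t k) (v (f k)) = sval t (v (f j)) * \prod_(k | k != j) sval (q k) (v (f k)).
  rewrite (bigD1 j) //= upd_same; congr (_ * _); apply: eq_bigr => k /negbTE hk.
  by rewrite /upd hk.
by rewrite !E dualD dualZ; ring.
Qed.

(** The sum over index maps factors into a product of sums over k, each at most lam times a norm by
    [locfact_dual]; the bound is independent of n. *)
Lemma finite_form_bound (lam S : R) n m (v : 'I_n -> Y) (p : 'I_n -> Dual Y) (x : {ffun 'I_m -> 'I_n} -> W) q : adapted lam v p ->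
  (forall f, nm (x f) <= S) -> 0 <= S -> nm (finite_form v x q) <= S * \prod_j (lam * nm (q j)).
Proof.
move=> [_ vb] hx S0; apply: (le_trans (nm_sum _ _ _)).
apply: le_trans (_ : \sum_(f : {ffun 'I_m -> 'I_n}) S * \prod_j nm (sval (q j) (v (f j))) <= _).
  apply: ler_sum => f _; rewrite nmZ nm_prod mulrC; apply: ler_pM => //; first exact: nm_ge0.
  by apply: prodr_ge0 => j _; exact: nm_ge0.
rewrite -mulr_sumr; apply: ler_wpM2l => //.
rewrite -(bigA_distr_bigA (fun j k => nm (sval (q j) (v k)))).
apply: ler_prod => j _; apply/andP; split; first by apply: sumr_ge0 => *; exact: nm_ge0.
by rewrite mulrC; exact: locfact_dual.
Qed.

Lemma finite_form_wunif n m (v : 'I_n -> Y) (x : {ffun 'I_m -> 'I_n} -> W) : wunif (fun phi => finite_form v x (fun=> phi)).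
Proof. by apply: wunif_sum => f; have [] := wunif_prod (fun j => v (f j)) (x f). Qed.

Lemma finite_form_proj n m (v : 'I_n -> Y) (p : 'I_n -> Dual Y) (A : ('I_m -> Dual Y) -> W) q : mlin A ->
  A (fun j => fdproj v p (q j)) = finite_form v (fun f => A (fun j => p (f j))) q.
Proof. by move=> mA; rewrite /fdproj (mlin_expand (fun j k => sval (q j) (v k)) (fun=> p) mA). Qed.

Lemma mlin_fdproj n m (v : 'I_n -> Y) (p : 'I_n -> Dual Y) (A : ('I_m -> Dual Y) -> W) : mlin A ->
  mlin (fun q => A (fun j => fdproj v p (q j))).
Proof.
move=> mA j q a u w; have E t : (fun k => fdproj v p (upd q j t k)) = upd (fun k => fdproj v p (q k)) j (fdproj v p t).
  by apply: funext => k; rewrite /upd; case: eqP.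
by rewrite !E fdproj_lin mA.
Qed.
End FiniteForms.

Lemma mlinB (V W : normedModType K) m (A B : ('I_m -> V) -> W) : mlin A -> mlin B -> mlin (fun q => A q - B q).
Proof. by move=> mA mB j q a u w; rewrite mA mB scalerBr opprD addrACA. Qed.

Lemma mlin_sum (V W : normedModType K) m n (A : nat -> ('I_m -> V) -> W) : (forall k, mlin (A k)) ->
  mlin (fun q => \sum_(k < n) A k q).
Proof.
move=> mA j q a u w; rewrite scaler_sumr -big_split; apply: eq_bigr => k _.
exact: mA.
Qed.

Section Lifting.
Context {Y A B C : completeNormedModType K}.
Variables (lam D : R) (hY : locfact Y lam) (lam1 : 1 <= lam).
Variables (a : A -> B) (b : B -> C) (ex : short_exact a b).
Hypothesis D0 : 0 < D.
Hypothesis hD : forall z, exists2 x, b x = z & nm x <= D * nm z.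

(* E lives on finitely many coordinates, so composing it with a suitable
   [fdproj] does not change it and only finitely many coefficients are lifted. *)
Lemma finite_lift m (E : ('I_m -> Dual Y) -> C) (S : R) (L : seq Y) : mlin E ->
  (forall phi, nm phi <= 1 -> nm (E (fun=> phi)) <= S) ->
  (forall phi phi' : Dual Y, (forall y, y \in L -> sval phi y = sval phi' y) -> E (fun=> phi) = E (fun=> phi')) ->
  exists F : ('I_m -> Dual Y) -> B, [/\ mlin F, (forall phi, b (F (fun=> phi)) = E (fun=> phi)),
    wunif (fun phi => F (fun=> phi)) & mbound F (D * (4 ^+ m * S) * lam ^+ m)].
Proof.
move=> mE ES EL; have S0 : 0 <= S by apply: le_trans (nm_ge0 _) (ES 0 _); rewrite nm0.
have [n [v [p [gd hp]]]] := fdproj_seq hY L.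
(* The coefficients are off-diagonal values, and only those of the symmetrization are controlled by
   the diagonal, with m^m / m! <= 4^m. *)
pose c (f : {ffun 'I_m -> 'I_n}) := msym E (fun j => p (f j)).
have cS f : nm (c f) <= 4 ^+ m * S.
  apply: (le_trans (mlin_diag_bound mE ES (x := fun j => p (f j)) _)) => [j|]; first exact: gd.1.
  apply: ler_wpM2r => //; rewrite ler_pdivrMr ?ltr0n ?fact_gt0 //.
  by rewrite -!natrX -natrM ler_nat pow_le_fact.
have /choice[x hx] : forall f, exists x, b x = c f /\ nm x <= D * nm (c f).
  by move=> f; have [x h1 h2] := hD (c f); exists x.
exists (finite_form v x); split.
- exact: finite_form_mlin.
- move=> phi; rewrite (lin_sum (ex_ql ex)).
  rewrite (EL phi (fdproj v p phi)); last by move=> y yL; rewrite hp.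
  rewrite -(msym_diag E) (finite_form_proj v p (fun=> phi) (msym_mlin mE)); apply: eq_bigr => f _.
  by rewrite (linZ (ex_ql ex)) (proj1 (hx f)).
- exact: finite_form_wunif.
- move=> q hq; have DS : 0 <= D * (4 ^+ m * S) by rewrite mulr_ge0 ?(ltW D0) // mulr_ge0 // exprn_ge0.
  apply: (le_trans (finite_form_bound q gd (S := D * (4 ^+ m * S)) _ DS)).
    by move=> f; apply: (le_trans (proj2 (hx f))); apply: ler_wpM2l; [exact: ltW|exact: cS].
  apply: ler_wpM2l => //; rewrite -[m in leRHS]card_ord -prodr_const.
  have l0 : 0 <= lam by exact: le_trans lam1.
  apply: ler_prod => j _; rewrite mulr_ge0 ?nm_ge0 //= -[leRHS]mulr1; exact: ler_wpM2l.
Qed.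

(* G is the telescoping sum of the differences of G o fdproj, each of which depends
   on finitely many coordinates and is small on the unit ball. *)
Lemma poly_lift m (G : ('I_m -> Dual Y) -> C) (s : R) : 0 < s -> mlin G -> wunif (fun phi => G (fun=> phi)) ->
  (forall phi, nm phi <= 1 -> nm (G (fun=> phi)) <= s) ->
  exists F : ('I_m -> Dual Y) -> B, [/\ mlin F, (forall phi, b (F (fun=> phi)) = G (fun=> phi)),
    wunif (fun phi => F (fun=> phi)) & mbound F (8 * D * s * (4 * lam) ^+ m)].
Proof.
move=> s0 mG wG hs.
have half0 n : 0 < (2^-1 : R) ^+ n := halfX_gt0 n.
have ap N : exists P : {n : nat & (('I_n -> Y) * ('I_n -> Dual Y))%type},
    adapted lam (projT2 P).1 (projT2 P).2 /\ forall phi, nm phi <= 1 ->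
      nm (G (fun=> phi) - G (fun=> fdproj (projT2 P).1 (projT2 P).2 phi)) <= s * (2^-1) ^+ N.
  have [n [v [p [gd h]]]] := fdproj_approx hY lam1 ler01 wG (mulr_gt0 s0 (half0 N)).
  by exists (existT _ n (v, p)).
have /choice[P hP] := ap.
pose pr N := fdproj (projT2 (P N)).1 (projT2 (P N)).2.
pose GN N (q : 'I_m -> Dual Y) := G (fun j => pr N (q j)).
have mGN N : mlin (GN N) by exact: mlin_fdproj.
pose E N q := if N is M.+1 then GN N q - GN M q else GN 0%N q.
have mE N : mlin (E N) by case: N => [|N]; [exact: mGN|exact: mlinB].
have ES N phi : nm phi <= 1 -> nm (E N (fun=> phi)) <= 4 * s * (2^-1) ^+ N.
  move=> p1; case: N => [|N].
    have [_ h] := hP 0%N; have := h phi p1; have := hs phi p1; rewrite expr0 !mulr1.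
    have := nm_tri (GN 0%N (fun=> phi)) (G (fun=> phi)) 0; rewrite !subr0 (nmBC (GN _ _)) /= /GN /pr; lra.
  have [_ h] := hP N; have [_ h'] := hP N.+1; have h1 := h phi p1; have h2 := h' phi p1.
  apply: (le_trans (nm_tri _ (G (fun=> phi)) _)); rewrite nmBC /GN /pr.
  apply: (le_trans (lerD h2 h1)); rewrite exprS; have := mulr_gt0 s0 (half0 N); lra.
(* E_N sees phi only through the vectors of the two projections involved. *)
pose L N := [seq (projT2 (P N)).1 k | k : 'I_(projT1 (P N))] ++
  (if N is M.+1 then [seq (projT2 (P M)).1 k | k : 'I_(projT1 (P M))] else [::]).
have prL N (phi phi' : Dual Y) : (forall k, sval phi ((projT2 (P N)).1 k) = sval phi' ((projT2 (P N)).1 k)) -> pr N phi = pr N phi'.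
  by move=> h; apply: eq_bigr => k _; rewrite h.
have EL N (phi phi' : Dual Y) : (forall y, y \in L N -> sval phi y = sval phi' y) -> E N (fun=> phi) = E N (fun=> phi').
  move=> h; have h1 : pr N phi = pr N phi'.
    by apply: prL => k; apply: h; rewrite mem_cat map_f // mem_enum.
  case: N h h1 => [|N] h h1; rewrite /E /GN h1 //.
  have -> // : pr N phi = pr N phi'.
  by apply: prL => k; apply: h; rewrite mem_cat map_f ?orbT // mem_enum.
have /choice[F hF] : forall N, exists F : ('I_m -> Dual Y) -> B, [/\ mlin F, (forall phi, b (F (fun=> phi)) = E N (fun=> phi)),
    wunif (fun phi => F (fun=> phi)) & mbound F (D * (4 ^+ m * (4 * s * (2^-1) ^+ N)) * lam ^+ m)].
  by move=> N; exact: finite_lift (mE N) (ES N) (EL N).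
pose k := 4 * D * s * (4 * lam) ^+ m.
have l0 : 0 <= lam by exact: le_trans lam1.
have k0 : 0 <= k by rewrite /k mulr_ge0 ?exprn_ge0 ?mulr_ge0 // ltW.
have kE N : D * (4 ^+ m * (4 * s * (2^-1) ^+ N)) * lam ^+ m = k * (2^-1) ^+ N by rewrite /k exprMn; ring.
have Fm N : mlin (F N) by have [] := hF N.
have Fw N : wunif (fun phi => F N (fun=> phi)) by have [] := hF N.
have Fb N : mbound (F N) (k * (2^-1) ^+ N) by rewrite -kE; have [] := hF N.
pose Sn n q := \sum_(N < n) F N q.
have Sm n : mlin (Sn n) by exact: mlin_sum.
have SD n q : Sn n.+1 q - Sn n q = F n q by rewrite /Sn big_ord_recr /= addrAC subrr add0r.
have st (r : R) q : (forall j, nm (q j) <= r) -> forall n, nm (Sn n.+1 q - Sn n q) <= k * r ^+ m * (2^-1) ^+ n.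
  by move=> hq n; rewrite SD mulrAC; exact: (mbound_pow (Fm n) (Fb n) hq).
have qb (q : 'I_m -> Dual Y) : exists r : R, forall j, nm (q j) <= r.
  exists (\sum_j nm (q j)) => j; rewrite (bigD1 j) //= lerDl; apply: sumr_ge0 => *; exact: nm_ge0.
have /choice[T hT] : forall q, exists l, forall c : R, (forall n, nm (Sn n.+1 q - Sn n q) <= c * (2^-1) ^+ n) ->
    forall n, nm (l - Sn n q) <= 2 * c * (2^-1) ^+ n.
  move=> q; apply: (geo_lim (s := fun n => Sn n q) (seqcompleteP (W := B))).
  by have [r hr] := qb q; exists (k * r ^+ m); exact: st.
have mT : mlin T.
  apply: (mlin_lim Sm) => q; have [r hr] := qb q.
  by exists (2 * (k * r ^+ m)); apply: hT; exact: st.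
have bS n phi : b (Sn n.+1 (fun=> phi)) = GN n (fun=> phi).
  rewrite (lin_sum (ex_ql ex)) big_ord_recl; have [_ -> _ _] := hF 0%N.
  elim: n => [|n IH]; first by rewrite big_ord0 addr0.
  rewrite big_ord_recr /= addrA IH; have [_ -> _ _] := hF n.+1.
  by rewrite addrC subrK.
(* The approximation by projections is known on the unit ball only; homogeneity of both sides
   extends the identity afterwards. *)
have bT1 phi : nm phi <= 1 -> b (T (fun=> phi)) = G (fun=> phi).
  move=> p1; apply/eqP; rewrite -subr_eq0; apply/eqP; apply: nm_small => e e0.
  have [cb cb0 hcb] := ex_q_bound ex.
  pose c := cb * (2 * k) + s + 1.
  have cbk : 0 <= cb * (2 * k) by apply: mulr_ge0; [exact: ltW|exact: mulr_ge0].
  have c0 : 0 < c by rewrite /c; lra.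
  have [n hn] := half_pow (divr_gt0 e0 c0); rewrite ltr_pdivlMr // in hn.
  have h1 := hT (fun=> phi) _ (st 1 (fun=> phi) (fun=> p1)) n.+1; rewrite expr1n mulr1 in h1.
  have [_ h] := hP n; have h2 := h phi p1.
  apply: (le_trans (nm_tri _ (b (Sn n.+1 (fun=> phi))) _)); rewrite -(linB (ex_ql ex)) bS (nmBC (GN _ _)).
  have h3 := hcb (T (fun=> phi) - Sn n.+1 (fun=> phi)).
  have h4 : cb * nm (T (fun=> phi) - Sn n.+1 (fun=> phi)) <= cb * (2 * k * (2^-1) ^+ n).
    apply: ler_wpM2l; first exact: ltW.
    apply: (le_trans h1); rewrite exprS; apply: ler_wpM2l; first exact: mulr_ge0.
    by have := half0 n; lra.
  have h5 := half0 n; rewrite /c in hn; rewrite /GN /pr; lra.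
exists T; split=> //.
- move=> phi; pose r := nm phi + 1; have r0 : 0 < r by rewrite /r; have := nm_ge0 phi; lra.
  have -> : phi = rc r *: (rc r^-1 *: phi) by rewrite scalerA -rcM mulfV ?rc1 ?scale1r // lt0r_neq0.
  rewrite (mlin_diagZ _ _ mT) (mlin_diagZ _ _ mG) (linZ (ex_ql ex)) bT1 //.
  by rewrite nmZ nm_rc gtr0_norm ?invr_gt0 // ler_pdivrMl // mulr1 /r; lra.
- apply: wunif_lim => r e e0; pose r' := Num.max r 0.
  have r0 : 0 <= r' by rewrite le_max lexx orbT.
  pose c := 2 * (k * r' ^+ m) + 1; have c0 : 0 < c by rewrite ltr_wpDl //; do 2!apply: mulr_ge0 => //; exact: exprn_ge0.
  have [n hn] := half_pow (divr_gt0 e0 c0); rewrite ltr_pdivlMr // in hn.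
  exists (fun phi => Sn n (fun=> phi)); split; first exact: wunif_sum.
  move=> phi pr'; have p2 : nm phi <= r' by rewrite le_max pr'.
  have := hT (fun=> phi) _ (st r' (fun=> phi) (fun=> p2)) n.
  by have := half0 n; rewrite /c in hn; lra.
- move=> q hq; have := hT q _ (st 1 q hq) 0%N; rewrite /Sn big_ord0 subr0 expr0 expr1n !mulr1.
  by rewrite /k; lra.
Qed.

(** The polynomial is within 1 of its composition with a projection, which is a finite form and
    bounded on the unit ball. *)
Lemma wunif_poly_bdd (W : completeNormedModType K) m (G : ('I_m -> Dual Y) -> W) : mlin G -> wunif (fun phi => G (fun=> phi)) ->
  exists2 s : R, 0 < s & forall phi, nm phi <= 1 -> nm (G (fun=> phi)) <= s.
Proof.
move=> mG wG; have [n [v [p [gd h]]]] := fdproj_approx hY lam1 ler01 wG ltr01.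
pose S := \sum_(f : {ffun 'I_m -> 'I_n}) nm (G (fun j => p (f j))).
have S0 : 0 <= S by apply: sumr_ge0 => *; exact: nm_ge0.
have l0 : 0 <= lam by exact: le_trans lam1.
exists (1 + S * lam ^+ m) => [|phi p1].
  by rewrite ltr_wpDr // mulr_ge0 // exprn_ge0.
have := h phi p1; have := nm_tri (G (fun=> phi)) (G (fun=> fdproj v p phi)) 0; rewrite !subr0.
suff : nm (G (fun=> fdproj v p phi)) <= S * lam ^+ m by lra.
rewrite (finite_form_proj v p (fun=> phi) mG).
apply: (le_trans (finite_form_bound (S := S) (fun=> phi) gd _ S0)).
  move=> f; rewrite /S (bigD1 f) //= lerDl; apply: sumr_ge0 => *; exact: nm_ge0.
rewrite prodr_const card_ord; apply: ler_wpM2l => //; apply: lerXn2r; rewrite ?nnegrE ?mulr_ge0 ?nm_ge0 //.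
by rewrite -[leRHS]mulr1; exact: ler_wpM2l.
Qed.
End Lifting.

Lemma dual_multilinearP (Y W : completeNormedModType K) m (G : ('I_m -> Dual Y) -> W) : dual_multilinear G <-> mlin G.
Proof.
split=> [h j x c u w|h j x c chi u w /dual_combE ->]; last exact: h.
by apply: h; apply/dual_combE.
Qed.

Lemma PKwstarP (Y W : completeNormedModType K) m (P : Dual Y -> W) :
  PKwstar m Y W P <-> (exists G : ('I_m -> Dual Y) -> W, mlin G /\ P = fun phi => G (fun=> phi)) /\ wunif P.
Proof.
split=> [[[G [mG PG]] _ wP]|[[G [mG PG]] wP]].
  split; last exact: wstar_norm_cont_wunif.
  by exists G; split; [exact/dual_multilinearP|exact: funext].
split; [|exact: wunif_cont|exact: wunif_wstar_norm_cont].
by exists G; split; [exact/dual_multilinearP|move=> phi; rewrite PG].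
Qed.

(** The inverse of a can be applied to the multilinear form only if its values lie in the kernel of
    b; those of the symmetrization do, being combinations of values of v. *)
Lemma poly_corestrict (Y A B C : completeNormedModType K) (a : A -> B) (b : B -> C) m (v : Dual Y -> B) :
  short_exact a b -> PKwstar m Y B v -> (forall phi, b (v phi) = 0) ->
  exists u, PKwstar m Y A u /\ forall phi, v phi = a (u phi).
Proof.
move=> ex /PKwstarP[[G [mG vG]] wv] bv; have [inv [invi iinv invl [D hD]]] := ex_section ex.
exists (fun phi => inv (v phi)); split; last by move=> phi; rewrite iinv.
apply/PKwstarP; split; last by apply: (wunif_lip wv (c := D)) => p p'; exact: hD.
exists (fun q => inv (msym G q)); split; last by apply: funext => phi; rewrite msym_diag vG.
apply: (mlin_comp (msym_mlin mG) (N := [set x | b x = 0]) invl) => q /=.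
rewrite (polarization _ mG) (linZ (ex_ql ex)) (lin_sum (ex_ql ex)) big1 ?scaler0 // => e _.
by rewrite (linZ (ex_ql ex)); have := bv (\sum_k sgn (e k) *: q k); rewrite vG => ->; rewrite scaler0.
Qed.

Lemma poly_lifts (Y A B C : completeNormedModType K) (lam : R) (a : A -> B) (b : B -> C) m (w : Dual Y -> C) :
  locfact Y lam -> short_exact a b -> PKwstar m Y C w -> exists v, PKwstar m Y B v /\ forall phi, b (v phi) = w phi.
Proof.
move=> /locfact_ge1[lam' [lam1 hY]] ex /PKwstarP[[G [mG wG]] ww].
rewrite wG in ww; have [s s0 hs] := wunif_poly_bdd hY lam1 mG ww.
have [D D0 hD] := ex_lift ex.
have [F [mF bF wF _]] := poly_lift hY lam1 ex D0 hD s0 mG ww hs.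
exists (fun phi => F (fun=> phi)); split; last by move=> phi; rewrite bF wG.
by apply/PKwstarP; split=> //; exists F.
Qed.

Lemma comp_exact (Y : completeNormedModType K) (Cl : forall W : completeNormedModType K, (Dual Y -> W) -> Prop) :
  (forall (A B C : completeNormedModType K) (a : A -> B) (b : B -> C) v, short_exact a b -> Cl B v ->
     (forall phi, b (v phi) = 0) -> exists u, Cl A u /\ forall phi, v phi = a (u phi)) ->
  (forall (A B C : completeNormedModType K) (a : A -> B) (b : B -> C) w, short_exact a b -> Cl C w ->
     exists v, Cl B v /\ forall phi, b (v phi) = w phi) ->
  comp_functor_exact Cl.
Proof.
move=> h1 h2 A B C a b ex; split.
- by move=> u u' v _ _ -> /funeqP h; apply: funext => phi; exact: (ex_inj ex (h phi)).
- move=> v Pv; split=> [[u [_ ->]]|/funeqP h].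
    by apply: funext => phi /=; rewrite (ex_qi ex).
  have [|u [Pu vu]] := h1 _ _ _ _ _ v ex Pv; first by move=> phi; have /= <- := h phi.
  by exists u; split=> //; exact: funext.
- move=> w Pw; have [v [Pv bv]] := h2 _ _ _ _ _ w ex Pw; exists v; split=> //.
  by apply: funext => phi /=; rewrite bv.
Qed.

Lemma locfact_PK_exact (Y : completeNormedModType K) (lam : R) m : locfact Y lam -> comp_functor_exact (PKwstar m Y).
Proof.
move=> hY; apply: comp_exact => A B C a b v ex Pv; first exact: poly_corestrict ex Pv.
exact: poly_lifts hY ex Pv.
Qed.
End PolyExact.

(** * The injective tensor product and compact operators as degree one *)

Section LinearFunctors.
Context {R : realType}.
Local Notation K := (Cplx R).

Lemma PKwstar1P (Y W : completeNormedModType K) (T : Dual Y -> W) : PKwstar 1 Y W T <-> lin T /\ wunif T.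
Proof.
split=> [/PKwstarP[[G [mG ->]] wT]|[Tl wT]].
  split=> // c phi psi; have E t : (fun=> t) = upd (fun=> 0) ord0 t :> ('I_1 -> Dual Y).
    by apply: funext => k; rewrite /upd; case: eqP => // -[]; rewrite !ord1.
  by have := mG ord0 (fun=> 0) c phi psi; rewrite -!E.
apply/PKwstarP; split=> //; exists (fun q => T (q ord0)); split=> //.
by move=> j q c u w; rewrite !ord1 !upd_same Tl.
Qed.

Section Approx.
Context {Y : completeNormedModType K}.
Variables (lam : R) (lam1 : 1 <= lam) (hY : locfact Y lam).

Lemma lin_fdproj (W : completeNormedModType K) (T : Dual Y -> W) n (v : 'I_n -> Y) p phi : lin T ->
  T (fdproj v p phi) = \sum_k sval phi (v k) *: T (p k).
Proof. by move=> Tl; rewrite /fdproj (lin_sum Tl); apply: eq_bigr => k _; rewrite (linZ Tl). Qed.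

Lemma inj_tensor_of (W : completeNormedModType K) (T : Dual Y -> W) : lin T -> wunif T ->
  inj_tensor (fun phi th => sval th (T phi)).
Proof.
move=> Tl wT; split.
- by move=> c chi phi psi th /dual_combE ->; rewrite Tl (dual_lfun th).
- by move=> c phi chi th1 th2 h; exact: h.
move=> eps /rcK[e e0 ->].
have [n [v [p [gd h]]]] := fdproj_approx hY lam1 ler01 wT e0.
exists n, v, (fun k => T (p k)) => phi th /dual_le_nm; rewrite nm1 => p1 /dual_le_nm; rewrite nm1 => t1.
rewrite nm_le; have := h phi p1; rewrite (lin_fdproj v p phi Tl) => h1.
have -> : sval th (T phi) - \sum_(k < n) sval phi (v k) * sval th (T (p k)) =
    sval th (T phi - \sum_k sval phi (v k) *: T (p k)).
  rewrite (lfunB (dual_lfun th)) (lfun_sum (dual_lfun th)); congr (_ - _).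
  by apply: eq_bigr => k _; rewrite (lfunZ (dual_lfun th)).
apply: (le_trans (nm_dual_ge _ _)); apply: le_trans h1; rewrite -[leRHS]mul1r.
by apply: ler_wpM2r => //; exact: nm_ge0.
Qed.

(** The finite tensors approximating u are finite-rank operators that form a Cauchy sequence
    uniformly on balls; their limit inherits linearity and [wunif], and scaling extends the identity
    from the unit balls. *)
Lemma inj_tensor_operator (W : completeNormedModType K) (u : Dual Y -> Dual W -> K) : inj_tensor u ->
  exists T : Dual Y -> W, [/\ lin T, wunif T & u = fun phi th => sval th (T phi)].
Proof.
move=> hu.
have /choice[t ht] : forall N, exists t : Dual Y -> W, [/\ lin t, wunif t &
    forall phi th, nm phi <= 1 -> nm th <= 1 -> nm (u phi th - sval th (t phi)) <= (2^-1) ^+ N].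
  move=> N; have [n [ys [ws h]]] := inj_tensor_approx hu (halfX_gt0 N).
  exists (fun phi => \sum_(k < n) sval phi (ys k) *: ws k); split.
  - move=> c phi psi; rewrite scaler_sumr -big_split; apply: eq_bigr => k _.
    by rewrite dualD dualZ scalerDl scalerA.
  - apply: wunif_sum => k; apply: wunif_mul; first exact: wunif_cst.
    by move=> r; exists (nm (ws k)).
  - move=> phi th p1 t1; apply: le_trans (h phi th p1 t1); rewrite (lfun_sum (dual_lfun th)).
    by under eq_bigr do rewrite (lfunZ (dual_lfun th)).
have tl N : lin (t N) by have [] := ht N.
have d1 n phi : nm phi <= 1 -> nm (t n.+1 phi - t n phi) <= 2 * (2^-1) ^+ n.
  move=> p1; apply: nm_by_dual => th t1; rewrite (lfunB (dual_lfun th)).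
  have [_ _ h1] := ht n; have [_ _ h2] := ht n.+1.
  have k1 := h1 phi th p1 t1; have k2 := h2 phi th p1 t1; rewrite nmBC in k2.
  apply: (le_trans (nm_tri _ (u phi th : K^o) _)); apply: (le_trans (lerD k2 k1)).
  by rewrite exprS; have := halfX_gt0 n (R := R); lra.
have d2 n phi : nm (t n.+1 phi - t n phi) <= 2 * (nm phi + 1) * (2^-1) ^+ n.
  pose r := nm phi + 1; have r0 : 0 < r by rewrite /r; have := nm_ge0 phi; lra.
  have := d1 n (rc r^-1 *: phi); rewrite !(linZ (tl _)) -scalerBr !nmZ nm_rc gtr0_norm ?invr_gt0 //.
  rewrite !ler_pdivrMl // mulr1 -/r => h.
  have -> : 2 * r * (2^-1) ^+ n = r * (2 * (2^-1) ^+ n) by ring.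
  by apply: h; rewrite /r; lra.
have /choice[T hT] : forall phi, exists l, forall n, nm (l - t n phi) <= 2 * (2 * (nm phi + 1)) * (2^-1) ^+ n.
  by move=> phi; apply: (geo_cvg (s := fun n => t n phi) (seqcompleteP (W := W))) => n; exact: d2.
have Tl : lin T.
  have mT : mlin (fun q : 'I_1 -> Dual Y => T (q ord0)).
    apply: (mlin_lim (S := fun n (q : 'I_1 -> Dual Y) => t n (q ord0))).
      by move=> n j q c x y; rewrite !ord1 !upd_same tl.
    by move=> q; exists (2 * (2 * (nm (q ord0) + 1))) => n; exact: hT.
  by move=> c x y; have := mT ord0 (fun=> 0) c x y; rewrite !upd_same.
have unif (r e : R) : 0 < e -> exists n, forall phi, nm phi <= r -> nm (T phi - t n phi) <= e /\ (2^-1) ^+ n <= e.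
  move=> e0; pose c := 2 * (2 * (`|r| + 1)) + 1; have c0 : 0 < c by rewrite /c; have := normr_ge0 r; lra.
  have [n hn] := half_pow (divr_gt0 e0 c0); rewrite ltr_pdivlMr // in hn.
  exists n => phi pr; have d0 := halfX_gt0 n (R := R); split.
    apply: (le_trans (hT phi n)); apply: le_trans (ltW hn); rewrite mulrC; apply: ler_wpM2l; first exact: ltW.
    by rewrite /c; have := ler_norm r; lra.
  by have := normr_ge0 r; rewrite /c in hn; nra.
exists T; split=> //.
  apply: wunif_lim => r e e0; have [n hn] := unif r e e0; exists (t n); split; first by have [] := ht n.
  by move=> phi /hn[].
have E1 phi th : nm phi <= 1 -> nm th <= 1 -> u phi th = sval th (T phi).
  move=> p1 t1; apply/eqP; rewrite -subr_eq0; apply/eqP; apply: (@nm_small R K^o) => e e0.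
  have e2 : 0 < e / 2 by lra.
  have [n hn] := unif 1 _ e2; have [h1 h2] := hn phi p1; have [_ _ h3] := ht n; have h4 := h3 phi th p1 t1.
  have h5 : nm (sval th (t n phi) - sval th (T phi)) <= e / 2.
    rewrite -(lfunB (dual_lfun th)); apply: (le_trans (nm_dual_ge _ _)); rewrite nmBC; apply: le_trans h1.
    by rewrite -[leRHS]mul1r; apply: ler_wpM2r => //; exact: nm_ge0.
  apply: (le_trans (nm_tri _ (sval th (t n phi) : K^o) _)); apply: (le_trans (lerD h4 h5)); lra.
apply: funext => phi; apply: funext => th.
pose r := nm phi + 1; have r0 : 0 < r by rewrite /r; have := nm_ge0 phi; lra.
pose s := nm th + 1; have s0 : 0 < s by rewrite /s; have := nm_ge0 th; lra.
have E : u (rc r^-1 *: phi) (rc s^-1 *: th) = sval (rc s^-1 *: th) (T (rc r^-1 *: phi)).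
  by apply: E1; rewrite nmZ nm_rc gtr0_norm ?invr_gt0 // ler_pdivrMl // mulr1 /r /s; lra.
rewrite (lfunZ (inj_tensor_l _ hu)) (lfunZ (inj_tensor_r _ hu)) dualZ (linZ Tl) (lfunZ (dual_lfun th)) in E.
have rn : rc r^-1 != 0 by rewrite -rc0 (inj_eq (@rc_inj R)) invr_eq0 lt0r_neq0.
have sn : rc s^-1 != 0 by rewrite -rc0 (inj_eq (@rc_inj R)) invr_eq0 lt0r_neq0.
by apply: (mulfI sn); apply: (mulfI rn); rewrite E mulrCA.
Qed.

(** If T is compact, a finite net of the image and the functionals norming its points minus T(phi0)
    turn weak into norm convergence on bounded sets. Conversely, finite-rank approximation gives
    compactness, and each psi o T is evaluation at a point of Y, hence weak*-continuous on the whole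
    dual and not only on bounded sets. *)
Lemma KwstarP (W : completeNormedModType K) (T : Dual Y -> W) : Kwstar Y W T <-> lin T /\ wunif T.
Proof.
split=> [[/dual_linearP Tl Tc /compact_tbdd Tk Tw]|[Tl wT]].
  split=> //; apply: wstar_norm_cont_wunif => B /dual_boundedP[c hc] phi0 B0 F FF FB hF.
  have Bk : tbdd (T @` B).
    have H : tbdd [set rc (`|c| + 1) *: y | y in T @` [set phi | dual_le phi 1]].
      by apply: (@tbdd_lin R W W _ _ (`|c| + 1)) Tk => [a x y|x]; [rewrite scalerDr !scalerA mulrC|rewrite nmZ nm_rc ger0_norm // addr_ge0].
    apply: tbdd_sub H => _ [phi Bphi <-].
    have c0 : 0 < `|c| + 1 by have := normr_ge0 c; lra.
    exists (T (rc (`|c| + 1)^-1 *: phi)).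
      exists (rc (`|c| + 1)^-1 *: phi) => //=; rewrite -rc1; apply: nm_dual_le'.
      rewrite nmZ nm_rc gtr0_norm ?invr_gt0 // ler_pdivrMl // mulr1.
      by have := hc phi Bphi; have := ler_norm c; lra.
    by rewrite (linZ Tl) scalerA -rcM mulfV ?rc1 ?scale1r // lt0r_neq0.
  apply/cvg_nmP => e e0; have e4 : 0 < e / 4 by lra.
  have [N [w [_ hw]]] := tbdd_in Bk e4.
  have far (j : 'I_N) : exists psi : Dual W, nm psi <= 1 /\ sval psi (w j - T phi0) = rc (nm (w j - T phi0)).
    exact: dual_norming.
  have /choice[psi hpsi] := far.
  have FF' : Filter F by exact: _.
  have Fj (s : seq 'I_N) : F [set phi | forall j, j \in s -> nm (sval (psi j) (T phi0) - sval (psi j) (T phi)) < e / 4].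
    elim: s => [|j s IH]; first exact: filterE.
    have /cvg_nmP/(_ _ e4) h := Tw phi0 F FF hF (psi j).
    apply: filterS2 IH h => phi /= h1 h2 k; rewrite inE => /orP[/eqP ->|/h1 //]; exact: h2.
  apply: filterS2 FB (Fj (enum 'I_N)) => phi /= Bphi hphi.
  have [|j hj] := hw (T phi); first by exists phi.
  have [hle|hgt] := leP (nm (w j - T phi0)) (e / 2).
    have := nm_tri (T phi0) (w j) (T phi); rewrite (nmBC (T phi0) (w j)) (nmBC (w j) (T phi)); lra.
  have [p1 pw] := hpsi j; exfalso.
  have h1 : nm (sval (psi j) (T phi - w j)) <= e / 4.
    apply: (le_trans (nm_dual_ge _ _)); apply: le_trans hj; rewrite -[leRHS]mul1r.
    by apply: ler_wpM2r => //; exact: nm_ge0.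
  have h2 := hphi j (mem_enum _ j).
  have : nm (sval (psi j) (w j - T phi0)) <= e / 4 + e / 4.
    have -> : sval (psi j) (w j - T phi0) = - (sval (psi j) (T phi - w j) + (sval (psi j) (T phi0) - sval (psi j) (T phi))).
      by rewrite !(lfunB (dual_lfun _)); ring.
    by rewrite nmN; apply: (le_trans (nmD _ _)); apply: lerD => //; exact: ltW.
  rewrite pw nm_rc ger0_norm ?nm_ge0 //; lra.
split.
- exact/dual_linearP.
- exact: wunif_cont.
- apply: tbdd_compact; apply: tbdd_approx => e e0.
  have [n [v [p [gd h]]]] := fdproj_approx hY lam1 ler01 wT e0.
  pose M := \sum_k nm (v k).
  exists [set x | exists c : 'I_n -> K, (forall k, nm (c k) <= M) /\ x = \sum_(k < n) c k *: T (p k)].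
  split; first exact: tbdd_fd.
  move=> _ [phi hphi <-]; have := dual_le_nm hphi; rewrite nm1 => p1; exists (T (fdproj v p phi)); last exact: h.
  exists (fun k => sval phi (v k)); split; last exact: lin_fdproj.
  move=> k; apply: (le_trans (nm_dual_ge _ _)); apply: le_trans (_ : 1 * nm (v k) <= _).
    by apply: ler_wpM2r => //; exact: nm_ge0.
  by rewrite mul1r /M (bigD1 k) //= lerDl; apply: sumr_ge0 => *; exact: nm_ge0.
- move=> phi0 F FF hF psi.
  pose r := nm psi + 1; have r0 : 0 < r by rewrite /r; have := nm_ge0 psi; lra.
  have [|y hy] := inj_tensor_repr (th := rc r^-1 *: psi) (inj_tensor_of Tl wT).
    by rewrite nmZ nm_rc gtr0_norm ?invr_gt0 // ler_pdivrMl // mulr1 /r; lra.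
  have E phi : sval psi (T phi) = sval phi (rc r *: y).
    by rewrite (lfunZ (dual_lfun phi)) hy dualZ mulrA -rcM mulfV ?rc1 ?mul1r // lt0r_neq0.
  rewrite (_ : (fun phi => _) = (fun phi : Dual Y => sval phi (rc r *: y))); last exact: funext.
  by rewrite E; exact: hF.
Qed.
End Approx.

Lemma locfact_K_exact (Y : completeNormedModType K) (lam : R) : locfact Y lam -> comp_functor_exact (Kwstar Y).
Proof.
move=> hY; have [lam' [lam1 hY']] := locfact_ge1 hY.
have E (W : completeNormedModType K) (T : Dual Y -> W) : Kwstar Y W T <-> PKwstar 1 Y W T.
  by apply: (iff_trans (KwstarP lam1 hY' T)); apply: iff_sym; exact: PKwstar1P.
apply: comp_exact => A B C a b v ex /E Pv.
  move=> /(poly_corestrict ex Pv)[u [Pu vu]]; exists u; split=> //; exact/E.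
have [u [Pu vu]] := poly_lifts hY ex Pv; exists u; split=> //; exact/E.
Qed.

Lemma locfact_tensor_exact (Y : completeNormedModType K) (lam : R) : locfact Y lam -> tensor_functor_exact Y.
Proof.
move=> hY; have [lam' [lam1 hY']] := locfact_ge1 hY.
have comp (A B : completeNormedModType K) (f : A -> B) (th : Dual B) : lin f -> continuous f ->
    exists chi : Dual A, forall x, sval chi x = sval th (f x).
  move=> fl fc; have [c c0 hc] := lin_bound fl fc.
  have hl : lfun (fun x => sval th (f x)) by move=> k x y; rewrite fl (dual_lfun th).
  have hb x : nm (sval th (f x)) <= nm th * c * nm x.
    by apply: (le_trans (nm_dual_ge _ _)); rewrite -mulrA; apply: ler_wpM2l => //; exact: nm_ge0.
  by exists (mkdual hl hb).
move=> A B C a b ex.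
have al := ex_il ex; have bl := ex_ql ex.
have ac : continuous a by case: ex => -[].
have bc : continuous b by case: ex => _ [].
split.
- move=> u u' v _ _ hu hu'; apply: funext => phi; apply: funext => chi.
  have [D D0 hD] := ex_extend ex; have [th [hth _]] := hD chi.
  by rewrite -(hu phi th chi) ?(hu' phi th chi).
- move=> v Pv; have [T [Tl wT vE]] := inj_tensor_operator Pv; split=> [[u [Pu huv]]|hv].
    move=> phi th chi hchi; rewrite (huv phi chi 0); last by move=> x; rewrite hchi (ex_qi ex) (lfun0 (dual_lfun th)).
    by rewrite (lfun0 (inj_tensor_r phi Pu)).
  have bT phi : b (T phi) = 0.
    apply: eq_by_dual => th; have [chi hchi] := comp _ _ b th bl bc.
    by rewrite (lfun0 (dual_lfun th)) -hchi; have := hv phi th chi hchi; rewrite vE /= => <-.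
  have [u [/PKwstar1P[ul wu] Tu]] := poly_corestrict ex (proj2 (PKwstar1P T) (conj Tl wT)) bT.
  exists (fun phi th => sval th (u phi)); split; first exact: inj_tensor_of lam1 hY' _ _ ul wu.
  by move=> phi th chi hchi; rewrite vE Tu hchi.
- move=> w Pw; have [S [Sl wS wE]] := inj_tensor_operator Pw.
  have [T [/PKwstar1P[Tl wT] bT]] := poly_lifts hY ex (proj2 (PKwstar1P S) (conj Sl wS)).
  exists (fun phi th => sval th (T phi)); split; first exact: inj_tensor_of lam1 hY' _ _ Tl wT.
  by move=> phi th chi hchi; rewrite wE hchi bT.
Qed.
End LinearFunctors.

(** * Exactness for weak*-continuous holomorphic maps *)

Section HoloExact.
Context {R : realType}.
Local Notation K := (Cplx R).

Lemma HKwstarP (Y W : completeNormedModType K) (g : Dual Y -> W) : HKwstar Y W g <-> entire_bt g /\ wunif g.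
Proof.
split=> [[gd gb gw]|[[gd gb] gw]].
  split; last exact: wstar_norm_cont_wunif.
  split=> [phi0|r].
    have [L [/dual_linearP Ll _ hL]] := gd phi0; exists L; split=> // e e0.
    have [dl [dl0 hd]] := hL (rc e) ltac:(by rewrite -rc0 rc_lt).
    have [r r0 dE] := rcK dl0; exists r => // h hr.
    have := hd (phi0 + h) h (rc (nm h)); rewrite dE -rcM nm_le; apply.
    - by move=> y; rewrite dualD.
    - by rewrite -rc0 rc_le nm_ge0.
    - by rewrite rc_le ltW.
    - exact: nm_dual_le'.
  have [M hM] := gb (rc r); exists (re M) => x xr.
  by have [] := nmP (hM x (nm_dual_le' xr)).
split; last exact: wunif_wstar_norm_cont.
- move=> phi0; have hL := DfP phi0 gd; have [M hM] := gb (nm phi0 + 2).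
  have Lb h : nm (Df g phi0 h) <= 2 * M * nm h.
    apply: (cauchy_derivative_ball h gd _ hL) => y hy; apply: hM.
    by have := nm_tri y phi0 0; rewrite !subr0; lra.
  have M0 : 0 <= M by apply: le_trans (nm_ge0 _) (hM phi0 _); lra.
  exists (Df g phi0); split; first by apply/dual_linearP; exact: hL.1.
    exists (rc (2 * M)) => h c c0 /dual_le_nm hc; have [cE _] := K_ge0 c0.
    rewrite cE -rcM nm_le; apply: (le_trans (Lb h)); apply: ler_wpM2l; first exact: mulr_ge0.
    by apply: (le_trans hc); rewrite cE nm_rc ger0_norm // -rc_le rc0 -cE.
  move=> eps /rcK[e e0 ->]; have [r r0 hr] := hL.2 e e0; exists (rc (r / 2)); split.
    by rewrite -rc0 rc_lt divr_gt0.
  move=> phi h c hphi c0 cd /dual_le_nm hc; have [cE rc0'] := K_ge0 c0.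
  have -> : phi = phi0 + h by apply: dual_ext_eq => y; rewrite dualD hphi.
  rewrite cE nm_rc ger0_norm // in hc; rewrite cE rc_le in cd.
  rewrite cE -rcM nm_le; apply: (le_trans (hr h _)); first by lra.
  by apply: ler_wpM2l => //; exact: ltW.
- move=> c; have [M hM] := gb (nm c); exists (rc M) => phi /dual_le_nm h.
  by rewrite nm_le; exact: hM.
Qed.

Lemma frechet_post (V W X : normedModType K) (f : V -> W) x L (l : W -> X) : lin l -> continuous l ->
  frechet f x L -> frechet (fun y => l (f y)) x (fun h => l (L h)).
Proof.
move=> ll lc [Ll hL]; have [c c0 hc] := lin_bound ll lc; split=> [a u v|e e0]; first by rewrite Ll ll.
have [r r0 hr] := hL _ (divr_gt0 e0 c0); exists r => // h /hr h1.
rewrite -!(linB ll); apply: (le_trans (hc _)); rewrite mulrC -ler_pdivlMr //.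
by apply: (le_trans h1); rewrite mulrAC.
Qed.

Lemma frechet_pre (V V' W : normedModType K) (f : V -> W) (P : V' -> V) (c : R) x L : lin P -> 0 < c ->
  (forall y, nm (P y) <= c * nm y) -> frechet f (P x) L -> frechet (fun y => f (P y)) x (fun h => L (P h)).
Proof.
move=> Pl c0 hc [Ll hL]; split=> [a u v|e e0]; first by rewrite Pl Ll.
have [r r0 hr] := hL _ (divr_gt0 e0 c0); exists (r / c) => [|h]; first exact: divr_gt0.
rewrite ltr_pdivlMr // mulrC => hh; rewrite (linD Pl); apply: (le_trans (hr _ (le_lt_trans (hc h) hh))).
by rewrite mulrAC ler_pdivrMr // -mulrA; apply: ler_wpM2l; [exact: ltW|rewrite mulrC].
Qed.

Lemma entire_bt_pre (V V' W : normedModType K) (f : V -> W) (P : V' -> V) (c : R) : lin P -> 0 < c ->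
  (forall y, nm (P y) <= c * nm y) -> entire_bt f -> entire_bt (fun y => f (P y)).
Proof.
move=> Pl c0 hc [fd fb]; split=> [x|r].
  by have [L hL] := fd (P x); eexists; exact: frechet_pre Pl c0 hc hL.
have [M hM] := fb (c * r); exists M => x xr; apply: hM; apply: (le_trans (hc x)).
by rewrite ler_pM2l.
Qed.

Lemma iter_Df_pre (V V' : normedModType K) (W : completeNormedModType K) (f : V -> W) (P : V' -> V) (c : R) m (h : 'I_m -> V') x :
  lin P -> 0 < c -> (forall y, nm (P y) <= c * nm y) -> entire_bt f ->
  iter_Df (fun y => f (P y)) h x = iter_Df f (fun j => P (h j)) (P x).
Proof.
move=> Pl c0 hc; elim: m f h => [|m IH] f h hf //=.
rewrite -IH; last exact: entire_bt_Df.
congr (iter_Df _ _ _); apply: funext => y.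
by rewrite (DfE (h ord0) (frechet_pre Pl c0 hc (DfP (P y) hf.1))).
Qed.

(** Since b o v = 0, the derivatives of v also take values in the kernel of b, so the bounded
    inverse of a applies to the map, its derivatives and its remainders alike. *)
Lemma holo_corestrict (Y A B C : completeNormedModType K) (a : A -> B) (b : B -> C) (v : Dual Y -> B) :
  short_exact a b -> HKwstar Y B v -> (forall phi, b (v phi) = 0) ->
  exists u, HKwstar Y A u /\ forall phi, v phi = a (u phi).
Proof.
move=> ex /HKwstarP[[vd vb] wv] bv; have [inv [invi iinv invl [D hD]]] := ex_section ex.
have bl := ex_ql ex; have bc : continuous b by case: ex => _ [].
have b0 := lin0 bl.
have inv0 : inv 0 = 0 by rewrite -(lin0 (ex_il ex)) invi.
have invB x y : b x = 0 -> b y = 0 -> inv (x - y) = inv x - inv y.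
  move=> hx hy; have := invl (-1) y x hy hx; rewrite !scaleN1r addrC => ->; exact: addrC.
have invb x : b x = 0 -> nm (inv x) <= `|D| * nm x.
  move=> hx; have := hD x 0 hx b0; rewrite inv0 !subr0 => h; apply: (le_trans h).
  by apply: ler_wpM2r; [exact: nm_ge0|exact: ler_norm].
exists (fun phi => inv (v phi)); split; last by move=> phi; rewrite iinv.
apply/HKwstarP; split; last by apply: (wunif_lip wv (c := D)) => p p'; exact: hD.
split=> [phi|r]; last first.
  have [M hM] := vb r; exists (`|D| * M) => x xr; apply: (le_trans (invb _ (bv x))).
  by apply: ler_wpM2l => //; exact: hM.
have [L hL] := vd phi; have [Ll hL'] := hL.
have bL h : b (L h) = 0.
  have := frechet_post bl bc hL; rewrite (_ : (fun y => _) = (fun=> 0)); last exact: funext.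
  by move=> h1; rewrite (frechet_uniq h h1 (frechet_cst 0 phi)).
exists (fun h => inv (L h)); split=> [k x y|e e0]; first by rewrite Ll invl.
have D1 : 0 < `|D| + 1 by have := normr_ge0 D; lra.
have [r r0 hr] := hL' _ (divr_gt0 e0 D1); exists r => // h /hr h1.
have bd : b (v (phi + h) - v phi) = 0 by rewrite (linB bl) !bv subrr.
rewrite -!invB ?bL ?bv //.
apply: (le_trans (invb _ _)); first by rewrite (linB bl) bd bL subrr.
have h2 := ler_wpM2l (normr_ge0 D) h1; apply: (le_trans h2).
rewrite mulrA; apply: ler_wpM2r; first exact: nm_ge0.
by rewrite mulrA ler_pdivrMr // mulrC ler_wpM2l ?ltW //; lra.
Qed.

Section TaylorForms.
Context {Y W : completeNormedModType K}.
Variables (lam : R) (lam1 : 1 <= lam) (hY : locfact Y lam).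

(* The Taylor forms of w - w o fdproj are small by the Cauchy estimates, so those
   of w are limits of finite forms. *)
Lemma taylor_form_wunif (w : Dual Y -> W) m : entire_bt w -> wunif w -> wunif (fun phi => taylor_form w (fun _ : 'I_m => phi)).
Proof.
move=> wEB ww; apply: wunif_lim => r e e0; pose r' := Num.max r 1.
have r1 : 1 <= r' by rewrite le_max lexx orbT.
pose rho := 16 * r'; have rho0 : 0 < rho by rewrite /rho; lra.
have [n [v [p [gd h]]]] := fdproj_approx hY lam1 (ltW rho0) ww e0.
pose P := fdproj v p.
have Pl : lin P := fdproj_lin v p.
have lam0 : 0 < lam by exact: lt_le_trans ltr01 lam1.
have Pb y : nm (P y) <= lam * nm y := fdproj_bound y (ltW lam0) gd.
have wP : entire_bt (fun phi => w (P phi)) by exact: entire_bt_pre Pl lam0 Pb wEB.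
exists (fun phi => finite_form v (fun f => taylor_form w (fun j => p (f j))) (fun _ : 'I_m => phi)); split; first exact: finite_form_wunif.
move=> phi pr.
rewrite -(finite_form_proj v p (fun=> phi) (taylor_form_mlin wEB)).
have E : taylor_form w (fun _ : 'I_m => phi) - taylor_form w (fun _ : 'I_m => P phi) =
    taylor_form (fun y => w y - w (P y)) (fun _ : 'I_m => phi).
  have -> : (fun y => w y - w (P y)) = (fun y => -1 *: w (P y) + w y) by apply: funext => y; rewrite scaleN1r addrC.
  rewrite /taylor_form (iter_Df_comb _ _ _ wP wEB) scaleN1r (iter_Df_pre _ _ Pl lam0 Pb wEB) (lin0 Pl).
  by rewrite scalerDr scalerN addrC.
rewrite -/P E.
have := taylor_form_bound (m := m) (entire_btB wEB wP) rho0 h => hb.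
have pr' : nm phi <= r' by rewrite le_max pr.
apply: (le_trans (mbound_pow (taylor_form_mlin (entire_btB wEB wP)) hb (fun=> pr'))).
rewrite mulrAC -exprMn; have -> : 16 / rho * r' = 1.
  by rewrite /rho; field; rewrite lt0r_neq0 //; lra.
by rewrite expr1n mul1r.
Qed.
End TaylorForms.

(** Each Taylor term is lifted by [poly_lift] with a bound proportional to its supremum [c m] on the
    unit ball; the extra factor (4 lam')^m is geometric, so [taylor_series] sums the lifts. *)
Lemma holo_lifts (Y A B C : completeNormedModType K) (lam : R) (a : A -> B) (b : B -> C) (w : Dual Y -> C) :
  locfact Y lam -> short_exact a b -> HKwstar Y C w -> exists v, HKwstar Y B v /\ forall phi, b (v phi) = w phi.
Proof.
move=> /locfact_ge1[lam' [lam1 hY]] ex /HKwstarP[wEB ww].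
have [D D0 hD] := ex_lift ex.
have bl := ex_ql ex; have bc : continuous b by case: ex => _ [].
have l0 : 0 <= lam' by lra.
pose unit := [set phi : Dual Y | nm phi <= 1].
have /choice[c hc] : forall m, exists c : R, [/\ 0 <= c, (forall phi, unit phi -> nm (taylor_term w m phi) <= c) &
    forall M', (forall phi, unit phi -> nm (taylor_term w m phi) <= M') -> c <= M'].
  move=> m; have [M hM] := wEB.2 1; apply: (sup_bound (M := (16 / 1) ^+ m * M)).
    by exists 0; rewrite /unit /= nm0.
  by move=> phi hphi; rewrite nm_ge0; apply: (taylor_form_bound wEB).
have hcr m (rho M : R) : 0 < rho -> (forall y, nm y <= rho -> nm (w y) <= M) -> c m <= (16 / rho) ^+ m * M.
  by move=> hr hM; have [_ _ h] := hc m; apply: h => phi hphi; apply: (taylor_form_bound wEB hr hM).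
have hex : forall m, exists F : ('I_m -> Dual Y) -> B, [/\ mlin F, (forall phi, b (F (fun=> phi)) = taylor_term w m phi),
    wunif (fun phi => F (fun=> phi)) & mbound F (8 * D * (4 * lam') ^+ m * c m)].
  move=> m; have [c0 c1 _] := hc m.
  have mG : mlin (@taylor_form _ _ _ w m) := taylor_form_mlin wEB.
  (* [poly_lift] requires a positive bound; a term of supremum 0 vanishes identically and is lifted
     by 0. *)
  have [cE|cn] := eqVneq (c m) 0.
    exists (fun=> 0); split.
    - by move=> j x k u v; rewrite scaler0 addr0.
    - move=> phi; rewrite (lin0 bl); apply/esym.
      pose r := nm phi + 1; have r0 : 0 < r by rewrite /r; have := nm_ge0 phi; lra.
      have -> : phi = rc r *: (rc r^-1 *: phi) by rewrite scalerA -rcM mulfV ?rc1 ?scale1r // lt0r_neq0.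
      rewrite /taylor_term (mlin_diagZ _ _ mG); have := c1 (rc r^-1 *: phi); rewrite cE => h.
      rewrite -/(taylor_term w m (rc r^-1 *: phi)) (nm_le0 (h _)) ?scaler0 //.
      by rewrite /unit /= nmZ nm_rc gtr0_norm ?invr_gt0 // ler_pdivrMl // mulr1 /r; lra.
    - exact: wunif_cst.
    - by move=> x _; rewrite nm0 cE mulr0.
  have cp : 0 < c m by rewrite lt_neqAle eq_sym cn c0.
  have [F [mF bF wF Fb]] := poly_lift hY lam1 ex D0 hD cp mG (taylor_form_wunif lam1 hY m wEB ww) c1.
  exists F; split=> //; have -> : 8 * D * (4 * lam') ^+ m * c m = 8 * D * c m * (4 * lam') ^+ m by ring.
  exact: Fb.
(* The type of the form depends on m, so the choice is a dependent one. *)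
pose F m := projT1 (cid (hex m)).
have hF m : [/\ mlin (F m), (forall phi, b (F m (fun=> phi)) = taylor_term w m phi),
    wunif (fun phi => F m (fun=> phi)) & mbound (F m) (8 * D * (4 * lam') ^+ m * c m)].
  exact: (projT2 (cid (hex m))).
have Fm m : mlin (F m) by have [] := hF m.
have Fb m : mbound (F m) (8 * D * (4 * lam') ^+ m * c m) by have [] := hF m.
have Fw m : wunif (fun phi => F m (fun=> phi)) by have [] := hF m.
have bF m phi : b (F m (fun=> phi)) = taylor_term w m phi by have [] := hF m.
have D8 : 0 <= 8 * D by lra.
have l4 : 0 <= 4 * lam' by lra.
have [T [TEB bT unif]] := taylor_series wEB D8 l4 Fm Fb hcr bl bc bF.
exists T; split=> //; apply/HKwstarP; split=> //.
apply: wunif_lim => r e e0; have [N hN] := unif r e e0.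
exists (fun phi => \sum_(m < N) F m (fun=> phi)); split; last exact: hN.
exact: wunif_sum.
Qed.

Lemma locfact_HK_exact (Y : completeNormedModType K) (lam : R) : locfact Y lam -> comp_functor_exact (HKwstar Y).
Proof.
move=> hY; apply: comp_exact => A B C a b v ex Pv; first exact: holo_corestrict ex Pv.
exact: holo_lifts hY ex Pv.
Qed.
End HoloExact.

Theorem theorem3 (R : realType) (Y : completeNormedModType (Cplx R)) :
  [/\ (Linfty_space Y <->
        forall (X Z : completeNormedModType (Cplx R)) (i : Y -> X) (q : X -> Z),
          short_exact i q -> locally_splits i q),
      (Linfty_space Y <->
        forall (X Z : completeNormedModType (Cplx R)) (i : Y -> X) (q : X -> Z),
          short_exact i q ->
          [/\ lifts q A_compact,
              (forall n : nat, (1 <= n)%N -> lifts q (A_poly n)) &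
              lifts q A_holo]) &
      (Linfty_space Y <->
        [/\ tensor_functor_exact Y,
            comp_functor_exact (Kwstar Y),
            (forall n : nat, (1 <= n)%N -> comp_functor_exact (PKwstar n Y)) &
            comp_functor_exact (HKwstar Y)])].
Proof.
split; split.
- by move=> /Linfty_locfact[lam hY] X Z i q ex; exact: locfact_splits hY ex.
- by move=> /locally_splits_locfact[lam hY]; exact: locfact_Linfty hY.
- move=> /Linfty_locfact[lam hY] X Z i q ex; split.
  + exact: locfact_lifts_compact hY ex.
  + by move=> n _; exact: locfact_lifts_poly hY ex.
  + exact: locfact_lifts_holo hY ex.
- move=> h; have [|lam hY] := @compact_lifts_locfact R Y; last exact: locfact_Linfty hY.
  by move=> X Z i q /h[].
- move=> /Linfty_locfact[lam hY]; split.
  + exact: locfact_tensor_exact hY.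
  + exact: locfact_K_exact hY.
  + by move=> n _; exact: locfact_PK_exact hY.
  + exact: locfact_HK_exact hY.
- by move=> [/tensor_locfact[lam hY] _ _ _]; exact: locfact_Linfty hY.
Qed.
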